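(* Let $F$ be a meromorphic function of two variables, not singular at the origin, with $F(z,w)=G(z,w)/H(z,w)=\sum_{r,s\ge 0}a_{rs}z^rw^s$. Suppose that $(z^*,w^* )$ is a strictly minimal double point of $\mathcal V$. Let $\mathbf H(z^*,w^* )$ denote the Hessian matrix of $H$ at $(z^*,w^* )$ and suppose that $\det\mathbf H(z^*,w^* )\ne 0$. Then: (i) for each subset $K$ that is boundedly interior to $\mathbf K(z^*,w^* )$ there is $c>0$ such that $$a_{rs}=(z^* )^{-r}(w^* )^{-s}\left(\frac{G(z^*,w^* )}{\sqrt{-(z^* )^2(w^* )^2\det\mathbf H(z^*,w^* )}}+O\big(e^{-c|(r,s)|}\big)\right)\quad\text{uniformly for }(r,s)\in K;$$ (ii) if $\delta=r/s$ lies on the boundary of $\mathbf K(z^*,w^* )$ (that is, $(r,s)$ lies on a boundary ray of the cone), then in direction $\delta$ there is a complete asymptotic expansion $$a_{rs}\sim(z^* )^{-r}(w^* )^{-s}\sum_{k\ge 0}b_k s^{-k/2}\qquad (s\to\infty,\ r/s=\delta),$$ where $$b_0=\frac{G(z^*,w^* )}{2\sqrt{-(z^* )^2(w^* )^2\det\mathbf H(z^*,w^* )}}.$$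
   Context: $G,H$ are functions analytic in some open polydisk about $\mathbf 0$ in $\mathbb C^2$, $F=G/H$, and $\mathcal V$ is the set where $H$ vanishes. $\mathcal D$ is the open domain of convergence of the power series of $F$ at the origin. A point $(z^*,w^* )\in\mathcal V$ is minimal if it lies in $\partial\mathcal D$ and both coordinates are nonzero; it is strictly minimal if moreover $\mathcal V\cap\{|z|\le|z^*|,|w|\le|w^*|\}=\{(z^*,w^* )\}$. Double point: there are functions $v_0,v_1$ analytic near $z^*$ and $\phi$ analytic near $(z^*,w^* )$ such that near $(z^*,w^* )$ $$F(z,w)=\frac{\phi(z,w)}{(1-wv_0(z))(1-wv_1(z))},$$ with $w^*v_j(z^* )=1$ and $v_j'(z^* )\neq0$ for $j=0,1$, and with $wv_j(z)=1$ for some $j$ if and only if $(z,w)\in\mathcal V$ (for $(z,w)$ near $(z^*,w^* )$). Cone: put $c_j=z^*w^*v_j'(z^* )$ (this is the logarithmic derivative $z v_j'/v_j$ at $z^*$; it is real and positive at a minimal point). $\mathbf K(z^*,w^* )$ is the positive hull of the vectors $(c_0,1)$ and $(c_1,1)$ in $\mathbb R^2$, whose coordinates correspond to $(r,s)$. A subset $K$ of $\mathbf K$ is boundedly interior to $\mathbf K$ if the directions of its vectors are bounded away from the walls of $\mathbf K$, i.e. the image of $K$ under $\mathbb R^2\setminus\{\mathbf 0\}\to\mathbb{RP}^1$ is contained in a compact subset of the interior of the image of $\mathbf K$. Branch: the square root $\sqrt{-(z^* )^2(w^* )^2\det\mathbf H(z^*,w^* )}$ is the one that is a positive real multiple of $(w^*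 )^2\,\partial^2H/\partial w^2(z^*,w^* )$.
   Formalization: Two conditions are added, without which the claim is false: the sheets v_0 and v_1 are not identical near z*; and in (ii), for the sheet whose slope c_j equals δ, the derivative of z v_j'/v_j at z* is nonzero (otherwise powers such as s^{-1/4} can occur). *)

(* Defs.v *)
From Stdlib Require Import Reals List.
From Coquelicot Require Import Coquelicot.

Open Scope R_scope.

(** * Double series and analytic functions *)

Definition abs_summable2 (u : nat -> nat -> C) : Prop :=
  exists M : R, forall n : nat,
    sum_n (fun i => sum_n (fun j => Cmod (u i j)) n) n <= M.

(* Under absolute summability the order of summation is irrelevant, so the
   square partial sums give the sum of the family. *)
Definition is_sum2 (u : nat -> nat -> C) (l : C) : Prop :=
  abs_summable2 u /\
  filterlim (fun n => sum_n (fun i => sum_n (fun j => u i j) n) n)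
    eventually (locally l).

Definition monomials (a : nat -> nat -> C) (z w : C) : nat -> nat -> C :=
  fun r s => (a r s * Cpow z r * Cpow w s)%C.

Definition is_pseries2 (a : nat -> nat -> C) (z w l : C) : Prop :=
  is_sum2 (monomials a z w) l.

Definition analytic_at (f : C -> C) (z0 : C) : Prop :=
  exists a : nat -> C,
    locally z0 (fun z : C =>
      is_pseries (K := C_AbsRing) (V := C_NormedModule) a (z - z0)%C (f z)).

Definition analytic2_at (f : C -> C -> C) (z0 w0 : C) : Prop :=
  exists a : nat -> nat -> C,
    locally ((z0, w0) : C * C) (fun p =>
      is_pseries2 a (fst p - z0)%C (snd p - w0)%C (f (fst p) (snd p))).

(* Infinite radii are allowed. *)
Definition polydisk (R1 R2 : Rbar) (z w : C) : Prop :=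
  Rbar_lt (Cmod z) R1 /\ Rbar_lt (Cmod w) R2.

Definition analytic_on_polydisk (R1 R2 : Rbar) (f : C -> C -> C) : Prop :=
  forall z w : C, polydisk R1 R2 z w -> analytic2_at f z w.

(** * Partial derivatives and the Hessian determinant *)

Definition dz (f : C -> C -> C) (z w : C) : C := C_derive (fun x => f x w) z.
Definition dw (f : C -> C -> C) (z w : C) : C := C_derive (fun y => f z y) w.

Definition hessian_det (H : C -> C -> C) (z w : C) : C :=
  (dz (dz H) z w * dw (dw H) z w - dz (dw H) z w * dw (dz H) z w)%C.

(** * Minimal points *)

(* [locally x A] says that [x] is an interior point of [A]. *)
Definition boundary {T : UniformSpace} (A : T -> Prop) (x : T) : Prop :=
  ~ locally x A /\ ~ locally x (fun y => ~ A y).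

Definition convergence_domain (a : nat -> nat -> C) (p : C * C) : Prop :=
  locally p (fun q => abs_summable2 (monomials a (fst q) (snd q))).

Definition zero_set (R1 R2 : Rbar) (H : C -> C -> C) (z w : C) : Prop :=
  polydisk R1 R2 z w /\ H z w = RtoC 0.

Definition minimal (V : C -> C -> Prop) (a : nat -> nat -> C) (zs ws : C)
  : Prop :=
  V zs ws /\ boundary (convergence_domain a) (zs, ws) /\
  zs <> RtoC 0 /\ ws <> RtoC 0.

Definition strictly_minimal (V : C -> C -> Prop) (a : nat -> nat -> C)
  (zs ws : C) : Prop :=
  minimal V a zs ws /\
  forall z w : C, V z w -> Cmod z <= Cmod zs -> Cmod w <= Cmod ws ->
    z = zs /\ w = ws.

(** * Double points *)

(* G / H is only meaningful off the zero set of H, so the factorization of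
   the meromorphic function G / H is required there; by the last clause the
   right-hand denominator does not vanish there.
   The clause that [v0] and [v1] are different germs says that there really
   are two sheets: without it a smooth point of the zero set would qualify,
   with [v0 = v1] and a numerator [phi] divisible by [1 - w v0(z)]. *)
Definition double_point (V : C -> C -> Prop) (G H : C -> C -> C) (zs ws : C)
  (v0 v1 : C -> C) (phi : C -> C -> C) : Prop :=
  analytic_at v0 zs /\ analytic_at v1 zs /\ analytic2_at phi zs ws /\
  (ws * v0 zs = 1)%C /\ (ws * v1 zs = 1)%C /\
  C_derive v0 zs <> RtoC 0 /\ C_derive v1 zs <> RtoC 0 /\
  ~ locally zs (fun z => v0 z = v1 z) /\
  locally ((zs, ws) : C * C) (fun p =>
    let z := fst p in let w := snd p in
    (H z w <> RtoC 0 ->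
       (G z w / H z w = phi z w / ((1 - w * v0 z) * (1 - w * v1 z)))%C) /\
    (((w * v0 z = 1)%C \/ (w * v1 z = 1)%C) <-> V z w)).

(* This complex number is real at a minimal point, hence the real part. *)
Definition slope (zs ws : C) (v : C -> C) : R :=
  Re (zs * ws * C_derive v zs)%C.

(* At the slope of v, the phase  theta |-> log v(zs e^(i theta))  has a
   nonzero quadratic term: the logarithmic derivative z v'(z) / v(z) is not
   stationary at zs.  Without this, the remainder on the boundary rays need
   not have an expansion in powers of s^(-1/2); for
   v0(z) = z^2 - (1 - z)^4 / 20, v1(z) = (2 + z) / 3, G = 1 and
   H = (1 - w v0) (1 - w v1), at (1, 1), the quantity a_{2s,s} - b_0 has exact
   order s^(-1/4). *)
Definition phase_nondegenerate (v : C -> C) (zs : C) : Prop :=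
  C_derive (fun z => z * C_derive v z / v z)%C zs <> RtoC 0.

(** * The cone and the real projective line *)

Definition positive_hull (u v : R * R) (x : R * R) : Prop :=
  exists a b : R, 0 <= a /\ 0 <= b /\
    x = (a * fst u + b * fst v, a * snd u + b * snd v).

Definition cone (zs ws : C) (v0 v1 : C -> C) : R * R -> Prop :=
  positive_hull (slope zs ws v0, 1) (slope zs ws v1, 1).

(* A subset of RP^1 is represented by its preimage in R^2 \ {0}: a set of
   nonzero vectors stable under nonzero scalings.  Openness, interior and
   compactness below are those of the quotient topology (the quotient map is
   open, and R^2 \ {0} is open in R^2). *)
Definition rp1_set (A : R * R -> Prop) : Prop :=
  forall x : R * R, A x ->
    x <> (0, 0) /\ forall t : R, t <> 0 -> A (t * fst x, t * snd x).

Definition rp1_image (S : R * R -> Prop) (x : R * R) : Prop :=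
  x <> (0, 0) /\
  exists t : R, t <> 0 /\ S (t * fst x, t * snd x).

Definition rp1_open (A : R * R -> Prop) : Prop := rp1_set A /\ open A.

Definition rp1_interior (A : R * R -> Prop) (x : R * R) : Prop :=
  exists U : R * R -> Prop,
    rp1_open U /\ (forall y, U y -> A y) /\ U x.

Definition rp1_compact (A : R * R -> Prop) : Prop :=
  rp1_set A /\
  forall (I : Type) (U : I -> R * R -> Prop),
    (forall i, rp1_open (U i)) ->
    (forall x, A x -> exists i, U i x) ->
    exists l : list I, forall x, A x -> exists i, In i l /\ U i x.

Definition boundedly_interior (Kc K : R * R -> Prop) : Prop :=
  (forall x, K x -> Kc x) /\
  exists T : R * R -> Prop,
    rp1_compact T /\
    (forall x, T x -> rp1_interior (rp1_image Kc) x) /\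
    (forall x, rp1_image K x -> T x).

(** * The branch of the square root and asymptotic expansions *)

Definition is_branch_sqrt (H : C -> C -> C) (zs ws S : C) : Prop :=
  (S * S = - (Cpow zs 2 * Cpow ws 2 * hessian_det H zs ws))%C /\
  exists t : R, 0 < t /\ (S = RtoC t * (Cpow ws 2 * dw (dw H) zs ws))%C.

(* a_{rs} z^r w^s ~ sum_k b_k s^(-k/2) as s -> oo with r = delta s *)
Definition half_power_expansion (a : nat -> nat -> C) (zs ws : C) (delta : R)
  (b : nat -> C) : Prop :=
  forall N : nat, exists (M : R) (s0 : nat), forall r s : nat,
    (s0 <= s)%nat -> (0 < s)%nat -> INR r = delta * INR s ->
    Cmod (a r s * Cpow zs r * Cpow ws s
          - sum_n (fun k => b k * RtoC (Rpower (INR s) (- INR k / 2)))%C N)%C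
      <= M * Rpower (INR s) (- INR (N + 1) / 2).

(* Main.v *)
Require Import Defs.
From Stdlib Require Import Reals List Lra Lia Psatz Classical ClassicalEpsilon.
From Stdlib Require Import FunctionalExtensionality PropExtensionality.
From Coquelicot Require Import Coquelicot.

Open Scope R_scope.

(** The coefficients are Cauchy integrals, and they are governed by the two simple poles that [y |->
F(x, y)] has near the double point.

Rescale so that the double point is (1, 1): put A_rs = a_rs zs^r ws^s and u_j(x) = ws v_j(zs x), so
that u_j(1) = 1 and u_j'(1) = c_j. Strict minimality says that F has no singularity on the closed
unit bidisk other than (1, 1), and that |u_j(x)| < 1 for |x| <= 1, x <> 1 near 1. For x in the open
unit disk let f_s(x) = sum_r A_rs x^r be the coefficient of y^s in F(x, y). Away from x = 1 the
function F(x, .) is holomorphic on a disk of radius 1 + d, uniformly in x by compactness, so f_s(x)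
is exponentially small in s ([slice_decay]). Near x = 1 the product F(x, y) (1 - y u_0(x)) (1 - y
u_1(x)) extends holomorphically to such a disk, and comparing residues gives (u_0 - u_1) f_s = u_0
phi(x, 1/u_0) u_0^s - u_1 phi(x, 1/u_1) u_1^s, again up to an exponentially small error
([slice_two_poles]). With x = e^z and u_j(e^z) = e^(f_j(z)), the coefficient A_rs = (1/2 pi) int
f_s(x) x^(-r) dt over a circle |x| = e^(-eta) is therefore, up to an exponentially small error, the
sum for j = 0, 1 of
  (1/2 pi) int_(-del)^(del) h_j(z)/z e^(s f_j(z) - r z) dt,   z = -eta + i t,
where h_0(0) = - h_1(0) = phi(1, 1) / (c_0 - c_1), because u_0 - u_1 vanishes to first order only
([coefficients_as_pole_integrals]).

Such an integral depends on the position of r/s with respect to the slope c_j = f_j'(0). The segment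
of integration lies to the left of the pole 0. If r/s < c_j, the exponential is small there
([pole_integral_below_slope]). If r/s > c_j, it is small to the right of 0, and pushing the segment
across the pole costs the residue: the value is - h_j(0) up to an exponentially small error
([pole_integral_above_slope]). In the interior of the cone there is one slope on either side of r/s,
and A_rs tends exponentially fast to phi(1, 1) / |c_0 - c_1|. If r/s = c_j, the pole is also a
critical point of the phase ([pole_integral_at_slope]). It contributes half of its residue; what
remains is regular, and in a coordinate u with s f_j(z) - r z = - s u^2 its Taylor series turns into
a series of Gaussian moments, that is, of powers s^(-(k+1)/2).

The constant is identified by differentiating H = 0 twice along the two sheets w = 1/v_j(z)
([hessian_double]). The gradient of H vanishes at the double point, the sheets are transverse
because the Hessian determinant is not zero, and - zs^2 ws^2 det = (ws^2 H_ww (c_0 - c_1) / 2)^2,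
while 2 G = phi ws^2 H_ww.

Holomorphic means here continuously differentiable in the complex sense. For such functions Cauchy's
formula follows by shrinking the circle and differentiating under the integral ([cauchy_formula]),
power series and primitives follow from it, and the analytic functions of the statement enter
through their power series. *)

(** * Complex derivatives *)

Lemma Cmod_sub_sym (x y : C) : Cmod (x - y) = Cmod (y - x).
Proof. rewrite <- Cmod_opp. f_equal. ring. Qed.

Lemma Cmod_sub_tri (x y z : C) : Cmod (x - z) <= Cmod (x - y) + Cmod (y - z).
Proof.
  replace (x - z)%C with ((x - y) + (y - z))%C by ring. apply Cmod_triangle.
Qed.

Lemma Cmod_minus_le (x y : C) : Cmod (x - y) <= Cmod x + Cmod y.
Proof. rewrite <- (Cmod_opp y). apply Cmod_triangle. Qed.

Lemma Cmod_ge_sub (x y : C) : Cmod x - Cmod y <= Cmod (x - y).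
Proof.
  assert (Cmod x <= Cmod (x - y) + Cmod y); [|lra].
  replace x with ((x - y) + y)%C at 1 by ring. apply Cmod_triangle.
Qed.

Lemma Cmod_le_eq0 (x : C) : (forall e, 0 < e -> Cmod x <= e) -> x = RtoC 0.
Proof.
  intros H. apply Cmod_eq_0. apply Rle_antisym; [|apply Cmod_ge_0].
  apply le_epsilon. intros e He. rewrite Rplus_0_l. auto.
Qed.

(** The estimate f = f0 + L + o(n), for a size n on an arbitrary type, so that derivatives along
    complex and along real variables obey the same rules. *)
Definition dif {T : Type} (n : T -> R) (f : T -> C) (f0 : C) (L : T -> C) :=
  forall e, 0 < e -> exists d, 0 < d /\
    forall y, n y < d -> Cmod (f y - f0 - L y) <= e * n y.

Definition cderiv (f : C -> C) (z l : C) : Prop :=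
  dif (fun y => Cmod (y - z)) f (f z) (fun y => l * (y - z))%C.

Definition rderiv (f : R -> C) (t : R) (l : C) : Prop :=
  dif (fun y => Rabs (y - t)) f (f t) (fun y => l * RtoC (y - t))%C.

Definition ccont (f : C -> C) (z : C) : Prop :=
  forall e, 0 < e -> exists d, 0 < d /\
    forall y, Cmod (y - z) < d -> Cmod (f y - f z) < e.

Lemma dif_ext {T} (n : T -> R) f g f0 L d0 :
  0 < d0 -> (forall y, n y < d0 -> f y = g y) -> dif n f f0 L -> dif n g f0 L.
Proof.
  intros Hd0 Hfg Hf e He. destruct (Hf e He) as (d & Hd & H).
  exists (Rmin d d0). split; [now apply Rmin_glb_lt|].
  intros y Hy. rewrite <- Hfg.
  - apply H. eapply Rlt_le_trans; [exact Hy | apply Rmin_l].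
  - eapply Rlt_le_trans; [exact Hy | apply Rmin_r].
Qed.

Lemma dif_extL {T} (n : T -> R) f f0 L L' :
  (forall y, L y = L' y) -> dif n f f0 L -> dif n f f0 L'.
Proof.
  intros HL Hf e He. destruct (Hf e He) as (d & Hd & H).
  exists d. split; [exact Hd|]. intros y Hy. rewrite <- HL. auto.
Qed.

(** A differential with a bounded linear part is Lipschitz at the point; this is what the chain and
    product rules use. *)
Lemma dif_lip {T} (n : T -> R) f f0 L K :
  (forall y, 0 <= n y) -> (forall y, Cmod (L y) <= K * n y) -> dif n f f0 L ->
  exists d, 0 < d /\ forall y, n y < d -> Cmod (f y - f0) <= (K + 1) * n y.
Proof.
  intros Hn HL Hf. destruct (Hf 1 Rlt_0_1) as (d & Hd & H).
  exists d. split; [exact Hd|]. intros y Hy.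
  replace (f y - f0)%C with ((f y - f0 - L y) + L y)%C by ring.
  eapply Rle_trans; [apply Cmod_triangle|].
  specialize (H y Hy). specialize (HL y). lra.
Qed.

Lemma dif_plus {T} (n : T -> R) f g f0 g0 L M :
  dif n f f0 L -> dif n g g0 M ->
  dif n (fun y => f y + g y)%C (f0 + g0)%C (fun y => L y + M y)%C.
Proof.
  intros Hf Hg e He.
  destruct (Hf (e / 2)) as (d & Hd & H1); [lra|].
  destruct (Hg (e / 2)) as (d' & Hd' & H2); [lra|].
  exists (Rmin d d'). split; [now apply Rmin_glb_lt|]. intros y Hy.
  assert (n y < d /\ n y < d') as [Ha Hb].
  { split; (eapply Rlt_le_trans; [exact Hy|]); [apply Rmin_l|apply Rmin_r]. }
  replace (f y + g y - (f0 + g0) - (L y + M y))%C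
    with ((f y - f0 - L y) + (g y - g0 - M y))%C by ring.
  eapply Rle_trans; [apply Cmod_triangle|].
  specialize (H1 y Ha). specialize (H2 y Hb). lra.
Qed.

Lemma dif_comp {T} (n : T -> R) f f0 L K g l :
  (forall y, 0 <= n y) -> (forall y, Cmod (L y) <= K * n y) ->
  dif n f f0 L -> cderiv g f0 l ->
  dif n (fun y => g (f y)) (g f0) (fun y => l * L y)%C.
Proof.
  intros Hn HL Hf Hg e He.
  destruct (dif_lip n f f0 L K Hn HL Hf) as (d1 & Hd1 & Hlip).
  set (K1 := Rabs K + 1).
  assert (HK1 : 0 < K1) by (unfold K1; generalize (Rabs_pos K); lra).
  assert (HKK : forall y, n y < d1 -> Cmod (f y - f0) <= K1 * n y).
  { intros y Hy. eapply Rle_trans; [apply Hlip, Hy|].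
    apply Rmult_le_compat_r; [apply Hn|]. unfold K1. generalize (Rle_abs K). lra. }
  destruct (Hg (e / 2 / K1)) as (d2 & Hd2 & H2).
  { apply Rdiv_lt_0_compat; lra. }
  assert (Hl : 0 < Cmod l + 1) by (generalize (Cmod_ge_0 l); lra).
  destruct (Hf (e / 2 / (Cmod l + 1))) as (d3 & Hd3 & H3).
  { apply Rdiv_lt_0_compat; lra. }
  exists (Rmin d1 (Rmin (d2 / K1) d3)). split.
  { repeat apply Rmin_glb_lt; auto. now apply Rdiv_lt_0_compat. }
  intros y Hy.
  assert (Ha : n y < d1) by (eapply Rlt_le_trans; [exact Hy|apply Rmin_l]).
  assert (Hb' : n y < Rmin (d2 / K1) d3) by (eapply Rlt_le_trans; [exact Hy|apply Rmin_r]).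
  assert (Hb : n y < d2 / K1) by (eapply Rlt_le_trans; [exact Hb'|apply Rmin_l]).
  assert (Hc : n y < d3) by (eapply Rlt_le_trans; [exact Hb'|apply Rmin_r]).
  assert (Hfy : Cmod (f y - f0) < d2).
  { eapply Rle_lt_trans; [apply HKK, Ha|].
    apply (Rmult_lt_compat_l K1) in Hb; [|exact HK1].
    replace (K1 * (d2 / K1)) with d2 in Hb by (field; lra). exact Hb. }
  replace (g (f y) - g f0 - l * L y)%C
    with ((g (f y) - g f0 - l * (f y - f0)) + l * (f y - f0 - L y))%C by ring.
  eapply Rle_trans; [apply Cmod_triangle|]. rewrite Cmod_mult.
  specialize (H2 _ Hfy). specialize (H3 _ Hc). specialize (HKK _ Ha).
  assert (e / 2 / K1 * Cmod (f y - f0) <= e / 2 * n y).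
  { apply Rle_trans with (e / 2 / K1 * (K1 * n y)).
    - apply Rmult_le_compat_l; [|exact HKK]. apply Rlt_le, Rdiv_lt_0_compat; lra.
    - right. field. lra. }
  assert (Cmod l * Cmod (f y - f0 - L y) <= e / 2 * n y).
  { apply Rle_trans with ((Cmod l + 1) * (e / 2 / (Cmod l + 1) * n y)).
    - apply Rmult_le_compat; try apply Cmod_ge_0; lra.
    - right. field. lra. }
  lra.
Qed.

Lemma dif_mult {T} (n : T -> R) f g f0 g0 L M K :
  (forall y, 0 <= n y) -> (forall y, Cmod (L y) <= K * n y) ->
  (forall y, Cmod (M y) <= K * n y) ->
  dif n f f0 L -> dif n g g0 M ->
  dif n (fun y => f y * g y)%C (f0 * g0)%C (fun y => f0 * M y + g0 * L y)%C.
Proof.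
  intros Hn HL HM Hf Hg.
  assert (Hsq : forall c : C, cderiv (fun z => z * z)%C c (2 * c)%C).
  { intros c e He. exists e. split; [exact He|]. intros y Hy.
    replace (y * y - c * c - 2 * c * (y - c))%C with ((y - c) * (y - c))%C by ring.
    rewrite Cmod_mult. apply Rmult_le_compat_r; [apply Cmod_ge_0|lra]. }
  assert (Hhalf : forall c : C, cderiv (fun z => z * z / 4)%C c (c / 2)%C).
  { intros c e He. destruct (Hsq c e He) as (d & Hd & H). exists d. split; [exact Hd|].
    intros y Hy. specialize (H y Hy).
    replace (y * y / 4 - c * c / 4 - c / 2 * (y - c))%C
      with ((y * y - c * c - 2 * c * (y - c)) / 4)%C by field.
    unfold Cdiv. rewrite Cmod_mult.
    rewrite <- RtoC_inv by lra. rewrite Cmod_R, Rabs_pos_eq by lra.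
    generalize (Cmod_ge_0 (y * y - c * c - 2 * c * (y - c))). lra. }
  assert (Hneg : dif n (fun y => - g y)%C (- g0)%C (fun y => - M y)%C).
  { intros e He. destruct (Hg e He) as (d & Hd & H). exists d. split; [exact Hd|].
    intros y Hy. replace (- g y - - g0 - - M y)%C with (- (g y - g0 - M y))%C by ring.
    rewrite Cmod_opp. auto. }
  assert (HB1 : forall y, Cmod (L y + M y) <= (K + K) * n y).
  { intros y. eapply Rle_trans; [apply Cmod_triangle|].
    specialize (HL y). specialize (HM y). lra. }
  assert (HB2 : forall y, Cmod (L y + - M y) <= (K + K) * n y).
  { intros y. eapply Rle_trans; [apply Cmod_triangle|]. rewrite Cmod_opp.
    specialize (HL y). specialize (HM y). lra. }
  pose proof (dif_comp n _ _ _ (K + K) _ _ Hn HB1 (dif_plus _ _ _ _ _ _ _ Hf Hg) (Hhalf _)) as H1.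
  pose proof (dif_comp n _ _ _ (K + K) _ _ Hn HB2 (dif_plus _ _ _ _ _ _ _ Hf Hneg) (Hhalf _)) as H2.
  intros e He.
  destruct (H1 (e / 2)) as (d1 & Hd1 & H1'); [lra|].
  destruct (H2 (e / 2)) as (d2 & Hd2 & H2'); [lra|].
  exists (Rmin d1 d2). split; [now apply Rmin_glb_lt|]. intros y Hy.
  assert (n y < d1 /\ n y < d2) as [Ha Hb].
  { split; (eapply Rlt_le_trans; [exact Hy|]); [apply Rmin_l|apply Rmin_r]. }
  specialize (H1' y Ha). specialize (H2' y Hb).
  match type of H1' with Cmod ?a <= _ => match type of H2' with Cmod ?b <= _ =>
    replace (f y * g y - f0 * g0 - (f0 * M y + g0 * L y))%C with (a - b)%C by field end end.
  eapply Rle_trans; [apply Cmod_minus_le|]. lra.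
Qed.

Lemma cderiv_bound (l z : C) (y : C) : Cmod (l * (y - z))%C <= Cmod l * Cmod (y - z).
Proof. rewrite Cmod_mult. apply Rle_refl. Qed.

Lemma rderiv_bound (l : C) t y : Cmod (l * RtoC (y - t))%C <= Cmod l * Rabs (y - t).
Proof. rewrite Cmod_mult, Cmod_R. apply Rle_refl. Qed.

Lemma cderiv_eq f z l l' : cderiv f z l -> l = l' -> cderiv f z l'.
Proof. intros H <-. exact H. Qed.

Lemma cderiv_ext f g z l d0 : 0 < d0 ->
  (forall y, Cmod (y - z) < d0 -> f y = g y) -> cderiv f z l -> cderiv g z l.
Proof.
  intros Hd0 H Hf. unfold cderiv. rewrite <- H.
  - exact (dif_ext _ _ _ _ _ d0 Hd0 H Hf).
  - replace (z - z)%C with (RtoC 0) by ring. now rewrite Cmod_0.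
Qed.

Lemma cderiv_const c z : cderiv (fun _ => c) z 0.
Proof.
  intros e He. exists 1. split; [lra|]. intros y _.
  replace (c - c - 0 * (y - z))%C with (RtoC 0) by ring. rewrite Cmod_0.
  apply Rmult_le_pos; [lra|apply Cmod_ge_0].
Qed.

Lemma cderiv_id z : cderiv (fun y => y) z 1.
Proof.
  intros e He. exists 1. split; [lra|]. intros y _.
  replace (y - z - 1 * (y - z))%C with (RtoC 0) by ring. rewrite Cmod_0.
  apply Rmult_le_pos; [lra|apply Cmod_ge_0].
Qed.

Lemma cderiv_plus f g z l m : cderiv f z l -> cderiv g z m ->
  cderiv (fun y => f y + g y)%C z (l + m).
Proof.
  intros Hf Hg. eapply dif_extL; [|exact (dif_plus _ _ _ _ _ _ _ Hf Hg)].
  intros y. cbv beta. ring.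
Qed.

Lemma cderiv_mult f g z l m : cderiv f z l -> cderiv g z m ->
  cderiv (fun y => f y * g y)%C z (f z * m + g z * l).
Proof.
  intros Hf Hg. eapply dif_extL.
  2:{ refine (dif_mult _ _ _ _ _ _ _ (Rmax (Cmod l) (Cmod m)) _ _ _ Hf Hg).
      - intros y. apply Cmod_ge_0.
      - intros y. eapply Rle_trans; [apply cderiv_bound|].
        apply Rmult_le_compat_r; [apply Cmod_ge_0|apply Rmax_l].
      - intros y. eapply Rle_trans; [apply cderiv_bound|].
        apply Rmult_le_compat_r; [apply Cmod_ge_0|apply Rmax_r]. }
  intros y. cbv beta. ring.
Qed.

Lemma cderiv_comp f g z l m : cderiv f z l -> cderiv g (f z) m ->
  cderiv (fun y => g (f y)) z (m * l).
Proof.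
  intros Hf Hg. eapply dif_extL.
  2:{ refine (dif_comp _ _ _ _ (Cmod l) _ _ _ _ Hf Hg).
      - intros y. apply Cmod_ge_0.
      - intros y. apply cderiv_bound. }
  intros y. cbv beta. ring.
Qed.

Lemma cderiv_inv z : z <> RtoC 0 -> cderiv Cinv z (- / (z * z)).
Proof.
  intros Hz e He. assert (Hm : 0 < Cmod z) by now apply Cmod_gt_0.
  exists (Rmin (Cmod z / 2) (e * (Cmod z ^ 3) / 2)). split.
  { apply Rmin_glb_lt; [lra|]. apply Rdiv_lt_0_compat; [|lra].
    apply Rmult_lt_0_compat; [exact He|now apply pow_lt]. }
  intros y Hy.
  assert (Ha : Cmod (y - z) < Cmod z / 2) by (eapply Rlt_le_trans; [exact Hy|apply Rmin_l]).
  assert (Hb : Cmod (y - z) < e * Cmod z ^ 3 / 2) by (eapply Rlt_le_trans; [exact Hy|apply Rmin_r]).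
  assert (Hym : Cmod z / 2 < Cmod y).
  { generalize (Cmod_ge_sub z y). rewrite Cmod_sub_sym. lra. }
  assert (Hy0 : y <> RtoC 0) by (apply Cmod_gt_0; lra).
  replace (/ y - / z - - / (z * z) * (y - z))%C
    with ((y - z) * (y - z) * / (y * (z * z)))%C by (field; auto).
  rewrite !Cmod_mult, Cmod_inv, !Cmod_mult.
  2:{ repeat apply Cmult_neq_0; auto. }
  rewrite Rmult_assoc, (Rmult_comm e). apply Rmult_le_compat_l; [apply Cmod_ge_0|].
  apply (Rmult_le_reg_r (Cmod y * (Cmod z * Cmod z))).
  { repeat apply Rmult_lt_0_compat; lra. }
  rewrite Rmult_assoc, Rinv_l, Rmult_1_r.
  2:{ apply Rgt_not_eq. repeat apply Rmult_lt_0_compat; lra. }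
  apply Rle_trans with (e * (Cmod z / 2 * (Cmod z * Cmod z))).
  - nra.
  - apply Rmult_le_compat_l; [lra|]. apply Rmult_le_compat_r; [nra|lra].
Qed.

Lemma cderiv_unique f z l l' : cderiv f z l -> cderiv f z l' -> l = l'.
Proof.
  intros H1 H2. cut (l - l' = 0)%C.
  { intros H. replace l with ((l - l') + l')%C by ring. rewrite H. ring. }
  apply Cmod_le_eq0. intros e He.
  destruct (H1 (e / 2)) as (d1 & Hd1 & H1'); [lra|].
  destruct (H2 (e / 2)) as (d2 & Hd2 & H2'); [lra|].
  set (h := Rmin d1 d2 / 2). assert (Hm : 0 < Rmin d1 d2) by now apply Rmin_glb_lt.
  assert (Hh : 0 < h) by (unfold h; lra).
  assert (Hh1 : h < d1) by (unfold h; generalize (Rmin_l d1 d2); lra).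
  assert (Hh2 : h < d2) by (unfold h; generalize (Rmin_r d1 d2); lra).
  assert (E : (z + h - z)%C = RtoC h) by ring.
  specialize (H1' (z + h)%C). specialize (H2' (z + h)%C).
  rewrite E, Cmod_R, Rabs_pos_eq in H1', H2' by lra.
  specialize (H1' Hh1). specialize (H2' Hh2).
  assert (H3 : Cmod ((l - l') * h)%C <= e * h).
  { replace ((l - l') * h)%C
     with ((f (z + h) - f z - l' * h) - (f (z + h) - f z - l * h))%C by ring.
    eapply Rle_trans; [apply Cmod_minus_le|]. lra. }
  rewrite Cmod_mult, Cmod_R, (Rabs_pos_eq h) in H3 by lra.
  apply (Rmult_le_reg_r h); assumption.
Qed.

Lemma cderiv_cont f z l : cderiv f z l -> ccont f z.
Proof.
  intros H e He.
  destruct (dif_lip _ _ _ _ (Cmod l) (fun y => Cmod_ge_0 _) (cderiv_bound l z) H) as (d & Hd & Hl).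
  generalize (Cmod_ge_0 l). intros Hl0.
  exists (Rmin d (e / (Cmod l + 2))). split.
  { apply Rmin_glb_lt; auto. apply Rdiv_lt_0_compat; lra. }
  intros y Hy.
  assert (Ha : Cmod (y - z) < d) by (eapply Rlt_le_trans; [exact Hy|apply Rmin_l]).
  assert (Hb : Cmod (y - z) < e / (Cmod l + 2)) by (eapply Rlt_le_trans; [exact Hy|apply Rmin_r]).
  eapply Rle_lt_trans; [apply Hl, Ha|].
  apply Rle_lt_trans with ((Cmod l + 2) * Cmod (y - z)).
  { apply Rmult_le_compat_r; [apply Cmod_ge_0|lra]. }
  apply (Rmult_lt_compat_l (Cmod l + 2)) in Hb; [|lra].
  replace ((Cmod l + 2) * (e / (Cmod l + 2))) with e in Hb by (field; lra). exact Hb.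
Qed.

Lemma ball_Cmod (x y : C) (e : R) : ball (M := C_UniformSpace) x e y -> Cmod (y - x) < sqrt 2 * e.
Proof.
  intros H.
  assert (He : 0 < e).
  { apply Rle_lt_trans with (Rabs (fst y - fst x)); [apply Rabs_pos|apply H]. }
  exact (C_NormedModule_mixin_compat2 x y (mkposreal e He) H).
Qed.

Lemma Cmod_ball (x y : C) (e : R) : Cmod (y - x) < e -> ball (M := C_UniformSpace) x e y.
Proof. exact (C_NormedModule_mixin_compat1 x y e). Qed.

Lemma sqrt2_bounds : 1 < sqrt 2 < 2.
Proof.
  split.
  - rewrite <- sqrt_1 at 1. apply sqrt_lt_1; lra.
  - rewrite <- (sqrt_Rsqr 2) at 2 by lra. apply sqrt_lt_1; unfold Rsqr; lra.
Qed.

(** Neighborhoods of the product topology on R * R are squares; Cauchy estimates want disks. *)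
Lemma locally_C_iff (z : C) (P : C -> Prop) :
  locally (T := C_UniformSpace) z P <-> exists d, 0 < d /\ forall y, Cmod (y - z) < d -> P y.
Proof.
  split.
  - intros (d & H). exists d. split; [apply cond_pos|]. intros y Hy. apply H. now apply Cmod_ball.
  - intros (d & Hd & H). assert (Hd2 : 0 < d / 2) by lra. exists (mkposreal _ Hd2). intros y Hy. apply H.
    eapply Rlt_trans; [apply ball_Cmod, Hy|]. simpl. generalize sqrt2_bounds. nra.
Qed.

(** [C_derive] is a total function defined as a limit; this identifies its value, so that every
    computation can be made with [cderiv]. *)
Lemma cderiv_C_derive f z l : cderiv f z l -> C_derive f z = l.
Proof.
  intros H. unfold C_derive. apply is_C_lim_unique. intros P HP.
  apply locally_C_iff in HP. destruct HP as (e & He & HP).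
  destruct (H (e / 2)) as (d & Hd & H'); [lra|].
  unfold filtermap, locally', within.
  apply (proj2 (locally_C_iff z (fun y => y <> z -> P ((f y - f z) / (y - z))%C))).
  exists d. split; [exact Hd|]. intros y Hy Hne. apply HP.
  assert (Hyz : (y - z <> 0)%C) by now apply Cminus_eq_contra.
  assert (Hm : 0 < Cmod (y - z)) by now apply Cmod_gt_0.
  replace ((f y - f z) / (y - z) - l)%C
    with ((f y - f z - l * (y - z)) / (y - z))%C by now field.
  rewrite Cmod_div by exact Hyz. specialize (H' y Hy).
  apply (Rmult_lt_reg_r (Cmod (y - z))); [exact Hm|].
  unfold Rdiv. rewrite Rmult_assoc, Rinv_l by lra. nra.
Qed.

(** * Continuity and holomorphic germs *)

Lemma ccont_const c z : ccont (fun _ => c) z.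
Proof. exact (cderiv_cont _ _ _ (cderiv_const c z)). Qed.

Lemma ccont_id z : ccont (fun y => y) z.
Proof. exact (cderiv_cont _ _ _ (cderiv_id z)). Qed.

Lemma ccont_comp f g z : ccont f z -> ccont g (f z) -> ccont (fun y => g (f y)) z.
Proof.
  intros Hf Hg e He. destruct (Hg e He) as (d & Hd & H).
  destruct (Hf d Hd) as (d' & Hd' & H'). exists d'. split; auto.
Qed.

Lemma ccont_ext f g z d0 : 0 < d0 ->
  (forall y, Cmod (y - z) < d0 -> f y = g y) -> ccont f z -> ccont g z.
Proof.
  intros Hd0 H Hf e He. destruct (Hf e He) as (d & Hd & H').
  exists (Rmin d d0). split; [now apply Rmin_glb_lt|]. intros y Hy.
  assert (Hz : Cmod (z - z) < d0).
  { replace (z - z)%C with (RtoC 0) by ring. now rewrite Cmod_0. }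
  rewrite <- (H z Hz), <- H.
  - apply H'. eapply Rlt_le_trans; [exact Hy|apply Rmin_l].
  - eapply Rlt_le_trans; [exact Hy|apply Rmin_r].
Qed.

Lemma ccont_plus f g z : ccont f z -> ccont g z -> ccont (fun y => f y + g y)%C z.
Proof.
  intros Hf Hg e He. destruct (Hf (e/2)) as (d & Hd & H); [lra|].
  destruct (Hg (e/2)) as (d' & Hd' & H'); [lra|].
  exists (Rmin d d'). split; [now apply Rmin_glb_lt|]. intros y Hy.
  replace (f y + g y - (f z + g z))%C with ((f y - f z) + (g y - g z))%C by ring.
  eapply Rle_lt_trans; [apply Cmod_triangle|].
  specialize (H y (Rlt_le_trans _ _ _ Hy (Rmin_l _ _))).
  specialize (H' y (Rlt_le_trans _ _ _ Hy (Rmin_r _ _))). lra.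
Qed.

(** By polarization, f g = ((f + g)^2 - (f - g)^2) / 4, since squaring is continuous. *)
Lemma ccont_mult f g z : ccont f z -> ccont g z -> ccont (fun y => f y * g y)%C z.
Proof.
  intros Hf Hg.
  assert (Hs : forall h, ccont h z -> ccont (fun y => h y * h y / 4)%C z).
  { intros h Hh. apply (ccont_comp h (fun y => y * y / 4)%C z Hh).
    eapply cderiv_cont. unfold Cdiv. apply cderiv_mult; [apply cderiv_mult; apply cderiv_id|apply cderiv_const]. }
  assert (Hn : ccont (fun y => - g y)%C z).
  { apply (ccont_comp g (fun y => - y)%C z Hg).
    apply (ccont_ext (fun y => (-1) * y)%C _ _ 1); [lra|intros; ring|].
    eapply cderiv_cont. apply cderiv_mult; [apply cderiv_const|apply cderiv_id]. }
  pose proof (Hs _ (ccont_plus _ _ _ Hf Hg)) as H1.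
  pose proof (Hs _ (ccont_plus _ _ _ Hf Hn)) as H2.
  assert (H3 : ccont (fun y => - ((f y + - g y) * (f y + - g y) / 4))%C z).
  { apply (ccont_comp _ (fun y => - y)%C z H2).
    apply (ccont_ext (fun y => (-1) * y)%C _ _ 1); [lra|intros; ring|].
    eapply cderiv_cont. apply cderiv_mult; [apply cderiv_const|apply cderiv_id]. }
  refine (ccont_ext _ _ _ 1 _ _ (ccont_plus _ _ _ H1 H3)); [lra|].
  intros y _. field.
Qed.

Lemma ccont_inv f z : f z <> RtoC 0 -> ccont f z -> ccont (fun y => / f y)%C z.
Proof.
  intros Hz Hf. apply (ccont_comp f Cinv z Hf). eapply cderiv_cont. now apply cderiv_inv.
Qed.

Lemma ccont_neq f z c : ccont f z -> f z <> c ->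
  exists d, 0 < d /\ forall y, Cmod (y - z) < d -> f y <> c.
Proof.
  intros Hf Hne.
  assert (H0 : 0 < Cmod (f z - c)) by (apply Cmod_gt_0; now apply Cminus_eq_contra).
  destruct (Hf _ H0) as (d & Hd & H). exists d. split; [exact Hd|].
  intros y Hy E. specialize (H y Hy). rewrite E, Cmod_sub_sym in H. lra.
Qed.

(** Continuity of the derivative is part of the definition; it makes differentiation under the
    integral sign available at once. *)
Definition hol_at (f : C -> C) (z : C) : Prop :=
  exists d, 0 < d /\ forall y, Cmod (y - z) < d ->
    cderiv f y (C_derive f y) /\ ccont (C_derive f) y.

Lemma Cmod_diag (z : C) : Cmod (z - z) = 0.
Proof. replace (z - z)%C with (RtoC 0) by ring. apply Cmod_0. Qed.

Lemma hol_intro f f' z d : 0 < d ->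
  (forall y, Cmod (y - z) < d -> cderiv f y (f' y) /\ ccont f' y) -> hol_at f z.
Proof.
  intros Hd H. exists d. split; [exact Hd|]. intros y Hy.
  destruct (H y Hy) as [Ha Hb]. split.
  - now rewrite (cderiv_C_derive _ _ _ Ha).
  - apply (ccont_ext f' _ _ (d - Cmod (y - z))); [lra| |exact Hb].
    intros x Hx. symmetry. apply cderiv_C_derive. apply H.
    generalize (Cmod_sub_tri x y z). lra.
Qed.

Lemma hol_cderiv f z : hol_at f z -> cderiv f z (C_derive f z).
Proof. intros (d & Hd & H). apply H. now rewrite Cmod_diag. Qed.

Lemma hol_dcont f z : hol_at f z -> ccont (C_derive f) z.
Proof. intros (d & Hd & H). apply H. now rewrite Cmod_diag. Qed.

Lemma hol_cont f z : hol_at f z -> ccont f z.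
Proof. intros H. eapply cderiv_cont. now apply hol_cderiv. Qed.

Lemma hol_near f z : hol_at f z ->
  exists d, 0 < d /\ forall y, Cmod (y - z) < d -> hol_at f y.
Proof.
  intros (d & Hd & H). exists d. split; [exact Hd|]. intros y Hy.
  exists (d - Cmod (y - z)). split; [lra|]. intros x Hx. apply H.
  generalize (Cmod_sub_tri x y z). lra.
Qed.

Lemma hol_ext f g z d : 0 < d -> (forall y, Cmod (y - z) < d -> f y = g y) ->
  hol_at f z -> hol_at g z.
Proof.
  intros Hd E (d' & Hd' & H).
  apply (hol_intro g (C_derive f) z (Rmin d d')); [now apply Rmin_glb_lt|].
  intros y Hy.
  assert (Ha : Cmod (y - z) < d) by (eapply Rlt_le_trans; [exact Hy|apply Rmin_l]).
  assert (Hb : Cmod (y - z) < d') by (eapply Rlt_le_trans; [exact Hy|apply Rmin_r]).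
  destruct (H y Hb) as [H1 H2]. split; [|exact H2].
  apply (cderiv_ext f g y _ (d - Cmod (y - z))); [lra| |exact H1].
  intros x Hx. apply E. generalize (Cmod_sub_tri x y z). lra.
Qed.

Lemma hol_const c z : hol_at (fun _ => c) z.
Proof.
  apply (hol_intro _ (fun _ => RtoC 0) z 1); [lra|]. intros y _.
  split; [apply cderiv_const|apply ccont_const].
Qed.

Lemma hol_id z : hol_at (fun y => y) z.
Proof.
  apply (hol_intro _ (fun _ => RtoC 1) z 1); [lra|]. intros y _.
  split; [apply cderiv_id|apply ccont_const].
Qed.

Lemma hol_pair f g z : hol_at f z -> hol_at g z ->
  exists d, 0 < d /\ forall y, Cmod (y - z) < d -> hol_at f y /\ hol_at g y.
Proof.
  intros Hf Hg. destruct (hol_near _ _ Hf) as (d & Hd & H).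
  destruct (hol_near _ _ Hg) as (d' & Hd' & H').
  exists (Rmin d d'). split; [now apply Rmin_glb_lt|]. intros y Hy.
  split; [apply H|apply H']; (eapply Rlt_le_trans; [exact Hy|]); [apply Rmin_l|apply Rmin_r].
Qed.

Lemma hol_plus f g z : hol_at f z -> hol_at g z -> hol_at (fun y => f y + g y)%C z.
Proof.
  intros Hf Hg. destruct (hol_pair _ _ _ Hf Hg) as (d & Hd & H).
  apply (hol_intro _ (fun y => C_derive f y + C_derive g y)%C z d Hd).
  intros y Hy. destruct (H y Hy) as [H1 H2]. split.
  - apply cderiv_plus; now apply hol_cderiv.
  - apply ccont_plus; now apply hol_dcont.
Qed.

Lemma hol_mult f g z : hol_at f z -> hol_at g z -> hol_at (fun y => f y * g y)%C z.
Proof.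
  intros Hf Hg. destruct (hol_pair _ _ _ Hf Hg) as (d & Hd & H).
  apply (hol_intro _ (fun y => f y * C_derive g y + g y * C_derive f y)%C z d Hd).
  intros y Hy. destruct (H y Hy) as [H1 H2]. split.
  - apply cderiv_mult; now apply hol_cderiv.
  - apply ccont_plus; apply ccont_mult; auto using hol_dcont, hol_cont.
Qed.

Lemma hol_comp f g z : hol_at f z -> hol_at g (f z) -> hol_at (fun y => g (f y)) z.
Proof.
  intros Hf Hg. destruct (hol_near _ _ Hf) as (d & Hd & H).
  destruct (hol_near _ _ Hg) as (e & He & H').
  destruct (hol_cont _ _ Hf e He) as (d' & Hd' & Hc).
  apply (hol_intro _ (fun y => C_derive g (f y) * C_derive f y)%C z (Rmin d d')).
  { now apply Rmin_glb_lt. }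
  intros y Hy.
  assert (Ha : Cmod (y - z) < d) by (eapply Rlt_le_trans; [exact Hy|apply Rmin_l]).
  assert (Hb : Cmod (y - z) < d') by (eapply Rlt_le_trans; [exact Hy|apply Rmin_r]).
  specialize (H y Ha). specialize (H' _ (Hc y Hb)). split.
  - apply cderiv_comp; now apply hol_cderiv.
  - apply ccont_mult; [|now apply hol_dcont].
    apply (ccont_comp f (C_derive g)); [now apply hol_cont|now apply hol_dcont].
Qed.

Lemma hol_inv_at z : z <> RtoC 0 -> hol_at Cinv z.
Proof.
  intros Hz. assert (Hm : 0 < Cmod z) by now apply Cmod_gt_0.
  apply (hol_intro _ (fun y => - / (y * y))%C z (Cmod z) Hm). intros y Hy.
  assert (Hy0 : y <> RtoC 0).
  { intros ->. rewrite Cmod_sub_sym in Hy. replace (z - 0)%C with z in Hy by ring. lra. }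
  split; [now apply cderiv_inv|].
  apply (ccont_ext (fun y => (-1) * / (y * y))%C _ _ 1); [lra|intros; ring|].
  apply ccont_mult; [apply ccont_const|]. apply ccont_inv; [now apply Cmult_neq_0|].
  apply ccont_mult; apply ccont_id.
Qed.

Lemma hol_inv f z : hol_at f z -> f z <> RtoC 0 -> hol_at (fun y => / f y)%C z.
Proof. intros Hf Hz. apply (hol_comp f Cinv z Hf). now apply hol_inv_at. Qed.

Lemma hol_div f g z : hol_at f z -> hol_at g z -> g z <> RtoC 0 ->
  hol_at (fun y => f y / g y)%C z.
Proof. intros Hf Hg Hz. apply hol_mult; [exact Hf|now apply hol_inv]. Qed.

Lemma hol_opp f z : hol_at f z -> hol_at (fun y => - f y)%C z.
Proof.
  intros Hf. apply (hol_ext (fun y => (-1) * f y)%C _ _ 1); [lra|intros; ring|].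
  apply hol_mult; [apply hol_const|exact Hf].
Qed.

Lemma hol_minus f g z : hol_at f z -> hol_at g z -> hol_at (fun y => f y - g y)%C z.
Proof. intros Hf Hg. apply hol_plus; [exact Hf|now apply hol_opp]. Qed.

Lemma hol_pow f n z : hol_at f z -> hol_at (fun y => f y ^ n)%C z.
Proof.
  intros Hf. induction n as [|n IH].
  - apply (hol_ext (fun _ => 1%C) _ _ 1); [lra|reflexivity|apply hol_const].
  - apply (hol_ext (fun y => f y * f y ^ n)%C _ _ 1); [lra| |now apply hol_mult].
    intros y _. now rewrite Cpow_S.
Qed.

(** * The complex exponential *)

Definition Cexp (z : C) : C := (exp (Re z) * cos (Im z), exp (Re z) * sin (Im z)).

Lemma Cexp_plus z w : Cexp (z + w) = (Cexp z * Cexp w)%C.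
Proof.
  unfold Cexp, Cplus, Cmult, Re, Im; simpl. rewrite exp_plus, cos_plus, sin_plus.
  f_equal; ring.
Qed.

Lemma Cexp_0 : Cexp 0 = 1%C.
Proof. unfold Cexp, Re, Im; simpl. rewrite exp_0, cos_0, sin_0. unfold RtoC. f_equal; ring. Qed.

Lemma Cexp_opp z : (Cexp z * Cexp (- z) = 1)%C.
Proof. rewrite <- Cexp_plus. replace (z + - z)%C with (RtoC 0) by ring. apply Cexp_0. Qed.

Lemma Cexp_neq_0 z : Cexp z <> RtoC 0.
Proof.
  intros H. generalize (Cexp_opp z). rewrite H. intros E.
  apply C1_nz. rewrite <- E. ring.
Qed.

Lemma Cexp_R x : Cexp (RtoC x) = RtoC (exp x).
Proof. unfold Cexp, Re, Im; simpl. rewrite cos_0, sin_0. unfold RtoC. f_equal; ring. Qed.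

Lemma Cmod_Cexp z : Cmod (Cexp z) = exp (Re z).
Proof.
  unfold Cexp, Cmod; simpl.
  replace (exp (Re z) * cos (Im z) * (exp (Re z) * cos (Im z) * 1) +
   exp (Re z) * sin (Im z) * (exp (Re z) * sin (Im z) * 1))
   with (Rsqr (exp (Re z)) * (Rsqr (sin (Im z)) + Rsqr (cos (Im z)))) by (unfold Rsqr; ring).
  rewrite sin2_cos2, Rmult_1_r. apply sqrt_Rsqr. apply Rlt_le, exp_pos.
Qed.

Lemma Cexp_pow z n : (Cexp z ^ n = Cexp (INR n * z))%C.
Proof.
  induction n as [|n IH].
  - simpl. rewrite <- Cexp_0. f_equal. simpl. ring.
  - rewrite Cpow_S, IH, <- Cexp_plus. f_equal. rewrite S_INR, RtoC_plus. ring.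
Qed.

Lemma Cexp_Ci_PI : Cexp (Ci * PI) = (-1)%C.
Proof.
  unfold Cexp. replace (Re (Ci * PI)%C) with 0 by (unfold Re, Ci, RtoC, Cmult; simpl; ring).
  replace (Im (Ci * PI)%C) with PI by (unfold Im, Ci, RtoC, Cmult; simpl; ring).
  rewrite cos_PI, sin_PI, exp_0. unfold RtoC. f_equal; ring.
Qed.

Lemma Cmod_le_abs (z : C) : Cmod z <= Rabs (Re z) + Rabs (Im z).
Proof.
  replace z with (RtoC (Re z) + Ci * RtoC (Im z))%C at 1.
  - eapply Rle_trans; [apply Cmod_triangle|]. rewrite Cmod_mult, Cmod_Ci, !Cmod_R. lra.
  - destruct z as [a b]. unfold Re, Im, Ci, RtoC, Cmult, Cplus; simpl. f_equal; ring.
Qed.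

Lemma Re_le_Cmod (z : C) : Rabs (Re z) <= Cmod z.
Proof. apply re_le_Cmod. Qed.

Lemma Im_le_Cmod (z : C) : Rabs (Im z) <= Cmod z.
Proof. eapply Rle_trans; [apply Rmax_r|apply Rmax_Cmod]. Qed.

Lemma derivable_o (f : R -> R) (l : R) : derivable_pt_lim f 0 l ->
  forall e, 0 < e -> exists d, 0 < d /\
   forall x, Rabs x < d -> Rabs (f x - f 0 - l * x) <= e * Rabs x.
Proof.
  intros H e He. destruct (H e He) as (d & Hd). exists d. split; [apply cond_pos|].
  intros x Hx. destruct (Req_dec x 0) as [->|Hx0].
  - replace (f 0 - f 0 - l * 0) with 0 by ring. rewrite Rabs_R0. lra.
  - specialize (Hd x Hx0 Hx). rewrite Rplus_0_l in Hd.
    replace (f x - f 0 - l * x) with (((f x - f 0) / x - l) * x) by (field; auto).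
    rewrite Rabs_mult. apply Rmult_le_compat_r; [apply Rabs_pos|lra].
Qed.

(** Euler's formula [Cexp_plus] reduces the claim to 0, where it follows from the derivatives of
    exp, cos and sin. *)
Lemma cderiv_Cexp z : cderiv Cexp z (Cexp z).
Proof.
  intros e He.
  set (E := exp (Re z)). assert (HE : 0 < E) by apply exp_pos.
  set (e1 := Rmin 1 (e / E / 9)).
  assert (He1 : 0 < e1).
  { apply Rmin_glb_lt; [lra|]. repeat apply Rdiv_lt_0_compat; lra. }
  assert (Hexp : derivable_pt_lim exp 0 1) by (rewrite <- exp_0; apply derivable_pt_lim_exp).
  assert (Hsin : derivable_pt_lim sin 0 1) by (rewrite <- cos_0; apply derivable_pt_lim_sin).
  assert (Hcos : derivable_pt_lim cos 0 0).
  { replace 0 with (- sin 0) at 2 by (rewrite sin_0; ring). apply derivable_pt_lim_cos. }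
  destruct (derivable_o _ _ Hexp e1 He1) as (d1 & Hd1 & H1).
  destruct (derivable_o _ _ Hsin e1 He1) as (d2 & Hd2 & H2).
  destruct (derivable_o _ _ Hcos e1 He1) as (d3 & Hd3 & H3).
  rewrite exp_0 in H1. rewrite sin_0 in H2. rewrite cos_0 in H3.
  exists (Rmin (Rmin d1 e1) (Rmin d2 d3)). split.
  { apply Rmin_glb_lt; apply Rmin_glb_lt; assumption. }
  intros y Hy. set (h := (y - z)%C) in *.
  replace y with (z + h)%C by (unfold h; ring). rewrite Cexp_plus.
  replace (Cexp z * Cexp h - Cexp z - Cexp z * h)%C with (Cexp z * (Cexp h - 1 - h))%C by ring.
  rewrite Cmod_mult, Cmod_Cexp. fold E.
  assert (Hre := Re_le_Cmod h). assert (Him := Im_le_Cmod h).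
  set (a := Re h) in *. set (b := Im h) in *. set (m := Cmod h) in *.
  assert (Hm1 : m < d1 /\ m < e1 /\ m < d2 /\ m < d3).
  { generalize (Rmin_l (Rmin d1 e1) (Rmin d2 d3)) (Rmin_r (Rmin d1 e1) (Rmin d2 d3))
      (Rmin_l d1 e1) (Rmin_r d1 e1) (Rmin_l d2 d3) (Rmin_r d2 d3). lra. }
  destruct Hm1 as (M1 & M2 & M3 & M4).
  specialize (H1 a ltac:(lra)). specialize (H2 b ltac:(lra)). specialize (H3 b ltac:(lra)).
  assert (HL : Cmod (Cexp h - 1 - h) <= 9 * e1 * m).
  { assert (He11 : e1 <= 1) by apply Rmin_l.
    assert (Hm0 : 0 <= m) by apply Cmod_ge_0.
    eapply Rle_trans; [apply Cmod_le_abs|].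
    replace (Re (Cexp h - 1 - h)) with (exp a * cos b - 1 - a)
      by (unfold Cexp, Cminus, Copp, Cplus, RtoC; simpl; fold a b; unfold a, b, Re; simpl; ring).
    replace (Im (Cexp h - 1 - h)) with (exp a * sin b - b)
      by (unfold Cexp, Cminus, Copp, Cplus, RtoC; simpl; fold a b; unfold a, b, Im; simpl; ring).
    apply Rabs_le_between in H1. apply Rabs_le_between in H2. apply Rabs_le_between in H3.
    apply Rabs_le_between in Hre. apply Rabs_le_between in Him.
    assert (Rabs a <= m /\ Rabs b <= m) as [Ra Rb]
      by (split; apply Rabs_le; lra).
    assert (Hea : e1 * Rabs a <= e1 * m) by nra.
    assert (Heb : e1 * Rabs b <= e1 * m) by nra.
    assert (Hex : Rabs (exp a - 1) <= 2 * m).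
    { apply Rabs_le. assert (e1 * m <= m) by nra. lra. }
    assert (Hexa : 0 < exp a <= 3).
    { split; [apply exp_pos|]. apply Rabs_le_between in Hex. lra. }
    assert (A1 : Rabs (exp a * (cos b - 1)) <= 3 * (e1 * m)).
    { rewrite Rabs_mult. apply Rmult_le_compat; try apply Rabs_pos.
      - rewrite Rabs_pos_eq; lra.
      - apply Rabs_le. lra. }
    assert (A2 : Rabs ((exp a - 1) * sin b) <= (2 * m) * (2 * e1)).
    { rewrite Rabs_mult. apply Rmult_le_compat; try apply Rabs_pos; [exact Hex|].
      apply Rabs_le. assert (e1 * m <= e1) by nra. lra. }
    apply Rabs_le_between in A1. apply Rabs_le_between in A2.
    assert (B1 : Rabs (exp a * cos b - 1 - a) <= 4 * (e1 * m)).
    { apply Rabs_le.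
      replace (exp a * cos b - 1 - a) with (exp a * (cos b - 1) + (exp a - 1 - 1 * a)) by ring. lra. }
    assert (B2 : Rabs (exp a * sin b - b) <= e1 * m + 2 * m * (2 * e1)).
    { apply Rabs_le.
      replace (exp a * sin b - b) with ((exp a - 1) * sin b + (sin b - 0 - 1 * b)) by ring. lra. }
    replace (2 * m * (2 * e1)) with (4 * (e1 * m)) in B2 by ring. lra. }
  apply Rle_trans with (E * (9 * e1 * m)).
  - apply Rmult_le_compat_l; lra.
  - assert (He2 : e1 <= e / E / 9) by apply Rmin_r.
    assert (Hm0 : 0 <= m) by apply Cmod_ge_0.
    replace (E * (9 * e1 * m)) with (m * (9 * E * e1)) by ring.
    rewrite (Rmult_comm e). apply Rmult_le_compat_l; [exact Hm0|].
    apply Rle_trans with (9 * E * (e / E / 9)).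
    + apply Rmult_le_compat_l; lra.
    + right. field. lra.
Qed.

Lemma hol_Cexp z : hol_at Cexp z.
Proof.
  apply (hol_intro _ Cexp z 1); [lra|]. intros y _. split; [apply cderiv_Cexp|].
  eapply cderiv_cont. apply cderiv_Cexp.
Qed.

(** * Finite and infinite sums of complex numbers *)

Fixpoint Csum (u : nat -> C) (n : nat) : C :=
  match n with O => RtoC 0 | S m => (Csum u m + u m)%C end.

Fixpoint Rsum (u : nat -> R) (n : nat) : R :=
  match n with O => 0 | S m => Rsum u m + u m end.

Definition Csum2 (u : nat -> nat -> C) (n : nat) : C :=
  Csum (fun i => Csum (u i) n) n.

Definition ctends (u : nat -> C) (l : C) : Prop :=
  forall e, 0 < e -> exists N, forall n, (N <= n)%nat -> Cmod (u n - l) <= e.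

Definition cser (u : nat -> C) (l : C) : Prop := ctends (Csum u) l.
(** Square partial sums, as in [is_sum2]. *)
Definition cser2 (u : nat -> nat -> C) (l : C) : Prop := ctends (Csum2 u) l.

Lemma Csum_ext u v n : (forall k, (k < n)%nat -> u k = v k) -> Csum u n = Csum v n.
Proof. induction n as [|n IH]; intros H; simpl; [reflexivity|]. rewrite IH, H; auto. Qed.

Lemma Csum_plus u v n : Csum (fun k => u k + v k)%C n = (Csum u n + Csum v n)%C.
Proof. induction n as [|n IH]; simpl; [ring|]. rewrite IH. ring. Qed.

Lemma Csum_scal c u n : Csum (fun k => c * u k)%C n = (c * Csum u n)%C.
Proof. induction n as [|n IH]; simpl; [ring|]. rewrite IH. ring. Qed.

Lemma Csum_0 n : Csum (fun _ => RtoC 0) n = RtoC 0.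
Proof. induction n as [|n IH]; simpl; [ring|]. rewrite IH. ring. Qed.

Lemma Csum_shift u n : Csum u (S n) = (u O + Csum (fun k => u (S k)) n)%C.
Proof. induction n as [|n IH]; [simpl; ring|]. change (Csum u (S (S n))) with (Csum u (S n) + u (S n))%C.
  rewrite IH. simpl. ring. Qed.

Lemma Csum_swap (u : nat -> nat -> C) n m :
  Csum (fun i => Csum (u i) m) n = Csum (fun j => Csum (fun i => u i j) n) m.
Proof.
  induction n as [|n IH]; simpl.
  - now rewrite Csum_0.
  - rewrite IH. now rewrite <- Csum_plus.
Qed.

Lemma Csum_le u v n : (forall k, (k < n)%nat -> Cmod (u k) <= v k) -> Cmod (Csum u n) <= Rsum v n.
Proof.
  induction n as [|n IH]; intros H; simpl; [rewrite Cmod_0; lra|].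
  eapply Rle_trans; [apply Cmod_triangle|]. apply Rplus_le_compat; auto.
Qed.

Lemma Rsum_scal c u n : Rsum (fun k => c * u k) n = c * Rsum u n.
Proof. induction n as [|n IH]; simpl; [ring|]. rewrite IH. ring. Qed.

Lemma Rsum_geom q n : 0 <= q < 1 -> Rsum (fun k => q ^ k) n <= / (1 - q).
Proof.
  intros Hq. assert (H : Rsum (fun k => q ^ k) n * (1 - q) = 1 - q ^ n).
  { induction n as [|n IH]; simpl; [ring|]. rewrite Rmult_plus_distr_r, IH. ring. }
  apply (Rmult_le_reg_r (1 - q)); [lra|]. rewrite H, Rinv_l by lra.
  generalize (pow_le q n). lra.
Qed.

Lemma Csum_tail u B q n m : 0 <= B -> 0 <= q < 1 -> (n <= m)%nat ->
  (forall k, Cmod (u k) <= B * q ^ k) ->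
  Cmod (Csum u m - Csum u n) <= B * q ^ n / (1 - q).
Proof.
  intros HB Hq Hnm H.
  assert (E : forall k, (Csum u (n + k) - Csum u n)%C = Csum (fun i => u (n + i)%nat) k).
  { induction k as [|k IH]; [rewrite Nat.add_0_r; simpl; ring|].
    rewrite Nat.add_succ_r. simpl. rewrite <- IH. ring. }
  replace m with (n + (m - n))%nat by lia. rewrite E.
  eapply Rle_trans; [apply (Csum_le _ (fun i => (B * q ^ n) * q ^ i))|].
  - intros k _. eapply Rle_trans; [apply H|]. rewrite pow_add. lra.
  - rewrite Rsum_scal. apply Rmult_le_compat_l; [|now apply Rsum_geom].
    apply Rmult_le_pos; [exact HB|]. apply pow_le; lra.
Qed.

Lemma ctends_unique u l l' : ctends u l -> ctends u l' -> l = l'.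
Proof.
  intros H H'. cut (l - l' = 0)%C.
  { intros E. replace l with ((l - l') + l')%C by ring. rewrite E. ring. }
  apply Cmod_le_eq0. intros e He.
  destruct (H (e/2)) as (N & HN); [lra|]. destruct (H' (e/2)) as (N' & HN'); [lra|].
  specialize (HN (N + N')%nat ltac:(lia)). specialize (HN' (N + N')%nat ltac:(lia)).
  rewrite Cmod_sub_sym in HN. generalize (Cmod_sub_tri l (u (N + N')%nat) l'). lra.
Qed.

Lemma ctends_ext u v l : (forall n, u n = v n) -> ctends u l -> ctends v l.
Proof. intros E H e He. destruct (H e He) as (N & HN). exists N. intros n Hn. rewrite <- E. auto. Qed.

Lemma ctends_plus u v l m : ctends u l -> ctends v m -> ctends (fun n => u n + v n)%C (l + m)%C.
Proof.
  intros H H' e He.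
  destruct (H (e/2)) as (N & HN); [lra|]. destruct (H' (e/2)) as (N' & HN'); [lra|].
  exists (N + N')%nat. intros n Hn.
  specialize (HN n ltac:(lia)). specialize (HN' n ltac:(lia)).
  replace (u n + v n - (l + m))%C with ((u n - l) + (v n - m))%C by ring.
  eapply Rle_trans; [apply Cmod_triangle|]. lra.
Qed.

Lemma ctends_scal c u l : ctends u l -> ctends (fun n => c * u n)%C (c * l)%C.
Proof.
  intros H e He. assert (Hc : 0 < Cmod c + 1) by (generalize (Cmod_ge_0 c); lra).
  destruct (H (e / (Cmod c + 1))) as (N & HN); [now apply Rdiv_lt_0_compat|].
  exists N. intros n Hn. specialize (HN n Hn).
  replace (c * u n - c * l)%C with (c * (u n - l))%C by ring. rewrite Cmod_mult.
  apply Rle_trans with ((Cmod c + 1) * (e / (Cmod c + 1))).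
  - apply Rmult_le_compat; try apply Cmod_ge_0; lra.
  - right. field. lra.
Qed.

Lemma ctends_const c : ctends (fun _ => c) c.
Proof. intros e He. exists O. intros n _. rewrite Cmod_diag. lra. Qed.

Lemma pow_tends0 q B : 0 <= q < 1 -> 0 <= B -> forall e, 0 < e ->
  exists N, forall n, (N <= n)%nat -> B * q ^ n <= e.
Proof.
  intros Hq HB e He. destruct (pow_lt_1_zero q) with (y := e / (B + 1)) as (N & HN).
  - rewrite Rabs_pos_eq; lra.
  - apply Rdiv_lt_0_compat; lra.
  - exists N. intros n Hn. specialize (HN n Hn). rewrite Rabs_pos_eq in HN by (apply pow_le; lra).
    apply Rle_trans with ((B + 1) * (e / (B + 1))).
    + apply Rmult_le_compat; try lra. apply pow_le; lra.
    + right. field. lra.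
Qed.

Lemma ctends_geom0 u B q : 0 <= q < 1 -> 0 <= B -> (forall n, Cmod (u n) <= B * q ^ n) -> ctends u 0.
Proof.
  intros Hq HB H e He. destruct (pow_tends0 q B Hq HB e He) as (N & HN). exists N. intros n Hn.
  replace (u n - 0)%C with (u n) by ring. eapply Rle_trans; [apply H|auto].
Qed.

(** Completeness of C, for sequences that are Cauchy at a geometric rate, together with the rate of
    convergence. *)
Lemma ctends_geom u B q : 0 <= B -> 0 <= q < 1 ->
  (forall n m, (n <= m)%nat -> Cmod (u m - u n) <= B * q ^ n) ->
  exists l, ctends u l /\ forall n, Cmod (u n - l) <= B * q ^ n.
Proof.
  intros HB Hq H.
  assert (HC : forall g : C -> R, (forall z w, g (z - w)%C = g z - g w) ->
     (forall z, Rabs (g z) <= Cmod z) -> exists x, Un_cv (fun n => g (u n)) x).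
  { intros g Hg Hgm.
    assert (Hc : Cauchy_crit (fun n => g (u n))).
    { intros e He. destruct (pow_tends0 q B Hq HB (e/2)) as (N & HN); [lra|].
      exists N. intros n m Hn Hm. unfold Rdist. rewrite <- Hg. eapply Rle_lt_trans; [apply Hgm|].
      destruct (Nat.le_gt_cases n m) as [L|L].
      - rewrite Cmod_sub_sym. specialize (H n m L). specialize (HN n Hn). lra.
      - specialize (H m n ltac:(lia)). specialize (HN m Hm). lra. }
    destruct (Rcomplete.R_complete _ Hc) as (x & Hx). now exists x. }
  destruct (HC Re) as (x & Hx). { intros [? ?] [? ?]. reflexivity. } { apply Re_le_Cmod. }
  destruct (HC Im) as (y & Hy). { intros [? ?] [? ?]. reflexivity. } { apply Im_le_Cmod. }
  assert (HT : ctends u (x, y)).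
  { intros e He. destruct (Hx (e/2)) as (N & HN); [lra|]. destruct (Hy (e/2)) as (N' & HN'); [lra|].
    exists (N + N')%nat. intros n Hn. eapply Rle_trans; [apply Cmod_le_abs|].
    specialize (HN n ltac:(lia)). specialize (HN' n ltac:(lia)).
    change (Re (u n - (x, y))) with (Re (u n) - x).
    change (Im (u n - (x, y))) with (Im (u n) - y).
    unfold Rdist in *. lra. }
  exists (x, y). split; [exact HT|]. intros n. apply le_epsilon. intros e He.
  destruct (HT e He) as (N & HN). specialize (HN (n + N)%nat ltac:(lia)).
  specialize (H n (n + N)%nat ltac:(lia)). rewrite Cmod_sub_sym in H.
  generalize (Cmod_sub_tri (u n) (u (n + N)%nat) (x, y)). lra.
Qed.

Lemma cser_geom u B q : 0 <= B -> 0 <= q < 1 -> (forall k, Cmod (u k) <= B * q ^ k) ->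
  exists l, cser u l /\ Cmod l <= B / (1 - q) /\
    forall n, Cmod (l - Csum u n) <= B * q ^ n / (1 - q).
Proof.
  intros HB Hq H. destruct (ctends_geom (Csum u) (B / (1 - q)) q) as (l & Hl & Hn).
  - apply Rmult_le_pos; [exact HB|]. apply Rlt_le, Rinv_0_lt_compat; lra.
  - exact Hq.
  - intros n m Hnm. eapply Rle_trans; [now apply (Csum_tail u B q)|]. right. field. lra.
  - exists l. split; [exact Hl|]. split.
    + specialize (Hn O). simpl in Hn. rewrite Cmod_sub_sym in Hn.
      replace (l - 0)%C with l in Hn by ring. lra.
    + intros n. rewrite Cmod_sub_sym. eapply Rle_trans; [apply Hn|]. right. field. lra.
Qed.

Lemma cser_bound u l B q : 0 <= B -> 0 <= q < 1 -> (forall k, Cmod (u k) <= B * q ^ k) ->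
  cser u l -> Cmod l <= B / (1 - q).
Proof.
  intros HB Hq H Hl. destruct (cser_geom u B q HB Hq H) as (l' & Hl' & Hb & _).
  now rewrite (ctends_unique _ _ _ Hl Hl').
Qed.

Lemma cser_tail u l B q n : 0 <= B -> 0 <= q < 1 -> (forall k, Cmod (u k) <= B * q ^ k) ->
  cser u l -> Cmod (l - Csum u n) <= B * q ^ n / (1 - q).
Proof.
  intros HB Hq H Hl. destruct (cser_geom u B q HB Hq H) as (l' & Hl' & _ & Hb).
  now rewrite (ctends_unique _ _ _ Hl Hl').
Qed.

Lemma cser_plus u v l m : cser u l -> cser v m -> cser (fun k => u k + v k)%C (l + m)%C.
Proof.
  intros H H'. eapply ctends_ext; [|exact (ctends_plus _ _ _ _ H H')].
  intros n. now rewrite Csum_plus.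
Qed.

Lemma cser_scal c u l : cser u l -> cser (fun k => c * u k)%C (c * l)%C.
Proof.
  intros H. eapply ctends_ext; [|exact (ctends_scal c _ _ H)]. intros n. now rewrite Csum_scal.
Qed.

Lemma cser_ext u v l : (forall k, u k = v k) -> cser u l -> cser v l.
Proof. intros E. apply ctends_ext. intros n. apply Csum_ext. auto. Qed.

Lemma cser_terms u l : cser u l -> ctends u 0.
Proof.
  intros H e He. destruct (H (e/2)) as (N & HN); [lra|]. exists N. intros n Hn.
  assert (H1 := HN n Hn). assert (H2 := HN (S n) ltac:(lia)). simpl in H2.
  replace (u n - 0)%C with ((Csum u n + u n - l) - (Csum u n - l))%C by ring.
  eapply Rle_trans; [apply Cmod_minus_le|]. lra.
Qed.

Lemma ctends_bounded u l : ctends u l -> exists B, 0 <= B /\ forall n, Cmod (u n) <= B.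
Proof.
  intros H. destruct (H 1 Rlt_0_1) as (N & HN).
  assert (HB : forall M, exists B, 0 <= B /\ forall n, (n < M)%nat -> Cmod (u n) <= B).
  { induction M as [|M (B & HB0 & HB)]; [exists 0; split; [lra|]; intros; lia|].
    exists (B + Cmod (u M)). generalize (Cmod_ge_0 (u M)). intros Hm. split; [lra|].
    intros n Hn. destruct (Nat.eq_dec n M) as [->|Hne]; [lra|]. specialize (HB n ltac:(lia)). lra. }
  destruct (HB N) as (B & HB0 & HB').
  exists (B + Cmod l + 1). generalize (Cmod_ge_0 l). intros Hl. split; [lra|].
  intros n. destruct (Nat.lt_ge_cases n N) as [L|L].
  - specialize (HB' n L). lra.
  - specialize (HN n L). generalize (Cmod_ge_sub (u n) l). lra.
Qed.

(** * Double series *)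

(** The terms of the square of side n + 1 outside the square of side n: they turn square partial
    sums into the partial sums of a single series. *)
Definition shell (u : nat -> nat -> C) (n : nat) : C :=
  (Csum (fun i => u i n) n + Csum (u n) (S n))%C.

Lemma Csum2_shell u n : Csum2 u n = Csum (shell u) n.
Proof.
  induction n as [|n IH]; [reflexivity|].
  simpl Csum at 1. rewrite <- IH. unfold Csum2, shell.
  simpl. rewrite Csum_plus. ring.
Qed.

(** Domination by a geometric double series, which is what power series satisfy strictly inside
    their disk and what allows rearrangements. *)
Definition dom2 (B q : R) (u : nat -> nat -> C) : Prop :=
  0 <= B /\ 0 <= q < 1 /\ forall i j, Cmod (u i j) <= B * (q ^ i * q ^ j).

Lemma dom2_col B q u i n : dom2 B q u -> Cmod (Csum (fun k => u k i) n) <= B / (1 - q) * q ^ i.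
Proof.
  intros (HB & Hq & H).
  eapply Rle_trans; [apply (Csum_le _ (fun k => (B * q ^ i) * q ^ k))|].
  - intros k _. eapply Rle_trans; [apply H|]. lra.
  - rewrite Rsum_scal. replace (B / (1 - q) * q ^ i) with (B * q ^ i * / (1 - q)) by (field; lra).
    apply Rmult_le_compat_l; [|now apply Rsum_geom].
    apply Rmult_le_pos; [exact HB|]. apply pow_le; lra.
Qed.

Lemma dom2_swap B q u : dom2 B q u -> dom2 B q (fun i j => u j i).
Proof. intros (HB & Hq & H). repeat split; try lra. intros i j. rewrite (Rmult_comm (q ^ i)). apply H. Qed.

Lemma dom2_shell B q u n : dom2 B q u -> Cmod (shell u n) <= 2 * (B / (1 - q)) * q ^ n.
Proof.
  intros H. unfold shell. eapply Rle_trans; [apply Cmod_triangle|].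
  apply Rle_trans with (B / (1 - q) * q ^ n + B / (1 - q) * q ^ n).
  - apply Rplus_le_compat; [apply (dom2_col B q u n n H)|].
    exact (dom2_col B q _ n (S n) (dom2_swap _ _ _ H)).
  - right. ring.
Qed.

Lemma cser2_dom B q u : dom2 B q u -> exists l, cser2 u l /\ Cmod l <= 2 * (B / (1 - q)) / (1 - q).
Proof.
  intros H. assert (HB := proj1 H). assert (Hq := proj1 (proj2 H)).
  destruct (cser_geom (shell u) (2 * (B / (1 - q))) q) as (l & Hl & Hb & _); auto.
  - apply Rmult_le_pos; [lra|]. apply Rmult_le_pos; [lra|]. apply Rlt_le, Rinv_0_lt_compat; lra.
  - intros n. now apply dom2_shell.
  - exists l. split; [|exact Hb]. eapply ctends_ext; [|exact Hl]. intros n. symmetry. apply Csum2_shell.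
Qed.

Lemma cser2_bound B q u l : dom2 B q u -> cser2 u l -> Cmod l <= 2 * (B / (1 - q)) / (1 - q).
Proof.
  intros H Hl. destruct (cser2_dom B q u H) as (l' & Hl' & Hb).
  now rewrite (ctends_unique _ _ _ Hl Hl').
Qed.

Lemma Csum2_plus u v n : Csum2 (fun i j => u i j + v i j)%C n = (Csum2 u n + Csum2 v n)%C.
Proof.
  unfold Csum2. rewrite <- Csum_plus. apply Csum_ext. intros. now rewrite <- Csum_plus.
Qed.

Lemma Csum2_scal c u n : Csum2 (fun i j => c * u i j)%C n = (c * Csum2 u n)%C.
Proof.
  unfold Csum2. rewrite <- Csum_scal. apply Csum_ext. intros. now rewrite <- Csum_scal.
Qed.

Lemma cser2_plus u v l m : cser2 u l -> cser2 v m -> cser2 (fun i j => u i j + v i j)%C (l + m)%C.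
Proof.
  intros H H'. eapply ctends_ext; [|exact (ctends_plus _ _ _ _ H H')].
  intros n. now rewrite Csum2_plus.
Qed.

Lemma cser2_scal c u l : cser2 u l -> cser2 (fun i j => c * u i j)%C (c * l)%C.
Proof.
  intros H. eapply ctends_ext; [|exact (ctends_scal c _ _ H)]. intros n. now rewrite Csum2_scal.
Qed.

Lemma cser2_ext u v l : (forall i j, u i j = v i j) -> cser2 u l -> cser2 v l.
Proof.
  intros E. apply ctends_ext. intros n. apply Csum_ext. intros. apply Csum_ext. auto.
Qed.

Lemma cser2_swap u l : cser2 u l -> cser2 (fun i j => u j i) l.
Proof. apply ctends_ext. intros n. unfold Csum2. now rewrite Csum_swap. Qed.

(** The rows have geometric tails, uniformly after weighting by q^i, so truncating them costs a
    vanishing amount. *)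
Lemma cser2_iter B q u l rw : dom2 B q u -> cser2 u l -> (forall i, cser (u i) (rw i)) -> cser rw l.
Proof.
  intros HD Hl Hr. destruct HD as (HB & Hq & H).
  assert (H1q : 0 < / (1 - q)) by (apply Rinv_0_lt_compat; lra).
  apply (ctends_ext (fun n => Csum2 u n + (Csum rw n - Csum2 u n))%C); [intros; ring|].
  replace l with (l + 0)%C by ring. apply ctends_plus; [exact Hl|].
  apply (ctends_geom0 _ (B / (1 - q) / (1 - q)) q); auto.
  - repeat apply Rmult_le_pos; lra.
  - intros n. replace (Csum rw n - Csum2 u n)%C with (Csum (fun i => rw i + (-1) * Csum (u i) n)%C n)
      by (rewrite Csum_plus, Csum_scal; unfold Csum2; ring).
    eapply Rle_trans; [apply (Csum_le _ (fun i => (B * q ^ n / (1 - q)) * q ^ i))|].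
    + intros i _. replace (rw i + -1 * Csum (u i) n)%C with (rw i - Csum (u i) n)%C by ring.
      eapply Rle_trans; [apply (cser_tail (u i) (rw i) (B * q ^ i) q n)|]; auto.
      * apply Rmult_le_pos; [exact HB|]. apply pow_le; lra.
      * intros k. rewrite Rmult_assoc. apply H.
      * right. field. lra.
    + rewrite Rsum_scal. replace (B / (1 - q) / (1 - q) * q ^ n) with (B * q ^ n / (1 - q) * / (1 - q)) by (field; lra).
      apply Rmult_le_compat_l; [|now apply Rsum_geom].
      apply Rmult_le_pos; [|lra]. apply Rmult_le_pos; [exact HB|]. apply pow_le; lra.
Qed.

(** Used to differentiate term by term: the terms without x disappear and the first index moves
    down. *)
Lemma cser2_shift B q u l : dom2 B q u -> (forall j, u O j = RtoC 0) -> cser2 u l ->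
  cser2 (fun i j => u (S i) j) l.
Proof.
  intros HD H0 Hl.
  apply (ctends_ext (fun n => Csum2 u n + Csum (u n) n)%C).
  { intros n. unfold Csum2.
    assert (E := Csum_shift (fun i => Csum (u i) n) n). simpl in E. rewrite E.
    rewrite (Csum_ext (u O) (fun _ => RtoC 0)) by auto. rewrite Csum_0, Cplus_0_l.
    reflexivity. }
  replace l with (l + 0)%C by ring. apply ctends_plus; [exact Hl|].
  apply (ctends_geom0 _ (B / (1 - q)) q).
  - apply HD.
  - destruct HD as (HB & Hq & _). apply Rmult_le_pos; [lra|]. apply Rlt_le, Rinv_0_lt_compat; lra.
  - intros n. exact (dom2_col B q _ n n (dom2_swap _ _ _ HD)).
Qed.

(** * Estimates for monomials *)

(** Polynomial factors are absorbed by any slightly larger ratio. *)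
Lemma poly_geom q : 0 <= q < 1 -> exists K q', 0 <= K /\ 0 <= q' < 1 /\
  forall n, (INR n + 1) ^ 2 * q ^ n <= K * q' ^ n.
Proof.
  intros Hq. set (p := 2 / (1 + q)).
  assert (Hp : 1 < p).
  { apply (Rmult_lt_reg_r (1 + q)); [lra|]. unfold p, Rdiv. rewrite Rmult_assoc, Rinv_l; lra. }
  assert (Hpq : p * (1 + q) = 2) by (unfold p; field; lra).
  set (K := 1 + / (p - 1)). assert (Hi : 0 < / (p - 1)) by (apply Rinv_0_lt_compat; lra).
  assert (HB : forall n, INR n + 1 <= K * p ^ n).
  { intros n. assert (H := poly n (p - 1) ltac:(lra)).
    replace (1 + (p - 1)) with p in H by ring.
    assert (K * (1 + INR n * (p - 1)) = INR n + 1 + INR n * (p - 1) + / (p - 1)).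
    { unfold K. field. lra. }
    assert (0 <= INR n) by apply pos_INR.
    assert (0 <= INR n * (p - 1)) by (apply Rmult_le_pos; lra).
    assert (K * (1 + INR n * (p - 1)) <= K * p ^ n) by (apply Rmult_le_compat_l; unfold K in *; lra).
    lra. }
  exists (K ^ 2), (p * p * q). split; [apply pow2_ge_0|]. split.
  - split; [nra|]. assert (p * (1 + q) * (p * (1 + q)) = 4) by (rewrite Hpq; ring).
    assert ((1 - q) ^ 2 * (p * p) > 0) by (apply Rmult_lt_0_compat; nra). nra.
  - intros n. rewrite !Rpow_mult_distr. replace (K ^ 2 * (p ^ n * p ^ n * q ^ n)) with ((K * p ^ n) ^ 2 * q ^ n) by ring.
    apply Rmult_le_compat_r; [apply pow_le; lra|]. apply pow_incr. split; [generalize (pos_INR n); lra|apply HB].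
Qed.

(** The derivative of x^r. The exponent r - 1 is truncated at r = 0, where the factor r vanishes. *)
Definition dpow (r : nat) (x : C) : C := (INR r * x ^ (r - 1))%C.

Lemma dpow_S r x : dpow (S r) x = (x * dpow r x + x ^ r)%C.
Proof.
  unfold dpow. destruct r as [|r].
  { change (1 * 1 = x * (0 * x ^ (0 - 1)) + 1)%C. ring. }
  replace (S (S r) - 1)%nat with (S r) by lia. replace (S r - 1)%nat with r by lia.
  rewrite (S_INR (S r)), RtoC_plus, Cpow_S. ring.
Qed.

Lemma Cmod_pow_le x r rho : Cmod x <= rho -> Cmod (x ^ r)%C <= rho ^ r.
Proof. intros H. rewrite Cmod_pow. apply pow_incr. split; [apply Cmod_ge_0|exact H]. Qed.

Lemma dpow_le r x rho : 0 < rho -> Cmod x <= rho -> rho * Cmod (dpow r x) <= INR r * rho ^ r.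
Proof.
  intros Hr Hx. unfold dpow. rewrite Cmod_mult, Cmod_R, Rabs_pos_eq by apply pos_INR.
  destruct r as [|r]; [simpl; lra|].
  replace (S r - 1)%nat with r by lia. change (rho ^ S r) with (rho * rho ^ r).
  generalize (Cmod_pow_le x r rho Hx) (pos_INR (S r)). intros H1 H2.
  replace (rho * (INR (S r) * Cmod (x ^ r)%C)) with (rho * INR (S r) * Cmod (x ^ r)%C) by ring.
  replace (INR (S r) * (rho * rho ^ r)) with (rho * INR (S r) * rho ^ r) by ring.
  apply Rmult_le_compat_l; [nra|exact H1].
Qed.

Lemma pow_diff1 r x y rho : 0 < rho -> Cmod x <= rho -> Cmod y <= rho ->
  rho * Cmod (y ^ r - x ^ r)%C <= INR r * rho ^ r * Cmod (y - x).
Proof.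
  intros Hr Hx Hy. induction r as [|r IH].
  - simpl. replace (1 - 1)%C with (RtoC 0) by ring. rewrite Cmod_0. lra.
  - rewrite !Cpow_S. replace (y * y ^ r - x * x ^ r)%C with (y * (y ^ r - x ^ r) + x ^ r * (y - x))%C by ring.
    assert (H1 : Cmod (y * (y ^ r - x ^ r) + x ^ r * (y - x))%C
       <= rho * Cmod (y ^ r - x ^ r)%C + rho ^ r * Cmod (y - x)).
    { eapply Rle_trans; [apply Cmod_triangle|]. rewrite !Cmod_mult.
      apply Rplus_le_compat; apply Rmult_le_compat_r; try apply Cmod_ge_0; [exact Hy|].
      now apply Cmod_pow_le. }
    rewrite S_INR. simpl pow.
    apply Rle_trans with (rho * (INR r * rho ^ r * Cmod (y - x) + rho ^ r * Cmod (y - x))).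
    + apply Rmult_le_compat_l; [lra|]. lra.
    + right. ring.
Qed.

(** The second-order remainder of x^r, with a constant quadratic in r: summed against geometrically
    decaying coefficients, it makes power series differentiable term by term. *)
Lemma pow_diff2 r x y rho : 0 < rho -> Cmod x <= rho -> Cmod y <= rho ->
  rho ^ 2 * Cmod (y ^ r - x ^ r - dpow r x * (y - x))%C
    <= INR r ^ 2 * rho ^ r * Cmod (y - x) ^ 2.
Proof.
  intros Hr Hx Hy. induction r as [|r IH].
  - unfold dpow. simpl. replace (1 - 1 - 0 * 1 * (y - x))%C with (RtoC 0) by ring. rewrite Cmod_0. lra.
  - rewrite !Cpow_S, dpow_S.
    set (e := (y ^ r - x ^ r - dpow r x * (y - x))%C) in *.
    replace (y * y ^ r - x * x ^ r - (x * dpow r x + x ^ r) * (y - x))%C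
      with (y * e + dpow r x * ((y - x) * (y - x)))%C by (unfold e; ring).
    set (h := Cmod (y - x)) in *. assert (Hh : 0 <= h) by apply Cmod_ge_0.
    assert (H1 : Cmod (y * e + dpow r x * ((y - x) * (y - x)))%C <= rho * Cmod e + Cmod (dpow r x) * (h * h)).
    { eapply Rle_trans; [apply Cmod_triangle|]. rewrite !Cmod_mult. fold h.
      apply Rplus_le_compat_r. apply Rmult_le_compat_r; [apply Cmod_ge_0|exact Hy]. }
    assert (H2 := dpow_le r x rho Hr Hx).
    assert (Hp : 0 <= rho ^ r) by (apply pow_le; lra). assert (Hi := pos_INR r).
    rewrite S_INR.
    apply Rle_trans with (rho * (rho ^ 2 * Cmod e) + rho * (rho * Cmod (dpow r x)) * (h * h)).
    + replace (rho * (rho ^ 2 * Cmod e) + rho * (rho * Cmod (dpow r x)) * (h * h))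
       with (rho ^ 2 * (rho * Cmod e + Cmod (dpow r x) * (h * h))) by ring.
      apply Rmult_le_compat_l; [apply pow2_ge_0|exact H1].
    + apply Rle_trans with (rho * (INR r ^ 2 * rho ^ r * h ^ 2) + rho * (INR r * rho ^ r) * (h * h)).
      * apply Rplus_le_compat; [apply Rmult_le_compat_l; lra|].
        apply Rmult_le_compat_r; [nra|]. apply Rmult_le_compat_l; lra.
      * simpl pow. assert (0 <= (INR r + 1) * (rho * rho ^ r * (h * h))).
        { apply Rmult_le_pos; [lra|]. apply Rmult_le_pos; [|nra]. apply Rmult_le_pos; lra. }
        nra.
Qed.

(** * Power series are holomorphic *)

(** A choice of the limit, so that sums of series are functions. *)
Definition Clim (u : nat -> C) : C := epsilon (inhabits (RtoC 0)) (fun l => ctends u l).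

Lemma Clim_correct u : (exists l, ctends u l) -> ctends u (Clim u).
Proof. intros H. unfold Clim. apply epsilon_spec. exact H. Qed.

Lemma ctends_S u l : ctends (fun n => u (S n)) l -> ctends u l.
Proof.
  intros H e He. destruct (H e He) as (N & HN). exists (S N). intros n Hn.
  destruct n as [|n]; [lia|]. apply HN. lia.
Qed.

Definition ps (R : R) (c : nat -> C) (f : C -> C) : Prop :=
  forall z, Cmod z < R -> cser (fun n => c n * z ^ n)%C (f z).

Definition pder (c : nat -> C) (n : nat) : C := (INR (S n) * c (S n))%C.

Lemma ps_bound R c f rho : 0 <= rho < R -> ps R c f ->
  exists B, 0 <= B /\ forall n, Cmod (c n) * rho ^ n <= B.
Proof.
  intros Hr H. assert (E : Cmod (RtoC rho) = rho) by (rewrite Cmod_R; apply Rabs_pos_eq; lra).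
  destruct (ctends_bounded _ _ (cser_terms _ _ (H (RtoC rho) ltac:(lra)))) as (B & HB & Hb).
  exists B. split; [exact HB|]. intros n. specialize (Hb n).
  rewrite Cmod_mult, Cmod_pow, E in Hb. exact Hb.
Qed.

Lemma ratio_pow a b n : 0 < b -> a ^ n = (a / b) ^ n * b ^ n.
Proof. intros Hb. rewrite <- Rpow_mult_distr. f_equal. field. lra. Qed.

Lemma ratio_lt1 a b : 0 <= a < b -> 0 <= a / b < 1.
Proof.
  intros H. split.
  - apply Rmult_le_pos; [lra|]. apply Rlt_le, Rinv_0_lt_compat; lra.
  - apply (Rmult_lt_reg_r b); [lra|]. unfold Rdiv. rewrite Rmult_assoc, Rinv_l; lra.
Qed.

Lemma ps_pder R c f : ps R c f -> exists g, ps R (pder c) g.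
Proof.
  intros H. exists (fun z => Clim (Csum (fun n => pder c n * z ^ n)%C)).
  intros z Hz. apply Clim_correct.
  assert (Hz0 := Cmod_ge_0 z). set (r := (Cmod z + R) / 2).
  destruct (ps_bound R c f r) as (B & HB & Hb); [unfold r; lra|exact H|].
  assert (Hr : 0 < r) by (unfold r; lra).
  assert (Hq : 0 <= Cmod z / r < 1) by (apply ratio_lt1; unfold r; lra).
  destruct (poly_geom _ Hq) as (K & q & HK & Hq' & Hp).
  destruct (cser_geom (fun n => pder c n * z ^ n)%C (B / r * K) q) as (l & Hl & _); auto.
  - apply Rmult_le_pos; [|exact HK]. apply Rmult_le_pos; [exact HB|]. now apply Rlt_le, Rinv_0_lt_compat.
  - intros n. unfold pder. rewrite !Cmod_mult, Cmod_pow, Cmod_R, Rabs_pos_eq by apply pos_INR.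
    rewrite (ratio_pow (Cmod z) r n Hr).
    assert (H1 : Cmod (c (S n)) * r ^ n <= B / r).
    { apply (Rmult_le_reg_r r); [exact Hr|]. replace (B / r * r) with B by (field; lra).
      specialize (Hb (S n)). simpl in Hb. lra. }
    assert (H2 : 0 <= (Cmod z / r) ^ n) by (apply pow_le; lra).
    assert (H3 : INR (S n) * (Cmod z / r) ^ n <= K * q ^ n).
    { eapply Rle_trans; [|apply Hp]. apply Rmult_le_compat_r; [exact H2|].
      rewrite S_INR. generalize (pos_INR n). intros. nra. }
    replace (INR (S n) * Cmod (c (S n)) * ((Cmod z / r) ^ n * r ^ n))
      with ((Cmod (c (S n)) * r ^ n) * (INR (S n) * (Cmod z / r) ^ n)) by ring.
    rewrite (Rmult_assoc (B / r)).
    apply Rmult_le_compat; auto.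
    + apply Rmult_le_pos; [apply Cmod_ge_0|apply pow_le; lra].
    + apply Rmult_le_pos; [apply pos_INR|exact H2].
  - now exists l.
Qed.

Lemma pder_dpow c x l : cser (fun n => pder c n * x ^ n)%C l ->
  cser (fun n => c n * dpow n x)%C l.
Proof.
  intros H. apply ctends_S. eapply ctends_ext; [|exact H]. intros n.
  rewrite Csum_shift. unfold dpow at 1. change (INR 0) with 0.
  replace (c O * (0 * x ^ (0 - 1)))%C with (RtoC 0) by ring. rewrite Cplus_0_l.
  apply Csum_ext. intros k _. unfold pder, dpow. replace (S k - 1)%nat with k by lia. ring.
Qed.

(** Summation of [pow_diff2]: the remainder of order two is uniform on smaller disks. *)
Lemma ps_quad R c f g rho : 0 < rho < R -> ps R c f -> ps R (pder c) g ->
  exists M, 0 <= M /\ forall x y, Cmod x <= rho -> Cmod y <= rho ->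
    Cmod (f y - f x - g x * (y - x))%C <= M * Cmod (y - x) ^ 2.
Proof.
  intros Hr Hf Hg. set (r := (rho + R) / 2).
  destruct (ps_bound R c f r) as (B & HB & Hb); [unfold r; lra|exact Hf|].
  assert (Hr0 : 0 < r) by (unfold r; lra).
  assert (Hq : 0 <= rho / r < 1) by (apply ratio_lt1; unfold r; lra).
  destruct (poly_geom _ Hq) as (K & q & HK & Hq' & Hp).
  assert (Hi : 0 < / rho ^ 2) by (apply Rinv_0_lt_compat, pow_lt; lra).
  assert (Hiq : 0 < / (1 - q)) by (apply Rinv_0_lt_compat; lra).
  exists (B * K / rho ^ 2 / (1 - q)). split.
  { repeat apply Rmult_le_pos; lra. }
  intros x y Hx Hy. set (h := Cmod (y - x)).
  replace (B * K / rho ^ 2 / (1 - q) * h ^ 2) with (B * K / rho ^ 2 * h ^ 2 / (1 - q)) by (field; lra).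
  apply (cser_bound (fun n => c n * (y ^ n - x ^ n - dpow n x * (y - x)))%C); auto.
  - apply Rmult_le_pos; [|apply pow2_ge_0]. repeat apply Rmult_le_pos; lra.
  - intros n. rewrite Cmod_mult.
    assert (H1 := pow_diff2 n x y rho (proj1 Hr) Hx Hy). fold h in H1.
    apply (Rmult_le_reg_l (rho ^ 2)); [apply pow_lt; lra|].
    replace (rho ^ 2 * (B * K / rho ^ 2 * h ^ 2 * q ^ n)) with (B * (K * q ^ n) * h ^ 2) by (field; lra).
    apply Rle_trans with (Cmod (c n) * (INR n ^ 2 * rho ^ n * h ^ 2)).
    { rewrite <- Rmult_assoc, (Rmult_comm (rho ^ 2)), Rmult_assoc.
      apply Rmult_le_compat_l; [apply Cmod_ge_0|exact H1]. }
    rewrite (ratio_pow rho r n Hr0).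
    assert (H2 : 0 <= (rho / r) ^ n) by (apply pow_le; lra).
    replace (Cmod (c n) * (INR n ^ 2 * ((rho / r) ^ n * r ^ n) * h ^ 2))
      with ((Cmod (c n) * r ^ n) * (INR n ^ 2 * (rho / r) ^ n) * h ^ 2) by ring.
    apply Rmult_le_compat_r; [apply pow2_ge_0|]. apply Rmult_le_compat; auto.
    + apply Rmult_le_pos; [apply Cmod_ge_0|apply pow_le; lra].
    + apply Rmult_le_pos; [apply pow2_ge_0|exact H2].
    + eapply Rle_trans; [|apply Hp]. apply Rmult_le_compat_r; [exact H2|].
      apply pow_incr. generalize (pos_INR n). lra.
  - replace (f y - f x - g x * (y - x))%C with (f y + ((-1) * f x + (- (y - x)) * g x))%C by ring.
    assert (Ha := Hf y ltac:(lra)). assert (Hb' := Hf x ltac:(lra)).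
    assert (Hc := pder_dpow _ _ _ (Hg x ltac:(lra))).
    pose proof (cser_plus _ _ _ _ Ha (cser_plus _ _ _ _ (cser_scal (-1) _ _ Hb')
      (cser_scal (- (y - x)) _ _ Hc))) as HH.
    eapply cser_ext; [|exact HH]. intros n. cbv beta. ring.
Qed.

Lemma quad_cderiv f z l M d : 0 < d -> 0 <= M ->
  (forall y, Cmod (y - z) < d -> Cmod (f y - f z - l * (y - z)) <= M * Cmod (y - z) ^ 2) ->
  cderiv f z l.
Proof.
  intros Hd HM H e He. exists (Rmin d (e / (M + 1))). split.
  { apply Rmin_glb_lt; [exact Hd|]. apply Rdiv_lt_0_compat; lra. }
  intros y Hy.
  assert (Ha : Cmod (y - z) < d) by (eapply Rlt_le_trans; [exact Hy|apply Rmin_l]).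
  assert (Hb : Cmod (y - z) < e / (M + 1)) by (eapply Rlt_le_trans; [exact Hy|apply Rmin_r]).
  eapply Rle_trans; [apply H, Ha|]. assert (H0 := Cmod_ge_0 (y - z)).
  simpl. rewrite Rmult_1_r, <- Rmult_assoc. apply Rmult_le_compat_r; [exact H0|].
  apply Rle_trans with ((M + 1) * (e / (M + 1))).
  - apply Rmult_le_compat; lra.
  - right. field. lra.
Qed.

Lemma ps_cderiv R c f g z : ps R c f -> ps R (pder c) g -> Cmod z < R -> cderiv f z (g z).
Proof.
  intros Hf Hg Hz. assert (H0 := Cmod_ge_0 z).
  destruct (ps_quad R c f g ((Cmod z + R) / 2)) as (M & HM & H); [lra|exact Hf|exact Hg|].
  apply (quad_cderiv f z (g z) M ((R - Cmod z) / 2)); [lra|exact HM|].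
  intros y Hy. apply H; [lra|].
  replace y with (z + (y - z))%C by ring. eapply Rle_trans; [apply Cmod_triangle|]. lra.
Qed.

Lemma ps_hol R c f z : ps R c f -> Cmod z < R -> hol_at f z.
Proof.
  intros Hf Hz. destruct (ps_pder _ _ _ Hf) as (g & Hg). destruct (ps_pder _ _ _ Hg) as (g' & Hg').
  apply (hol_intro f g z (R - Cmod z)); [lra|]. intros y Hy.
  assert (Hy' : Cmod y < R).
  { replace y with (z + (y - z))%C by ring. eapply Rle_lt_trans; [apply Cmod_triangle|]. lra. }
  split; [now apply (ps_cderiv R c)|]. eapply cderiv_cont. now apply (ps_cderiv R (pder c) g g').
Qed.

Lemma ps_0 R c f : 0 < R -> ps R c f -> f 0 = c O.
Proof.
  intros HR H. apply (ctends_unique (Csum (fun n => c n * 0 ^ n)%C)).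
  - apply H. now rewrite Cmod_0.
  - apply ctends_S. eapply ctends_ext; [|apply (ctends_const (c O))]. intros n.
    rewrite Csum_shift, (Csum_ext _ (fun _ => RtoC 0)), Csum_0; [simpl; ring|].
    intros k _. rewrite Cpow_S. ring.
Qed.

(** * Double power series *)

(** The bound on the coefficients is at the radius R itself; it gives geometric domination on every
    smaller bidisk. *)
Definition ps2 (R : R) (a : nat -> nat -> C) (f : C -> C -> C) : Prop :=
  0 < R /\ (exists B, 0 <= B /\ forall i j, Cmod (a i j) * (R ^ i * R ^ j) <= B) /\
  forall x y, Cmod x < R -> Cmod y < R -> cser2 (monomials a x y) (f x y).

Definition pder1 (a : nat -> nat -> C) (i j : nat) : C := (INR (S i) * a (S i) j)%C.
Definition pder2 (a : nat -> nat -> C) (i j : nat) : C := (INR (S j) * a i (S j))%C.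

Lemma mono_dom R a B rho x y : 0 < R -> 0 <= B -> 0 <= rho < R ->
  (forall i j, Cmod (a i j) * (R ^ i * R ^ j) <= B) ->
  Cmod x <= rho -> Cmod y <= rho -> dom2 B (rho / R) (monomials a x y).
Proof.
  intros HR HB Hr H Hx Hy. split; [exact HB|]. split; [now apply ratio_lt1|].
  intros i j. unfold monomials. rewrite !Cmod_mult.
  assert (H1 := Cmod_pow_le x i rho Hx). assert (H2 := Cmod_pow_le y j rho Hy).
  apply Rle_trans with (Cmod (a i j) * rho ^ i * rho ^ j).
  { apply Rmult_le_compat; try apply Cmod_ge_0; [|apply Rmult_le_compat_l; [apply Cmod_ge_0|exact H1]|exact H2].
    apply Rmult_le_pos; apply Cmod_ge_0. }
  rewrite (ratio_pow rho R i HR), (ratio_pow rho R j HR).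
  replace (Cmod (a i j) * ((rho / R) ^ i * R ^ i) * ((rho / R) ^ j * R ^ j))
   with ((Cmod (a i j) * (R ^ i * R ^ j)) * ((rho / R) ^ i * (rho / R) ^ j)) by ring.
  apply Rmult_le_compat_r; [|apply H].
  assert (0 <= rho / R) by (apply ratio_lt1; lra).
  apply Rmult_le_pos; now apply pow_le.
Qed.

Lemma ps2_swap R a f : ps2 R a f -> ps2 R (fun i j => a j i) (fun x y => f y x).
Proof.
  intros (HR & (B & HB & Hb) & H). split; [exact HR|]. split.
  - exists B. split; [exact HB|]. intros i j. rewrite (Rmult_comm (R ^ i)). apply Hb.
  - intros x y Hx Hy. eapply cser2_ext; [|exact (cser2_swap _ _ (H y x Hy Hx))].
    intros i j. unfold monomials. ring.
Qed.

Lemma ps2_pder1 R rho a f : 0 < rho < R -> ps2 R a f -> exists p, ps2 rho (pder1 a) p.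
Proof.
  intros Hr (HR & (B & HB & Hb) & H).
  exists (fun x y => Clim (Csum2 (monomials (pder1 a) x y))).
  assert (Hq : 0 <= rho / R < 1) by (apply ratio_lt1; lra).
  destruct (poly_geom _ Hq) as (K & q & HK & Hq' & Hp).
  assert (Hbd : forall i j, Cmod (pder1 a i j) * (rho ^ i * rho ^ j) <= B / R * K).
  { intros i j. unfold pder1. rewrite Cmod_mult, Cmod_R, Rabs_pos_eq by apply pos_INR.
    assert (H1 : Cmod (a (S i) j) * (R ^ i * R ^ j) <= B / R).
    { apply (Rmult_le_reg_r R); [exact HR|]. replace (B / R * R) with B by (field; lra).
      specialize (Hb (S i) j). simpl in Hb. lra. }
    rewrite (ratio_pow rho R i HR), (ratio_pow rho R j HR).
    assert (H2 : forall n, 0 <= (rho / R) ^ n) by (intros; apply pow_le; lra).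
    assert (H2' : (rho / R) ^ j <= 1).
    { rewrite <- (pow1 j). apply pow_incr. lra. }
    assert (H3 : INR (S i) * (rho / R) ^ i <= K).
    { apply Rle_trans with (K * q ^ i).
      - eapply Rle_trans; [|apply Hp]. apply Rmult_le_compat_r; [apply H2|].
        rewrite S_INR. generalize (pos_INR i). intros. nra.
      - rewrite <- (Rmult_1_r K) at 2. apply Rmult_le_compat_l; [exact HK|].
        rewrite <- (pow1 i). apply pow_incr. lra. }
    replace (INR (S i) * Cmod (a (S i) j) * ((rho / R) ^ i * R ^ i * ((rho / R) ^ j * R ^ j)))
      with ((Cmod (a (S i) j) * (R ^ i * R ^ j)) * ((INR (S i) * (rho / R) ^ i) * (rho / R) ^ j)) by ring.
    assert (0 <= INR (S i) * (rho / R) ^ i) by (apply Rmult_le_pos; [apply pos_INR|apply H2]).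
    apply Rmult_le_compat; auto.
    - apply Rmult_le_pos; [apply Cmod_ge_0|]. apply Rmult_le_pos; apply pow_le; lra.
    - apply Rmult_le_pos; auto.
    - rewrite <- (Rmult_1_r K). apply Rmult_le_compat; auto. }
  assert (HBK : 0 <= B / R * K).
  { apply Rmult_le_pos; [|exact HK]. apply Rmult_le_pos; [exact HB|]. now apply Rlt_le, Rinv_0_lt_compat. }
  split; [apply Hr|]. split; [now exists (B / R * K)|].
  intros x y Hx Hy. apply Clim_correct.
  destruct (cser2_dom (B / R * K) (Rmax (Cmod x) (Cmod y) / rho) (monomials (pder1 a) x y)) as (l & Hl & _).
  - apply mono_dom; auto; try lra; [|apply Rmax_l|apply Rmax_r]. split; [|now apply Rmax_lub_lt].
    eapply Rle_trans; [apply Cmod_ge_0|apply Rmax_l].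
  - now exists l.
Qed.

Lemma ps2_pder2 R rho a f : 0 < rho < R -> ps2 R a f -> exists p, ps2 rho (pder2 a) p.
Proof.
  intros Hr H. destruct (ps2_pder1 R rho _ _ Hr (ps2_swap _ _ _ H)) as (p & Hp).
  exists (fun x y => p y x). exact (ps2_swap _ _ _ Hp).
Qed.

(** The sum of the differentiated series, indexed as the original one. *)
Lemma pder1_dpow R rho a f p x y : 0 < rho < R -> ps2 R a f -> ps2 rho (pder1 a) p ->
  Cmod x < rho -> Cmod y < rho -> cser2 (fun i j => a i j * dpow i x * y ^ j)%C (p x y).
Proof.
  intros Hr (HR & (B & HB & Hb) & _) (_ & _ & Hp) Hx Hy.
  assert (Hq : 0 <= rho / R < 1) by (apply ratio_lt1; lra).
  destruct (poly_geom _ Hq) as (K & q & HK & Hq' & Hpg).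
  assert (HD : dom2 (B / rho * K * 1 ) (Rmax q (rho / R)) (fun i j => a i j * dpow i x * y ^ j)%C).
  { split; [|split].
    - rewrite Rmult_1_r. apply Rmult_le_pos; [|exact HK]. apply Rmult_le_pos; [exact HB|].
      apply Rlt_le, Rinv_0_lt_compat; lra.
    - split; [eapply Rle_trans; [|apply Rmax_l]; lra|apply Rmax_lub_lt; lra].
    - intros i j. rewrite !Cmod_mult.
      assert (H1 := dpow_le i x rho ltac:(lra) ltac:(lra)). assert (H2 := Cmod_pow_le y j rho ltac:(lra)).
      apply (Rmult_le_reg_l rho); [lra|].
      replace (rho * (B / rho * K * 1 * (Rmax q (rho / R) ^ i * Rmax q (rho / R) ^ j)))
        with (B * ((K * Rmax q (rho / R) ^ i) * Rmax q (rho / R) ^ j)) by (field; lra).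
      apply Rle_trans with (Cmod (a i j) * (INR i * rho ^ i) * rho ^ j).
      { replace (rho * (Cmod (a i j) * Cmod (dpow i x) * Cmod (y ^ j)%C))
          with (Cmod (a i j) * (rho * Cmod (dpow i x)) * Cmod (y ^ j)%C) by ring.
        apply Rmult_le_compat; try apply Cmod_ge_0; [|apply Rmult_le_compat_l; [apply Cmod_ge_0|exact H1]|exact H2].
        apply Rmult_le_pos; [apply Cmod_ge_0|]. apply Rmult_le_pos; [lra|apply Cmod_ge_0]. }
      rewrite (ratio_pow rho R i HR), (ratio_pow rho R j HR).
      assert (H3 : forall n, 0 <= (rho / R) ^ n) by (intros; apply pow_le; lra).
      replace (Cmod (a i j) * (INR i * ((rho / R) ^ i * R ^ i)) * ((rho / R) ^ j * R ^ j))
        with ((Cmod (a i j) * (R ^ i * R ^ j)) * ((INR i * (rho / R) ^ i) * (rho / R) ^ j)) by ring.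
      assert (H4 : INR i * (rho / R) ^ i <= K * Rmax q (rho / R) ^ i).
      { apply Rle_trans with (K * q ^ i).
        - eapply Rle_trans; [|apply Hpg]. apply Rmult_le_compat_r; [apply H3|].
          generalize (pos_INR i). intros. nra.
        - apply Rmult_le_compat_l; [exact HK|]. apply pow_incr. split; [lra|apply Rmax_l]. }
      assert (H5 : (rho / R) ^ j <= Rmax q (rho / R) ^ j).
      { apply pow_incr. split; [lra|apply Rmax_r]. }
      assert (0 <= INR i * (rho / R) ^ i) by (apply Rmult_le_pos; [apply pos_INR|apply H3]).
      apply Rmult_le_compat; auto.
      + apply Rmult_le_pos; [apply Cmod_ge_0|]. apply Rmult_le_pos; apply pow_le; lra.
      + apply Rmult_le_pos; auto.
      + apply Rmult_le_compat; auto. }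
  destruct (cser2_dom _ _ _ HD) as (l & Hl & _).
  assert (E : p x y = l); [|now rewrite E].
  apply (ctends_unique (Csum2 (monomials (pder1 a) x y))).
  - apply Hp; assumption.
  - refine (cser2_ext _ _ _ _ (cser2_shift _ _ _ _ HD _ Hl)).
    + intros i j. unfold monomials, pder1, dpow. replace (S i - 1)%nat with i by lia. ring.
    + intros j. unfold dpow. change (INR 0) with 0. ring.
Qed.

(** The analogue of [ps_quad] in two variables. Uniformity of M also in the base point is needed
    where two sheets are compared along a sequence. *)
Lemma ps2_quad R rho a f p q : 0 < rho < R -> ps2 R a f ->
  ps2 rho (pder1 a) p -> ps2 rho (pder2 a) q ->
  exists M, 0 <= M /\ forall x y x' y', Cmod x < rho -> Cmod y < rho -> Cmod x' < rho -> Cmod y' < rho ->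
    Cmod (f x' y' - f x y - p x y * (x' - x) - q x y * (y' - y))%C
      <= M * (Cmod (x' - x) + Cmod (y' - y)) ^ 2.
Proof.
  intros Hr Hf Hp Hq0.
  pose proof Hf as (HR & (B & HB & Hb) & H).
  assert (Hq : 0 <= rho / R < 1) by (apply ratio_lt1; lra).
  destruct (poly_geom _ Hq) as (K & t & HK & Ht & Hpg).
  assert (Hi : 0 < / rho ^ 2) by (apply Rinv_0_lt_compat, pow_lt; lra).
  assert (Hit : 0 < / (1 - t)) by (apply Rinv_0_lt_compat; lra).
  exists (2 * (B * K ^ 2 / rho ^ 2 / (1 - t)) / (1 - t)). split.
  { repeat apply Rmult_le_pos; lra. }
  intros x y x' y' Hx Hy Hx' Hy'.
  set (h := (x' - x)%C). set (k := (y' - y)%C). set (m := Cmod h + Cmod k).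
  assert (Hh0 := Cmod_ge_0 h). assert (Hk0 := Cmod_ge_0 k).
  replace (2 * (B * K ^ 2 / rho ^ 2 / (1 - t)) / (1 - t) * m ^ 2)
    with (2 * (B * K ^ 2 / rho ^ 2 * m ^ 2 / (1 - t)) / (1 - t)) by (field; lra).
  apply (cser2_bound _ _ (fun i j => a i j * (x' ^ i * y' ^ j - x ^ i * y ^ j
     - dpow i x * y ^ j * h - x ^ i * dpow j y * k))%C).
  - split; [|split; [exact Ht|]].
    { apply Rmult_le_pos; [|apply pow2_ge_0]. repeat apply Rmult_le_pos; lra. }
    intros i j. rewrite Cmod_mult.
    set (ei := (x' ^ i - x ^ i - dpow i x * (x' - x))%C).
    set (ej := (y' ^ j - y ^ j - dpow j y * (y' - y))%C).
    replace (x' ^ i * y' ^ j - x ^ i * y ^ j - dpow i x * y ^ j * h - x ^ i * dpow j y * k)%C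
      with (ei * y' ^ j + dpow i x * h * (y' ^ j - y ^ j) + x ^ i * ej)%C
      by (unfold ei, ej, h, k; ring).
    assert (H1 := pow_diff2 i x x' rho (proj1 Hr) ltac:(lra) ltac:(lra)). fold h ei in H1.
    assert (H2 := pow_diff2 j y y' rho (proj1 Hr) ltac:(lra) ltac:(lra)). fold k ej in H2.
    assert (H3 := pow_diff1 j y y' rho (proj1 Hr) ltac:(lra) ltac:(lra)). fold k in H3.
    assert (H4 := dpow_le i x rho (proj1 Hr) ltac:(lra)).
    assert (H5 := Cmod_pow_le y' j rho ltac:(lra)). assert (H6 := Cmod_pow_le x i rho ltac:(lra)).
    assert (Hi0 := pos_INR i). assert (Hj0 := pos_INR j).
    assert (Hpi : 0 <= rho ^ i) by (apply pow_le; lra). assert (Hpj : 0 <= rho ^ j) by (apply pow_le; lra).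
    assert (HT : rho ^ 2 * Cmod (ei * y' ^ j + dpow i x * h * (y' ^ j - y ^ j) + x ^ i * ej)%C
       <= (INR i + 1) ^ 2 * (INR j + 1) ^ 2 * (rho ^ i * rho ^ j) * m ^ 2).
    { apply Rle_trans with ((rho ^ 2 * Cmod ei) * Cmod (y' ^ j)%C
         + (rho * Cmod (dpow i x)) * Cmod h * (rho * Cmod (y' ^ j - y ^ j)%C)
         + Cmod (x ^ i)%C * (rho ^ 2 * Cmod ej)).
      { replace ((rho ^ 2 * Cmod ei) * Cmod (y' ^ j)%C
         + (rho * Cmod (dpow i x)) * Cmod h * (rho * Cmod (y' ^ j - y ^ j)%C)
         + Cmod (x ^ i)%C * (rho ^ 2 * Cmod ej)) with
         (rho ^ 2 * (Cmod (ei * y' ^ j)%C + Cmod (dpow i x * h * (y' ^ j - y ^ j))%C + Cmod (x ^ i * ej)%C))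
         by (rewrite !Cmod_mult; ring).
        apply Rmult_le_compat_l; [apply pow2_ge_0|].
        eapply Rle_trans; [apply Cmod_triangle|]. apply Rplus_le_compat_r. apply Cmod_triangle. }
      apply Rle_trans with ((INR i ^ 2 * rho ^ i * Cmod h ^ 2) * rho ^ j
         + (INR i * rho ^ i) * Cmod h * (INR j * rho ^ j * Cmod k)
         + rho ^ i * (INR j ^ 2 * rho ^ j * Cmod k ^ 2)).
      { apply Rplus_le_compat; [apply Rplus_le_compat|].
        - apply Rmult_le_compat; auto; try apply Cmod_ge_0.
          apply Rmult_le_pos; [apply pow2_ge_0|apply Cmod_ge_0].
        - apply Rmult_le_compat; auto.
          + apply Rmult_le_pos; [|exact Hh0]. apply Rmult_le_pos; [lra|apply Cmod_ge_0].
          + apply Rmult_le_pos; [lra|apply Cmod_ge_0].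
          + apply Rmult_le_compat_r; auto.
        - apply Rmult_le_compat; auto; try apply Cmod_ge_0.
          apply Rmult_le_pos; [apply pow2_ge_0|apply Cmod_ge_0]. }
      set (I := INR i) in *. set (J := INR j) in *. set (P := rho ^ i * rho ^ j).
      assert (HP : 0 <= P) by (unfold P; apply Rmult_le_pos; auto).
      replace (I ^ 2 * rho ^ i * Cmod h ^ 2 * rho ^ j + I * rho ^ i * Cmod h * (J * rho ^ j * Cmod k) +
        rho ^ i * (J ^ 2 * rho ^ j * Cmod k ^ 2))
        with (P * ((I * Cmod h) ^ 2 + (I * Cmod h) * (J * Cmod k) + (J * Cmod k) ^ 2)) by (unfold P; ring).
      replace ((I + 1) ^ 2 * (J + 1) ^ 2 * P * m ^ 2) with (P * ((I + 1) * (J + 1) * m) ^ 2) by ring.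
      apply Rmult_le_compat_l; [exact HP|].
      apply Rle_trans with ((I * Cmod h + J * Cmod k) ^ 2).
      - assert (0 <= (I * Cmod h) * (J * Cmod k)) by (apply Rmult_le_pos; apply Rmult_le_pos; auto). nra.
      - apply pow_incr. split; [apply Rplus_le_le_0_compat; apply Rmult_le_pos; auto|].
        unfold m. assert (0 <= I * J) by (apply Rmult_le_pos; auto).
        assert (0 <= I * J * Cmod h) by (apply Rmult_le_pos; auto).
        assert (0 <= I * J * Cmod k) by (apply Rmult_le_pos; auto).
        assert (0 <= I * Cmod k) by (apply Rmult_le_pos; auto).
        assert (0 <= J * Cmod h) by (apply Rmult_le_pos; auto). lra. }
    apply (Rmult_le_reg_l (rho ^ 2)); [apply pow_lt; lra|].
    replace (rho ^ 2 * (B * K ^ 2 / rho ^ 2 * m ^ 2 * (t ^ i * t ^ j)))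
      with (B * ((K * t ^ i) * (K * t ^ j)) * m ^ 2) by (field; lra).
    match type of HT with _ * ?c <= _ => apply Rle_trans with (Cmod (a i j) * (rho ^ 2 * c)); [right; ring|] end.
    eapply Rle_trans; [apply Rmult_le_compat_l; [apply Cmod_ge_0|exact HT]|].
    rewrite (ratio_pow rho R i HR), (ratio_pow rho R j HR).
    assert (H7 : forall n, 0 <= (rho / R) ^ n) by (intros; apply pow_le; lra).
    replace (Cmod (a i j) * ((INR i + 1) ^ 2 * (INR j + 1) ^ 2 * ((rho / R) ^ i * R ^ i * ((rho / R) ^ j * R ^ j)) * m ^ 2))
     with ((Cmod (a i j) * (R ^ i * R ^ j)) * (((INR i + 1) ^ 2 * (rho / R) ^ i) * ((INR j + 1) ^ 2 * (rho / R) ^ j)) * m ^ 2) by ring.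
    assert (H8 : forall n, 0 <= (INR n + 1) ^ 2 * (rho / R) ^ n).
    { intros n. apply Rmult_le_pos; [apply pow2_ge_0|apply H7]. }
    apply Rmult_le_compat_r; [apply pow2_ge_0|]. apply Rmult_le_compat; auto.
    + apply Rmult_le_pos; [apply Cmod_ge_0|]. apply Rmult_le_pos; apply pow_le; lra.
    + apply Rmult_le_pos; auto.
    + apply Rmult_le_compat; auto.
  - assert (Ha := H x' y' ltac:(lra) ltac:(lra)). assert (Hb' := H x y ltac:(lra) ltac:(lra)).
    assert (Hc := pder1_dpow R rho a f p x y Hr Hf Hp Hx Hy).
    assert (Hd := cser2_swap _ _ (pder1_dpow R rho _ _ _ y x Hr (ps2_swap _ _ _ Hf) (ps2_swap _ _ _ Hq0) Hy Hx)).
    pose proof (cser2_plus _ _ _ _ Ha (cser2_plus _ _ _ _ (cser2_scal (-1) _ _ Hb')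
      (cser2_plus _ _ _ _ (cser2_scal (- h) _ _ Hc) (cser2_scal (- k) _ _ Hd)))) as HH.
    cbv beta in HH.
    replace (f x' y' - f x y - p x y * h - q x y * k)%C
      with (f x' y' + (-1 * f x y + (- h * p x y + - k * q x y)))%C by ring.
    eapply cser2_ext; [|exact HH]. intros i j. unfold monomials. cbv beta. ring.
Qed.

Lemma ps2_curve_cderiv R rho a f p q X Y t X' Y' : 0 < rho < R -> ps2 R a f ->
  ps2 rho (pder1 a) p -> ps2 rho (pder2 a) q ->
  Cmod (X t) < rho -> Cmod (Y t) < rho -> cderiv X t X' -> cderiv Y t Y' ->
  cderiv (fun s => f (X s) (Y s)) t (p (X t) (Y t) * X' + q (X t) (Y t) * Y').
Proof.
  intros Hr Hf Hp Hq HXt HYt HX HY.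
  destruct (ps2_quad R rho a f p q Hr Hf Hp Hq) as (M & HM & H).
  set (P := p (X t) (Y t)) in *. set (Q := q (X t) (Y t)) in *.
  destruct (dif_lip _ _ _ _ (Cmod X') (fun y => Cmod_ge_0 _) (cderiv_bound X' t) HX) as (d1 & Hd1 & L1).
  destruct (dif_lip _ _ _ _ (Cmod Y') (fun y => Cmod_ge_0 _) (cderiv_bound Y' t) HY) as (d2 & Hd2 & L2).
  destruct (cderiv_cont _ _ _ HX (rho - Cmod (X t))) as (d3 & Hd3 & C3); [lra|].
  destruct (cderiv_cont _ _ _ HY (rho - Cmod (Y t))) as (d4 & Hd4 & C4); [lra|].
  set (g := fun s => (f (X s) (Y s) - f (X t) (Y t) - P * (X s - X t) - Q * (Y s - Y t))%C).
  assert (Hx0 := Cmod_ge_0 X'). assert (Hy0 := Cmod_ge_0 Y').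
  assert (Hg : cderiv g t 0).
  { apply (quad_cderiv g t 0 (M * (Cmod X' + Cmod Y' + 2) ^ 2) (Rmin (Rmin d1 d2) (Rmin d3 d4))).
    - repeat apply Rmin_glb_lt; assumption.
    - apply Rmult_le_pos; [exact HM|apply pow2_ge_0].
    - intros s Hs.
      assert (Cmod (s - t) < d1 /\ Cmod (s - t) < d2 /\ Cmod (s - t) < d3 /\ Cmod (s - t) < d4) as (S1 & S2 & S3 & S4).
      { generalize (Rmin_l (Rmin d1 d2) (Rmin d3 d4)) (Rmin_r (Rmin d1 d2) (Rmin d3 d4))
          (Rmin_l d1 d2) (Rmin_r d1 d2) (Rmin_l d3 d4) (Rmin_r d3 d4). lra. }
      assert (Eg : g t = 0%C) by (unfold g; ring). rewrite Eg.
      replace (g s - 0 - 0 * (s - t))%C with (g s) by ring.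
      assert (HXs : Cmod (X s) < rho).
      { replace (X s) with ((X s - X t) + X t)%C by ring. eapply Rle_lt_trans; [apply Cmod_triangle|].
        specialize (C3 s S3). lra. }
      assert (HYs : Cmod (Y s) < rho).
      { replace (Y s) with ((Y s - Y t) + Y t)%C by ring. eapply Rle_lt_trans; [apply Cmod_triangle|].
        specialize (C4 s S4). lra. }
      eapply Rle_trans; [apply H; assumption|]. rewrite Rmult_assoc. apply Rmult_le_compat_l; [exact HM|].
      rewrite <- Rpow_mult_distr. apply pow_incr. split.
      + apply Rplus_le_le_0_compat; apply Cmod_ge_0.
      + specialize (L1 s S1). specialize (L2 s S2). lra. }
  pose proof (cderiv_plus _ _ _ _ _ (cderiv_plus _ _ _ _ _ Hg
     (cderiv_mult _ _ _ _ _ (cderiv_const P t) HX)) (cderiv_mult _ _ _ _ _ (cderiv_const Q t) HY)) as H1.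
  pose proof (cderiv_plus _ _ _ _ _ H1 (cderiv_const (f (X t) (Y t) - P * X t - Q * Y t)%C t)) as H2.
  apply (cderiv_ext _ (fun s => f (X s) (Y s)) _ _ 1 Rlt_0_1) in H2.
  - eapply cderiv_eq; [exact H2|]. cbv beta. ring.
  - intros s _. cbv beta. unfold g. ring.
Qed.

(** Composition with holomorphic curves is all that is used of holomorphy in two variables. *)
Lemma ps2_curve_hol R a f X Y t : ps2 R a f -> Cmod (X t) < R -> Cmod (Y t) < R ->
  hol_at X t -> hol_at Y t -> hol_at (fun s => f (X s) (Y s)) t.
Proof.
  intros Hf HXt HYt HX HY.
  set (m := Rmax (Cmod (X t)) (Cmod (Y t))).
  assert (Hm : 0 <= m < R).
  { split; [eapply Rle_trans; [apply Cmod_ge_0|apply Rmax_l]|now apply Rmax_lub_lt]. }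
  set (r1 := (m + 2 * R) / 3). set (r2 := (2 * m + R) / 3).
  assert (Hr1 : 0 < r1 < R) by (unfold r1; lra).
  assert (Hr2 : 0 < r2 < r1) by (unfold r1, r2; lra).
  destruct (ps2_pder1 R r1 a f Hr1 Hf) as (p & Hp). destruct (ps2_pder2 R r1 a f Hr1 Hf) as (q & Hq).
  destruct (ps2_pder1 r1 r2 _ p Hr2 Hp) as (pp & Hpp). destruct (ps2_pder2 r1 r2 _ p Hr2 Hp) as (pq & Hpq).
  destruct (ps2_pder1 r1 r2 _ q Hr2 Hq) as (qp & Hqp). destruct (ps2_pder2 r1 r2 _ q Hr2 Hq) as (qq & Hqq).
  destruct (hol_pair _ _ _ HX HY) as (d & Hd & HXY).
  assert (Hmx : Cmod (X t) <= m) by apply Rmax_l. assert (Hmy : Cmod (Y t) <= m) by apply Rmax_r.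
  destruct (hol_cont _ _ HX (r2 - m)) as (d3 & Hd3 & C3); [unfold r2; lra|].
  destruct (hol_cont _ _ HY (r2 - m)) as (d4 & Hd4 & C4); [unfold r2; lra|].
  apply (hol_intro _ (fun s => p (X s) (Y s) * C_derive X s + q (X s) (Y s) * C_derive Y s)%C t
    (Rmin d (Rmin d3 d4))).
  { repeat apply Rmin_glb_lt; assumption. }
  intros s Hs.
  assert (Cmod (s - t) < d /\ Cmod (s - t) < d3 /\ Cmod (s - t) < d4) as (S1 & S3 & S4).
  { generalize (Rmin_l d (Rmin d3 d4)) (Rmin_r d (Rmin d3 d4)) (Rmin_l d3 d4) (Rmin_r d3 d4). lra. }
  destruct (HXY s S1) as [HXs HYs].
  assert (BX : Cmod (X s) < r2).
  { replace (X s) with ((X s - X t) + X t)%C by ring. eapply Rle_lt_trans; [apply Cmod_triangle|].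
    specialize (C3 s S3). lra. }
  assert (BY : Cmod (Y s) < r2).
  { replace (Y s) with ((Y s - Y t) + Y t)%C by ring. eapply Rle_lt_trans; [apply Cmod_triangle|].
    specialize (C4 s S4). lra. }
  split.
  - apply (ps2_curve_cderiv R r1 a); auto using hol_cderiv; lra.
  - apply ccont_plus; apply ccont_mult; try (now apply hol_dcont).
    + eapply cderiv_cont. apply (ps2_curve_cderiv r1 r2 (pder1 a) p pp pq X Y s (C_derive X s) (C_derive Y s)); auto using hol_cderiv.
    + eapply cderiv_cont. apply (ps2_curve_cderiv r1 r2 (pder2 a) q qp qq X Y s (C_derive X s) (C_derive Y s)); auto using hol_cderiv.
Qed.

(** * Power series of analytic functions *)

Lemma filterlim_ctends (u : nat -> C) (l : C) :
  filterlim u eventually (locally (T := C_UniformSpace) l) -> ctends u l.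
Proof.
  intros H e He.
  assert (Hl : locally (T := C_UniformSpace) l (fun y => Cmod (y - l) < e)).
  { apply locally_C_iff. exists e. auto. }
  destruct (H _ Hl) as (N & HN). exists N. intros n Hn. apply Rlt_le. now apply HN.
Qed.

Lemma sum_n_Csum (u : nat -> C) n : sum_n (G := C_AbelianMonoid) u n = Csum u (S n).
Proof.
  induction n as [|n IH].
  - rewrite sum_O. simpl. ring.
  - rewrite sum_Sn, IH. reflexivity.
Qed.

Lemma sum_n_Rsum (u : nat -> R) n : sum_n (G := R_AbelianMonoid) u n = Rsum u (S n).
Proof.
  induction n as [|n IH].
  - rewrite sum_O. simpl. ring.
  - rewrite sum_Sn, IH. reflexivity.
Qed.

Lemma pow_n_Cpow (z : C) n : pow_n (K := C_Ring) z n = (z ^ n)%C.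
Proof. induction n as [|n IH]; [reflexivity|]. simpl pow_n. rewrite IH, Cpow_S. reflexivity. Qed.

Lemma analytic_ps f z0 : analytic_at f z0 -> exists R c, 0 < R /\ ps R c (fun h => f (z0 + h)%C).
Proof.
  intros (a & Ha). apply locally_C_iff in Ha. destruct Ha as (d & Hd & H).
  exists d, a. split; [exact Hd|]. intros h Hh.
  specialize (H (z0 + h)%C). replace (z0 + h - z0)%C with h in H by ring. specialize (H Hh).
  apply filterlim_ctends in H. apply ctends_S. eapply ctends_ext; [|exact H].
  intros n. rewrite sum_n_Csum. apply Csum_ext. intros k _. rewrite pow_n_Cpow.
  change ((h ^ k * a k)%C = (a k * h ^ k)%C). ring.
Qed.

Lemma locally_C2_iff (z w : C) (P : C * C -> Prop) :
  locally (T := prod_UniformSpace C_UniformSpace C_UniformSpace) (z, w) P <->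
  exists d, 0 < d /\ forall x y, Cmod (x - z) < d -> Cmod (y - w) < d -> P (x, y).
Proof.
  split.
  - intros (d & H). exists d. split; [apply cond_pos|]. intros x y Hx Hy. apply H.
    split; now apply Cmod_ball.
  - intros (d & Hd & H). assert (Hd2 : 0 < d / 2) by lra. exists (mkposreal _ Hd2).
    intros [x y] [Hx Hy]. apply H; (eapply Rlt_trans; [apply ball_Cmod; eassumption|]);
    simpl; generalize sqrt2_bounds; nra.
Qed.

Lemma sum2_cser2 u l : is_sum2 u l -> cser2 u l.
Proof.
  intros [_ H]. apply filterlim_ctends in H. apply ctends_S. eapply ctends_ext; [|exact H].
  intros n. cbv beta. rewrite sum_n_Csum. apply Csum_ext. intros i _. apply sum_n_Csum.
Qed.

Lemma Rsum_term u n k : (forall i, 0 <= u i) -> (k < n)%nat -> u k <= Rsum u n.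
Proof.
  intros Hu. induction n as [|n IH]; intros Hk; [lia|]. simpl.
  assert (0 <= Rsum u n).
  { clear -Hu. induction n as [|n IH]; simpl; [lra|]. specialize (Hu n). lra. }
  destruct (Nat.eq_dec k n) as [->|]; [lra|]. specialize (IH ltac:(lia)). specialize (Hu n). lra.
Qed.

Lemma Rsum_nonneg u n : (forall i, 0 <= u i) -> 0 <= Rsum u n.
Proof. intros Hu. induction n as [|n IH]; simpl; [lra|]. specialize (Hu n). lra. Qed.

Lemma abs_summable_terms u : abs_summable2 u -> exists B, 0 <= B /\ forall i j, Cmod (u i j) <= B.
Proof.
  intros (M & HM).
  assert (H : forall i j, Cmod (u i j) <= M).
  { intros i j. specialize (HM (i + j)%nat). rewrite sum_n_Rsum in HM.
    eapply Rle_trans; [|exact HM].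
    eapply Rle_trans; [|apply (Rsum_term _ _ i)]; [|intros k; cbv beta; rewrite sum_n_Rsum; apply Rsum_nonneg; intros; apply Cmod_ge_0|lia].
    cbv beta. rewrite sum_n_Rsum. apply (Rsum_term (fun j => Cmod (u i j))); [intros; apply Cmod_ge_0|lia]. }
  exists M. split; [|exact H]. eapply Rle_trans; [apply (Cmod_ge_0 (u O O))|apply H].
Qed.

Lemma analytic2_ps2 f z0 w0 : analytic2_at f z0 w0 ->
  exists R a, ps2 R a (fun h k => f (z0 + h)%C (w0 + k)%C).
Proof.
  intros (a & Ha). apply locally_C2_iff in Ha. destruct Ha as (d & Hd & H).
  exists (d / 2), a. split; [lra|]. split.
  - specialize (H (z0 + RtoC (d / 2))%C (w0 + RtoC (d / 2))%C). simpl in H.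
    replace (z0 + RtoC (d / 2) - z0)%C with (RtoC (d / 2)) in H by ring.
    replace (w0 + RtoC (d / 2) - w0)%C with (RtoC (d / 2)) in H by ring.
    assert (Em : Cmod (RtoC (d / 2)) = d / 2) by (rewrite Cmod_R; apply Rabs_pos_eq; lra).
    rewrite Em in H. destruct (H ltac:(lra) ltac:(lra)) as [Hs _].
    destruct (abs_summable_terms _ Hs) as (B & HB & Hb). exists B. split; [exact HB|].
    intros i j. specialize (Hb i j). unfold monomials in Hb. rewrite !Cmod_mult, !Cmod_pow, Em in Hb. lra.
  - intros x y Hx Hy. apply sum2_cser2. specialize (H (z0 + x)%C (w0 + y)%C). simpl in H.
    replace (z0 + x - z0)%C with x in H by ring. replace (w0 + y - w0)%C with y in H by ring.
    apply H; lra.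
Qed.

Lemma analytic_hol f z0 : analytic_at f z0 -> hol_at f z0.
Proof.
  intros H. destruct (analytic_ps _ _ H) as (R & c & HR & Hps).
  apply (hol_ext (fun z => (fun h => f (z0 + h)%C) (z - z0)%C) f z0 1 Rlt_0_1).
  - intros y _. cbv beta. f_equal. ring.
  - apply (hol_comp (fun z => z - z0)%C (fun h => f (z0 + h)%C)).
    + apply hol_minus; [apply hol_id|apply hol_const].
    + apply (ps_hol R c); [exact Hps|]. now rewrite Cmod_diag.
Qed.

(** Holomorphy in two variables, tested on holomorphic curves: it is stable under products,
    quotients and substitutions without any theory of several variables. *)
Definition hol2_on (f : C -> C -> C) (z0 w0 : C) (d : R) : Prop :=
  forall X Y t, Cmod (X t - z0) < d -> Cmod (Y t - w0) < d -> hol_at X t -> hol_at Y t ->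
    hol_at (fun s => f (X s) (Y s)) t.

Definition ccont2 (f : C -> C -> C) (z0 w0 : C) : Prop :=
  forall e, 0 < e -> exists d, 0 < d /\ forall z w,
    Cmod (z - z0) < d -> Cmod (w - w0) < d -> Cmod (f z w - f z0 w0) < e.

Lemma analytic2_hol2 f z0 w0 : analytic2_at f z0 w0 ->
  (exists d, 0 < d /\ hol2_on f z0 w0 d) /\ ccont2 f z0 w0.
Proof.
  intros H. destruct (analytic2_ps2 _ _ _ H) as (R & a & Hps). assert (HR : 0 < R) by apply Hps. split.
  - exists R. split; [exact HR|]. intros X Y t HX HY HhX HhY.
    apply (hol_ext (fun s => (fun h k => f (z0 + h)%C (w0 + k)%C) (X s - z0)%C (Y s - w0)%C) _ t 1 Rlt_0_1).
    + intros y _. cbv beta. f_equal; ring.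
    + apply (ps2_curve_hol R a _ (fun s => X s - z0)%C (fun s => Y s - w0)%C t Hps HX HY);
      apply hol_minus; auto using hol_const.
  - assert (Hr : 0 < R / 2 < R) by lra.
    destruct (ps2_pder1 R _ a _ Hr Hps) as (p & Hp). destruct (ps2_pder2 R _ a _ Hr Hps) as (q & Hq).
    destruct (ps2_quad R _ a _ p q Hr Hps Hp Hq) as (M & HM & HQ).
    set (K := Cmod (p 0 0) + Cmod (q 0 0) + M * (2 * R) + 1).
    assert (H1 := Cmod_ge_0 (p 0 0)). assert (H2 := Cmod_ge_0 (q 0 0)).
    assert (HK : 0 < K) by (unfold K; nra).
    intros e He. exists (Rmin (R / 2) (e / K / 2)). split.
    { apply Rmin_glb_lt; [lra|]. repeat apply Rdiv_lt_0_compat; lra. }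
    intros z w Hz Hw.
    assert (A1 : Cmod (z - z0) < R / 2) by (eapply Rlt_le_trans; [exact Hz|apply Rmin_l]).
    assert (A2 : Cmod (w - w0) < R / 2) by (eapply Rlt_le_trans; [exact Hw|apply Rmin_l]).
    assert (A3 : Cmod (z - z0) < e / K / 2) by (eapply Rlt_le_trans; [exact Hz|apply Rmin_r]).
    assert (A4 : Cmod (w - w0) < e / K / 2) by (eapply Rlt_le_trans; [exact Hw|apply Rmin_r]).
    specialize (HQ 0%C 0%C (z - z0)%C (w - w0)%C). rewrite Cmod_0 in HQ.
    specialize (HQ ltac:(lra) ltac:(lra) A1 A2).
    replace (z0 + (z - z0))%C with z in HQ by ring. replace (w0 + (w - w0))%C with w in HQ by ring.
    replace (z0 + 0)%C with z0 in HQ by ring. replace (w0 + 0)%C with w0 in HQ by ring.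
    replace (z - z0 - 0)%C with (z - z0)%C in HQ by ring. replace (w - w0 - 0)%C with (w - w0)%C in HQ by ring.
    set (h := (z - z0)%C) in *. set (k := (w - w0)%C) in *.
    replace (f z w - f z0 w0)%C with ((f z w - f z0 w0 - p 0 0 * h - q 0 0 * k) + (p 0 0 * h + q 0 0 * k))%C by ring.
    eapply Rle_lt_trans; [apply Cmod_triangle|].
    assert (A5 : Cmod (p 0 0 * h + q 0 0 * k)%C <= Cmod (p 0 0) * Cmod h + Cmod (q 0 0) * Cmod k).
    { rewrite <- !Cmod_mult. apply Cmod_triangle. }
    assert (B1 := Cmod_ge_0 h). assert (B2 := Cmod_ge_0 k). set (m := Cmod h + Cmod k) in *.
    assert (A6 : M * m ^ 2 <= M * (2 * R) * m).
    { rewrite Rmult_assoc. apply Rmult_le_compat_l; [exact HM|]. unfold m in *. nra. }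
    assert (A7 : Cmod (p 0 0) * Cmod h + Cmod (q 0 0) * Cmod k <= (Cmod (p 0 0) + Cmod (q 0 0)) * m).
    { unfold m. assert (0 <= Cmod (p 0 0) * Cmod k) by now apply Rmult_le_pos.
      assert (0 <= Cmod (q 0 0) * Cmod h) by now apply Rmult_le_pos. lra. }
    apply Rle_lt_trans with (K * m).
    { unfold K. assert (0 <= m) by (unfold m; lra). lra. }
    assert (A8 : m < e / K) by (unfold m; lra).
    apply (Rmult_lt_compat_l K) in A8; [|exact HK]. replace (K * (e / K)) with e in A8 by (field; lra). exact A8.
Qed.

(** * Integrals of complex functions of a real variable *)

Definition Cint (g : R -> C) (a b : R) : C := RInt (V := C_R_CompleteNormedModule) g a b.

Definition rcont (g : R -> C) (t : R) : Prop :=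
  forall e, 0 < e -> exists d, 0 < d /\ forall s, Rabs (s - t) < d -> Cmod (g s - g t) < e.

Lemma rcont_continuous g t : rcont g t -> continuous (T := R_UniformSpace) (U := C_UniformSpace) g t.
Proof.
  intros H P HP. apply locally_C_iff in HP. destruct HP as (e & He & HP).
  destruct (H e He) as (d & Hd & H'). exists (mkposreal d Hd). intros s Hs. apply HP, H'. exact Hs.
Qed.

Lemma norm_C_R (x : C) : norm (K := R_AbsRing) (V := C_R_NormedModule) x = Cmod x.
Proof.
  change (sqrt (Rabs (fst x) ^ 2 + Rabs (snd x) ^ 2) = Cmod x).
  rewrite !pow2_abs. reflexivity.
Qed.

Lemma rderiv_is_derive g t l : rderiv g t l ->
  is_derive (K := R_AbsRing) (V := C_R_NormedModule) g t l.
Proof.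
  intros H. split.
  - apply is_linear_scal_l.
  - intros x Hx e. assert (E := is_filter_lim_locally_unique _ _ Hx). rewrite <- E in *.
    destruct (H e (cond_pos e)) as (d & Hd & H'). exists (mkposreal d Hd). intros s Hs.
    specialize (H' s Hs).
    assert (Es : scal (V := C_R_ModuleSpace) (minus s t) l = (l * RtoC (s - t))%C).
    { rewrite scal_R_Cmult. apply Cmult_comm. }
    rewrite norm_C_R.
    change (Cmod (g s - g t - scal (V := C_R_ModuleSpace) (minus s t) l) <= e * Rabs (s - t)).
    rewrite Es. exact H'.
Qed.

Lemma is_derive_rderiv g t l : is_derive (K := R_AbsRing) (V := C_R_NormedModule) g t l -> rderiv g t l.
Proof.
  intros [_ H] e He. specialize (H t (fun P H => H) (mkposreal e He)).
  destruct H as (d & H'). exists d. split; [apply cond_pos|]. intros s Hs.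
  specialize (H' s Hs).
  assert (Es : scal (V := C_R_ModuleSpace) (minus s t) l = (l * RtoC (s - t))%C).
  { rewrite scal_R_Cmult. apply Cmult_comm. }
  rewrite norm_C_R in H'. rewrite <- Es. exact H'.
Qed.

Lemma rderiv_comp g f t l m : rderiv g t l -> cderiv f (g t) m -> rderiv (fun s => f (g s)) t (m * l).
Proof.
  intros Hg Hf. eapply dif_extL.
  2:{ refine (dif_comp _ _ _ _ (Cmod l) _ _ _ _ Hg Hf).
      - intros y. apply Rabs_pos.
      - intros y. apply rderiv_bound. }
  intros y. cbv beta. ring.
Qed.

Lemma rderiv_RtoC t : rderiv RtoC t 1.
Proof.
  intros e He. exists 1. split; [lra|]. intros s _.
  rewrite RtoC_minus. replace (s - t - 1 * (s - t))%C with (RtoC 0) by ring. rewrite Cmod_0.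
  apply Rmult_le_pos; [lra|apply Rabs_pos].
Qed.

Lemma rderiv_cderiv f t l : cderiv f (RtoC t) l -> rderiv (fun s => f (RtoC s)) t l.
Proof.
  intros H. replace l with (l * 1)%C by ring. exact (rderiv_comp RtoC f t 1 l (rderiv_RtoC t) H).
Qed.

Lemma rderiv_eq g t l l' : rderiv g t l -> l = l' -> rderiv g t l'.
Proof. intros H <-. exact H. Qed.

Lemma rderiv_ext f g t l : (forall s, f s = g s) -> rderiv f t l -> rderiv g t l.
Proof. intros E H. unfold rderiv. rewrite <- E. exact (dif_ext _ f g _ _ 1 Rlt_0_1 (fun y _ => E y) H). Qed.

Lemma rderiv_line a b t : rderiv (fun s => a + RtoC s * b)%C t b.
Proof.
  apply (rderiv_cderiv (fun z => a + z * b)%C). eapply cderiv_eq.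
  - apply cderiv_plus; [apply cderiv_const|]. apply cderiv_mult; [apply cderiv_id|apply cderiv_const].
  - cbv beta; ring.
Qed.

Lemma rderiv_plus f g t l m : rderiv f t l -> rderiv g t m -> rderiv (fun s => f s + g s)%C t (l + m).
Proof.
  intros Hf Hg. eapply dif_extL; [|exact (dif_plus _ _ _ _ _ _ _ Hf Hg)].
  intros y. cbv beta. ring.
Qed.

Lemma rderiv_cont g t l : rderiv g t l -> rcont g t.
Proof.
  intros H e He.
  destruct (dif_lip _ _ _ _ (Cmod l) (fun y => Rabs_pos _) (rderiv_bound l t) H) as (d & Hd & Hl).
  assert (Hl0 := Cmod_ge_0 l).
  exists (Rmin d (e / (Cmod l + 2))). split.
  { apply Rmin_glb_lt; auto. apply Rdiv_lt_0_compat; lra. }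
  intros y Hy.
  assert (Ha : Rabs (y - t) < d) by (eapply Rlt_le_trans; [exact Hy|apply Rmin_l]).
  assert (Hb : Rabs (y - t) < e / (Cmod l + 2)) by (eapply Rlt_le_trans; [exact Hy|apply Rmin_r]).
  eapply Rle_lt_trans; [apply Hl, Ha|].
  apply Rle_lt_trans with ((Cmod l + 2) * Rabs (y - t)).
  { apply Rmult_le_compat_r; [apply Rabs_pos|lra]. }
  apply (Rmult_lt_compat_l (Cmod l + 2)) in Hb; [|lra].
  replace ((Cmod l + 2) * (e / (Cmod l + 2))) with e in Hb by (field; lra). exact Hb.
Qed.

Lemma rcont_comp g f t : rcont g t -> ccont f (g t) -> rcont (fun s => f (g s)) t.
Proof.
  intros Hg Hf e He. destruct (Hf e He) as (d & Hd & H).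
  destruct (Hg d Hd) as (d' & Hd' & H'). exists d'. split; auto.
Qed.

Lemma rcont_ext f g t : (forall s, f s = g s) -> rcont f t -> rcont g t.
Proof.
  intros E H e He. destruct (H e He) as (d & Hd & H'). exists d. split; [exact Hd|].
  intros s Hs. rewrite <- !E. auto.
Qed.

Lemma rcont_plus f g t : rcont f t -> rcont g t -> rcont (fun s => f s + g s)%C t.
Proof.
  intros Hf Hg e He. destruct (Hf (e/2)) as (d & Hd & H); [lra|].
  destruct (Hg (e/2)) as (d' & Hd' & H'); [lra|].
  exists (Rmin d d'). split; [now apply Rmin_glb_lt|]. intros y Hy.
  replace (f y + g y - (f t + g t))%C with ((f y - f t) + (g y - g t))%C by ring.
  eapply Rle_lt_trans; [apply Cmod_triangle|].
  specialize (H y (Rlt_le_trans _ _ _ Hy (Rmin_l _ _))).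
  specialize (H' y (Rlt_le_trans _ _ _ Hy (Rmin_r _ _))). lra.
Qed.

Lemma rcont_mult f g t : rcont f t -> rcont g t -> rcont (fun s => f s * g s)%C t.
Proof.
  intros Hf Hg.
  assert (Hs : forall h, rcont h t -> rcont (fun s => h s * h s / 4)%C t).
  { intros h Hh. apply (rcont_comp h (fun y => y * y / 4)%C t Hh).
    apply ccont_mult; [apply ccont_mult; apply ccont_id|apply ccont_const]. }
  assert (Hn : forall h, rcont h t -> rcont (fun s => (-1) * h s)%C t).
  { intros h Hh. apply (rcont_comp h (fun y => (-1) * y)%C t Hh).
    apply ccont_mult; [apply ccont_const|apply ccont_id]. }
  refine (rcont_ext _ _ t _ (rcont_plus _ _ _ (Hs _ (rcont_plus _ _ _ Hf Hg))
    (Hn _ (Hs _ (rcont_plus _ _ _ Hf (Hn _ Hg)))))).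
  intros s. cbv beta. field.
Qed.

Lemma rcont_const c t : rcont (fun _ => c) t.
Proof. intros e He. exists 1. split; [lra|]. intros. now rewrite Cmod_diag. Qed.

Lemma Cint_ex g a b : (forall t, a <= t <= b -> rcont g t) -> a <= b ->
  ex_RInt (V := C_R_CompleteNormedModule) g a b.
Proof.
  intros H Hab. apply (ex_RInt_continuous (V := C_R_CompleteNormedModule)).
  intros t. rewrite Rmin_left, Rmax_right by exact Hab. intros Ht. apply rcont_continuous. auto.
Qed.

Lemma Cint_FTC F g a b : a <= b -> (forall t, a <= t <= b -> rderiv F t (g t)) ->
  (forall t, a <= t <= b -> rcont g t) -> Cint g a b = (F b - F a)%C.
Proof.
  intros Hab HF Hg. unfold Cint. apply (is_RInt_unique (V := C_R_CompleteNormedModule)).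
  apply (is_RInt_derive (V := C_R_CompleteNormedModule) F g a b);
  intros t; rewrite Rmin_left, Rmax_right by exact Hab; intros Ht.
  - now apply rderiv_is_derive, HF.
  - now apply rcont_continuous, Hg.
Qed.

Lemma Cint_bound g a b M : a <= b -> (forall t, a <= t <= b -> rcont g t) ->
  (forall t, a <= t <= b -> Cmod (g t) <= M) -> Cmod (Cint g a b) <= (b - a) * M.
Proof.
  intros Hab Hg HM.
  rewrite <- norm_C_R.
  apply (norm_RInt_le_const (V := C_R_NormedModule) g a b (Cint g a b) M Hab).
  { intros t Ht. rewrite norm_C_R. auto. }
  apply (RInt_correct (V := C_R_CompleteNormedModule)). now apply Cint_ex.
Qed.

Lemma Cint_prim g a b : a <= b -> (forall t, rcont g t) ->
  exists F, forall t, rderiv F t (g t).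
Proof.
  intros Hab Hg. exists (fun t => RInt (V := C_R_CompleteNormedModule) g a t).
  intros t. apply is_derive_rderiv.
  apply (is_derive_RInt (V := C_R_CompleteNormedModule) g (fun t => RInt (V := C_R_CompleteNormedModule) g a t) a t).
  - apply filter_forall. intros s. apply (RInt_correct (V := C_R_CompleteNormedModule)).
    apply (ex_RInt_continuous (V := C_R_CompleteNormedModule)). intros u _. now apply rcont_continuous.
  - now apply rcont_continuous.
Qed.

Lemma Cint_plus f g a b : a <= b -> (forall t, rcont f t) -> (forall t, rcont g t) ->
  Cint (fun t => f t + g t)%C a b = (Cint f a b + Cint g a b)%C.
Proof.
  intros Hab Hf Hg. destruct (Cint_prim f a b Hab Hf) as (F & HF).
  destruct (Cint_prim g a b Hab Hg) as (G & HG).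
  rewrite (Cint_FTC F f), (Cint_FTC G g) by auto.
  rewrite (Cint_FTC (fun t => F t + G t)%C); auto; try ring.
  - intros t _. apply rderiv_plus; auto.
  - intros t _. apply rcont_plus; auto.
Qed.

Lemma Cint_scal c g a b : a <= b -> (forall t, rcont g t) ->
  Cint (fun t => c * g t)%C a b = (c * Cint g a b)%C.
Proof.
  intros Hab Hg. destruct (Cint_prim g a b Hab Hg) as (G & HG).
  rewrite (Cint_FTC G g) by auto.
  rewrite (Cint_FTC (fun t => c * G t)%C); auto; try ring.
  - intros t _. apply (rderiv_comp G (fun z => c * z)%C t (g t) c); [apply HG|].
    eapply cderiv_eq; [apply cderiv_mult; [apply cderiv_const|apply cderiv_id]|cbv beta; ring].
  - intros t _. apply rcont_mult; auto using rcont_const.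
Qed.

Lemma Cint_ext f g a b : a <= b -> (forall t, a <= t <= b -> f t = g t) -> Cint f a b = Cint g a b.
Proof.
  intros Hab H. unfold Cint. apply (RInt_ext (V := C_R_CompleteNormedModule)).
  rewrite Rmin_left, Rmax_right by exact Hab. intros t Ht. apply H. lra.
Qed.

Lemma Cint_Chasles g a b c : a <= b <= c -> (forall t, a <= t <= c -> rcont g t) ->
  Cint g a c = (Cint g a b + Cint g b c)%C.
Proof.
  intros Hab H. symmetry. apply (RInt_Chasles (V := C_R_CompleteNormedModule));
  apply Cint_ex; try lra; intros; apply H; lra.
Qed.

Lemma Cint_sum (u : nat -> R -> C) n a b : a <= b -> (forall k t, rcont (u k) t) ->
  Cint (fun t => Csum (fun k => u k t) n) a b = Csum (fun k => Cint (u k) a b) n.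
Proof.
  intros Hab Hu. induction n as [|n IH]; simpl.
  - rewrite (Cint_FTC (fun _ => RtoC 0)); [ring|exact Hab| |].
    + intros t _. apply (rderiv_cderiv (fun _ => RtoC 0)). apply cderiv_const.
    + intros t _. apply rcont_const.
  - rewrite Cint_plus, IH; auto. clear -Hu. intros t. induction n as [|n IH]; simpl.
    + apply rcont_const.
    + apply rcont_plus; auto.
Qed.

(** * The mean value inequality and compactness of disks *)

Lemma rderiv_Re f t l : rderiv f t l -> is_derive (fun s => Re (f s)) t (Re l).
Proof.
  intros H. apply is_derive_Reals. intros e He.
  destruct (H (e / 2)) as (d & Hd & H'); [lra|]. exists (mkposreal d Hd). intros h Hh Hhd.
  specialize (H' (t + h)). replace (t + h - t) with h in H' by ring. specialize (H' Hhd).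
  assert (Hh0 : 0 < Rabs h) by now apply Rabs_pos_lt.
  replace ((Re (f (t + h)) - Re (f t)) / h - Re l)
    with (Re (f (t + h)%R - f t - l * h)%C / h).
  2:{ destruct (f (t + h)), (f t), l. unfold Re; simpl. field. exact Hh. }
  unfold Rdiv. rewrite Rabs_mult, Rabs_inv.
  apply (Rmult_lt_reg_r (Rabs h)); [exact Hh0|]. rewrite Rmult_assoc, Rinv_l by lra.
  generalize (Re_le_Cmod (f (t + h)%R - f t - l * h)%C). intros. nra.
Qed.

(** The real mean value theorem applied to the component of f in the direction of f b - f a. *)
Lemma MVT_C f f' a b M : a <= b -> (forall t, a <= t <= b -> rderiv f t (f' t)) ->
  (forall t, a <= t <= b -> Cmod (f' t) <= M) -> Cmod (f b - f a) <= M * (b - a).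
Proof.
  intros Hab Hf HM. set (u := (f b - f a)%C).
  (* the real part of f, up to the factor |u|, in the direction of its total increment u *)
  set (g := fun t => Re (Cconj u * f t)%C).
  assert (Hg : forall t, a <= t <= b -> is_derive g t (Re (Cconj u * f' t)%C)).
  { intros t Ht. apply rderiv_Re.
    apply (rderiv_comp f (fun z => Cconj u * z)%C t (f' t) (Cconj u)); [now apply Hf|].
    eapply cderiv_eq; [apply cderiv_mult; [apply cderiv_const|apply cderiv_id]|cbv beta; ring]. }
  destruct (MVT_gen g a b (fun t => Re (Cconj u * f' t)%C)) as (c & Hc & E).
  - intros t. rewrite Rmin_left, Rmax_right by exact Hab. intros Ht. apply Hg. lra.
  - intros t. rewrite Rmin_left, Rmax_right by exact Hab. intros Ht.
    apply derivable_continuous_pt. exists (Re (Cconj u * f' t)%C). apply is_derive_Reals, Hg, Ht.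
  - rewrite Rmin_left, Rmax_right in Hc by exact Hab.
    assert (E2 : g b - g a = Cmod u ^ 2).
    { assert (E3 := Cmod2_conj u).
      assert (E4 : Re (RtoC (Cmod u ^ 2)) = Cmod u ^ 2) by reflexivity.
      rewrite <- E4, E3. unfold g.
      assert (E5 : forall v x y : C, Re (v * x)%C - Re (v * y)%C = Re ((x - y) * v)%C).
      { intros [v1 v2] [x1 x2] [y1 y2]. unfold Re; simpl. ring. }
      apply E5. }
    rewrite E2 in E.
    assert (H1 : Re (Cconj u * f' c)%C <= Cmod u * M).
    { eapply Rle_trans; [apply Rle_abs|]. eapply Rle_trans; [apply Re_le_Cmod|].
      rewrite Cmod_mult, Cmod_conj. apply Rmult_le_compat_l; [apply Cmod_ge_0|now apply HM]. }
    assert (Hu := Cmod_ge_0 u). assert (HM0 : 0 <= M).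
    { eapply Rle_trans; [apply (Cmod_ge_0 (f' c))|now apply HM]. }
    destruct (Req_dec (Cmod u) 0) as [E0|E0]; [rewrite E0; apply Rmult_le_pos; lra|].
    apply (Rmult_le_reg_l (Cmod u)); [lra|]. replace (Cmod u * Cmod u) with (Cmod u ^ 2) by ring.
    rewrite E. replace (Cmod u * (M * (b - a))) with (Cmod u * M * (b - a)) by ring.
    apply Rmult_le_compat_r; lra.
Qed.

Lemma MVT_seg f f' x y M : (forall t, 0 <= t <= 1 -> cderiv f (x + RtoC t * (y - x))%C (f' (x + RtoC t * (y - x))%C)) ->
  (forall t, 0 <= t <= 1 -> Cmod (f' (x + RtoC t * (y - x))%C) <= M) ->
  Cmod (f y - f x) <= M * Cmod (y - x).
Proof.
  intros Hf HM.
  assert (H := MVT_C (fun t => f (x + RtoC t * (y - x))%C) (fun t => f' (x + RtoC t * (y - x)) * (y - x))%C 0 1 (M * Cmod (y - x))).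
  cbv beta in H.
  replace (x + RtoC 1 * (y - x))%C with y in H by ring.
  replace (x + RtoC 0 * (y - x))%C with x in H by ring.
  rewrite <- (Rmult_1_r (M * Cmod (y - x))). replace 1 with (1 - 0) by ring. apply H.
  - lra.
  - intros t Ht. apply (rderiv_comp (fun t => x + RtoC t * (y - x))%C f); [apply rderiv_line|now apply Hf].
  - intros t Ht. rewrite Cmod_mult. apply Rmult_le_compat_r; [apply Cmod_ge_0|now apply HM].
Qed.

(** The Lebesgue number of a cover of a closed disk: every point is within the radius e of some
    chosen center t, and all radii are bounded below. *)
Lemma disc_compact rho (P : C -> R -> Prop) :
  (forall x, Cmod x <= rho -> exists d, 0 < d /\ P x d) ->
  exists d, 0 < d /\ forall x, Cmod x <= rho ->
    exists t e, Cmod t <= rho /\ P t e /\ Cmod (x - t) < e /\ d <= e.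
Proof.
  intros H.
  assert (HC : forall u v : R, exists e : posreal,
    (Cmod (u, v) <= rho /\ P (u, v) (2 * e)) \/ (rho < Cmod (u, v) /\ 2 * e <= Cmod (u, v) - rho)).
  { intros u v. destruct (Rle_or_lt (Cmod (u, v)) rho) as [L|L].
    - destruct (H _ L) as (d & Hd & HP). assert (Hd2 : 0 < d / 2) by lra.
      exists (mkposreal _ Hd2). left. split; [exact L|]. simpl. now replace (2 * (d / 2)) with d by field.
    - assert (Hd2 : 0 < (Cmod (u, v) - rho) / 2) by lra. exists (mkposreal _ Hd2). right. simpl. lra. }
  set (delta := fun u v => proj1_sig (constructive_indefinite_description _ (HC u v))).
  assert (Hdelta : forall u v, (Cmod (u, v) <= rho /\ P (u, v) (2 * delta u v)) \/
     (rho < Cmod (u, v) /\ 2 * delta u v <= Cmod (u, v) - rho)).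
  { intros u v. unfold delta. apply proj2_sig. }
  destruct (compactness_value_2d (- rho) rho (- rho) rho delta) as (d & Hd).
  exists d. split; [apply cond_pos|]. intros x Hx.
  assert (Hre := Re_le_Cmod x). assert (Him := Im_le_Cmod x).
  apply Rabs_le_between in Hre. apply Rabs_le_between in Him.
  destruct (NNPP _ (Hd (Re x) (Im x) ltac:(lra) ltac:(lra))) as (u & v & _ & _ & H1 & H2 & H3).
  assert (H4 : Cmod (x - (u, v)) < 2 * delta u v).
  { eapply Rle_lt_trans; [apply Cmod_le_abs|].
    change (Re (x - (u, v))) with (Re x - u). change (Im (x - (u, v))) with (Im x - v). lra. }
  assert (Hpos := cond_pos (delta u v)).
  destruct (Hdelta u v) as [[L HP]|[L HL]].
  - exists (u, v), (2 * delta u v). repeat split; auto. lra.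
  - exfalso. generalize (Cmod_ge_sub (u, v) x). rewrite Cmod_sub_sym. lra.
Qed.

(** * Cauchy's formula *)

Definition hol_on (R : R) (f : C -> C) : Prop := forall z, Cmod z < R -> hol_at f z.

Lemma hol_on_bounded R f rho : hol_on R f -> rho < R ->
  exists B, 0 < B /\ forall x, Cmod x <= rho -> Cmod (f x) <= B.
Proof.
  intros Hf Hr.
  destruct (disc_compact rho (fun x d => forall y, Cmod (y - x) < d -> Cmod (f y) <= / d)) as (d & Hd & H).
  - intros x Hx. destruct (hol_cont _ _ (Hf x ltac:(lra)) 1 Rlt_0_1) as (d & Hd & Hc).
    assert (H0 := Cmod_ge_0 (f x)).
    assert (HI : 0 < / (Cmod (f x) + 1)) by (apply Rinv_0_lt_compat; lra).
    exists (Rmin d (/ (Cmod (f x) + 1))). split; [apply Rmin_glb_lt; [exact Hd|exact HI]|].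
    intros y Hy. specialize (Hc y (Rlt_le_trans _ _ _ Hy (Rmin_l _ _))).
    apply Rle_trans with (Cmod (f x) + 1); [generalize (Cmod_ge_sub (f y) (f x)); lra|].
    apply Rle_trans with (/ / (Cmod (f x) + 1)); [right; now rewrite Rinv_inv|]. apply Rinv_le_contravar; [|apply Rmin_r].
    apply Rmin_glb_lt; [exact Hd|exact HI].
  - exists (/ d). split; [now apply Rinv_0_lt_compat|]. intros x Hx.
    destruct (H x Hx) as (t & e & _ & HP & Hxt & Hde).
    eapply Rle_trans; [apply HP, Hxt|]. now apply Rinv_le_contravar.
Qed.

(** Differentiability is uniform on smaller disks, by compactness and the mean value inequality
    applied to the function minus its linear part. *)
Lemma hol_on_unif R f rho : hol_on R f -> rho < R -> forall e, 0 < e -> exists d, 0 < d /\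
  forall x y, Cmod x <= rho -> Cmod y <= rho -> Cmod (y - x) < d ->
    Cmod (f y - f x - C_derive f x * (y - x)) <= e * Cmod (y - x).
Proof.
  intros Hf Hr e He.
  destruct (disc_compact rho (fun x d => forall y, Cmod (y - x) < 2 * d -> Cmod (C_derive f y - C_derive f x) < e / 2)) as (d & Hd & H).
  - intros x Hx. destruct (hol_dcont _ _ (Hf x ltac:(lra)) (e / 2)) as (d & Hd & Hc); [lra|].
    exists (d / 2). split; [lra|]. intros y Hy. apply Hc. lra.
  - exists d. split; [exact Hd|]. intros x y Hx Hy Hxy.
    destruct (H x Hx) as (t & e' & _ & HP & Hxt & Hde).
    assert (HL := MVT_seg (fun z => f z - C_derive f x * z)%C (fun z => C_derive f z - C_derive f x)%C x y e).
    cbv beta in HL.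
    replace (f y - f x - C_derive f x * (y - x))%C with (f y - C_derive f x * y - (f x - C_derive f x * x))%C by ring.
    assert (Hseg : forall s, 0 <= s <= 1 -> Cmod (x + RtoC s * (y - x)) <= rho).
    { intros s Hs. replace (x + RtoC s * (y - x))%C with (RtoC (1 - s) * x + RtoC s * y)%C by (rewrite RtoC_minus; ring).
      eapply Rle_trans; [apply Cmod_triangle|]. rewrite !Cmod_mult, !Cmod_R, !Rabs_pos_eq by lra. nra. }
    apply HL; intros s Hs.
    + eapply cderiv_eq.
      * apply cderiv_plus; [apply hol_cderiv, Hf; specialize (Hseg s Hs); lra|].
        apply (cderiv_ext (fun z => (- C_derive f x) * z)%C _ _ _ 1 Rlt_0_1); [intros; ring|].
        apply cderiv_mult; [apply cderiv_const|apply cderiv_id].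
      * cbv beta. ring.
    + assert (Hclose : Cmod (x + RtoC s * (y - x) - t) < 2 * e').
      { replace (x + RtoC s * (y - x) - t)%C with ((x - t) + RtoC s * (y - x))%C by ring.
        eapply Rle_lt_trans; [apply Cmod_triangle|]. rewrite Cmod_mult, Cmod_R, Rabs_pos_eq by lra.
        assert (0 <= Cmod (y - x)) by apply Cmod_ge_0. nra. }
      assert (H1 := HP _ Hclose). assert (H2 : Cmod (C_derive f x - C_derive f t) < e / 2) by (apply HP; lra).
      rewrite Cmod_sub_sym in H2. cbv beta in *.
      generalize (Cmod_sub_tri (C_derive f (x + RtoC s * (y - x))) (C_derive f t) (C_derive f x)). lra.
Qed.

Definition cir (rho th : R) : C := (RtoC rho * Cexp (Ci * RtoC th))%C.

Lemma Re_Ci_R t : Re (Ci * RtoC t) = 0.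
Proof. unfold Re, Ci, RtoC, Cmult; simpl. ring. Qed.

Lemma Cmod_Cexp_i t : Cmod (Cexp (Ci * RtoC t)) = 1.
Proof. rewrite Cmod_Cexp, Re_Ci_R. apply exp_0. Qed.

Lemma Cmod_cir rho th : 0 <= rho -> Cmod (cir rho th) = rho.
Proof. intros H. unfold cir. rewrite Cmod_mult, Cmod_Cexp_i, Cmod_R, Rabs_pos_eq; lra. Qed.

Lemma cir_deriv rho th : rderiv (cir rho) th (Ci * cir rho th).
Proof.
  apply (rderiv_cderiv (fun z => RtoC rho * Cexp (Ci * z))%C). unfold cir.
  eapply cderiv_eq.
  - apply cderiv_mult; [apply cderiv_const|].
    apply (cderiv_comp (fun z => Ci * z)%C Cexp); [apply cderiv_mult; [apply cderiv_const|apply cderiv_id]|apply cderiv_Cexp].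
  - cbv beta. ring.
Qed.

Lemma cir_cont rho th : rcont (cir rho) th.
Proof. eapply rderiv_cont. apply cir_deriv. Qed.

Lemma cir_period rho : cir rho PI = cir rho (- PI).
Proof.
  unfold cir. f_equal. rewrite Cexp_Ci_PI.
  assert (H := Cexp_opp (Ci * RtoC PI)%C). rewrite Cexp_Ci_PI in H.
  replace (Ci * RtoC (- PI))%C with (- (Ci * RtoC PI))%C by (rewrite RtoC_opp; ring).
  replace (Cexp (- (Ci * RtoC PI))) with (- (-1 * Cexp (- (Ci * RtoC PI))))%C by ring. rewrite H. ring.
Qed.

Lemma cir_neq_0 rho th : 0 < rho -> cir rho th <> RtoC 0.
Proof. intros H. apply Cmod_gt_0. rewrite Cmod_cir; lra. Qed.

(** An integral depending on a parameter whose derivative integrates to zero is constant. The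
    hypothesis of uniform differentiability in the parameter stands for differentiation under the
    integral sign. *)
Lemma Cint_const_param (k dk : R -> R -> C) a b : a <= b ->
  (forall l t, 0 <= l <= 1 -> rcont (k l) t) -> (forall l t, 0 <= l <= 1 -> rcont (dk l) t) ->
  (forall l, 0 <= l <= 1 -> Cint (dk l) a b = 0%C) ->
  (forall e, 0 < e -> exists d, 0 < d /\ forall l l' t, 0 <= l <= 1 -> 0 <= l' <= 1 -> Rabs (l' - l) < d ->
     Cmod (k l' t - k l t - RtoC (l' - l) * dk l t) <= e * Rabs (l' - l)) ->
  Cint (k 1) a b = Cint (k 0) a b.
Proof.
  intros Hab Hk Hdk H0 Hu.
  assert (HE : (Cint (k 1) a b - Cint (k 0) a b)%C = 0%C).
  2:{ replace (Cint (k 1) a b) with ((Cint (k 1) a b - Cint (k 0) a b) + Cint (k 0) a b)%C by ring. rewrite HE. ring. }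
  apply Cmod_le_eq0. intros e He.
  set (e1 := e / (b - a + 1)). assert (He1 : 0 < e1) by (apply Rdiv_lt_0_compat; lra).
  destruct (Hu e1 He1) as (d & Hd & H).
  assert (Hstep : forall l l', 0 <= l <= 1 -> 0 <= l' <= 1 -> Rabs (l' - l) < d ->
     Cmod (Cint (k l') a b - Cint (k l) a b) <= e * Rabs (l' - l)).
  { intros l l' Hl Hl' Hd'.
    replace (Cint (k l') a b - Cint (k l) a b)%C
      with (Cint (k l') a b + ((-1) * Cint (k l) a b + (- RtoC (l' - l)) * Cint (dk l) a b))%C
      by (rewrite H0 by exact Hl; ring).
    rewrite <- !Cint_scal by auto. rewrite <- !Cint_plus; auto;
      try (intros; repeat apply rcont_plus; apply rcont_mult; auto using rcont_const).
    eapply Rle_trans; [apply (Cint_bound _ a b (e1 * Rabs (l' - l)) Hab)|].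
    - intros; repeat apply rcont_plus; auto; apply rcont_mult; auto using rcont_const.
    - intros t _. replace (k l' t + (-1 * k l t + - RtoC (l' - l) * dk l t))%C
        with (k l' t - k l t - RtoC (l' - l) * dk l t)%C by ring. apply H; auto.
    - rewrite <- Rmult_assoc. apply Rmult_le_compat_r; [apply Rabs_pos|].
      apply Rle_trans with ((b - a + 1) * e1); [apply Rmult_le_compat_r; lra|].
      right. unfold e1. field. lra. }
  destruct (archimed_cor1 d Hd) as (n & Hn & Hn0).
  assert (HnR : 0 < INR n) by now apply lt_0_INR.
  assert (Hj : forall j, (j <= n)%nat -> Cmod (Cint (k (INR j / INR n)) a b - Cint (k 0) a b) <= e * (INR j / INR n)).
  { induction j as [|j IH]; intros Hjn.
    - simpl. replace (0 / INR n) with 0 by (field; lra). rewrite Cmod_diag. lra.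
    - specialize (IH ltac:(lia)). rewrite S_INR in *.
      assert (HjR : INR j + 1 <= INR n) by (rewrite <- S_INR; now apply le_INR).
      assert (Hj0 := pos_INR j).
      assert (Hin : 0 < / INR n) by now apply Rinv_0_lt_compat.
      assert (Hb1 : 0 <= INR j / INR n <= 1).
      { split; [apply Rmult_le_pos; lra|]. apply (Rmult_le_reg_r (INR n)); [lra|].
        unfold Rdiv. rewrite Rmult_assoc, Rinv_l; lra. }
      assert (Hb2 : 0 <= (INR j + 1) / INR n <= 1).
      { split; [apply Rmult_le_pos; lra|]. apply (Rmult_le_reg_r (INR n)); [lra|].
        unfold Rdiv. rewrite Rmult_assoc, Rinv_l; lra. }
      assert (Ed : (INR j + 1) / INR n - INR j / INR n = / INR n) by (field; lra).
      assert (Hs := Hstep _ _ Hb1 Hb2). rewrite Ed, Rabs_pos_eq in Hs by lra. specialize (Hs Hn).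
      eapply Rle_trans; [apply (Cmod_sub_tri _ (Cint (k (INR j / INR n)) a b))|].
      replace (e * ((INR j + 1) / INR n)) with (e * / INR n + e * (INR j / INR n)) by (field; lra). lra. }
  specialize (Hj n (le_n _)). replace (INR n / INR n) with 1 in Hj by (field; lra). lra.
Qed.

Lemma icir_eq rho t : 0 < rho -> (/ cir rho t = RtoC (/ rho) * Cexp (- Ci * RtoC t))%C.
Proof.
  intros H. unfold cir. assert (H0 : RtoC rho <> 0%C) by (intros E; apply RtoC_inj in E; lra).
  assert (E := Cexp_opp (Ci * RtoC t)). replace (- Ci * RtoC t)%C with (- (Ci * RtoC t))%C by ring.
  rewrite RtoC_inv by lra.
  apply (f_equal (fun x => (/ (RtoC rho * Cexp (Ci * RtoC t)) * x)%C)) in E. rewrite Cmult_1_r in E.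
  rewrite <- E. field. split; [exact H0|apply Cexp_neq_0].
Qed.

Lemma icir_cont rho k t : 0 < rho -> rcont (fun s => (/ cir rho s) ^ k)%C t.
Proof.
  intros H. apply (rcont_comp (cir rho) (fun z => (/ z) ^ k)%C); [apply cir_cont|].
  apply hol_cont, hol_pow, hol_inv; [apply hol_id|now apply cir_neq_0].
Qed.

Lemma PI2_le : - PI <= PI.
Proof. generalize PI_RGT_0. lra. Qed.

Lemma Cint_const c a b : a <= b -> Cint (fun _ => c) a b = (RtoC (b - a) * c)%C.
Proof.
  intros Hab. rewrite (Cint_FTC (fun t => 0 + RtoC t * c)%C); auto.
  - rewrite RtoC_minus. ring.
  - intros t _. apply rderiv_line.
  - intros t _. apply rcont_const.
Qed.

Lemma circle_pow rho k : 0 < rho ->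
  Cint (fun t => (/ cir rho t) ^ S k)%C (- PI) PI = 0%C.
Proof.
  intros H.
  set (c := (- RtoC (INR (S k)) * Ci)%C).
  assert (Hk : INR (S k) <> 0) by (apply not_0_INR; lia).
  assert (Hc : c <> 0%C).
  { unfold c. apply Cmult_neq_0; [|apply Ci_nz]. intros E. apply (f_equal Copp) in E.
    replace (- - RtoC (INR (S k)))%C with (RtoC (INR (S k))) in E by ring.
    replace (- 0)%C with (RtoC 0) in E by ring. now apply RtoC_inj in E. }
  rewrite (Cint_FTC (fun t => RtoC (/ rho) ^ S k * (Cexp (c * RtoC t) / c))%C).
  - assert (E : Cexp (c * RtoC PI) = Cexp (c * RtoC (- PI))).
    { assert (E1 : Cexp (c * RtoC (- PI)) = (Cexp (Ci * RtoC PI) ^ S k)%C).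
      { rewrite Cexp_pow. f_equal. unfold c. rewrite RtoC_opp. ring. }
      assert (E2 := Cexp_opp (c * RtoC (- PI))).
      replace (- (c * RtoC (- PI)))%C with (c * RtoC PI)%C in E2 by (rewrite RtoC_opp; ring).
      rewrite E1, Cexp_Ci_PI in *.
      assert (E3 : ((-1) ^ S k * (-1) ^ S k = 1)%C).
      { rewrite <- Cpow_mult_l. replace (-1 * -1)%C with (RtoC 1) by ring. apply Cpow_1_l. }
      replace (Cexp (c * PI)) with (((-1) ^ S k * (-1) ^ S k) * Cexp (c * PI))%C by (rewrite E3; ring).
      rewrite <- Cmult_assoc, E2. ring. }
    rewrite E. ring.
  - apply PI2_le.
  - intros t _. apply (rderiv_cderiv (fun z => RtoC (/ rho) ^ S k * (Cexp (c * z) / c))%C).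
    eapply cderiv_eq.
    + apply cderiv_mult; [apply cderiv_const|]. unfold Cdiv. apply cderiv_mult; [|apply cderiv_const].
      apply (cderiv_comp (fun z => c * z)%C Cexp); [apply cderiv_mult; [apply cderiv_const|apply cderiv_id]|apply cderiv_Cexp].
    + cbv beta. rewrite icir_eq by exact H. rewrite Cpow_mult_l, Cexp_pow.
      replace (INR (S k) * (- Ci * t))%C with (c * t)%C by (unfold c; ring). field. exact Hc.
  - intros t _. now apply icir_cont.
Qed.

(** Cauchy's kernel in the angle variable: dzeta / (zeta - z) divided by i dt. *)
Definition cauchy_kernel (rho : R) (z : C) (t : R) : C := (cir rho t / (cir rho t - z))%C.

Lemma cauchy_kernel_bound rho z t : Cmod z < rho -> (cir rho t - z <> 0)%C ->
  Cmod (cauchy_kernel rho z t) <= / (1 - Cmod z / rho).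
Proof.
  intros Hz Hne. assert (H0 := Cmod_ge_0 z).
  unfold cauchy_kernel. rewrite Cmod_div by exact Hne. rewrite Cmod_cir by lra.
  assert (H : rho - Cmod z <= Cmod (cir rho t - z)).
  { generalize (Cmod_ge_sub (cir rho t) z). rewrite Cmod_cir; lra. }
  replace (/ (1 - Cmod z / rho)) with (rho / (rho - Cmod z)) by (field; lra).
  apply Rmult_le_compat_l; [lra|]. apply Rinv_le_contravar; lra.
Qed.

Lemma cir_sub_neq rho z t : Cmod z < rho -> (cir rho t - z <> 0)%C.
Proof.
  intros Hz. apply Cmod_gt_0. assert (H0 := Cmod_ge_0 z).
  generalize (Cmod_ge_sub (cir rho t) z). rewrite Cmod_cir by lra. lra.
Qed.

Lemma cauchy_kernel_cont rho z t : Cmod z < rho -> rcont (cauchy_kernel rho z) t.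
Proof.
  intros Hz. apply (rcont_comp (cir rho) (fun x => x / (x - z))%C); [apply cir_cont|].
  apply hol_cont, hol_div; [apply hol_id| |now apply cir_sub_neq].
  apply hol_minus; [apply hol_id|apply hol_const].
Qed.

(** Expansion of the kernel in a geometric series with an explicit remainder. *)
Lemma cauchy_kernel_series rho F B z : 0 < rho -> Cmod z < rho -> (forall t, rcont F t) -> 0 <= B ->
  (forall t, Cmod (F t) <= B) ->
  cser (fun k => Cint (fun t => F t * (/ cir rho t) ^ k)%C (- PI) PI * z ^ k)%C
       (Cint (fun t => F t * cauchy_kernel rho z t)%C (- PI) PI).
Proof.
  intros Hr Hz HF HB HBd.
  assert (Hz0 := Cmod_ge_0 z).
  assert (Hq : 0 <= Cmod z / rho < 1) by (apply ratio_lt1; lra).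
  assert (Hiq : 0 < / (1 - Cmod z / rho)) by (apply Rinv_0_lt_compat; lra).
  assert (HPI := PI_RGT_0).
  set (u := fun k t => (F t * (z ^ k * (/ cir rho t) ^ k))%C).
  assert (Hu : forall k t, rcont (u k) t).
  { intros k t. unfold u. apply rcont_mult; [apply HF|]. apply rcont_mult; [apply rcont_const|now apply icir_cont]. }
  (* partial sums, with the remainder still multiplied by the kernel *)
  assert (E : forall n, (Cint (fun t => F t * cauchy_kernel rho z t) (- PI) PI
      = Csum (fun k => Cint (fun t => F t * (/ cir rho t) ^ k) (- PI) PI * z ^ k) n
        + Cint (fun t => u n t * cauchy_kernel rho z t) (- PI) PI)%C).
  { intros n.
    replace (Csum (fun k => Cint (fun t => F t * (/ cir rho t) ^ k) (- PI) PI * z ^ k) n)%C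
      with (Cint (fun t => Csum (fun k => u k t) n) (- PI) PI).
    2:{ rewrite Cint_sum by (auto using PI2_le). apply Csum_ext. intros k _.
        rewrite Cmult_comm. rewrite <- Cint_scal; [|apply PI2_le|].
        - apply Cint_ext; [apply PI2_le|]. intros t _. unfold u. ring.
        - intros t. apply rcont_mult; [apply HF|now apply icir_cont]. }
    rewrite <- Cint_plus; [|apply PI2_le| |].
    - apply Cint_ext; [apply PI2_le|]. intros t _.
      induction n as [|n IH]; [unfold u; simpl; ring|].
      rewrite IH. simpl. rewrite <- Cplus_assoc. f_equal.
      unfold u, cauchy_kernel. rewrite !Cpow_S. set (x := cir rho t).
      assert (x <> 0%C) by (now apply cir_neq_0). assert (x - z <> 0)%C by (now apply cir_sub_neq).
      field. split; assumption.
    - intros t. induction n as [|n IH]; simpl; [apply rcont_const|]. apply rcont_plus; [exact IH|apply Hu].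
    - intros t. apply rcont_mult; [apply Hu|now apply cauchy_kernel_cont]. }
  intros e He.
  destruct (pow_tends0 (Cmod z / rho) (2 * PI * (B * / (1 - Cmod z / rho))) Hq) with (e := e) as (N & HN); [|exact He|].
  { apply Rmult_le_pos; [lra|]. apply Rmult_le_pos; [exact HB|now apply Rlt_le]. }
  exists N. intros n Hn. rewrite (E n), Cmod_sub_sym.
  match goal with |- Cmod (?a + ?b - ?a) <= _ => replace (a + b - a)%C with b by ring end.
  eapply Rle_trans; [|apply (HN n Hn)].
  eapply Rle_trans; [apply (Cint_bound _ _ _ (B * / (1 - Cmod z / rho) * (Cmod z / rho) ^ n)); [apply PI2_le| |]|].
  - intros t _. apply rcont_mult; [apply Hu|now apply cauchy_kernel_cont].
  - intros t _. unfold u. rewrite !Cmod_mult, !Cmod_pow, Cmod_inv by (now apply cir_neq_0). rewrite Cmod_cir by lra.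
    replace (Cmod (F t) * (Cmod z ^ n * (/ rho) ^ n) * Cmod (cauchy_kernel rho z t))
      with (Cmod (F t) * Cmod (cauchy_kernel rho z t) * (Cmod z / rho) ^ n)
      by (unfold Rdiv; rewrite Rpow_mult_distr; ring).
    apply Rmult_le_compat_r; [apply pow_le; lra|].
    apply Rmult_le_compat; try apply Cmod_ge_0; [apply HBd|]. apply cauchy_kernel_bound; [exact Hz|].
    now apply cir_sub_neq.
  - right. ring.
Qed.

Lemma cauchy_kernel_integral rho z : 0 < rho -> Cmod z < rho -> Cint (cauchy_kernel rho z) (- PI) PI = RtoC (2 * PI).
Proof.
  intros Hr Hz.
  assert (H := cauchy_kernel_series rho (fun _ => 1%C) 1 z Hr Hz (rcont_const 1) ltac:(lra)).
  assert (H1 : forall t : R, Cmod 1 <= 1) by (intros; rewrite Cmod_1; lra). specialize (H H1).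
  rewrite (Cint_ext _ (fun t => 1 * cauchy_kernel rho z t)%C); [|apply PI2_le|intros; ring].
  eapply ctends_unique; [exact H|]. apply ctends_S.
  eapply ctends_ext; [|apply ctends_const]. intros n. rewrite Csum_shift.
  rewrite (Csum_ext _ (fun _ => RtoC 0)), Csum_0.
  - rewrite (Cint_ext _ (fun _ => 1%C)); [|apply PI2_le|intros; simpl; ring].
    rewrite Cint_const by apply PI2_le. rewrite Cplus_0_r. simpl Cpow.
    replace (PI - - PI) with (2 * PI) by ring. ring.
  - intros k _. rewrite (Cint_ext _ (fun t => (/ cir rho t) ^ S k)%C); [|apply PI2_le|intros; ring].
    rewrite circle_pow by exact Hr. ring.
Qed.

(** Shrink the circle to the point z: the integral of f(z + l (zeta - z)) against the kernel has
    derivative in l the integral of f'(z + l (zeta - z)) zeta, a derivative along the closed circle,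
    hence zero. *)
Lemma cauchy_formula R f rho z : hol_on R f -> 0 < rho < R -> Cmod z < rho ->
  Cint (fun t => f (cir rho t) * cauchy_kernel rho z t)%C (- PI) PI = (RtoC (2 * PI) * f z)%C.
Proof.
  intros Hf Hr Hz.
  (* the circle contracted towards z by the factor l *)
  set (p := fun l t => (z + RtoC l * (cir rho t - z))%C).
  assert (Hp : forall l t, 0 <= l <= 1 -> Cmod (p l t) <= rho).
  { intros l t Hl. unfold p.
    replace (z + RtoC l * (cir rho t - z))%C with (RtoC (1 - l) * z + RtoC l * cir rho t)%C by (rewrite RtoC_minus; ring).
    eapply Rle_trans; [apply Cmod_triangle|].
    rewrite !Cmod_mult, !Cmod_R, !Rabs_pos_eq, Cmod_cir by lra. nra. }
  assert (Hpd : forall l t, rderiv (p l) t (RtoC l * (Ci * cir rho t))%C).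
  { intros l t. unfold p. apply (rderiv_comp (cir rho) (fun x => z + RtoC l * (x - z))%C t); [apply cir_deriv|].
    eapply cderiv_eq.
    - apply cderiv_plus; [apply cderiv_const|]. apply cderiv_mult; [apply cderiv_const|].
      unfold Cminus. apply cderiv_plus; [apply cderiv_id|apply cderiv_const].
    - cbv beta. ring. }
  set (k := fun l t => (f (p l t) * cauchy_kernel rho z t)%C).
  set (dk := fun l t => (C_derive f (p l t) * cir rho t)%C).
  assert (Hdk : forall l t, 0 <= l <= 1 -> rcont (dk l) t).
  { intros l t Hl. unfold dk. apply rcont_mult; [|apply cir_cont].
    apply (rcont_comp (p l) (C_derive f)); [eapply rderiv_cont; apply Hpd|].
    apply hol_dcont, Hf. specialize (Hp l t Hl). lra. }
  assert (HB : 0 < rho / (rho - Cmod z)) by (apply Rdiv_lt_0_compat; lra).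
  assert (H := Cint_const_param k dk (- PI) PI PI2_le). unfold k in H at 4 5.
  rewrite (Cint_ext (fun t => f (p 1 t) * cauchy_kernel rho z t)%C (fun t => f (cir rho t) * cauchy_kernel rho z t)%C) in H.
  2:{ apply PI2_le. } 2:{ intros t _. unfold p. do 2 f_equal. ring. }
  rewrite H.
  - rewrite (Cint_ext _ (fun t => f z * cauchy_kernel rho z t)%C).
    + rewrite Cint_scal; [|apply PI2_le|intros; now apply cauchy_kernel_cont].
      rewrite cauchy_kernel_integral by lra. ring.
    + apply PI2_le.
    + intros t _. unfold p. do 2 f_equal. ring.
  - intros l t Hl. unfold k. apply rcont_mult; [|now apply cauchy_kernel_cont].
    apply (rcont_comp (p l) f); [eapply rderiv_cont; apply Hpd|].
    apply hol_cont, Hf. specialize (Hp l t Hl). lra.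
  - exact Hdk.
  (* the derivative in l is the derivative in t of f(p l t) / (i l), and of a multiple of the circle
     when l = 0 *)
  - intros l Hl. destruct (Req_dec l 0) as [->|Hl0].
    + rewrite (Cint_FTC (fun t => C_derive f z * (cir rho t / Ci))%C).
      * rewrite cir_period. ring.
      * apply PI2_le.
      * intros t _. unfold dk. eapply rderiv_eq.
        -- apply (rderiv_comp (cir rho) (fun x => C_derive f z * (x / Ci))%C); [apply cir_deriv|].
           unfold Cdiv. apply cderiv_mult; [apply cderiv_const|]. apply cderiv_mult; [apply cderiv_id|apply cderiv_const].
        -- cbv beta. replace (p 0 t) with z by (unfold p; ring). field. apply Ci_nz.
      * intros t _. now apply Hdk.
    + assert (HlC : RtoC l <> 0%C) by (intros E; now apply RtoC_inj in E).
      rewrite (Cint_FTC (fun t => f (p l t) / (RtoC l * Ci))%C).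
      * unfold p. rewrite cir_period. ring.
      * apply PI2_le.
      * intros t _. unfold dk. eapply rderiv_eq.
        -- apply (rderiv_comp (p l) (fun x => f x / (RtoC l * Ci))%C); [apply Hpd|].
           unfold Cdiv. apply cderiv_mult; [|apply cderiv_const]. apply hol_cderiv, Hf.
           specialize (Hp l t Hl). lra.
        -- cbv beta. field. split; [apply Ci_nz|exact HlC].
      * intros t _. now apply Hdk.
  - intros e He.
    set (K := 2 * rho * (rho / (rho - Cmod z))). assert (HK : 0 < K) by (unfold K; nra).
    destruct (hol_on_unif R f rho Hf (proj2 Hr) (e / K)) as (d & Hd & Hu); [now apply Rdiv_lt_0_compat|].
    exists (d / (2 * rho)). split; [apply Rdiv_lt_0_compat; lra|].
    intros l l' t Hl Hl' Hll.
    assert (Ed : (p l' t - p l t = RtoC (l' - l) * (cir rho t - z))%C) by (unfold p; rewrite RtoC_minus; ring).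
    assert (Hcz : Cmod (cir rho t - z) <= 2 * rho).
    { eapply Rle_trans; [apply Cmod_minus_le|]. rewrite Cmod_cir; lra. }
    assert (Hdist : Cmod (p l' t - p l t) <= Rabs (l' - l) * (2 * rho)).
    { rewrite Ed, Cmod_mult, Cmod_R. apply Rmult_le_compat_l; [apply Rabs_pos|exact Hcz]. }
    assert (Hdist' : Cmod (p l' t - p l t) < d).
    { eapply Rle_lt_trans; [exact Hdist|]. apply (Rmult_lt_reg_r (/ (2 * rho))); [apply Rinv_0_lt_compat; lra|].
      rewrite Rmult_assoc, Rinv_r by lra. lra. }
    specialize (Hu (p l t) (p l' t) (Hp l t Hl) (Hp l' t Hl') Hdist').
    assert (Hne := cir_sub_neq rho z t Hz).
    replace (k l' t - k l t - RtoC (l' - l) * dk l t)%C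
      with ((f (p l' t) - f (p l t) - C_derive f (p l t) * (p l' t - p l t)) * cauchy_kernel rho z t)%C.
    2:{ rewrite Ed. unfold k, dk, cauchy_kernel. field. exact Hne. }
    rewrite Cmod_mult.
    assert (Hkb := cauchy_kernel_bound rho z t Hz Hne).
    replace (/ (1 - Cmod z / rho)) with (rho / (rho - Cmod z)) in Hkb by (field; lra).
    apply Rle_trans with ((e / K * (Rabs (l' - l) * (2 * rho))) * (rho / (rho - Cmod z))).
    + apply Rmult_le_compat; try apply Cmod_ge_0; [|exact Hkb].
      eapply Rle_trans; [exact Hu|]. apply Rmult_le_compat_l; [|exact Hdist].
      apply Rlt_le, Rdiv_lt_0_compat; lra.
    + right. unfold K. field. lra.
Qed.

(** * Taylor expansion, difference quotients and primitives *)

Definition coef (f : C -> C) (rho : R) (k : nat) : C :=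
  (Cint (fun t => f (cir rho t) * (/ cir rho t) ^ k) (- PI) PI / RtoC (2 * PI))%C.

Lemma RtoC_neq_0 x : x <> 0 -> RtoC x <> 0%C.
Proof. intros H E. now apply RtoC_inj in E. Qed.

Lemma TwoPI_neq_0 : RtoC (2 * PI) <> 0%C.
Proof. apply RtoC_neq_0. generalize PI_RGT_0. lra. Qed.

Lemma hol_cir_cont R f rho k t : hol_on R f -> 0 < rho < R ->
  rcont (fun s => f (cir rho s) * (/ cir rho s) ^ k)%C t.
Proof.
  intros Hf Hr. apply rcont_mult; [|now apply icir_cont].
  apply (rcont_comp (cir rho) f); [apply cir_cont|]. apply hol_cont, Hf. rewrite Cmod_cir; lra.
Qed.

Lemma hol_coef_ps R f rho : hol_on R f -> 0 < rho < R -> ps rho (coef f rho) f.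
Proof.
  intros Hf Hr z Hz. destruct (hol_on_bounded R f rho Hf (proj2 Hr)) as (B & HB & Hb).
  assert (H := cauchy_kernel_series rho (fun t => f (cir rho t)) B z (proj1 Hr) Hz).
  assert (Hc : forall t, rcont (fun t => f (cir rho t)) t).
  { intros t. apply (rcont_comp (cir rho) f); [apply cir_cont|]. apply hol_cont, Hf. rewrite Cmod_cir; lra. }
  assert (Hb' : forall t, Cmod (f (cir rho t)) <= B) by (intros t; apply Hb; rewrite Cmod_cir; lra).
  specialize (H Hc ltac:(lra) Hb'). cbv beta in H.
  rewrite (cauchy_formula R) in H by assumption.
  assert (H' := cser_scal (/ RtoC (2 * PI)) _ _ H).
  replace (f z) with (/ RtoC (2 * PI) * (RtoC (2 * PI) * f z))%C by (field; apply TwoPI_neq_0).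
  eapply cser_ext; [|exact H']. intros k. cbv beta. unfold coef. field. apply TwoPI_neq_0.
Qed.

Lemma coef_bound R f rho B k : hol_on R f -> 0 < rho < R -> (forall t, Cmod (f (cir rho t)) <= B) ->
  Cmod (coef f rho k) <= B * (/ rho) ^ k.
Proof.
  intros Hf Hr HB. assert (HPI := PI_RGT_0). unfold coef.
  rewrite Cmod_div by apply TwoPI_neq_0. rewrite Cmod_R, Rabs_pos_eq by lra.
  apply (Rmult_le_reg_r (2 * PI)); [lra|]. unfold Rdiv. rewrite Rmult_assoc, Rinv_l, Rmult_1_r by lra.
  eapply Rle_trans; [apply (Cint_bound _ _ _ (B * (/ rho) ^ k)); [apply PI2_le| |]|].
  - intros t _. now apply (hol_cir_cont R).
  - intros t _. rewrite Cmod_mult, Cmod_pow, Cmod_inv by (apply cir_neq_0; lra). rewrite Cmod_cir by lra.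
    apply Rmult_le_compat_r; [apply pow_le; apply Rlt_le, Rinv_0_lt_compat; lra|apply HB].
  - right. ring.
Qed.

(** The difference quotient at the origin, completed by the derivative. *)
Definition divz (f : C -> C) (z : C) : C :=
  if Ceq_dec z 0 then C_derive f 0 else ((f z - f 0) / z)%C.

Lemma ps_divz R c f : 0 < R -> ps R c f -> ps R (fun n => c (S n)) (divz f).
Proof.
  intros HR Hf z Hz. unfold divz. destruct (Ceq_dec z 0) as [->|Hz0].
  - destruct (ps_pder _ _ _ Hf) as (g & Hg).
    rewrite (cderiv_C_derive _ _ (g 0)) by (now apply (ps_cderiv R c)).
    rewrite (ps_0 R (pder c) g HR Hg). unfold pder. change (INR 1) with 1.
    apply ctends_S. eapply ctends_ext; [|apply ctends_const]. intros n. rewrite Csum_shift.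
    rewrite (Csum_ext _ (fun _ => RtoC 0)), Csum_0; [simpl; ring|]. intros k _. rewrite Cpow_S. ring.
  - assert (H := cser_scal (/ z) _ _ (Hf z Hz)).
    assert (E0 := ps_0 R c f HR Hf).
    intros e He. destruct (H e He) as (N & HN). exists N. intros n Hn.
    specialize (HN (S n) ltac:(lia)). rewrite Csum_shift in HN. simpl Cpow in HN.
    replace (Csum (fun k => c (S k) * z ^ k) n - (f z - f 0) / z)%C
      with (/ z * (c O * 1) + Csum (fun k => / z * (c (S k) * (z * z ^ k))) n - / z * f z)%C; [exact HN|].
    rewrite (Csum_ext (fun k => / z * (c (S k) * (z * z ^ k)))%C (fun k => c (S k) * z ^ k)%C).
    + rewrite E0. field. exact Hz0.
    + intros k _. field. exact Hz0.
Qed.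

Lemma divz_eq (f : C -> C) (z : C) : f z = (f 0 + z * divz f z)%C.
Proof.
  unfold divz. destruct (Ceq_dec z 0) as [->|Hz0]; [ring|]. field. exact Hz0.
Qed.

Lemma ps_unique n : forall R c c' f, 0 < R -> ps R c f -> ps R c' f -> c n = c' n.
Proof.
  induction n as [|n IH]; intros R c c' f HR H H'.
  - rewrite <- (ps_0 R c f HR H). now apply (ps_0 R).
  - exact (IH R _ _ _ HR (ps_divz R c f HR H) (ps_divz R c' f HR H')).
Qed.

Lemma ps_sub R R' c f : R' <= R -> ps R c f -> ps R' c f.
Proof. intros HR H z Hz. apply H. lra. Qed.

Lemma ps_hol_on R c f : ps R c f -> hol_on R f.
Proof. intros H z Hz. now apply (ps_hol R c). Qed.

Lemma ps_coef R r c f rho k : 0 < r <= R -> ps r c f -> hol_on R f -> 0 < rho < R -> c k = coef f rho k.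
Proof.
  intros Hr Hps Hf Hrho.
  assert (Hm : 0 < Rmin r rho) by (apply Rmin_glb_lt; lra).
  apply (ps_unique k (Rmin r rho) c (coef f rho) f Hm).
  - apply (ps_sub r); [apply Rmin_l|exact Hps].
  - apply (ps_sub rho); [apply Rmin_r|now apply (hol_coef_ps R)].
Qed.

(** A power series at the origin converges on every disk on which its sum extends holomorphically;
    this is how coefficients are bounded through analytic continuation. *)
Lemma hol_ps_extend R r c f : 0 < r <= R -> ps r c f -> hol_on R f -> ps R c f.
Proof.
  intros Hr Hps Hf z Hz. assert (Hz0 := Cmod_ge_0 z).
  assert (Hrho : 0 < (Cmod z + R) / 2 < R) by lra.
  assert (H := hol_coef_ps R f _ Hf Hrho z ltac:(lra)).
  eapply cser_ext; [|exact H]. intros k. cbv beta. now rewrite (ps_coef R r c f ((Cmod z + R) / 2)).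
Qed.

Lemma hol_ps R f : 0 < R -> hol_on R f -> exists c, ps R c f.
Proof.
  intros HR Hf. exists (coef f (R / 2)). apply (hol_ps_extend R (R / 2)); [lra| |exact Hf].
  apply (hol_coef_ps R); [exact Hf|lra].
Qed.

Lemma hol_divz R f : 0 < R -> hol_on R f -> hol_on R (divz f).
Proof.
  intros HR Hf. destruct (hol_ps R f HR Hf) as (c & Hc).
  exact (ps_hol_on _ _ _ (ps_divz R c f HR Hc)).
Qed.

Lemma hol_deriv R f : 0 < R -> hol_on R f -> hol_on R (C_derive f).
Proof.
  intros HR Hf. destruct (hol_ps R f HR Hf) as (c & Hc). destruct (ps_pder _ _ _ Hc) as (g & Hg).
  intros z Hz. apply (hol_ext g _ z (R - Cmod z)); [lra| |now apply (ps_hol R (pder c))].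
  intros y Hy. symmetry. apply cderiv_C_derive. apply (ps_cderiv R c); auto.
  replace y with (z + (y - z))%C by ring. eapply Rle_lt_trans; [apply Cmod_triangle|]. lra.
Qed.

(** Integrate the power series term by term. *)
Lemma hol_prim R f : 0 < R -> hol_on R f -> exists F, forall z, Cmod z < R -> cderiv F z (f z).
Proof.
  intros HR Hf. destruct (hol_ps R f HR Hf) as (c & Hc).
  set (d := fun n => match n with O => RtoC 0 | S m => (c m / RtoC (INR (S m)))%C end).
  assert (Hd : exists F, ps R d F).
  { exists (fun z => Clim (Csum (fun n => d n * z ^ n)%C)). intros z Hz. apply Clim_correct.
    assert (Hz0 := Cmod_ge_0 z). set (r := (Cmod z + R) / 2).
    destruct (ps_bound R c f r) as (B & HB & Hb); [unfold r; lra|exact Hc|].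
    assert (Hr : 0 < r) by (unfold r; lra).
    assert (Hq : 0 <= Cmod z / r < 1) by (apply ratio_lt1; unfold r; lra).
    destruct (cser_geom (fun n => d (S n) * z ^ (S n))%C (B * Cmod z) (Cmod z / r)) as (l & Hl & _); auto.
    - now apply Rmult_le_pos.
    - intros n. unfold d. rewrite Cpow_S, !Cmod_mult, Cmod_pow.
      assert (Hn : INR (S n) <> 0) by (apply not_0_INR; lia).
      rewrite Cmod_div by now apply RtoC_neq_0. rewrite Cmod_R, Rabs_pos_eq by apply pos_INR.
      assert (H1 : 1 <= INR (S n)) by (rewrite S_INR; generalize (pos_INR n); lra).
      assert (H2 : Cmod (c n) / INR (S n) <= Cmod (c n)).
      { rewrite <- (Rmult_1_r (Cmod (c n))) at 2. apply Rmult_le_compat_l; [apply Cmod_ge_0|].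
        rewrite <- Rinv_1. apply Rinv_le_contravar; lra. }
      rewrite (ratio_pow (Cmod z) r n Hr) at 1.
      assert (H3 : 0 <= (Cmod z / r) ^ n) by (apply pow_le; lra). assert (H4 : 0 <= r ^ n) by (apply pow_le; lra).
      apply Rle_trans with (Cmod (c n) * (Cmod z * ((Cmod z / r) ^ n * r ^ n))).
      + apply Rmult_le_compat_r; [|exact H2]. repeat apply Rmult_le_pos; auto.
      + replace (Cmod (c n) * (Cmod z * ((Cmod z / r) ^ n * r ^ n)))
          with ((Cmod (c n) * r ^ n) * (Cmod z * (Cmod z / r) ^ n)) by ring.
        rewrite (Rmult_assoc B). apply Rmult_le_compat_r; [now apply Rmult_le_pos|apply Hb].
    - exists l. apply ctends_S. eapply ctends_ext; [|exact Hl]. intros n. rewrite Csum_shift.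
      unfold d at 2. rewrite Cmult_0_l, Cplus_0_l. reflexivity. }
  destruct Hd as (F & HF). exists F. intros z Hz. apply (ps_cderiv R d); auto.
  intros y Hy. eapply cser_ext; [|exact (Hc y Hy)]. intros n. cbv beta. unfold pder, d.
  assert (Hn : INR (S n) <> 0) by (apply not_0_INR; lia). field. now apply RtoC_neq_0.
Qed.

(** * Logarithms *)

Lemma cderiv_zero_const R F z : (forall y, Cmod y < R -> cderiv F y 0) -> Cmod z < R -> F z = F 0%C.
Proof.
  intros H Hz.
  assert (HL : Cmod (F z - F 0%C) <= 0 * Cmod (z - 0)).
  { assert (Hs : forall t, 0 <= t <= 1 -> Cmod (0 + RtoC t * (z - 0))%C < R).
    { intros t Ht. replace (0 + RtoC t * (z - 0))%C with (RtoC t * z)%C by ring.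
      rewrite Cmod_mult, Cmod_R, Rabs_pos_eq by lra. generalize (Cmod_ge_0 z). intros. nra. }
    apply (MVT_seg F (fun _ => RtoC 0)).
    - intros t Ht. apply H, Hs, Ht.
    - intros t _. rewrite Cmod_0. lra. }
  rewrite Rmult_0_l in HL. assert (E : (F z - F 0 = 0)%C).
  { apply Cmod_eq_0. apply Rle_antisym; [exact HL|apply Cmod_ge_0]. }
  replace (F z) with ((F z - F 0) + F 0)%C by ring. rewrite E. ring.
Qed.

Lemma hol_on_cderiv R f z : hol_on R f -> Cmod z < R -> cderiv f z (C_derive f z).
Proof. intros H Hz. now apply hol_cderiv, H. Qed.

(** This bootstraps [cderiv] of a primitive into [hol_at], where the derivative has to be
    [C_derive]. *)
Lemma prim_hol R F f : hol_on R f -> (forall z, Cmod z < R -> cderiv F z (f z)) -> hol_on R F.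
Proof.
  intros Hf HF z Hz. apply (hol_intro F f z (R - Cmod z)); [lra|]. intros y Hy.
  assert (Cmod y < R).
  { replace y with (z + (y - z))%C by ring. eapply Rle_lt_trans; [apply Cmod_triangle|]. lra. }
  split; [now apply HF|]. now apply hol_cont, Hf.
Qed.

(** L is a primitive of V'/V, and V e^(-L) has derivative zero. *)
Lemma hol_log R V : 0 < R -> hol_on R V -> (forall z, Cmod z < R -> V z <> 0%C) ->
  exists L, hol_on R L /\ L 0%C = 0%C /\
    (forall z, Cmod z < R -> V z = (V 0 * Cexp (L z))%C) /\
    forall z, Cmod z < R -> C_derive L z = (C_derive V z / V z)%C.
Proof.
  intros HR HV Hn.
  assert (Hq : hol_on R (fun z => C_derive V z / V z)%C).
  { intros z Hz. apply hol_div; [|now apply HV|now apply Hn]. now apply (hol_deriv R). }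
  destruct (hol_prim R _ HR Hq) as (F & HF).
  assert (HFd : forall z, Cmod z < R -> cderiv (fun z => F z - F 0)%C z (C_derive V z / V z)%C).
  { intros z Hz. eapply cderiv_eq; [apply cderiv_plus; [now apply HF|apply cderiv_const]|ring]. }
  exists (fun z => F z - F 0)%C.
  assert (HLd : forall z, Cmod z < R -> C_derive (fun z => F z - F 0)%C z = (C_derive V z / V z)%C).
  { intros z Hz. now apply cderiv_C_derive, HFd. }
  split; [exact (prim_hol R _ _ Hq HFd)|]. split; [ring|]. split; [|exact HLd].
  intros z Hz.
  assert (HE : forall y, Cmod y < R -> cderiv (fun y => V y * Cexp (- (F y - F 0)))%C y 0).
  { intros y Hy. eapply cderiv_eq.
    - apply cderiv_mult; [now apply (hol_on_cderiv R)|].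
      apply (cderiv_comp (fun y => - (F y - F 0))%C Cexp); [|apply cderiv_Cexp].
      apply (cderiv_ext (fun y => (-1) * (F y - F 0))%C _ _ _ 1 Rlt_0_1); [intros; ring|].
      apply cderiv_mult; [apply cderiv_const|now apply HFd].
    - cbv beta. field. now apply Hn. }
  assert (E := cderiv_zero_const R _ z HE Hz). cbv beta in E.
  replace (- (F 0 - F 0))%C with (RtoC 0) in E by ring. rewrite Cexp_0, Cmult_1_r in E.
  rewrite <- E. rewrite <- Cmult_assoc, (Cmult_comm (Cexp (- _))), Cexp_opp. ring.
Qed.

(** The logarithm on the right half plane. Rotations of it provide branches on the left, upper and
    lower half planes. *)
Definition Clog (z : C) : C := (ln (Cmod z), atan (Im z / Re z)).

Lemma Cexp_Clog z : 0 < Re z -> Cexp (Clog z) = z.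
Proof.
  intros Hz. destruct z as [a b]. unfold Re in Hz; simpl in Hz.
  unfold Cexp, Clog, Re, Im; simpl.
  assert (Hm : 0 < Cmod (a, b)).
  { apply Cmod_gt_0. intros E. apply (f_equal fst) in E. simpl in E. lra. }
  rewrite exp_ln by exact Hm. rewrite cos_atan, sin_atan.
  assert (E : Cmod (a, b) = a * sqrt (1 + (b / a)²)).
  { unfold Cmod; simpl. rewrite <- (sqrt_Rsqr a) at 3 by lra.
    rewrite <- sqrt_mult_alt by apply Rle_0_sqr. f_equal. unfold Rsqr. field. lra. }
  assert (Hs : 0 < sqrt (1 + (b / a)²)).
  { apply sqrt_lt_R0. generalize (Rle_0_sqr (b / a)). lra. }
  rewrite E. f_equal; field; lra.
Qed.

Lemma ccont_Re z : ccont (fun y => RtoC (Re y)) z.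
Proof.
  intros e He. exists e. split; [exact He|]. intros y Hy.
  rewrite <- RtoC_minus, Cmod_R.
  replace (Re y - Re z) with (Re (y - z)) by (destruct y, z; reflexivity).
  eapply Rle_lt_trans; [apply Re_le_Cmod|exact Hy].
Qed.

Lemma ccont_Im z : ccont (fun y => RtoC (Im y)) z.
Proof.
  intros e He. exists e. split; [exact He|]. intros y Hy.
  rewrite <- RtoC_minus, Cmod_R.
  replace (Im y - Im z) with (Im (y - z)) by (destruct y, z; reflexivity).
  eapply Rle_lt_trans; [apply Im_le_Cmod|exact Hy].
Qed.

Lemma continuity_eps (f : R -> R) x : continuity_pt f x -> forall e, 0 < e ->
  exists d, 0 < d /\ forall y, Rabs (y - x) < d -> Rabs (f y - f x) < e.
Proof.
  intros H e He. destruct (H e He) as (d & Hd & H'). exists d. split; [exact Hd|].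
  intros y Hy. destruct (Req_dec x y) as [->|Hne].
  - replace (f y - f y) with 0 by ring. now rewrite Rabs_R0.
  - apply H'. split; [split; [exact I|exact Hne]|exact Hy].
Qed.

Lemma Clog_cont z : 0 < Re z -> ccont Clog z.
Proof.
  intros Hz e He.
  assert (Hm : 0 < Cmod z).
  { apply Cmod_gt_0. intros ->. unfold Re in Hz; simpl in Hz. lra. }
  destruct (continuity_eps ln (Cmod z)) with (e := e / 2) as (d1 & Hd1 & H1); [|lra|].
  { apply derivable_continuous_pt. exists (/ Cmod z). now apply derivable_pt_lim_ln. }
  destruct (continuity_eps atan (Im z / Re z)) with (e := e / 2) as (d2 & Hd2 & H2); [|lra|].
  { apply derivable_continuous_pt. exists (/ (1 + (Im z / Re z) ^ 2)). apply derivable_pt_lim_atan. }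
  assert (Hq : ccont (fun y => RtoC (Im y) * / RtoC (Re y))%C z).
  { apply ccont_mult; [apply ccont_Im|]. apply ccont_inv; [|apply ccont_Re]. apply RtoC_neq_0. lra. }
  destruct (Hq d2 Hd2) as (d3 & Hd3 & H3).
  exists (Rmin (Rmin d1 d3) (Re z)). split; [repeat apply Rmin_glb_lt; assumption|].
  intros y Hy.
  assert (Ha : Cmod (y - z) < d1 /\ Cmod (y - z) < d3 /\ Cmod (y - z) < Re z).
  { generalize (Rmin_l (Rmin d1 d3) (Re z)) (Rmin_r (Rmin d1 d3) (Re z)) (Rmin_l d1 d3) (Rmin_r d1 d3). lra. }
  destruct Ha as (A1 & A2 & A3).
  assert (Hy0 : 0 < Re y).
  { assert (H := Re_le_Cmod (y - z)). replace (Re (y - z)) with (Re y - Re z) in H by (destruct y, z; reflexivity).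
    apply Rabs_le_between in H. lra. }
  assert (B1 : Rabs (ln (Cmod y) - ln (Cmod z)) < e / 2).
  { apply H1. apply Rle_lt_trans with (Cmod (y - z)); [|exact A1]. apply Rabs_le.
    generalize (Cmod_ge_sub y z) (Cmod_ge_sub z y). rewrite (Cmod_sub_sym z y). lra. }
  assert (B2 : Rabs (atan (Im y / Re y) - atan (Im z / Re z)) < e / 2).
  { apply H2. specialize (H3 y A2). rewrite <- !RtoC_inv, <- !RtoC_mult, <- RtoC_minus, Cmod_R in H3 by lra. exact H3. }
  eapply Rle_lt_trans; [apply Cmod_le_abs|].
  unfold Clog, Re, Im; simpl. unfold Re, Im in B2. unfold Rminus in *. lra.
Qed.

(** The inverse of the exponential: its differentiability follows from continuity and the derivative
    of the exponential at 0. *)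
Lemma Clog_cderiv z : 0 < Re z -> cderiv Clog z (/ z).
Proof.
  intros Hz.
  assert (Hz0 : z <> 0%C) by (intros ->; unfold Re in Hz; simpl in Hz; lra).
  assert (Hm : 0 < Cmod z) by now apply Cmod_gt_0.
  intros e He. set (e1 := Rmin (1 / 2) (e * Cmod z / 2)).
  assert (He1 : 0 < e1) by (apply Rmin_glb_lt; nra).
  destruct (cderiv_Cexp 0 e1 He1) as (d1 & Hd1 & H1).
  destruct (Clog_cont z Hz d1 Hd1) as (d2 & Hd2 & H2).
  exists (Rmin d2 (Re z)). split; [now apply Rmin_glb_lt|]. intros y Hy.
  assert (A1 : Cmod (y - z) < d2) by (eapply Rlt_le_trans; [exact Hy|apply Rmin_l]).
  assert (A2 : Cmod (y - z) < Re z) by (eapply Rlt_le_trans; [exact Hy|apply Rmin_r]).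
  assert (Hy0 : 0 < Re y).
  { assert (H := Re_le_Cmod (y - z)). replace (Re (y - z)) with (Re y - Re z) in H by (destruct y, z; reflexivity).
    apply Rabs_le_between in H. lra. }
  set (k := (Clog y - Clog z)%C).
  assert (Hk : Cmod k < d1) by now apply H2.
  assert (Ey : y = (z * Cexp k)%C).
  { rewrite <- (Cexp_Clog z Hz) at 1. rewrite <- Cexp_plus. unfold k.
    replace (Clog z + (Clog y - Clog z))%C with (Clog y) by ring. now rewrite Cexp_Clog. }
  specialize (H1 k). replace (k - 0)%C with k in H1 by ring. specialize (H1 Hk).
  rewrite Cexp_0 in H1. set (r := (Cexp k - 1 - 1 * k)%C) in *.
  assert (Ek : (k - / z * (y - z) = - r)%C) by (rewrite Ey; unfold r; field; exact Hz0).
  rewrite Ek, Cmod_opp. eapply Rle_trans; [exact H1|].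
  assert (Hk2 : Cmod k <= 2 * (Cmod (y - z) / Cmod z)).
  { replace (Cmod (y - z) / Cmod z) with (Cmod (/ z * (y - z))%C) by (rewrite Cmod_mult, Cmod_inv by exact Hz0; field; lra).
    assert (Cmod k <= Cmod (k - / z * (y - z))%C + Cmod (/ z * (y - z))%C).
    { replace k with ((k - / z * (y - z)) + / z * (y - z))%C at 1 by ring. apply Cmod_triangle. }
    rewrite Ek, Cmod_opp in H. assert (e1 <= 1 / 2) by apply Rmin_l. assert (0 <= Cmod k) by apply Cmod_ge_0. nra. }
  assert (He2 : e1 <= e * Cmod z / 2) by apply Rmin_r.
  apply Rle_trans with (e * Cmod z / 2 * (2 * (Cmod (y - z) / Cmod z))).
  - apply Rmult_le_compat; auto; [lra|apply Cmod_ge_0].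
  - right. field. lra.
Qed.

(** Branches of the logarithm on half planes that meet in a quadrant differ by a multiple of i pi/2.
    *)
Lemma Clog_corner a b : 0 < a -> 0 < b ->
  Clog (a, - b)%R = (Clog (b, a) - Ci * RtoC (PI / 2))%C /\ Clog (a, b) = (Clog (b, - a)%R + Ci * RtoC (PI / 2))%C.
Proof.
  intros Ha Hb.
  assert (Em : forall x y, Cmod (x, y) = Cmod (y, x) /\ Cmod (x, - y) = Cmod (x, y)).
  { intros x y. unfold Cmod; simpl. split; f_equal; ring. }
  assert (E1 : atan (a / b) = PI / 2 - atan (b / a)).
  { rewrite <- atan_inv by (apply Rdiv_lt_0_compat; lra). f_equal. field. lra. }
  unfold Clog, Re, Im, Ci, RtoC, Cminus, Cplus, Copp, Cmult; simpl. split; f_equal.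
  - rewrite (proj2 (Em a b)), (proj1 (Em a b)). ring.
  - replace (- b / a) with (- (b / a)) by (field; lra). rewrite atan_opp, E1. lra.
  - rewrite (proj2 (Em b a)), (proj1 (Em a b)). ring.
  - replace (- a / b) with (- (a / b)) by (field; lra). rewrite atan_opp, E1. lra.
Qed.

(** * Vertical integrals through a simple pole *)

(** With K a primitive of (m(z) - m(0))/z, the functions K(z) + m(0) log z, for the branches of the
    logarithm on the upper, lower and right half planes, are primitives of m(z)/z. The integral on a
    segment left of the pole, and the passage from left to right, are then read off from the jumps
    of the branches: each half turn around the pole contributes i pi m(0). *)
Lemma pole_primitives R (m K : C -> C) : hol_on R m ->
  (forall z, Cmod z < R -> z <> 0%C -> cderiv K z ((m z - m 0) / z)) ->
  exists GU GD GR : C -> C,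
    (forall z, Cmod z < R -> 0 < Im z -> cderiv GU z (m z / z)) /\
    (forall z, Cmod z < R -> Im z < 0 -> cderiv GD z (m z / z)) /\
    (forall z, Cmod z < R -> 0 < Re z -> cderiv GR z (m z / z)) /\
    (forall a b, 0 < a -> 0 < b -> a + b < R ->
       Cint (fun t => m (- a, t)%R / (- a, t)%R)%C (- b) b
         = (- RtoC PI * m 0 + (GU (- a, b)%R - GD (- a, - b)%R) / Ci)%C) /\
    (forall a b, 0 < a -> 0 < b ->
       (GU (a, b) - GD (a, - b)%R = - Ci * RtoC PI * m 0 + (GR (a, b) - GR (a, - b)%R))%C) /\
    (forall b, (GU b - GD (- b) = K b - K (- b))%C).
Proof.
  intros Hm HK.
  (* rot = 1, -1, -i, i turns the right, left, upper, lower half plane into the right one *)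
  set (G := fun rot z : C => (K z + m 0 * Clog (rot * z))%C).
  assert (HG : forall rot z : C, rot <> 0%C -> Cmod z < R -> 0 < Re (rot * z)%C -> cderiv (G rot) z (m z / z)).
  { intros rot z Hrot Hz Hre. unfold G.
    assert (Hz0 : z <> 0%C).
    { intros ->. replace (rot * 0)%C with (RtoC 0) in Hre by ring. unfold Re in Hre; simpl in Hre. lra. }
    eapply cderiv_eq.
    - apply cderiv_plus; [now apply HK|]. apply cderiv_mult; [apply cderiv_const|].
      apply (cderiv_comp (fun z => rot * z)%C Clog); [apply cderiv_mult; [apply cderiv_const|apply cderiv_id]|].
      now apply Clog_cderiv.
    - cbv beta. field. split; [exact Hz0|exact Hrot]. }
  assert (HnCi : (- Ci <> 0)%C).
  { intros E. apply Ci_nz. replace Ci with (- - Ci)%C by ring. rewrite E. ring. }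
  assert (Hm1 : RtoC (-1) <> 0%C) by (apply RtoC_neq_0; lra).
  exists (G (- Ci)%C), (G Ci), (G 1%C).
  split; [|split; [|split; [|split; [|split]]]].
  - intros z Hz Hi. apply HG; auto. destruct z as [x y]. unfold Re, Im, Ci, Copp, Cmult in *; simpl in *. lra.
  - intros z Hz Hi. apply HG; auto using Ci_nz. destruct z as [x y]. unfold Re, Im, Ci, Copp, Cmult in *; simpl in *. lra.
  - intros z Hz Hi. apply HG; auto using C1_nz. rewrite Cmult_1_l. exact Hi.
  - intros a b Ha Hb Hab.
    assert (Hline : forall t, ((- a, t)%R : C) = (RtoC (- a) + RtoC t * Ci)%C).
    { intros t. unfold RtoC, Ci, Cmult, Cplus; simpl. f_equal; ring. }
    assert (Hin : forall t, - b <= t <= b -> Cmod (- a, t)%R < R).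
    { intros t Ht. eapply Rle_lt_trans; [apply Cmod_le_abs|]. unfold Re, Im; simpl.
      rewrite Rabs_Ropp, (Rabs_pos_eq a) by lra. assert (Rabs t <= b) by (apply Rabs_le; lra). lra. }
    assert (Hre : forall t, 0 < Re (-1 * (- a, t)%R)%C).
    { intros t. unfold Re, Copp, RtoC, Cmult; simpl. lra. }
    rewrite (Cint_FTC (fun t => G (-1)%C (- a, t)%R / Ci)%C).
    + destruct (Clog_corner a b Ha Hb) as [E1 E2].
      unfold G.
      replace (-1 * (- a, b)%R)%C with ((a, - b)%R : C) by (unfold RtoC, Copp, Cmult; simpl; f_equal; ring).
      replace (-1 * (- a, - b)%R)%C with ((a, b)%R : C) by (unfold RtoC, Copp, Cmult; simpl; f_equal; ring).
      replace (- Ci * (- a, b)%R)%C with ((b, a)%R : C) by (unfold Ci, Copp, Cmult; simpl; f_equal; ring).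
      replace (Ci * (- a, - b)%R)%C with ((b, - a)%R : C) by (unfold Ci, Cmult; simpl; f_equal; ring).
      rewrite E1, E2. replace (RtoC PI) with (2 * RtoC (PI / 2))%C by (rewrite <- RtoC_mult; f_equal; field).
      field. apply Ci_nz.
    + lra.
    + intros t Ht.
      apply (rderiv_ext (fun t => G (-1)%C (RtoC (- a) + RtoC t * Ci)%C / Ci)%C).
      { intros s. now rewrite <- Hline. }
      eapply rderiv_eq.
      * apply (rderiv_comp (fun t => RtoC (- a) + RtoC t * Ci)%C (fun z => G (-1)%C z / Ci)%C); [apply rderiv_line|].
        unfold Cdiv. apply cderiv_mult; [|apply cderiv_const]. rewrite <- Hline. apply HG; auto.
      * cbv beta. assert (Hne : ((- a, t)%R : C) <> 0%C).
        { intros E. apply (f_equal fst) in E. simpl in E. lra. }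
        field. split; [exact Hne|apply Ci_nz].
    + intros t Ht. apply (rcont_ext (fun t => m (RtoC (- a) + RtoC t * Ci) / (RtoC (- a) + RtoC t * Ci))%C).
      { intros s. now rewrite <- Hline. }
      apply (rcont_comp (fun t => RtoC (- a) + RtoC t * Ci)%C (fun z => m z / z)%C).
      * eapply rderiv_cont. apply rderiv_line.
      * rewrite <- Hline. apply hol_cont, hol_div; [apply Hm, Hin, Ht|apply hol_id|].
        intros E. apply (f_equal fst) in E. simpl in E. lra.
  - intros a b Ha Hb. destruct (Clog_corner b a Hb Ha) as [E1 E2]. unfold G.
    replace (- Ci * (a, b)%R)%C with ((b, - a)%R : C) by (unfold Ci, Copp, Cmult; simpl; f_equal; ring).
    replace (Ci * (a, - b)%R)%C with ((b, a)%R : C) by (unfold Ci, Cmult; simpl; f_equal; ring).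
    rewrite E1, E2, !Cmult_1_l. replace (RtoC PI) with (2 * RtoC (PI / 2))%C by (rewrite <- RtoC_mult; f_equal; field).
    ring.
  - intros b. unfold G. replace (Ci * - b)%C with (- Ci * b)%C by ring. ring.
Qed.

(** The integral that each sheet contributes: a simple pole at 0 on the right of the vertical
    segment from -eta - i del to -eta + i del, against the factor e^(s f(z) - r z), normalized by 2
    pi. *)
Definition pole_integral (h f : C -> C) (eta del r s : R) : C :=
  (Cint (fun t => h (- eta, t)%R * Cexp (RtoC s * f (- eta, t)%R - RtoC r * (- eta, t)%R) / (- eta, t)%R) (- del) del
    / RtoC (2 * PI))%C.

(** Near 0 the real part of f grows along horizontal lines at a rate close to f'(0) = c. *)
Lemma Re_slope_bounds (f : C -> C) R c e x y th : 0 < R -> hol_on R f -> Rabs x + Rabs th < R -> Rabs y + Rabs th < R ->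
  x <= y -> (forall z, Cmod z < R -> Rabs (Re (C_derive f z) - c) <= e) ->
  (c - e) * (y - x) <= Re (f (y, th)) - Re (f (x, th)) <= (c + e) * (y - x).
Proof.
  intros HR Hf Hx Hy Hxy He.
  assert (Hline : forall t, ((t, th)%R : C) = ((0, th)%R + RtoC t * 1)%C).
  { intros t. unfold RtoC, Cmult, Cplus; simpl. f_equal; ring. }
  assert (Hin : forall t, x <= t <= y -> Cmod (t, th) < R).
  { intros t Ht. eapply Rle_lt_trans; [apply Cmod_le_abs|]. unfold Re, Im; simpl.
    assert (Rabs t <= Rmax (Rabs x) (Rabs y)); [|destruct (Rmax_Rle (Rabs x) (Rabs y) (Rabs t)) as [H1 _]; destruct (H1 H); lra].
    apply Rabs_le. generalize (Rmax_l (Rabs x) (Rabs y)) (Rmax_r (Rabs x) (Rabs y)) (Rle_abs x) (Rle_abs y) (Rle_abs (- x)) (Rle_abs (- y)).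
    rewrite !Rabs_Ropp. lra. }
  assert (Hd : forall t, x <= t <= y -> is_derive (fun t => Re (f (t, th))) t (Re (C_derive f (t, th)))).
  { intros t Ht. apply (rderiv_Re (fun t => f (t, th))).
    apply (rderiv_ext (fun t => f ((0, th)%R + RtoC t * 1)%C)); [intros s; now rewrite <- Hline|].
    eapply rderiv_eq.
    - apply (rderiv_comp (fun t => (0, th)%R + RtoC t * 1)%C f); [apply rderiv_line|].
      rewrite <- Hline. apply (hol_on_cderiv R); auto.
    - ring. }
  destruct (MVT_gen (fun t => Re (f (t, th))) x y (fun t => Re (C_derive f (t, th)))) as (t & Ht & E).
  - intros t. rewrite Rmin_left, Rmax_right by exact Hxy. intros Ht. apply Hd. lra.
  - intros t. rewrite Rmin_left, Rmax_right by exact Hxy. intros Ht.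
    apply derivable_continuous_pt. exists (Re (C_derive f (t, th))). apply is_derive_Reals, Hd, Ht.
  - rewrite Rmin_left, Rmax_right in Ht by exact Hxy. rewrite E.
    specialize (He _ (Hin t Ht)). apply Rabs_le_between in He. split; apply Rmult_le_compat_r; lra.
Qed.

Lemma Re_derive_near R f c e : 0 < R -> hol_on R f -> C_derive f 0 = RtoC c -> 0 < e ->
  exists R1, 0 < R1 <= R /\ forall z, Cmod z < R1 -> Rabs (Re (C_derive f z) - c) <= e.
Proof.
  intros HR Hf Hc He.
  assert (H0 : Cmod 0 < R) by (rewrite Cmod_0; exact HR).
  destruct (hol_dcont f 0 (Hf 0%C H0) e He) as (d & Hd & H).
  exists (Rmin d R). split; [split; [now apply Rmin_glb_lt|apply Rmin_r]|].
  intros z Hz. specialize (H z). replace (z - 0)%C with z in H by ring.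
  specialize (H (Rlt_le_trans _ _ _ Hz (Rmin_l _ _))). rewrite Hc in H.
  replace (Re (C_derive f z) - c) with (Re (C_derive f z - RtoC c)) by (destruct (C_derive f z); reflexivity).
  eapply Rle_trans; [apply Re_le_Cmod|lra].
Qed.

Lemma Cmod_expo (f : C -> C) r s (z : C) :
  Cmod (Cexp (RtoC s * f z - RtoC r * z)) = exp (s * Re (f z) - r * Re z).
Proof.
  rewrite Cmod_Cexp. f_equal. destruct (f z), z. unfold Re, RtoC, Cminus, Copp, Cplus, Cmult; simpl. ring.
Qed.

Lemma hol_on_sub R R' f : R' <= R -> hol_on R f -> hol_on R' f.
Proof. intros H Hf z Hz. apply Hf. lra. Qed.

Lemma hol_expo R (h f : C -> C) r s : hol_on R h -> hol_on R f ->
  hol_on R (fun z => h z * Cexp (RtoC s * f z - RtoC r * z))%C.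
Proof.
  intros Hh Hf z Hz. apply hol_mult; [now apply Hh|].
  apply (hol_comp (fun z => RtoC s * f z - RtoC r * z)%C Cexp); [|apply hol_Cexp].
  apply hol_minus; (apply hol_mult; [apply hol_const|]); [now apply Hf|apply hol_id].
Qed.

Lemma Cmod_pair_le (x y a b : R) : Rabs x <= a -> Rabs y <= b -> Cmod (x, y) <= a + b.
Proof. intros Hx Hy. eapply Rle_trans; [apply Cmod_le_abs|]. unfold Re, Im; simpl. lra. Qed.

(** In the application e^f is a sheet u_j(e^z), which is smaller than 1 on the unit circle except at
    1. *)
Definition on_axis_neg (R : R) (f : C -> C) : Prop :=
  forall t, 0 < Rabs t < R -> Re (f (0, t)) < 0.

Lemma axis_le0 R (f : C -> C) t : f 0%C = 0%C -> on_axis_neg R f -> Rabs t < R -> Re (f (0, t)) <= 0.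
Proof.
  intros H0 H Ht. destruct (Req_dec t 0) as [->|Hne].
  - change ((0, 0)%R) with (RtoC 0). rewrite H0. unfold Re; simpl. lra.
  - apply Rlt_le, H. split; [now apply Rabs_pos_lt|exact Ht].
Qed.

Lemma pair_C (x y : R) : ((x, y) : C) = (RtoC x + Ci * RtoC y)%C.
Proof. unfold RtoC, Ci, Cmult, Cplus; simpl. f_equal; ring. Qed.

Lemma pole_integrand_cont R h f r s eta t : hol_on R h -> hol_on R f -> 0 < eta -> eta + Rabs t < R ->
  rcont (fun t => h (- eta, t)%R * Cexp (RtoC s * f (- eta, t)%R - RtoC r * (- eta, t)%R) / (- eta, t)%R)%C t.
Proof.
  intros Hh Hf Heta Ht.
  assert (Hl : forall u, ((- eta, u)%R : C) = (RtoC (- eta) + RtoC u * Ci)%C) by (intros u; rewrite pair_C; ring).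
  apply (rcont_ext (fun t => (fun z => h z * Cexp (RtoC s * f z - RtoC r * z) / z) (RtoC (- eta) + RtoC t * Ci))%C).
  { intros u. cbv beta. now rewrite <- Hl. }
  apply (rcont_comp (fun t => RtoC (- eta) + RtoC t * Ci)%C (fun z => h z * Cexp (RtoC s * f z - RtoC r * z) / z)%C).
  { eapply rderiv_cont. apply rderiv_line. }
  rewrite <- Hl. apply hol_cont, hol_div; [|apply hol_id|].
  - apply (hol_expo R); auto. eapply Rle_lt_trans; [apply (Cmod_pair_le _ _ eta (Rabs t)); [rewrite Rabs_Ropp, Rabs_pos_eq; lra|lra]|exact Ht].
  - intros E. apply (f_equal fst) in E. simpl in E. lra.
Qed.

(** On the segment Re f is at most - (c - e) eta, by comparison with the imaginary axis, while - r
    Re z = r eta is at most (c - 2 e) s eta. *)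
Lemma pole_integral_below_slope R f h c e : 0 < R -> hol_on R f -> hol_on R h -> f 0%C = 0%C ->
  C_derive f 0 = RtoC c -> on_axis_neg R f -> 0 < e ->
  exists d0, 0 < d0 /\ forall del eta, 0 < del < d0 -> 0 < eta < d0 ->
    exists M, forall r s, 0 <= s -> r <= (c - 2 * e) * s ->
      Cmod (pole_integral h f eta del r s) <= M * exp (- (e * eta) * s).
Proof.
  intros HR Hf Hh Hf0 Hc Hax He.
  destruct (Re_derive_near R f c e HR Hf Hc He) as (R1 & HR1 & Hd).
  exists (R1 / 2). split; [lra|]. intros del eta Hdel Heta.
  destruct (hol_on_bounded R1 h (eta + del)) as (B & HB & Hb); [apply (hol_on_sub R); [lra|exact Hh]|lra|].
  exists (B * / eta * (2 * del)). intros r s Hs Hr. assert (HPI := PI_RGT_0). assert (HP3 := PI2_1).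
  assert (Hie : 0 < / eta) by (apply Rinv_0_lt_compat; lra).
  assert (Hexp := exp_pos (- (e * eta) * s)).
  assert (Hin : forall t, - del <= t <= del -> Cmod (- eta, t)%R <= eta + del).
  { intros t Ht. apply Cmod_pair_le; [rewrite Rabs_Ropp, Rabs_pos_eq; lra|apply Rabs_le; lra]. }
  assert (Hne : forall t, ((- eta, t)%R : C) <> 0%C).
  { intros t E. apply (f_equal fst) in E. simpl in E. lra. }
  unfold pole_integral. rewrite Cmod_div by apply TwoPI_neq_0. rewrite Cmod_R, Rabs_pos_eq by lra.
  apply Rle_trans with ((del - - del) * (B * / eta * exp (- (e * eta) * s)) / (2 * PI)).
  - apply Rmult_le_compat_r; [apply Rlt_le, Rinv_0_lt_compat; lra|]. apply Cint_bound; [lra| |].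
    + intros t Ht.
      apply (pole_integrand_cont R); auto; [lra|]. assert (Rabs t <= del) by (apply Rabs_le; lra). lra.
    + intros t Ht. rewrite Cmod_div by apply Hne. rewrite Cmod_mult, Cmod_expo.
      assert (H1 : Cmod (h (- eta, t)%R) <= B) by (apply Hb, Hin, Ht).
      assert (H2 : eta <= Cmod (- eta, t)%R).
      { eapply Rle_trans; [|apply Re_le_Cmod]. unfold Re; simpl. rewrite Rabs_Ropp, Rabs_pos_eq; lra. }
      assert (Hat : Rabs t <= del) by (apply Rabs_le; lra).
      destruct (Re_slope_bounds f R1 c e (- eta) 0 t) as [H3 _]; try lra.
      { apply (hol_on_sub R); [lra|exact Hf]. }
      { rewrite Rabs_Ropp, Rabs_pos_eq; lra. }
      { rewrite Rabs_R0. lra. }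
      { exact Hd. }
      assert (H4 := axis_le0 R f t Hf0 Hax ltac:(lra)).
      assert (H5 : exp (s * Re (f (- eta, t)%R) - r * Re (- eta, t)%R) <= exp (- (e * eta) * s)).
      { destruct (Rle_lt_or_eq_dec (s * Re (f (- eta, t)%R) - r * Re (- eta, t)%R) (- (e * eta) * s)) as [L|L].
        - unfold Re at 2; simpl.
          assert (s * Re (f (- eta, t)%R) <= s * (- (c - e) * eta)) by (apply Rmult_le_compat_l; lra).
          assert (r * eta <= (c - 2 * e) * s * eta) by (apply Rmult_le_compat_r; lra). nra.
        - apply Rlt_le, exp_increasing, L.
        - rewrite L. lra. }
      assert (H6 := exp_pos (s * Re (f (- eta, t)%R) - r * Re (- eta, t)%R)).
      assert (H7 : / Cmod (- eta, t)%R <= / eta) by (apply Rinv_le_contravar; lra).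
      assert (H8 : 0 < / Cmod (- eta, t)%R) by (apply Rinv_0_lt_compat; lra).
      unfold Rdiv. rewrite Rmult_assoc, (Rmult_assoc B). apply Rmult_le_compat; auto using Cmod_ge_0.
      * apply Rlt_le, Rmult_lt_0_compat; assumption.
      * rewrite (Rmult_comm (/ eta)). apply Rmult_le_compat; lra.
  - unfold Rdiv. replace (B * / eta * (2 * del) * exp (- (e * eta) * s)) with ((2 * del) * (B * / eta * exp (- (e * eta) * s))) by ring.
    replace (del - - del) with (2 * del) by ring.
    rewrite <- (Rmult_1_r (2 * del * (B * / eta * exp (- (e * eta) * s)))) at 2.
    apply Rmult_le_compat_l.
    + apply Rmult_le_pos; [lra|]. apply Rlt_le. apply Rmult_lt_0_compat; [|exact Hexp]. apply Rmult_lt_0_compat; assumption.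
    + rewrite <- Rinv_1. apply Rinv_le_contravar; lra.
Qed.

Lemma exp_le x y : x <= y -> exp x <= exp y.
Proof. intros [H|H]; [apply Rlt_le, exp_increasing, H|rewrite H; lra]. Qed.

(** * Directions above the slope *)

(** At height +-del the real part of f is negative on the axis; for small |x| neither the
    displacement nor the factor e^(-r x) can compensate it, uniformly for r of the order of s. *)
Lemma corner_decay R f c e del A : 0 < R -> hol_on R f -> on_axis_neg R f ->
  (forall z, Cmod z < R -> Rabs (Re (C_derive f z) - c) <= e) -> 0 < del < R / 2 -> 0 <= A ->
  exists mu eta0, 0 < mu /\ 0 < eta0 <= R / 2 /\ forall x r s, Rabs x <= eta0 -> 0 <= s -> Rabs r <= A * s ->
    s * Re (f (x, del)) - r * x <= - mu * s /\ s * Re (f (x, - del)) - r * x <= - mu * s.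
Proof.
  intros HR Hf Hax Hd Hdel HA.
  assert (He : 0 <= e).
  { eapply Rle_trans; [apply Rabs_pos|]. apply (Hd 0%C). rewrite Cmod_0. exact HR. }
  assert (H1 : Re (f (0, del)) < 0) by (apply Hax; rewrite Rabs_pos_eq; lra).
  assert (H2 : Re (f (0, - del)) < 0) by (apply Hax; rewrite Rabs_Ropp, Rabs_pos_eq; lra).
  set (mu := Rmin (- Re (f (0, del))) (- Re (f (0, - del))) / 2).
  assert (Hmu : 0 < mu).
  { unfold mu. assert (0 < Rmin (- Re (f (0, del))) (- Re (f (0, - del)))) by (apply Rmin_glb_lt; lra). lra. }
  assert (Hm1 : Re (f (0, del)) <= - (2 * mu)) by (unfold mu; generalize (Rmin_l (- Re (f (0, del))) (- Re (f (0, - del)))); lra).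
  assert (Hm2 : Re (f (0, - del)) <= - (2 * mu)) by (unfold mu; generalize (Rmin_r (- Re (f (0, del))) (- Re (f (0, - del)))); lra).
  assert (Hc := Rabs_pos c). set (L := Rabs c + e + A + 1). assert (HL : 0 < L) by (unfold L; lra).
  exists mu, (Rmin (R / 2) (mu / L)). split; [exact Hmu|]. split.
  { split; [apply Rmin_glb_lt; [lra|now apply Rdiv_lt_0_compat]|apply Rmin_l]. }
  intros x r s Hx Hs Hr.
  assert (Hx1 : Rabs x <= R / 2) by (eapply Rle_trans; [exact Hx|apply Rmin_l]).
  assert (Hx2 : L * Rabs x <= mu).
  { apply Rle_trans with (L * (mu / L)).
    - apply Rmult_le_compat_l; [lra|]. eapply Rle_trans; [exact Hx|apply Rmin_r].
    - right. field. lra. }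
  assert (HT : forall th, Rabs th = del -> Re (f (0, th)) <= - (2 * mu) -> s * Re (f (x, th)) - r * x <= - mu * s).
  { intros th Hth H0.
    assert (Hre : Re (f (x, th)) <= - (2 * mu) + (Rabs c + e) * Rabs x).
    { destruct (Rle_or_lt 0 x) as [L0|L0].
      - destruct (Re_slope_bounds f R c e 0 x th) as [_ H]; try lra; auto; try (rewrite Rabs_R0; lra).
        rewrite (Rabs_pos_eq x) by exact L0. assert ((c + e) * (x - 0) <= (Rabs c + e) * x); [|lra].
        rewrite Rminus_0_r. apply Rmult_le_compat_r; [exact L0|]. generalize (Rle_abs c). lra.
      - destruct (Re_slope_bounds f R c e x 0 th) as [H _]; try lra; auto; try (rewrite Rabs_R0; lra).
        rewrite (Rabs_left x) by exact L0. assert (- ((c - e) * (0 - x)) <= (Rabs c + e) * - x); [|lra].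
        replace (- ((c - e) * (0 - x))) with ((- c + e) * - x) by ring.
        apply Rmult_le_compat_r; [lra|]. generalize (Rle_abs (- c)). rewrite Rabs_Ropp. lra. }
    assert (Hrx : - (r * x) <= A * s * Rabs x).
    { apply Rle_trans with (Rabs (r * x)); [rewrite <- Rabs_Ropp; apply Rle_abs|]. rewrite Rabs_mult.
      apply Rmult_le_compat_r; [apply Rabs_pos|exact Hr]. }
    assert (H3 : s * Re (f (x, th)) <= s * (- (2 * mu) + (Rabs c + e) * Rabs x)) by (apply Rmult_le_compat_l; auto).
    assert (H4 : s * ((Rabs c + e + A) * Rabs x) <= s * mu).
    { apply Rmult_le_compat_l; [exact Hs|]. eapply Rle_trans; [|exact Hx2]. apply Rmult_le_compat_r; [apply Rabs_pos|unfold L; lra]. }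
    lra. }
  split; apply HT; auto; [|rewrite Rabs_Ropp]; apply Rabs_pos_eq; lra.
Qed.

Lemma seg_pt (a b c d t : R) : ((a, b) + RtoC t * ((c, d) - (a, b)))%C = (a + t * (c - a), b + t * (d - b))%R.
Proof. unfold RtoC, Cminus, Copp, Cplus, Cmult; simpl. f_equal; ring. Qed.

Lemma seg_bound G g (a b c d M : R) :
  (forall t, 0 <= t <= 1 -> cderiv G (a + t * (c - a), b + t * (d - b)) (g (a + t * (c - a), b + t * (d - b)))) ->
  (forall t, 0 <= t <= 1 -> Cmod (g (a + t * (c - a), b + t * (d - b))) <= M) ->
  Cmod (G (c, d) - G (a, b)) <= M * (Rabs (c - a) + Rabs (d - b)).
Proof.
  intros HG HM.
  assert (H0 : 0 <= M) by (eapply Rle_trans; [apply Cmod_ge_0|apply (HM 0); lra]).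
  eapply Rle_trans; [apply (MVT_seg G g (a, b) (c, d) M)|].
  - intros t Ht. rewrite seg_pt. now apply HG.
  - intros t Ht. rewrite seg_pt. now apply HM.
  - apply Rmult_le_compat_l; [exact H0|]. apply Cmod_le_abs.
Qed.

Lemma expo_quot_bound (h f : C -> C) r s z B del E : Cmod (h z) <= B -> 0 < del -> del <= Cmod z ->
  s * Re (f z) - r * Re z <= E ->
  Cmod (h z * Cexp (RtoC s * f z - RtoC r * z) / z) <= B / del * exp E.
Proof.
  intros Hh Hd Hz HE.
  assert (Hz0 : z <> 0%C) by (apply Cmod_gt_0; lra).
  rewrite Cmod_div, Cmod_mult, Cmod_expo by exact Hz0.
  assert (H1 := exp_le _ _ HE). assert (H2 := exp_pos (s * Re (f z) - r * Re z)).
  assert (H3 : / Cmod z <= / del) by (apply Rinv_le_contravar; lra).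
  assert (H4 : 0 < / Cmod z) by (apply Rinv_0_lt_compat; lra). assert (H5 := Cmod_ge_0 (h z)).
  replace (B / del * exp E) with (B * exp E * / del) by (unfold Rdiv; ring).
  apply Rmult_le_compat; try lra.
  - apply Rmult_le_pos; lra.
  - apply Rmult_le_compat; lra.
Qed.

Lemma im_le_Cmod_pair (x y : R) : Rabs y <= Cmod (x, y).
Proof. exact (Im_le_Cmod (x, y)). Qed.

Lemma re_le_Cmod_pair (x y : R) : Rabs x <= Cmod (x, y).
Proof. exact (Re_le_Cmod (x, y)). Qed.

(** The contribution of a horizontal edge of a contour at height y. *)
Lemma horizontal_edge (G h f : C -> C) (r s x0 x1 y B X : R) : y <> 0 ->
  (forall t, 0 <= t <= 1 -> let x := x0 + t * (x1 - x0) in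
     cderiv G (x, y) (h (x, y) * Cexp (RtoC s * f (x, y) - RtoC r * (x, y)) / (x, y)) /\
     Cmod (h (x, y)) <= B /\ s * Re (f (x, y)) - r * x <= X) ->
  Cmod (G (x1, y) - G (x0, y)) <= B / Rabs y * exp X * Rabs (x1 - x0).
Proof.
  intros Hy H. replace (Rabs (x1 - x0)) with (Rabs (x1 - x0) + Rabs (y - y)) by (rewrite Rminus_diag, Rabs_R0; ring).
  apply (seg_bound G (fun z => h z * Cexp (RtoC s * f z - RtoC r * z) / z)%C); intros t Ht;
    destruct (H t Ht) as (H1 & H2 & H3); replace (y + t * (y - y)) with y by ring; [exact H1|].
  apply expo_quot_bound; auto; [now apply Rabs_pos_lt|apply im_le_Cmod_pair].
Qed.

Lemma hol_prim_divz R m : 0 < R -> hol_on R m ->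
  exists K, forall z, Cmod z < R -> z <> 0%C -> cderiv K z ((m z - m 0) / z).
Proof.
  intros HR Hm. destruct (hol_prim R _ HR (hol_divz R m HR Hm)) as (K & HK).
  exists K. intros z Hz Hz0. eapply cderiv_eq; [now apply HK|].
  unfold divz. destruct (Ceq_dec z 0) as [E|_]; [contradiction|reflexivity].
Qed.

Lemma pole_integral_eq h f eta del r s m : m = (fun z => h z * Cexp (RtoC s * f z - RtoC r * z))%C ->
  pole_integral h f eta del r s = (Cint (fun t => m (- eta, t)%R / (- eta, t)%R) (- del) del / RtoC (2 * PI))%C.
Proof. intros ->. reflexivity. Qed.

Lemma Cmod_div_2PI (x : C) : Cmod (x / (RtoC (2 * PI) * Ci)) <= Cmod x.
Proof.
  assert (HPI := PI2_1).
  assert (H0 : (RtoC (2 * PI) * Ci <> 0)%C) by (apply Cmult_neq_0; [apply TwoPI_neq_0|apply Ci_nz]).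
  rewrite Cmod_div by exact H0. rewrite Cmod_mult, Cmod_Ci, Cmod_R, Rmult_1_r, Rabs_pos_eq by lra.
  rewrite <- (Rmult_1_r (Cmod x)) at 2. apply Rmult_le_compat_l; [apply Cmod_ge_0|].
  rewrite <- Rinv_1. apply Rinv_le_contravar; lra.
Qed.

(** Move the segment to the right of the pole. The two horizontal edges are small by [corner_decay],
    the right edge because e^(s f - r z) decays to the right when r > c s; the pole contributes -
    h(0). *)
Lemma pole_integral_above_slope R f h c e : 0 < R -> hol_on R f -> hol_on R h -> f 0%C = 0%C ->
  C_derive f 0 = RtoC c -> on_axis_neg R f -> 0 < e ->
  exists d0, 0 < d0 /\ forall del C0, 0 < del < d0 ->
    exists eta0, 0 < eta0 /\ forall eta, 0 < eta < eta0 ->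
    exists M ka, 0 < ka /\ forall r s, 0 <= s -> (c + 2 * e) * s <= r <= C0 * s ->
      Cmod (pole_integral h f eta del r s + h 0)%C <= M * exp (- ka * s).
Proof.
  intros HR Hf Hh Hf0 Hc Hax He.
  destruct (Re_derive_near R f c e HR Hf Hc He) as (R1 & HR1 & Hd).
  assert (Hf1 : hol_on R1 f) by (apply (hol_on_sub R); [lra|exact Hf]).
  assert (Hh1 : hol_on R1 h) by (apply (hol_on_sub R); [lra|exact Hh]).
  assert (Hax1 : on_axis_neg R1 f) by (intros t Ht; apply Hax; lra).
  exists (R1 / 2). split; [lra|]. intros del C0 Hdel.
  set (A := Rabs C0 + Rabs c + 2 * e). assert (HA : 0 <= A) by (unfold A; generalize (Rabs_pos C0) (Rabs_pos c); lra).
  destruct (corner_decay R1 f c e del A ltac:(lra) Hf1 Hax1 Hd Hdel HA) as (mu & eta0 & Hmu & Heta0 & Hcor).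
  exists eta0. split; [lra|]. intros eta Heta.
  destruct (hol_on_bounded R1 h (eta + del) Hh1 ltac:(lra)) as (B & HB & Hb).
  exists (2 * (B / del * (2 * eta)) + B / eta * (2 * del)), (Rmin mu (e * eta)).
  assert (Hee : 0 < e * eta) by (apply Rmult_lt_0_compat; lra).
  split; [apply Rmin_glb_lt; lra|]. intros r s Hs Hr.
  assert (Hrabs : Rabs r <= A * s).
  { apply Rabs_le. unfold A. generalize (Rle_abs C0) (Rle_abs (- c)) (Rabs_pos c) (Rabs_pos C0). rewrite Rabs_Ropp. intros.
    assert (C0 * s <= Rabs C0 * s) by (apply Rmult_le_compat_r; lra).
    assert (- c * s <= Rabs c * s) by (apply Rmult_le_compat_r; lra).
    assert (0 <= Rabs c * s) by (apply Rmult_le_pos; lra). assert (0 <= Rabs C0 * s) by (apply Rmult_le_pos; lra).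
    assert (0 <= e * s) by (apply Rmult_le_pos; lra). split; lra. }
  set (m := (fun z => h z * Cexp (RtoC s * f z - RtoC r * z))%C).
  assert (Hm : hol_on R1 m) by (now apply hol_expo).
  destruct (hol_prim_divz R1 m ltac:(lra) Hm) as (K & HK).
  destruct (pole_primitives R1 m K Hm HK) as (GU & GD & GR & HU & HD & HG & Hint & Hq & _).
  rewrite (pole_integral_eq h f eta del r s m eq_refl), (Hint eta del) by lra.
  assert (Hm0 : m 0%C = h 0%C).
  { unfold m. rewrite Hf0. replace (RtoC s * 0 - RtoC r * 0)%C with (RtoC 0) by ring. rewrite Cexp_0. ring. }
  specialize (Hq eta del ltac:(lra) ltac:(lra)).
  (* the contour around the pole without the left edge *)
  set (X := ((GU (- eta, del)%R - GU (eta, del)) - (GD (- eta, - del)%R - GD (eta, - del)%R) + (GR (eta, del) - GR (eta, - del)%R))%C).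
  assert (EX : ((- PI * m 0 + (GU (- eta, del)%R - GD (- eta, - del)%R) / Ci) / (2 * PI)%R + h 0)%C = (X / (RtoC (2 * PI) * Ci))%C).
  { replace (GU (- eta, del)%R - GD (- eta, - del)%R)%C
      with ((GU (- eta, del)%R - GU (eta, del)) - (GD (- eta, - del)%R - GD (eta, - del)%R) + (GU (eta, del) - GD (eta, - del)%R))%C by ring.
    rewrite Hq. unfold X. rewrite Hm0, RtoC_mult. field_simplify_eq; [ring|].
    repeat split; try apply Ci_nz; apply RtoC_neq_0; generalize PI_RGT_0; lra. }
  rewrite EX. eapply Rle_trans; [apply Cmod_div_2PI|].
  set (E := exp (- Rmin mu (e * eta) * s)).
  assert (HE1 : exp (- mu * s) <= E).
  { apply exp_le. generalize (Rmin_l mu (e * eta)). intros. nra. }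
  assert (HE2 : exp (- (e * eta) * s) <= E).
  { apply exp_le. generalize (Rmin_r mu (e * eta)). intros. nra. }
  assert (HEp := exp_pos (- Rmin mu (e * eta) * s)). fold E in HEp.
  assert (HBd : 0 < B / del) by (apply Rdiv_lt_0_compat; lra).
  assert (HBe : 0 < B / eta) by (apply Rdiv_lt_0_compat; lra).
  assert (Habs : forall t, 0 <= t <= 1 -> Rabs (eta + t * (- eta - eta)) <= eta) by (intros; apply Rabs_le; nra).
  assert (Hab2 : forall t, 0 <= t <= 1 -> Rabs (- del + t * (del - - del)) <= del) by (intros; apply Rabs_le; nra).
  assert (BH : forall (G : C -> C) y, Rabs y = del -> (y = del \/ y = - del) ->
    (forall x, Rabs x <= eta -> cderiv G (x, y) (m (x, y) / (x, y))) -> Cmod (G (- eta, y) - G (eta, y)) <= B / del * E * (2 * eta)).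
  { intros G y Hy Hyd HG'.
    eapply Rle_trans; [apply (horizontal_edge G h f r s eta (- eta) y B (- mu * s))|].
    - intros E0. rewrite E0, Rabs_R0 in Hy. lra.
    - intros t Ht x. assert (Hx := Habs t Ht : Rabs x <= eta). split; [now apply HG'|]. split; [apply Hb, Cmod_pair_le; lra|].
      destruct (Hcor x r s ltac:(lra) Hs Hrabs). destruct Hyd as [-> | ->]; assumption.
    - rewrite Hy. replace (- eta - eta) with (- (2 * eta)) by ring. rewrite Rabs_Ropp, (Rabs_pos_eq (2 * eta)) by lra.
      apply Rmult_le_compat_r; [lra|]. apply Rmult_le_compat_l; lra. }
  assert (Hpt : forall x y, Rabs x <= eta -> Rabs y = del -> Cmod (x, y) < R1).
  { intros x y Hx Hy. eapply Rle_lt_trans; [apply (Cmod_pair_le _ _ eta del); lra|lra]. }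
  assert (Ad1 : Rabs del = del) by (apply Rabs_pos_eq; lra). assert (Ad2 : Rabs (- del) = del) by (now rewrite Rabs_Ropp).
  assert (BU := BH GU del Ad1 (or_introl eq_refl) (fun x Hx => HU _ (Hpt x del Hx Ad1) ltac:(unfold Im; simpl; lra))).
  assert (BD := BH GD (- del) Ad2 (or_intror eq_refl) (fun x Hx => HD _ (Hpt x (- del) Hx Ad2) ltac:(unfold Im; simpl; lra))).
  assert (BR : Cmod (GR (eta, del) - GR (eta, - del)%R) <= B / eta * E * (2 * del)).
  { eapply Rle_trans; [apply (seg_bound GR (fun z => m z / z)%C eta (- del) eta del (B / eta * E))|].
    - intros t Ht. specialize (Hab2 t Ht). replace (eta + t * (eta - eta)) with eta by ring.
      apply HG; [|unfold Re; simpl; lra]. eapply Rle_lt_trans; [apply (Cmod_pair_le _ _ eta del); [rewrite Rabs_pos_eq; lra|exact Hab2]|lra].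
    - intros t Ht. specialize (Hab2 t Ht). replace (eta + t * (eta - eta)) with eta by ring.
      set (th := - del + t * (del - - del)) in *.
      eapply Rle_trans; [apply (expo_quot_bound h f r s _ B eta (- (e * eta) * s))|].
      + apply Hb. apply Cmod_pair_le; [rewrite Rabs_pos_eq; lra|exact Hab2].
      + lra.
      + eapply Rle_trans; [|apply re_le_Cmod_pair]. rewrite Rabs_pos_eq; lra.
      + destruct (Re_slope_bounds f R1 c e 0 eta th) as [_ H3]; try lra; auto.
        { rewrite Rabs_R0. lra. } { rewrite (Rabs_pos_eq eta); lra. }
        assert (H4 := axis_le0 R1 f th Hf0 Hax1 ltac:(lra)). unfold Re at 2; simpl.
        assert (s * Re (f (eta, th)) <= s * ((c + e) * eta)) by (apply Rmult_le_compat_l; lra).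
        assert ((c + 2 * e) * s * eta <= r * eta) by (apply Rmult_le_compat_r; lra). nra.
      + apply Rmult_le_compat_l; lra.
    - right. replace (eta - eta) with 0 by ring. rewrite Rabs_R0.
      rewrite Rabs_pos_eq by lra. ring. }
  unfold X. eapply Rle_trans; [apply Cmod_triangle|].
  eapply Rle_trans; [apply Rplus_le_compat_r, Cmod_minus_le|]. lra.
Qed.

(** * Complex square roots and entire primitives *)

Lemma Csqrt_ex (w : C) : exists q, (q * q = w)%C.
Proof.
  destruct w as [a b].
  assert (Hm : Rabs a <= Cmod (a, b)) by apply re_le_Cmod_pair.
  assert (H2 : Cmod (a, b) * Cmod (a, b) = a * a + b * b).
  { unfold Cmod; simpl. rewrite sqrt_sqrt by nra. ring. }
  set (m := Cmod (a, b)) in *. apply Rabs_le_between in Hm.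
  set (x := sqrt ((m + a) / 2)). set (y := sqrt ((m - a) / 2)).
  assert (Hx : x * x = (m + a) / 2) by (apply sqrt_sqrt; lra).
  assert (Hy : y * y = (m - a) / 2) by (apply sqrt_sqrt; lra).
  assert (Hx0 : 0 <= x) by apply sqrt_pos. assert (Hy0 : 0 <= y) by apply sqrt_pos.
  assert (Hxy : (2 * (x * y)) * (2 * (x * y)) = b * b).
  { replace (2 * (x * y) * (2 * (x * y))) with (4 * (x * x) * (y * y)) by ring. rewrite Hx, Hy. nra. }
  assert (Hxy0 : 0 <= x * y) by (apply Rmult_le_pos; assumption).
  destruct (Rle_or_lt 0 b) as [L|L].
  - exists (x, y). unfold Cmult; simpl. f_equal; [lra|]. assert (2 * (x * y) = b) by nra. lra.
  - exists (x, - y)%R. unfold Cmult; simpl. f_equal; [lra|]. assert (2 * (x * y) = - b) by nra. lra.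
Qed.

(** Primitives on growing disks, normalized at 0, agree. *)
Lemma hol_prim_entire f : (forall z, hol_at f z) -> exists F, forall z, cderiv F z (f z).
Proof.
  intros Hf.
  assert (H : forall R, exists F, 0 < R -> forall z, Cmod z < R -> cderiv F z (f z)).
  { intros R. destruct (Rlt_or_le 0 R) as [L|L].
    - destruct (hol_prim R f L) as (F & HF); [intros z _; apply Hf|]. exists F. auto.
    - exists f. intros; lra. }
  set (P := fun R => proj1_sig (constructive_indefinite_description _ (H R))).
  assert (HP : forall R, 0 < R -> forall z, Cmod z < R -> cderiv (P R) z (f z)).
  { intros R. unfold P. apply proj2_sig. }
  exists (fun z => P (Cmod z + 1)%R z - P (Cmod z + 1)%R 0)%C. intros z.
  assert (Hz := Cmod_ge_0 z).
  apply (cderiv_ext (fun y => P (Cmod z + 2)%R y - P (Cmod z + 2)%R 0)%C _ z _ 1 Rlt_0_1).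
  - intros y Hy. assert (Hy0 := Cmod_ge_0 y).
    assert (Hyz : Cmod y < Cmod z + 1).
    { replace y with ((y - z) + z)%C by ring. eapply Rle_lt_trans; [apply Cmod_triangle|]. lra. }
    set (r1 := Cmod z + 2). set (r2 := Cmod y + 1).
    assert (HE : forall x, Cmod x < Rmin r1 r2 -> cderiv (fun x => P r1 x + (-1) * P r2 x)%C x 0).
    { intros x Hx. eapply cderiv_eq.
      - apply cderiv_plus; [apply (HP r1)|apply cderiv_mult; [apply cderiv_const|apply (HP r2)]].
        + unfold r1; lra.
        + eapply Rlt_le_trans; [exact Hx|apply Rmin_l].
        + unfold r2; lra.
        + eapply Rlt_le_trans; [exact Hx|apply Rmin_r].
      - cbv beta. ring. }
    assert (E := cderiv_zero_const _ _ y HE). cbv beta in E.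
    assert (Hyr : Cmod y < Rmin r1 r2) by (apply Rmin_glb_lt; unfold r1, r2; lra).
    specialize (E Hyr).
    replace (P r1 y) with ((P r1 y + -1 * P r2 y) + P r2 y)%C by ring. rewrite E. ring.
  - eapply cderiv_eq; [apply cderiv_plus; [apply (HP (Cmod z + 2)); lra|apply cderiv_const]|ring].
Qed.

(** * Exponential decay and powers of the inverse square root *)

Lemma poly_geom_k k : forall q, 0 <= q < 1 -> exists K q', 0 <= K /\ 0 <= q' < 1 /\
  forall n, (INR n + 1) ^ k * q ^ n <= K * q' ^ n.
Proof.
  induction k as [|k IH]; intros q Hq.
  - exists 1, q. repeat split; try lra. intros n. simpl. lra.
  - destruct (poly_geom q Hq) as (K & q1 & HK & Hq1 & H).
    destruct (IH q1 Hq1) as (K' & q2 & HK' & Hq2 & H').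
    exists (K * K'), q2. split; [now apply Rmult_le_pos|]. split; [exact Hq2|]. intros n.
    assert (Hn := pos_INR n). assert (Hp : 0 <= (INR n + 1) ^ k) by (apply pow_le; lra).
    assert (Hqn : 0 <= q ^ n) by (apply pow_le; lra).
    apply Rle_trans with ((INR n + 1) ^ k * ((INR n + 1) ^ 2 * q ^ n)).
    + simpl. assert ((INR n + 1) * ((INR n + 1) ^ k * q ^ n) <= (INR n + 1) * ((INR n + 1) * ((INR n + 1) ^ k * q ^ n))); [|nra].
      assert (0 <= (INR n + 1) * ((INR n + 1) ^ k * q ^ n)) by (apply Rmult_le_pos; [lra|now apply Rmult_le_pos]). nra.
    + apply Rle_trans with ((INR n + 1) ^ k * (K * q1 ^ n)); [apply Rmult_le_compat_l; auto|].
      specialize (H' n). rewrite (Rmult_assoc K).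
      replace ((INR n + 1) ^ k * (K * q1 ^ n)) with (K * ((INR n + 1) ^ k * q1 ^ n)) by ring.
      apply Rmult_le_compat_l; auto.
Qed.

(** Powers of s^(-1/2), the scale of the expansion on the walls of the cone. *)
Definition rsqrt (s : nat) : R := / sqrt (INR s).

Lemma rsqrt_bounds s : (1 <= s)%nat -> 0 < rsqrt s <= 1 /\ / rsqrt s <= INR s + 1 /\ sqrt (INR s) * rsqrt s = 1.
Proof.
  intros Hs. assert (H1 : 1 <= INR s) by (change 1 with (INR 1); now apply le_INR).
  assert (H2 : 1 <= sqrt (INR s)) by (rewrite <- sqrt_1; apply sqrt_le_1; lra).
  unfold rsqrt. split; [split|split].
  - apply Rinv_0_lt_compat; lra.
  - rewrite <- Rinv_1. apply Rinv_le_contravar; lra.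
  - rewrite Rinv_inv. assert (sqrt (INR s) * sqrt (INR s) = INR s) by (apply sqrt_sqrt; lra). nra.
  - apply Rinv_r. lra.
Qed.

Lemma geom_small q N : 0 <= q < 1 -> exists M, 0 <= M /\ forall s, (1 <= s)%nat -> q ^ s <= M * rsqrt s ^ N.
Proof.
  intros Hq. destruct (poly_geom_k N q Hq) as (K & q' & HK & Hq' & H).
  exists K. split; [exact HK|]. intros s Hs. destruct (rsqrt_bounds s Hs) as ((H1 & H1') & H2 & _).
  assert (H3 : 0 < rsqrt s ^ N) by now apply pow_lt.
  apply (Rmult_le_reg_l ((/ rsqrt s) ^ N)); [apply pow_lt; now apply Rinv_0_lt_compat|].
  replace ((/ rsqrt s) ^ N * (K * rsqrt s ^ N)) with K.
  2:{ rewrite pow_inv. field. lra. }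
  apply Rle_trans with ((INR s + 1) ^ N * q ^ s).
  - apply Rmult_le_compat_r; [apply pow_le; lra|]. apply pow_incr. split; [|exact H2].
    apply Rlt_le, Rinv_0_lt_compat, H1.
  - eapply Rle_trans; [apply H|]. rewrite <- (Rmult_1_r K) at 2. apply Rmult_le_compat_l; [exact HK|].
    rewrite <- (pow1 s). apply pow_incr. lra.
Qed.

Lemma exp_INR k s : exp (- k * INR s) = exp (- k) ^ s.
Proof.
  induction s as [|s IH]; [simpl; rewrite Rmult_0_r; apply exp_0|].
  rewrite S_INR, <- tech_pow_Rmult, <- IH, <- exp_plus. f_equal. ring.
Qed.

(** Exponentially small errors are invisible on the scale of powers of s^(-1/2). *)
Lemma exp_small k N : 0 < k -> exists M, 0 <= M /\ forall s, (1 <= s)%nat -> exp (- k * INR s) <= M * rsqrt s ^ N.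
Proof.
  intros Hk. destruct (geom_small (exp (- k)) N) as (M & HM & H).
  - split; [apply Rlt_le, exp_pos|]. rewrite <- exp_0. apply exp_increasing. lra.
  - exists M. split; [exact HM|]. intros s Hs. rewrite exp_INR. auto.
Qed.

(** After the substitution y = sqrt(s) x this is the boundedness of y^N e^(-lam y^2); it gives the
    order of the remainder after N terms. *)
Lemma gauss_pow lam N : 0 < lam -> exists M, 0 <= M /\ forall x s, (1 <= s)%nat ->
  Rabs x ^ N * exp (- (INR s * (lam * x ^ 2))) <= M * rsqrt s ^ N.
Proof.
  intros Hl.
  assert (HM : exists M, 0 <= M /\ forall y, 0 <= y -> y ^ N * exp (- (lam * y ^ 2)) <= M).
  { exists (1 + (INR N / lam) ^ N).
    assert (HN := pos_INR N). assert (H0 : 0 <= (INR N / lam) ^ N).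
    { apply pow_le. apply Rmult_le_pos; [exact HN|apply Rlt_le, Rinv_0_lt_compat, Hl]. }
    split; [lra|]. intros y Hy. assert (He := exp_pos (- (lam * y ^ 2))).
    assert (Hy2 : y ^ N <= 1 + (y ^ 2) ^ N).
    { destruct (Rle_or_lt y 1) as [L|L].
      - assert (y ^ N <= 1) by (rewrite <- (pow1 N); apply pow_incr; lra).
        assert (0 <= (y ^ 2) ^ N) by (apply pow_le, pow2_ge_0). lra.
      - assert (y ^ N <= (y ^ 2) ^ N) by (apply pow_incr; nra). lra. }
    assert (He1 : exp (- (lam * y ^ 2)) <= 1).
    { rewrite <- exp_0. apply exp_le. assert (0 <= lam * y ^ 2) by (apply Rmult_le_pos; [lra|apply pow2_ge_0]). lra. }
    assert (HT : (y ^ 2) ^ N * exp (- (lam * y ^ 2)) <= (INR N / lam) ^ N).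
    { destruct N as [|N']; [simpl in *; lra|]. set (n := S N') in *.
      assert (Hn : 0 < INR n) by (apply lt_0_INR; unfold n; lia).
      set (z := lam * y ^ 2). assert (Hz : 0 <= z) by (apply Rmult_le_pos; [lra|apply pow2_ge_0]).
      assert (E1 : exp z = exp (z / INR n) ^ n).
      { rewrite <- (Ropp_involutive (z / INR n)), <- exp_INR. f_equal. field. lra. }
      assert (Hzn : z / INR n <= exp (z / INR n)).
      { destruct (Req_dec (z / INR n) 0) as [E0|E0]; [rewrite E0, exp_0; lra|]. generalize (exp_ineq1 _ E0). lra. }
      assert (H1 : (z / INR n) ^ n <= exp z).
      { rewrite E1. apply pow_incr. split; [|exact Hzn]. apply Rmult_le_pos; [exact Hz|apply Rlt_le, Rinv_0_lt_compat, Hn]. }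
      replace ((y ^ 2) ^ n) with ((INR n / lam) ^ n * (z / INR n) ^ n).
      2:{ rewrite <- Rpow_mult_distr. f_equal. unfold z. field. lra. }
      rewrite exp_Ropp, Rmult_assoc. rewrite <- (Rmult_1_r ((INR n / lam) ^ n)) at 2.
      apply Rmult_le_compat_l; [exact H0|]. apply (Rmult_le_reg_r (exp z)); [apply exp_pos|].
      rewrite Rmult_assoc, Rinv_l by (apply Rgt_not_eq, exp_pos). lra. }
    apply Rle_trans with ((1 + (y ^ 2) ^ N) * exp (- (lam * y ^ 2))); [apply Rmult_le_compat_r; lra|]. lra. }
  destruct HM as (M & HM & H). exists M. split; [exact HM|]. intros x s Hs.
  destruct (rsqrt_bounds s Hs) as ((H1 & _) & _ & H2).
  assert (Hs0 := pos_INR s). assert (Hsq : sqrt (INR s) * sqrt (INR s) = INR s) by now apply sqrt_sqrt.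
  specialize (H (sqrt (INR s) * Rabs x) ltac:(apply Rmult_le_pos; [apply sqrt_pos|apply Rabs_pos])).
  replace (lam * (sqrt (INR s) * Rabs x) ^ 2) with (INR s * (lam * x ^ 2)) in H.
  2:{ transitivity (lam * ((sqrt (INR s) * sqrt (INR s)) * Rabs x ^ 2)); [rewrite Hsq, pow2_abs; ring|ring]. }
  replace (Rabs x ^ N) with (rsqrt s ^ N * (sqrt (INR s) * Rabs x) ^ N).
  2:{ rewrite <- Rpow_mult_distr. f_equal. rewrite <- Rmult_assoc, (Rmult_comm (rsqrt s)), H2. ring. }
  rewrite Rmult_assoc, (Rmult_comm M). apply Rmult_le_compat_l; [apply pow_le; lra|exact H].
Qed.

(** * Gaussian moments *)

(** The integrand of the k-th Gaussian moment. *)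
Definition gauss_kernel (k : nat) (z : C) : C := (z ^ k * Cexp (- (z * z)))%C.

Lemma gauss_kernel_hol k z : hol_at (gauss_kernel k) z.
Proof.
  unfold gauss_kernel. apply hol_mult; [apply hol_pow, hol_id|].
  apply (hol_comp (fun z => - (z * z))%C Cexp); [|apply hol_Cexp]. apply hol_opp, hol_mult; apply hol_id.
Qed.

Lemma Re_scal (x : R) (w : C) : Re (RtoC x * w)%C = x * Re w.
Proof. destruct w. unfold Re, RtoC, Cmult; simpl. ring. Qed.

Lemma Re_opp (w : C) : Re (- w)%C = - Re w.
Proof. destruct w. reflexivity. Qed.

(** A primitive of the Gaussian moment has a limit along rays on which Re (z^2) grows: the
    increments between sqrt(s) U and sqrt(s+1) U are geometrically small in s. *)
Lemma moment_limit k G (U : C) : (forall z, cderiv G z (gauss_kernel k z)) -> 0 < Re (U * U)%C ->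
  exists M C0 q, 0 <= C0 /\ 0 <= q < 1 /\ forall s : nat, Cmod (G (RtoC (sqrt (INR s)) * U)%C - M) <= C0 * q ^ s.
Proof.
  intros HG HU. set (ka := Re (U * U)%C) in *.
  assert (Hq0 : 0 <= exp (- ka) < 1).
  { split; [apply Rlt_le, exp_pos|]. rewrite <- exp_0. apply exp_increasing. lra. }
  destruct (poly_geom_k k (exp (- ka)) Hq0) as (K & q & HK & Hq & HKq).
  assert (HU0 := Cmod_ge_0 U). set (K2 := Cmod U ^ k * Cmod U * K * 2 ^ k).
  assert (HK2 : 0 <= K2).
  { unfold K2. apply Rmult_le_pos; [|apply pow_le; lra]. apply Rmult_le_pos; [|exact HK].
    apply Rmult_le_pos; [now apply pow_le|exact HU0]. }
  assert (Hstep : forall s, Cmod (G (RtoC (sqrt (INR (S s))) * U)%C - G (RtoC (sqrt (INR s)) * U)%C) <= K2 * q ^ s).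
  { intros s. assert (Hs := pos_INR s).
    assert (Hsq1 : sqrt (INR s) <= sqrt (INR (S s))) by (apply sqrt_le_1; rewrite ?S_INR; lra).
    assert (Hsq0 : 0 <= sqrt (INR s)) by apply sqrt_pos.
    assert (HsS : sqrt (INR (S s)) * sqrt (INR (S s)) = INR s + 1) by (rewrite sqrt_sqrt; rewrite S_INR; lra).
    assert (Hss : sqrt (INR s) * sqrt (INR s) = INR s) by (apply sqrt_sqrt; lra).
    assert (Hup : sqrt (INR (S s)) <= INR s + 1) by nra.
    assert (Hdiff : sqrt (INR (S s)) - sqrt (INR s) <= 1) by nra.
    assert (HM := MVT_C (fun t => G (RtoC t * U)%C) (fun t => gauss_kernel k (RtoC t * U) * U)%C (sqrt (INR s)) (sqrt (INR (S s)))
       (Cmod U ^ k * Cmod U * (K * q ^ s)) Hsq1).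
    eapply Rle_trans; [apply HM|].
    - intros t _. apply (rderiv_cderiv (fun z => G (z * U)%C)).
      eapply cderiv_eq; [apply (cderiv_comp (fun z => z * U)%C G); [apply cderiv_mult; [apply cderiv_id|apply cderiv_const]|apply HG]|].
      cbv beta. ring.
    - intros t Ht. unfold gauss_kernel. rewrite !Cmod_mult, Cmod_pow, Cmod_mult, Cmod_R, Rabs_pos_eq, Cmod_Cexp by lra.
      replace (RtoC t * U * (RtoC t * U))%C with (RtoC (t * t) * (U * U))%C by (rewrite RtoC_mult; ring).
      rewrite Re_opp, Re_scal. fold ka. rewrite Rpow_mult_distr.
      replace (t ^ k * Cmod U ^ k * exp (- (t * t * ka)) * Cmod U) with (Cmod U ^ k * Cmod U * (t ^ k * exp (- (t * t * ka)))) by ring.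
      apply Rmult_le_compat_l; [apply Rmult_le_pos; [now apply pow_le|exact HU0]|].
      eapply Rle_trans; [|apply HKq]. rewrite <- exp_INR. apply Rmult_le_compat.
      + apply pow_le; lra.
      + apply Rlt_le, exp_pos.
      + apply pow_incr. lra.
      + apply exp_le. assert (INR s <= t * t) by nra.
        assert (INR s * ka <= t * t * ka) by (apply Rmult_le_compat_r; lra). lra.
    - unfold K2. assert (Hqs : 0 <= q ^ s) by (apply pow_le; lra).
      set (A := Cmod U ^ k * Cmod U). assert (HA : 0 <= A) by (apply Rmult_le_pos; [now apply pow_le|exact HU0]).
      assert (H2k : 1 <= 2 ^ k) by (apply pow_R1_Rle; lra).
      assert (HX : 0 <= A * K * q ^ s) by (apply Rmult_le_pos; [apply Rmult_le_pos; assumption|exact Hqs]).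
      replace (A * (K * q ^ s) * (sqrt (INR (S s)) - sqrt (INR s))) with (A * K * q ^ s * (sqrt (INR (S s)) - sqrt (INR s))) by ring.
      replace (A * K * 2 ^ k * q ^ s) with (A * K * q ^ s * 2 ^ k) by ring.
      apply Rmult_le_compat_l; lra. }
  set (u := fun s => (G (RtoC (sqrt (INR (S s))) * U)%C - G (RtoC (sqrt (INR s)) * U)%C)%C).
  assert (Hsum : forall s, Csum u s = (G (RtoC (sqrt (INR s)) * U)%C - G (RtoC (sqrt (INR 0)) * U)%C)%C).
  { induction s as [|s IH]; [simpl; ring|]. simpl Csum. rewrite IH. unfold u. ring. }
  destruct (cser_geom u K2 q HK2 Hq Hstep) as (l & _ & _ & Hl).
  exists (l + G (RtoC (sqrt (INR 0)) * U)%C)%C, (K2 / (1 - q)), q.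
  split; [apply Rmult_le_pos; [exact HK2|apply Rlt_le, Rinv_0_lt_compat; lra]|]. split; [exact Hq|].
  intros s. specialize (Hl s). rewrite Hsum in Hl. rewrite Cmod_sub_sym.
  replace (l + G (RtoC (sqrt (INR 0)) * U) - G (RtoC (sqrt (INR s)) * U))%C
    with (l - (G (RtoC (sqrt (INR s)) * U) - G (RtoC (sqrt (INR 0)) * U)))%C by ring.
  eapply Rle_trans; [exact Hl|]. right. field. lra.
Qed.

(** * A direction of descent at a critical point *)

Lemma divz_0 f : divz f 0 = C_derive f 0.
Proof. unfold divz. destruct (Ceq_dec 0 0) as [_|E]; [reflexivity|now destruct E]. Qed.

Lemma divz_derive R f : 0 < R -> hol_on R f -> (2 * C_derive (divz f) 0 = C_derive (C_derive f) 0)%C.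
Proof.
  intros HR Hf. destruct (hol_ps R f HR Hf) as (c & Hc).
  assert (H0 : Cmod 0 < R) by (rewrite Cmod_0; exact HR).
  assert (Hd := ps_divz R c f HR Hc).
  destruct (ps_pder _ _ _ Hd) as (g & Hg). rewrite (cderiv_C_derive _ _ _ (ps_cderiv _ _ _ _ _ Hd Hg H0)).
  rewrite (ps_0 _ _ _ HR Hg).
  destruct (ps_pder _ _ _ Hc) as (g1 & Hg1).
  assert (HD : ps R (pder c) (C_derive f)).
  { intros z Hz. rewrite (cderiv_C_derive _ _ _ (ps_cderiv _ _ _ _ _ Hc Hg1 Hz)). now apply Hg1. }
  destruct (ps_pder _ _ _ HD) as (g2 & Hg2). rewrite (cderiv_C_derive _ _ _ (ps_cderiv _ _ _ _ _ HD Hg2 H0)).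
  rewrite (ps_0 _ _ _ HR Hg2). unfold pder. simpl INR. rewrite !RtoC_plus. ring.
Qed.

(** Write kap = F''(0). That Re F < 0 on the imaginary axis forces only Re kap >= 0; if kap is
    purely imaginary, the axis is not a direction in which |e^F| decays like a Gaussian. Tilting it
    slightly, in the sense given by the sign of Im kap, makes Re (kap (xi + i)^2) negative, and Re F
    decreases on the way from the axis to the tilted line at fixed height. *)
Lemma descent_direction R F : 0 < R -> hol_on R F -> F 0%C = 0%C -> C_derive F 0 = 0%C ->
  C_derive (C_derive F) 0 <> 0%C -> on_axis_neg R F ->
  exists xi R1, 0 < R1 <= R /\ Rabs xi <= 1 / 2 /\
    0 < Re (- (C_derive (C_derive F) 0 / 2) * ((xi, 1) * (xi, 1)))%C /\
    forall sg del tau, (sg = 1 \/ sg = -1) -> 0 < del < R1 / 2 -> 0 <= tau <= 1 ->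
      Re (F (sg * (tau * xi * del), sg * del)) <= Re (F (0, sg * del)).
Proof.
  intros HR HF HF0 HF1 Hk Hax. set (kap := C_derive (C_derive F) 0) in *.
  assert (H0R : Cmod 0 < R) by (rewrite Cmod_0; exact HR).
  assert (HFd := hol_deriv R F HR HF).
  set (a := Re kap). set (b := Im kap). assert (Ekap : kap = (a, b)) by (unfold a, b; destruct kap; reflexivity).
  (* Re F = - t^2 Re Q on the imaginary axis, so Re kap < 0 is impossible *)
  set (Q := divz (divz F)).
  assert (HQ : hol_on R Q) by (apply hol_divz; [exact HR|now apply hol_divz]).
  assert (EQ : forall z, F z = (z * z * Q z)%C).
  { intros z. rewrite (divz_eq F z), HF0, (divz_eq (divz F) z), divz_0, HF1. unfold Q. ring. }
  assert (EQ0 : (2 * Q 0 = kap)%C) by (unfold Q; rewrite divz_0; now apply (divz_derive R)).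
  assert (Ha : 0 <= a).
  { destruct (Rle_or_lt 0 a) as [L|L]; [exact L|exfalso].
    destruct (hol_cont _ _ (HQ 0%C H0R) (- a / 4)) as (d & Hd & HdQ); [lra|].
    set (t := Rmin d R / 2). assert (Hm : 0 < Rmin d R) by now apply Rmin_glb_lt.
    assert (Ht : 0 < t < R) by (unfold t; generalize (Rmin_r d R); lra).
    assert (Htd : t < d) by (unfold t; generalize (Rmin_l d R); lra).
    assert (H1 := Hax t ltac:(rewrite Rabs_pos_eq; lra)). rewrite EQ in H1.
    specialize (HdQ (0, t)).
    assert (Hc : Cmod ((0, t) - 0) < d).
    { replace ((0, t) - 0)%C with ((0, t) : C) by (unfold Cminus, Copp, Cplus, RtoC; simpl; f_equal; ring).
      eapply Rle_lt_trans; [apply Cmod_le_abs|]. unfold Re, Im; simpl. rewrite Rabs_R0, Rabs_pos_eq; lra. }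
    specialize (HdQ Hc).
    assert (H3 : 2 * Re (Q 0) = a) by (unfold a; rewrite <- EQ0; destruct (Q 0%C); unfold Re, RtoC, Cmult; simpl; ring).
    replace (Re ((0, t) * (0, t) * Q (0, t))%C) with (- (t * t) * Re (Q (0, t))) in H1
      by (destruct (Q (0, t)); unfold Re, Cmult; simpl; ring).
    assert (0 < t * t) by nra.
    assert (H4 : Re (Q (0, t)) > 0) by nra.
    assert (H5 : Re (Q (0, t)) - Re (Q 0) <= - a / 4).
    { assert (HQ1 := Re_le_Cmod (Q (0, t) - Q 0)). replace (Re (Q (0, t) - Q 0)) with (Re (Q (0, t)) - Re (Q 0)) in HQ1 by (destruct (Q (0, t)), (Q 0%C); reflexivity).
      apply Rabs_le_between in HQ1. lra. }
    lra. }
  destruct (Req_dec b 0) as [Hb|Hb].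
  (* kap is real and positive, and the imaginary axis itself will do *)
  - exists 0, R. split; [lra|]. split; [rewrite Rabs_R0; lra|]. split.
    + rewrite Ekap, Hb. assert (a <> 0) by (intros E0; apply Hk; rewrite Ekap, Hb, E0; reflexivity).
      replace (Re (- ((a, 0) / 2) * ((0, 1) * (0, 1))))%C with (a / 2); [lra|].
      unfold Re, Cdiv, Cinv, Copp, RtoC, Cmult; simpl. field.
    + intros sg del tau _ _ _. right. do 2 f_equal. f_equal. ring.
  - assert (Hb0 : 0 < Rabs b) by now apply Rabs_pos_lt.
    (* a tilt so small that xi Re kap is outweighed by Im kap along the horizontal lines *)
    set (x0 := Rmin (1 / 2) (Rabs b / (2 * (a + 1)))).
    assert (Hx0 : 0 < x0) by (apply Rmin_glb_lt; [lra|apply Rdiv_lt_0_compat; lra]).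
    assert (Hx1 : x0 <= 1 / 2) by apply Rmin_l.
    assert (Hx2 : x0 * a <= Rabs b / 2).
    { apply Rle_trans with (Rabs b / (2 * (a + 1)) * (a + 1)).
      - apply Rmult_le_compat; try lra. apply Rmin_r.
      - right. field. lra. }
    assert (Hxi : exists xi, Rabs xi = x0 /\ xi * b = x0 * Rabs b).
    { destruct (Rle_or_lt 0 b) as [L|L].
      - exists x0. rewrite !Rabs_pos_eq; lra.
      - exists (- x0). rewrite Rabs_Ropp, Rabs_pos_eq, Rabs_left; lra. }
    destruct Hxi as (xi & Exi & Exib).
    (* along a horizontal line the derivative of Re F is controlled by Im kap *)
    set (P := divz (C_derive F)).
    assert (HP : hol_on R P) by now apply hol_divz.
    assert (EP : forall z, C_derive F z = (z * P z)%C).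
    { intros z. rewrite (divz_eq (C_derive F) z), HF1. unfold P. ring. }
    assert (EP0 : P 0%C = kap) by (unfold P; now rewrite divz_0).
    destruct (hol_cont _ _ (HP 0%C H0R) (Rabs b / 4)) as (d & Hd & HdP); [lra|].
    exists xi, (Rmin d R). split; [split; [now apply Rmin_glb_lt|apply Rmin_r]|].
    split; [lra|]. split.
    + rewrite Ekap.
      replace (Re (- ((a, b) / 2) * ((xi, 1) * (xi, 1))))%C with (a * (1 - xi * xi) / 2 + xi * b).
      2:{ unfold Re, Cdiv, Cinv, Copp, RtoC, Cmult; simpl. field. }
      assert (xi * xi <= 1 / 4).
      { replace (xi * xi) with (Rabs xi * Rabs xi) by (rewrite <- Rabs_mult; apply Rabs_pos_eq; nra). rewrite Exi. nra. }
      assert (0 <= a * (1 - xi * xi)) by (apply Rmult_le_pos; lra).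
      assert (0 < x0 * Rabs b) by (apply Rmult_lt_0_compat; lra). lra.
    + intros sg del tau Hsg Hdel Htau.
      assert (Hsg2 : sg * sg = 1) by (destruct Hsg as [-> | ->]; ring).
      assert (Hdm : del < d / 2 /\ del < R / 2) by (generalize (Rmin_l d R) (Rmin_r d R); lra).
      assert (Hpt : forall t, 0 <= t <= 1 -> Cmod (sg * (t * xi * del), sg * del) < 2 * del).
      { intros t Ht. eapply Rle_lt_trans; [apply Cmod_le_abs|]. unfold Re, Im; simpl.
        assert (Hs1 : Rabs sg = 1) by (destruct Hsg as [-> | ->]; [apply Rabs_R1|rewrite Rabs_left; lra]).
        rewrite !Rabs_mult, Hs1, Exi, (Rabs_pos_eq t), (Rabs_pos_eq del) by lra.
        assert (t * x0 * del <= 1 * (1 / 2) * del) by (apply Rmult_le_compat_r; [lra|apply Rmult_le_compat; lra]). lra. }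
      assert (Hline : forall t, ((sg * (t * xi * del), sg * del)%R : C) = ((0, sg * del)%R + RtoC t * RtoC (sg * xi * del))%C).
      { intros t. unfold RtoC, Cmult, Cplus; simpl. f_equal; ring. }
      assert (Hder : forall t, 0 <= t <= 1 -> is_derive (fun t => Re (F (sg * (t * xi * del), sg * del))) t
         (Re (C_derive F (sg * (t * xi * del), sg * del)%R * RtoC (sg * xi * del))%C)).
      { intros t Ht. apply (rderiv_Re (fun t => F (sg * (t * xi * del), sg * del))).
        apply (rderiv_ext (fun t => F ((0, sg * del)%R + RtoC t * RtoC (sg * xi * del))%C)); [intros s; now rewrite <- Hline|].
        apply (rderiv_comp (fun t => (0, sg * del)%R + RtoC t * RtoC (sg * xi * del))%C F); [apply rderiv_line|].
        rewrite <- Hline. apply (hol_on_cderiv R); [exact HF|]. specialize (Hpt t Ht). lra. }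
      destruct (MVT_gen (fun t => Re (F (sg * (t * xi * del), sg * del))) 0 tau
         (fun t => Re (C_derive F (sg * (t * xi * del), sg * del)%R * RtoC (sg * xi * del))%C)) as (t & Ht & E).
      * intros t. rewrite Rmin_left, Rmax_right by lra. intros Ht. apply Hder. lra.
      * intros t. rewrite Rmin_left, Rmax_right by lra. intros Ht.
        apply derivable_continuous_pt. eexists. apply is_derive_Reals, Hder. lra.
      * rewrite Rmin_left, Rmax_right in Ht by lra.
        replace (sg * (0 * xi * del)) with 0 in E by ring.
        cut (Re (C_derive F (sg * (t * xi * del), sg * del)%R * RtoC (sg * xi * del))%C * (tau - 0) <= 0); [lra|].
        cut (Re (C_derive F (sg * (t * xi * del), sg * del)%R * RtoC (sg * xi * del))%C <= 0); [intros; nra|].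
        rewrite EP. specialize (Hpt t ltac:(lra)).
        set (z := ((sg * (t * xi * del), sg * del)%R : C)) in *.
        specialize (HdP z). replace (z - 0)%C with z in HdP by ring. specialize (HdP ltac:(lra)).
        rewrite EP0, Ekap in HdP.
        set (p1 := Re (P z)). set (p2 := Im (P z)).
        assert (HP1 : Rabs (p1 - a) <= Rabs b / 4).
        { eapply Rle_trans; [|apply Rlt_le, HdP]. replace (p1 - a) with (Re (P z - (a, b))) by (unfold p1; destruct (P z); reflexivity). apply Re_le_Cmod. }
        assert (HP2 : Rabs (p2 - b) <= Rabs b / 4).
        { eapply Rle_trans; [|apply Rlt_le, HdP]. replace (p2 - b) with (Im (P z - (a, b))) by (unfold p2; destruct (P z); reflexivity). apply Im_le_Cmod. }
        replace (Re (z * P z * RtoC (sg * xi * del))%C) with (sg * sg * (del * del) * (xi * (t * xi * p1 - p2))).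
        2:{ unfold p1, p2. unfold z at 3. destruct (P z). unfold Re, Im, RtoC, Cmult; simpl. ring. }
        rewrite Hsg2.
        assert (Hxx : xi * xi = x0 * x0) by (rewrite <- Exi, <- Rabs_mult, Rabs_pos_eq; nra).
        assert (HM1 : xi * (t * xi * p1 - p2) <= 0).
        { replace (xi * (t * xi * p1 - p2)) with (t * (xi * xi) * a + t * (xi * xi) * (p1 - a) - xi * b - xi * (p2 - b)) by ring.
          rewrite Hxx, Exib.
          assert (B1 : t * (x0 * x0) * a <= x0 * (Rabs b / 2)).
          { replace (t * (x0 * x0) * a) with (t * (x0 * (x0 * a))) by ring.
            assert (0 <= x0 * (x0 * a)) by (apply Rmult_le_pos; [lra|apply Rmult_le_pos; lra]).
            apply Rle_trans with (1 * (x0 * (x0 * a))); [apply Rmult_le_compat_r; lra|]. rewrite Rmult_1_l. apply Rmult_le_compat_l; lra. }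
          assert (B2 : t * (x0 * x0) * (p1 - a) <= x0 * (Rabs b / 8)).
          { apply Rle_trans with (t * (x0 * x0) * (Rabs b / 4)).
            - apply Rmult_le_compat_l; [apply Rmult_le_pos; nra|]. eapply Rle_trans; [apply Rle_abs|exact HP1].
            - replace (t * (x0 * x0) * (Rabs b / 4)) with (x0 * ((t * x0) * (Rabs b / 4))) by ring.
              apply Rmult_le_compat_l; [lra|]. assert (t * x0 <= 1 * (1 / 2)) by (apply Rmult_le_compat; lra).
              assert (t * x0 * (Rabs b / 4) <= 1 * (1 / 2) * (Rabs b / 4)) by (apply Rmult_le_compat_r; lra). lra. }
          assert (B3 : - (xi * (p2 - b)) <= x0 * (Rabs b / 4)).
          { apply Rle_trans with (Rabs (xi * (p2 - b))); [rewrite <- Rabs_Ropp; apply Rle_abs|].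
            rewrite Rabs_mult, Exi. apply Rmult_le_compat_l; lra. }
          assert (0 < x0 * Rabs b) by (apply Rmult_lt_0_compat; lra). lra. }
        assert (0 <= del * del) by nra. nra.
Qed.

(** * The pole on a critical point *)

Lemma choose_fun {A B : Type} (P : A -> B -> Prop) : (forall k, exists x, P k x) -> exists f, forall k, P k (f k).
Proof.
  intros H. exists (fun k => proj1_sig (constructive_indefinite_description _ (H k))).
  intros k. exact (proj2_sig (constructive_indefinite_description _ (H k))).
Qed.

Lemma cderiv_Csum (f f' : nat -> C -> C) z n : (forall k, cderiv (f k) z (f' k z)) ->
  cderiv (fun y => Csum (fun k => f k y) n) z (Csum (fun k => f' k z) n).
Proof.
  intros H. induction n as [|n IH]; simpl; [apply cderiv_const|]. now apply cderiv_plus.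
Qed.

Lemma Csum_small (x : nat -> nat -> C) N n : (forall k, exists M, 0 <= M /\ forall s, (1 <= s)%nat -> Cmod (x k s) <= M * rsqrt s ^ N) ->
  exists M, 0 <= M /\ forall s, (1 <= s)%nat -> Cmod (Csum (fun k => x k s) n) <= M * rsqrt s ^ N.
Proof.
  intros H. induction n as [|n (M & HM & IH)].
  - exists 0. split; [lra|]. intros s _. simpl. rewrite Cmod_0. lra.
  - destruct (H n) as (M' & HM' & H'). exists (M + M'). split; [lra|]. intros s Hs. simpl.
    eapply Rle_trans; [apply Cmod_triangle|]. specialize (IH s Hs). specialize (H' s Hs). lra.
Qed.

(** The entire function (e^(-w) - 1) / (2 w). For w = s u^2 its primitive accounts for the
    logarithmic part of the pole: the derivative in z of psi(s u^2) is (e^(-s u^2) - 1) u'/u. *)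
Definition pole_kernel (w : C) : C := (/ 2 * divz (fun w => Cexp (- w)) w)%C.

Lemma Cexp_opp_hol w : hol_at (fun w => Cexp (- w)) w.
Proof. apply (hol_comp (fun w => - w)%C Cexp); [apply hol_opp, hol_id|apply hol_Cexp]. Qed.

Lemma pole_kernel_hol w : hol_at pole_kernel w.
Proof.
  unfold pole_kernel. apply hol_mult; [apply hol_const|].
  assert (Hw := Cmod_ge_0 w).
  apply (hol_divz (Cmod w + 1) (fun w => Cexp (- w))); [lra| |lra]. intros z _. apply Cexp_opp_hol.
Qed.

Lemma pole_kernel_eq w : (2 * w * pole_kernel w = Cexp (- w) - 1)%C.
Proof.
  assert (H := divz_eq (fun w => Cexp (- w)) w). cbv beta in H.
  replace (- 0)%C with (RtoC 0) in H by ring. rewrite Cexp_0 in H. rewrite H. unfold pole_kernel. field.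
Qed.

(** Repeated division: the values at 0 are the Taylor coefficients of g in powers of the coordinate
    u = z q(z), and [taylor_quotient_expand] is the expansion with remainder. *)
Fixpoint taylor_quotient (q g : C -> C) (k : nat) : C -> C :=
  match k with O => g | S k => fun z => (divz (taylor_quotient q g k) z / q z)%C end.

Lemma taylor_quotient_hol R q g k : 0 < R -> hol_on R q -> (forall z, Cmod z < R -> q z <> 0%C) -> hol_on R g -> hol_on R (taylor_quotient q g k).
Proof.
  intros HR Hq Hq0 Hg. induction k as [|k IH]; [exact Hg|]. intros z Hz. simpl.
  apply hol_div; [now apply (hol_divz R)|now apply Hq|now apply Hq0].
Qed.

Lemma taylor_quotient_expand (q g : C -> C) n z : q z <> 0%C ->
  g z = (Csum (fun k => taylor_quotient q g k 0 * (z * q z) ^ k) n + (z * q z) ^ n * taylor_quotient q g n z)%C.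
Proof.
  intros Hq. induction n as [|n IH]; [simpl; ring|]. rewrite IH at 1. simpl Csum.
  assert (E : taylor_quotient q g n z = (taylor_quotient q g n 0 + z * q z * taylor_quotient q g (S n) z)%C).
  { rewrite (divz_eq (taylor_quotient q g n) z) at 1. simpl. field. exact Hq. }
  rewrite E, Cpow_S. ring.
Qed.

(** Here e^(s f - r z) is e^(-s u^2) with u = z q0 e^L, and K is a primitive of the integrand from
    which the pole at 0 has been removed; its increment along a line through 0 on which Re (u^2) is
    positive is expanded in powers of s^(-1/2). As u'/u = 1/z + L', the integrand is h(0) (e^(-s
    u^2) - 1) u'/u + h(0) L' + Phi e^(-s u^2) with Phi regular. The first two terms integrate to the
    increment of psi(w) + (log w)/2 between the two end values of w = s u^2, where psi is a
    primitive of (e^(-w) - 1)/(2 w); the derivative e^(-w)/(2 w) of that function is exponentially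
    small on a path joining these values. Finally Phi = g u', where g is expanded in powers of u and
    integrated against the Gaussian. *)
Lemma pole_gauss_expansion R (L h : C -> C) (q0 om : C) lam e2 t0 :
  0 < R -> hol_on R L -> hol_on R h -> q0 <> 0%C -> 0 < lam -> Cmod om <= 2 ->
  (forall w, Cmod w <= e2 -> lam <= Re (om * om * (q0 * q0) * Cexp (2 * w))%C) ->
  (forall z, Cmod z < R -> Cmod (L z) <= e2) ->
  (forall z, Cmod z < R -> (1 + z * C_derive L z <> 0)%C) -> 0 < t0 -> 2 * t0 < R ->
  exists beta : nat -> C, forall N, exists M, 0 <= M /\ forall s, (1 <= s)%nat ->
    exists K, (forall z, Cmod z < R -> z <> 0%C ->
       cderiv K z ((h z * Cexp (- (RtoC (INR s) * ((z * (q0 * Cexp (L z))) * (z * (q0 * Cexp (L z)))))) - h 0) / z)) /\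
     Cmod (K (RtoC t0 * om)%C - K (- (RtoC t0 * om))%C - Csum (fun k => beta k * RtoC (rsqrt s ^ S k))%C N) <= M * rsqrt s ^ N.
Proof.
  intros HR HL Hh Hq0 Hlam Hom Hw HLe HL1 Ht0 Ht0R.
  assert (HLd := hol_deriv R L HR HL).
  set (q := fun z => (q0 * Cexp (L z))%C). set (u := fun z => (z * q z)%C).
  set (u' := fun z => (q z * (1 + z * C_derive L z))%C).
  assert (Hqn : forall z, q z <> 0%C) by (intros z; apply Cmult_neq_0; [exact Hq0|apply Cexp_neq_0]).
  assert (Hqh : hol_on R q).
  { intros z Hz. apply hol_mult; [apply hol_const|]. apply (hol_comp L Cexp); [now apply HL|apply hol_Cexp]. }
  assert (Hud : forall z, Cmod z < R -> cderiv u z (u' z)).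
  { intros z Hz. eapply cderiv_eq.
    - apply cderiv_mult; [apply cderiv_id|]. apply cderiv_mult; [apply cderiv_const|].
      apply (cderiv_comp L Cexp); [now apply (hol_on_cderiv R)|apply cderiv_Cexp].
    - unfold u', q. ring. }
  assert (Huh : hol_on R u').
  { intros z Hz. apply hol_mult; [now apply Hqh|]. apply hol_plus; [apply hol_const|]. apply hol_mult; [apply hol_id|now apply HLd]. }
  assert (Hu'n : forall z, Cmod z < R -> u' z <> 0%C) by (intros z Hz; apply Cmult_neq_0; [apply Hqn|now apply HL1]).
  (* what is left of h/z after subtracting h(0) u'/u *)
  set (Phi := fun z => (divz h z - h 0 * C_derive L z)%C).
  assert (HPhi : hol_on R Phi).
  { intros z Hz. apply hol_minus; [now apply (hol_divz R)|]. apply hol_mult; [apply hol_const|now apply HLd]. }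
  set (g := fun z => (Phi z / u' z)%C).
  assert (Hg : hol_on R g) by (intros z Hz; apply hol_div; auto).
  assert (Hgk : forall k, hol_on R (taylor_quotient q g k)) by (intros k; apply taylor_quotient_hol; auto).
  (* primitives of the Gaussian moments and of the logarithmic part, with their limits at both ends
     *)
  destruct (choose_fun _ (fun k => hol_prim_entire (gauss_kernel k) (gauss_kernel_hol k))) as (G & HG).
  destruct (hol_prim_entire pole_kernel pole_kernel_hol) as (psi & Hpsi).
  set (b := (RtoC t0 * om)%C). set (Up := u b). set (Um := u (- b)%C).
  assert (Hu2 : forall x, Cmod (RtoC x * om) < R -> (u (RtoC x * om) * u (RtoC x * om) = RtoC (x * x) * (om * om * (q0 * q0) * Cexp (2 * L (RtoC x * om))))%C).
  { intros x Hx. unfold u, q. replace (2 * L (RtoC x * om))%C with (L (RtoC x * om) + L (RtoC x * om))%C by ring.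
    rewrite Cexp_plus, RtoC_mult. ring. }
  assert (Hin : forall x, Rabs x <= t0 -> Cmod (RtoC x * om) <= 2 * t0).
  { intros x Hx. rewrite Cmod_mult, Cmod_R. assert (0 <= Rabs x) by apply Rabs_pos. assert (0 <= Cmod om) by apply Cmod_ge_0. nra. }
  assert (Hreu : forall x, Rabs x <= t0 -> lam * x ^ 2 <= Re (u (RtoC x * om) * u (RtoC x * om))%C).
  { intros x Hx. assert (Hi := Hin x Hx). rewrite Hu2 by lra. rewrite Re_scal.
    replace (lam * x ^ 2) with (x * x * lam) by ring. apply Rmult_le_compat_l; [nra|]. apply Hw, HLe. lra. }
  assert (Emb : (- b = RtoC (- t0) * om)%C) by (unfold b; rewrite RtoC_opp; ring).
  assert (Hp0 : 0 < lam * t0 ^ 2) by (apply Rmult_lt_0_compat; [lra|apply pow_lt; lra]).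
  assert (HUp : 0 < Re (Up * Up)%C).
  { unfold Up, b. eapply Rlt_le_trans; [exact Hp0|apply Hreu]. rewrite Rabs_pos_eq; lra. }
  assert (HUm : 0 < Re (Um * Um)%C).
  { unfold Um. rewrite Emb. eapply Rlt_le_trans; [exact Hp0|]. replace (t0 ^ 2) with ((- t0) ^ 2) by ring. apply Hreu. rewrite Rabs_Ropp, Rabs_pos_eq; lra. }
  destruct (choose_fun _ (fun k => moment_limit k (G k) Up (HG k) HUp)) as (MP & HMP).
  destruct (choose_fun _ (fun k => moment_limit k (G k) Um (HG k) HUm)) as (MM & HMM).
  exists (fun k => taylor_quotient q g k 0 * (MP k - MM k))%C. intros N.
  (* finite ends instead of infinite ones: exponentially small *)
  set (dG := fun (k s : nat) => (G k (RtoC (sqrt (INR s)) * Up) - G k (RtoC (sqrt (INR s)) * Um))%C).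
  destruct (Csum_small (fun k s => taylor_quotient q g k 0 * RtoC (rsqrt s ^ S k) * (dG k s - (MP k - MM k)))%C N N) as (M1 & HM1 & H1).
  { intros k. destruct (HMP k) as (C1 & q1 & HC1 & Hq1 & HE1). destruct (HMM k) as (C2 & q2 & HC2 & Hq2 & HE2).
    destruct (geom_small q1 N Hq1) as (K1 & HK1 & HS1). destruct (geom_small q2 N Hq2) as (K2 & HK2 & HS2).
    exists (Cmod (taylor_quotient q g k 0) * (C1 * K1 + C2 * K2)). assert (H0 := Cmod_ge_0 (taylor_quotient q g k 0)).
    assert (0 <= C1 * K1) by now apply Rmult_le_pos. assert (0 <= C2 * K2) by now apply Rmult_le_pos.
    split; [apply Rmult_le_pos; lra|]. intros s Hs. destruct (rsqrt_bounds s Hs) as (Hrs & _).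
    rewrite !Cmod_mult, Cmod_R, Rabs_pos_eq by (apply pow_le; lra).
    assert (Hr1 : rsqrt s ^ S k <= 1) by (rewrite <- (pow1 (S k)); apply pow_incr; lra).
    assert (Hr0 : 0 <= rsqrt s ^ S k) by (apply pow_le; lra).
    assert (Hd : Cmod (dG k s - (MP k - MM k)) <= (C1 * K1 + C2 * K2) * rsqrt s ^ N).
    { unfold dG. replace (G k (sqrt (INR s) * Up) - G k (sqrt (INR s) * Um) - (MP k - MM k))%C
        with ((G k (sqrt (INR s) * Up) - MP k) - (G k (sqrt (INR s) * Um) - MM k))%C by ring.
      eapply Rle_trans; [apply Cmod_minus_le|]. specialize (HE1 s). specialize (HE2 s). specialize (HS1 s Hs). specialize (HS2 s Hs).
      assert (C1 * q1 ^ s <= C1 * (K1 * rsqrt s ^ N)) by (apply Rmult_le_compat_l; auto).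
      assert (C2 * q2 ^ s <= C2 * (K2 * rsqrt s ^ N)) by (apply Rmult_le_compat_l; auto). lra. }
    rewrite (Rmult_assoc (Cmod (taylor_quotient q g k 0)) (C1 * K1 + C2 * K2)).
    rewrite (Rmult_assoc (Cmod (taylor_quotient q g k 0))). apply Rmult_le_compat_l; [exact H0|].
    apply Rle_trans with (1 * Cmod (dG k s - (MP k - MM k))); [apply Rmult_le_compat_r; [apply Cmod_ge_0|exact Hr1]|lra]. }
  (* the remainder of order u^N under the Gaussian *)
  destruct (hol_on_bounded R (fun z => u' z * taylor_quotient q g N z)%C (2 * t0)) as (B1 & HB1 & Hb1).
  { intros z Hz. apply hol_mult; [now apply Huh|now apply Hgk]. } { exact Ht0R. }
  destruct (hol_on_bounded R q (2 * t0) Hqh Ht0R) as (Bq & HBq & Hbq).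
  destruct (gauss_pow lam N Hlam) as (Mg & HMg & Hgp).
  set (M2 := B1 * (2 * Bq) ^ N * Mg * (4 * t0)).
  assert (HM2 : 0 <= M2).
  { unfold M2. assert (0 <= (2 * Bq) ^ N) by (apply pow_le; lra).
    apply Rmult_le_pos; [|lra]. apply Rmult_le_pos; [|exact HMg]. apply Rmult_le_pos; lra. }
  set (ell := (L b - L (- b))%C).
  destruct (exp_small (lam * t0 ^ 2) N Hp0) as (M3 & HM3 & H3).
  exists (M1 + M2 + Cmod (h 0) * (Cmod ell * M3)).
  assert (Hh0 := Cmod_ge_0 (h 0%C)). assert (Hell := Cmod_ge_0 ell).
  assert (HM3' : 0 <= Cmod (h 0) * (Cmod ell * M3)) by (apply Rmult_le_pos; [exact Hh0|now apply Rmult_le_pos]).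
  split; [lra|]. intros s Hs.
  destruct (rsqrt_bounds s Hs) as (Hrs & _ & Hrs1).
  assert (Hs0 := pos_INR s). assert (Hss : sqrt (INR s) * sqrt (INR s) = INR s) by now apply sqrt_sqrt.
  set (S0 := RtoC (INR s)). set (E := fun z => Cexp (- (S0 * (u z * u z)))).
  assert (HE : hol_on R E).
  { intros z Hz. apply (hol_comp (fun z => - (S0 * (u z * u z)))%C Cexp); [|apply hol_Cexp].
    assert (hol_at u z) by (apply hol_mult; [apply hol_id|now apply Hqh]).
    apply hol_opp, hol_mult; [apply hol_const|]. now apply hol_mult. }
  destruct (hol_prim R (fun z => Phi z * E z)%C HR) as (A & HA).
  { intros z Hz. apply hol_mult; [now apply HPhi|now apply HE]. }
  exists (fun z => A z + h 0 * (psi (S0 * (u z * u z)) + L z))%C. split.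
  { intros z Hz Hz0. eapply cderiv_eq.
    - apply cderiv_plus; [now apply HA|]. apply cderiv_mult; [apply cderiv_const|].
      apply cderiv_plus; [|now apply (hol_on_cderiv R)].
      apply (cderiv_comp (fun z => S0 * (u z * u z))%C psi); [|apply Hpsi].
      apply cderiv_mult; [apply cderiv_const|]. apply cderiv_mult; now apply Hud.
    - cbv beta. change (q0 * Cexp (L z))%C with (q z). change (z * q z)%C with (u z). fold S0.
      change (Cexp (- (S0 * (u z * u z)))) with (E z).
      assert (EE := pole_kernel_eq (S0 * (u z * u z))%C). change (Cexp (- (S0 * (u z * u z)))) with (E z) in EE.
      replace (pole_kernel (S0 * (u z * u z)) * (S0 * (u z * u' z + u z * u' z) + u z * u z * 0))%C
        with ((2 * (S0 * (u z * u z)) * pole_kernel (S0 * (u z * u z))) * ((1 + z * C_derive L z) / z))%C.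
      2:{ unfold u, u'. field. exact Hz0. }
      rewrite EE. unfold Phi, divz. destruct (Ceq_dec z 0) as [E0|_]; [contradiction|]. field. exact Hz0. }
  cbv beta. fold b. fold Up. fold Um.
  (* psi(w) + l t has derivative l e^(-w) along w = S0 Um^2 e^(2 l t), which joins S0 Um^2 to S0
     Up^2 and keeps its real part of the order of s *)
  assert (HY : Cmod (psi (S0 * (Up * Up)) - psi (S0 * (Um * Um)) + ell)%C <= Cmod ell * M3 * rsqrt s ^ N).
  { set (w := fun z : C => (S0 * (Um * Um) * Cexp (z * (2 * ell)))%C).
    assert (EUp : (S0 * (Up * Up) = w 1)%C).
    { unfold w, Up, Um. rewrite Emb. unfold b. rewrite !Hu2.
      - replace (1 * (2 * ell))%C with (2 * L (t0 * om) + - (2 * L ((- t0)%R * om)))%C by (unfold ell; rewrite Emb; unfold b; ring).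
        rewrite Cexp_plus. assert (E1 := Cexp_opp (2 * L (RtoC (- t0) * om))%C).
        replace (- t0 * - t0) with (t0 * t0) by ring.
        match goal with |- ?lhs = ?rhs => replace rhs with (lhs * (Cexp (2 * L (RtoC (- t0) * om)) * Cexp (- (2 * L (RtoC (- t0) * om)))))%C by ring end.
        rewrite E1. ring.
      - assert (Hi := Hin (- t0)). rewrite Rabs_Ropp, Rabs_pos_eq in Hi by lra. specialize (Hi ltac:(lra)). lra.
      - assert (Hi := Hin t0). rewrite Rabs_pos_eq in Hi by lra. specialize (Hi ltac:(lra)). lra. }
    assert (HM := MVT_C (fun t => psi (w (RtoC t)) + RtoC t * ell)%C (fun t => ell * Cexp (- w (RtoC t)))%C 0 1 (Cmod ell * exp (- (lam * t0 ^ 2) * INR s)) ltac:(lra)).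
    cbv beta in HM. rewrite EUp.
    replace (psi (w 1) - psi (S0 * (Um * Um)) + ell)%C with (psi (w 1) + 1 * ell - (psi (w 0) + 0 * ell))%C.
    2:{ replace (w 0%C) with (S0 * (Um * Um))%C; [ring|]. unfold w. rewrite Cmult_0_l, Cexp_0. ring. }
    eapply Rle_trans; [apply HM|].
    - intros t Ht. apply (rderiv_cderiv (fun z => psi (w z) + z * ell)%C). eapply cderiv_eq.
      + apply cderiv_plus; [|apply cderiv_mult; [apply cderiv_id|apply cderiv_const]].
        apply (cderiv_comp w psi); [|apply Hpsi]. unfold w. apply cderiv_mult; [apply cderiv_const|].
        apply (cderiv_comp (fun z => z * (2 * ell))%C Cexp); [apply cderiv_mult; [apply cderiv_id|apply cderiv_const]|apply cderiv_Cexp].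
      + cbv beta. fold (w (RtoC t)). assert (EE := pole_kernel_eq (w (RtoC t))).
        replace (Cexp (- w (RtoC t))) with (1 + (Cexp (- w (RtoC t)) - 1))%C by ring. rewrite <- EE. generalize (pole_kernel (w (RtoC t))). intros ek. unfold w. ring.
    - intros t Ht. rewrite Cmod_mult, Cmod_Cexp, Re_opp. apply Rmult_le_compat_l; [exact Hell|]. apply exp_le.
      unfold w, S0, Um. rewrite Emb. rewrite Hu2.
      2:{ assert (Hi := Hin (- t0)). rewrite Rabs_Ropp, Rabs_pos_eq in Hi by lra. specialize (Hi ltac:(lra)). lra. }
      replace (RtoC (INR s) * (RtoC (- t0 * - t0) * (om * om * (q0 * q0) * Cexp (2 * L (RtoC (- t0) * om)))) * Cexp (RtoC t * (2 * ell)))%C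
        with (RtoC (INR s * (t0 * t0)) * (om * om * (q0 * q0) * Cexp (2 * (RtoC (1 - t) * L (RtoC (- t0) * om) + RtoC t * L b))))%C.
      + rewrite Re_scal.
        assert (Hl := Hw (RtoC (1 - t) * L (RtoC (- t0) * om) + RtoC t * L b)%C).
        assert (HLb : Cmod (L b) <= e2).
        { apply HLe. unfold b. assert (Hi := Hin t0). rewrite (Rabs_pos_eq t0) in Hi by lra. specialize (Hi ltac:(lra)). lra. }
        assert (HLm : Cmod (L (RtoC (- t0) * om)%C) <= e2).
        { apply HLe. assert (Hi := Hin (- t0)). rewrite Rabs_Ropp, (Rabs_pos_eq t0) in Hi by lra. specialize (Hi ltac:(lra)). lra. }
        assert (Hc : Cmod (RtoC (1 - t) * L (RtoC (- t0) * om) + RtoC t * L b)%C <= e2).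
        { eapply Rle_trans; [apply Cmod_triangle|]. rewrite !Cmod_mult, !Cmod_R, !Rabs_pos_eq by lra.
          assert ((1 - t) * Cmod (L (RtoC (- t0) * om)%C) <= (1 - t) * e2) by (apply Rmult_le_compat_l; lra).
          assert (t * Cmod (L b) <= t * e2) by (apply Rmult_le_compat_l; lra). lra. }
        specialize (Hl Hc).
        assert (H0 : 0 <= INR s * (t0 * t0)) by (apply Rmult_le_pos; nra).
        assert (INR s * (t0 * t0) * lam <= INR s * (t0 * t0) * Re (om * om * (q0 * q0) * Cexp (2 * (RtoC (1 - t) * L (RtoC (- t0) * om) + RtoC t * L b)))%C) by (apply Rmult_le_compat_l; lra).
        lra.
      + replace (2 * (RtoC (1 - t) * L (RtoC (- t0) * om) + RtoC t * L b))%C with (2 * L (RtoC (- t0) * om) + RtoC t * (2 * ell))%C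
          by (unfold ell; rewrite Emb, RtoC_minus; ring).
        rewrite Cexp_plus. rewrite !RtoC_mult, RtoC_opp. ring.
    - specialize (H3 s Hs). rewrite Rminus_0_r, Rmult_1_r, (Rmult_assoc (Cmod ell)). apply Rmult_le_compat_l; assumption. }
  (* A minus the N first moments is a primitive of the remainder *)
  set (B := fun z => (A z + (-1) * Csum (fun k => taylor_quotient q g k 0 * RtoC (rsqrt s ^ S k) * G k (RtoC (sqrt (INR s)) * u z)) N)%C).
  assert (HBd : forall z, Cmod z < R -> cderiv B z (u' z * taylor_quotient q g N z * u z ^ N * E z)%C).
  { intros z Hz. eapply cderiv_eq.
    - apply cderiv_plus; [now apply HA|]. apply cderiv_mult; [apply cderiv_const|].
      apply (cderiv_Csum (fun k y => taylor_quotient q g k 0 * RtoC (rsqrt s ^ S k) * G k (RtoC (sqrt (INR s)) * u y))%C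
        (fun k y => taylor_quotient q g k 0 * u y ^ k * E y * u' y)%C).
      intros k. eapply cderiv_eq.
      + apply cderiv_mult; [apply cderiv_const|].
        apply (cderiv_comp (fun y => RtoC (sqrt (INR s)) * u y)%C (G k)); [|apply HG].
        apply cderiv_mult; [apply cderiv_const|now apply Hud].
      + cbv beta. unfold gauss_kernel, E, S0. rewrite Cpow_mult_l.
        replace (RtoC (sqrt (INR s)) * u z * (RtoC (sqrt (INR s)) * u z))%C with (RtoC (INR s) * (u z * u z))%C
          by (rewrite <- Hss at 1; rewrite RtoC_mult; ring).
        assert (E1 : (RtoC (rsqrt s ^ S k) * (RtoC (sqrt (INR s)) ^ k * RtoC (sqrt (INR s))) = 1)%C).
        { rewrite <- RtoC_pow, <- !RtoC_mult. f_equal. rewrite (Rmult_comm (sqrt (INR s) ^ k)).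
          change (sqrt (INR s) * sqrt (INR s) ^ k) with (sqrt (INR s) ^ S k). rewrite <- Rpow_mult_distr, (Rmult_comm (rsqrt s)), Hrs1. apply pow1. }
        match goal with |- ?lhs = ?rhs => replace rhs with (rhs * (RtoC (rsqrt s ^ S k) * (RtoC (sqrt (INR s)) ^ k * RtoC (sqrt (INR s)))))%C by (rewrite E1; ring) end.
        ring.
    - cbv beta.
      replace (Phi z) with (g z * u' z)%C by (unfold g; field; now apply Hu'n).
      rewrite (taylor_quotient_expand q g N z (Hqn z)). fold (u z).
      replace (Csum (fun k => taylor_quotient q g k 0 * u z ^ k * E z * u' z) N)%C with (Csum (fun k => taylor_quotient q g k 0 * u z ^ k) N * (E z * u' z))%C.
      2:{ rewrite Cmult_comm, <- Csum_scal. apply Csum_ext. intros k _. ring. }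
      ring. }
  assert (HBb : Cmod (B b - B (- b)%C) <= M2 * rsqrt s ^ N).
  { eapply Rle_trans; [apply (MVT_seg B (fun z => u' z * taylor_quotient q g N z * u z ^ N * E z)%C (- b)%C b (B1 * (2 * Bq) ^ N * Mg * rsqrt s ^ N))|].
    - intros t Ht. apply HBd. replace (- b + RtoC t * (b - - b))%C with (RtoC ((2 * t - 1) * t0) * om)%C
        by (unfold b; rewrite RtoC_mult, RtoC_minus, RtoC_mult; ring).
      assert (Hi := Hin ((2 * t - 1) * t0)). assert (Rabs ((2 * t - 1) * t0) <= t0) by (apply Rabs_le; nra). specialize (Hi H). lra.
    - intros t Ht. replace (- b + RtoC t * (b - - b))%C with (RtoC ((2 * t - 1) * t0) * om)%C
        by (unfold b; rewrite RtoC_mult, RtoC_minus, RtoC_mult; ring).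
      set (x := (2 * t - 1) * t0). assert (Hx : Rabs x <= t0) by (apply Rabs_le; unfold x; nra).
      assert (Hi := Hin x Hx). set (z := (RtoC x * om)%C) in *.
      rewrite !(Cmod_mult _ (E z)), (Cmod_mult _ (u z ^ N)%C), Cmod_pow.
      assert (A1 := Hb1 z Hi). cbv beta in A1.
      assert (A2 : Cmod (u z) <= 2 * Bq * Rabs x).
      { unfold u, z at 1. rewrite !Cmod_mult, Cmod_R. assert (Hb := Hbq z Hi). assert (Hx0 := Rabs_pos x). assert (Ho := Cmod_ge_0 om).
        assert (Hq' := Cmod_ge_0 (q z)). assert (Cmod om * Cmod (q z) <= 2 * Bq) by (apply Rmult_le_compat; assumption).
        rewrite Rmult_assoc, (Rmult_comm (2 * Bq)). apply Rmult_le_compat_l; assumption. }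
      assert (A3 : Cmod (E z) <= exp (- (INR s * (lam * x ^ 2)))).
      { unfold E. rewrite Cmod_Cexp, Re_opp. unfold S0. rewrite Re_scal. apply exp_le, Ropp_le_contravar.
        apply Rmult_le_compat_l; [exact Hs0|]. unfold z. now apply Hreu. }
      assert (A4 := Hgp x s Hs). assert (A5 : Cmod (u z) ^ N <= (2 * Bq) ^ N * Rabs x ^ N).
      { rewrite <- Rpow_mult_distr. apply pow_incr. split; [apply Cmod_ge_0|exact A2]. }
      assert (P1 := Cmod_ge_0 (u' z * taylor_quotient q g N z)). assert (P2 : 0 <= Cmod (u z) ^ N) by (apply pow_le, Cmod_ge_0).
      assert (P3 : 0 <= (2 * Bq) ^ N) by (apply pow_le; lra). assert (P4 : 0 <= Rabs x ^ N) by (apply pow_le, Rabs_pos).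
      assert (P5 := exp_pos (- (INR s * (lam * x ^ 2)))). assert (P6 := Cmod_ge_0 (E z)).
      apply Rle_trans with (B1 * ((2 * Bq) ^ N * Rabs x ^ N) * exp (- (INR s * (lam * x ^ 2)))).
      + apply Rmult_le_compat; auto; [now apply Rmult_le_pos|]. apply Rmult_le_compat; auto.
      + replace (B1 * ((2 * Bq) ^ N * Rabs x ^ N) * exp (- (INR s * (lam * x ^ 2))))
          with (B1 * (2 * Bq) ^ N * (Rabs x ^ N * exp (- (INR s * (lam * x ^ 2))))) by ring.
        rewrite (Rmult_assoc (B1 * (2 * Bq) ^ N)). apply Rmult_le_compat_l; [apply Rmult_le_pos; lra|exact A4].
    - assert (Hbm : Cmod (b - - b) <= 4 * t0).
      { replace (b - - b)%C with (RtoC (2 * t0) * om)%C by (unfold b; rewrite RtoC_mult; ring).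
        rewrite Cmod_mult, Cmod_R, Rabs_pos_eq by lra. assert (0 <= Cmod om) by apply Cmod_ge_0. nra. }
      assert (0 <= B1 * (2 * Bq) ^ N * Mg * rsqrt s ^ N).
      { apply Rmult_le_pos; [|apply pow_le; lra]. apply Rmult_le_pos; [|exact HMg]. apply Rmult_le_pos; [lra|apply pow_le; lra]. }
      apply Rle_trans with (B1 * (2 * Bq) ^ N * Mg * rsqrt s ^ N * (4 * t0)); [apply Rmult_le_compat_l; assumption|].
      right. unfold M2. ring. }
  specialize (H1 s Hs). cbv beta in H1.
  match goal with |- Cmod ?x <= _ =>
    replace x with ((B b - B (- b)) + Csum (fun k => taylor_quotient q g k 0 * RtoC (rsqrt s ^ S k) * (dG k s - (MP k - MM k))) N
      + h 0 * (psi (S0 * (Up * Up)) - psi (S0 * (Um * Um)) + ell))%C end.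
  - eapply Rle_trans; [apply Cmod_triangle|]. rewrite (Cmod_mult (h 0%C)).
    assert (Cmod (h 0%C) * Cmod (psi (S0 * (Up * Up)) - psi (S0 * (Um * Um)) + ell)%C <= Cmod (h 0%C) * (Cmod ell * M3 * rsqrt s ^ N)) by (apply Rmult_le_compat_l; assumption).
    eapply Rle_trans; [apply Rplus_le_compat_r, Cmod_triangle|]. lra.
  - assert (ES : Csum (fun k => taylor_quotient q g k 0 * RtoC (rsqrt s ^ S k) * (dG k s - (MP k - MM k)))%C N
       = (Csum (fun k => taylor_quotient q g k 0 * RtoC (rsqrt s ^ S k) * G k (RtoC (sqrt (INR s)) * u b)) N
          + (-1) * Csum (fun k => taylor_quotient q g k 0 * RtoC (rsqrt s ^ S k) * G k (RtoC (sqrt (INR s)) * u (- b))) N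
          + (-1) * Csum (fun k => taylor_quotient q g k 0 * (MP k - MM k) * RtoC (rsqrt s ^ S k)) N)%C).
    { rewrite <- !Csum_scal, <- !Csum_plus. apply Csum_ext. intros k _. unfold dG, Up, Um. ring. }
    rewrite ES. unfold B, ell. ring.
Qed.

Lemma hol_near0 f e : hol_at f 0 -> 0 < e -> exists d, 0 < d /\ forall z, Cmod z < d -> Cmod (f z - f 0%C) < e.
Proof.
  intros Hf He. destruct (hol_cont f 0 Hf e He) as (d & Hd & H). exists d. split; [exact Hd|].
  intros z Hz. apply H. now replace (z - 0)%C with z by ring.
Qed.

Lemma Re_minus_axis (c t : R) (w : C) : Re (w - RtoC c * (0, t)%R)%C = Re w.
Proof. destruct w. unfold Re, RtoC, Cminus, Copp, Cplus, Cmult; simpl. ring. Qed.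

(** For r = c s the exponent is s F with F(z) = f(z) - c z, and F has a double zero at 0. Deform the
    segment: horizontal edges to the imaginary axis and then to the end points of the tilted line of
    [descent_direction]; on them the integrand is exponentially small. On the line itself take
    logarithmic branches above and below, which account for half of the residue, and
    [pole_gauss_expansion] for the rest. *)
Lemma pole_integral_at_slope R f h c : 0 < R -> hol_on R f -> hol_on R h -> f 0%C = 0%C ->
  C_derive f 0 = RtoC c -> C_derive (C_derive f) 0 <> 0%C -> on_axis_neg R f ->
  exists d0, 0 < d0 /\ forall del, 0 < del < d0 ->
    exists eta0, 0 < eta0 /\ forall eta, 0 < eta < eta0 ->
    exists beta : nat -> C, forall N, exists M, 0 <= M /\ forall s, (1 <= s)%nat ->
      Cmod (pole_integral h f eta del (c * INR s) (INR s) + h 0 / 2 - Csum (fun k => beta k * RtoC (rsqrt s ^ S k))%C N)%C <= M * rsqrt s ^ N.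
Proof.
  intros HR Hf Hh Hf0 Hc Hk Hax.
  set (F := fun z => (f z - RtoC c * z)%C).
  assert (HF : hol_on R F).
  { intros z Hz. apply hol_minus; [now apply Hf|]. apply hol_mult; [apply hol_const|apply hol_id]. }
  assert (HFd : forall z, Cmod z < R -> C_derive F z = (C_derive f z - RtoC c)%C).
  { intros z Hz. apply cderiv_C_derive. unfold F. eapply cderiv_eq.
    - apply cderiv_plus; [now apply (hol_on_cderiv R)|].
      apply (cderiv_ext (fun y => (- RtoC c) * y)%C _ _ _ 1 Rlt_0_1); [intros; ring|].
      apply cderiv_mult; [apply cderiv_const|apply cderiv_id].
    - cbv beta. ring. }
  assert (H0R : Cmod 0 < R) by (rewrite Cmod_0; exact HR).
  assert (HF0 : F 0%C = 0%C) by (unfold F; rewrite Hf0; ring).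
  assert (HF1 : C_derive F 0 = 0%C) by (rewrite HFd, Hc by exact H0R; ring).
  assert (HF2 : C_derive (C_derive F) 0 = C_derive (C_derive f) 0).
  { apply cderiv_C_derive. apply (cderiv_ext (fun z => C_derive f z + - RtoC c)%C _ _ _ R HR).
    - intros y Hy. rewrite HFd; [reflexivity|]. now replace (y - 0)%C with y in Hy by ring.
    - eapply cderiv_eq; [apply cderiv_plus; [apply (hol_on_cderiv R); [now apply hol_deriv|exact H0R]|apply cderiv_const]|ring]. }
  assert (HaxF : on_axis_neg R F) by (intros t Ht; unfold F; rewrite Re_minus_axis; now apply Hax).
  destruct (descent_direction R F HR HF HF0 HF1 ltac:(rewrite HF2; exact Hk) HaxF) as (xi & R1 & HR1 & Hxi & Hre & Hdir).
  rewrite HF2 in Hre. set (kap := C_derive (C_derive f) 0) in *.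
  set (om := ((xi, 1)%R : C)) in *.
  set (Q := fun z => (- divz (divz F) z)%C).
  assert (HQ : hol_on R Q) by (intros z Hz; apply hol_opp; apply (hol_divz R); [exact HR|now apply hol_divz|exact Hz]).
  assert (EQ : forall z, F z = (- (z * z * Q z))%C).
  { intros z. rewrite (divz_eq F z), HF0, (divz_eq (divz F) z), divz_0, HF1. unfold Q. ring. }
  assert (EQ0 : Q 0%C = (- (kap / 2))%C).
  { unfold Q. rewrite divz_0. assert (E := divz_derive R F HR HF). rewrite HF2 in E. fold kap in E. rewrite <- E. field. }
  assert (HQ0 : Q 0%C <> 0%C).
  { rewrite EQ0. intros E. apply Hk. fold kap. replace kap with (- (2 * - (kap / 2)))%C by field. rewrite E. ring. }
  destruct (Csqrt_ex (Q 0%C)) as (q0 & Eq0).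
  assert (Hq0 : q0 <> 0%C) by (intros E; apply HQ0; rewrite <- Eq0, E; ring).
  rewrite <- EQ0, <- Eq0 in Hre.
  replace (q0 * q0 * (om * om))%C with (om * om * (q0 * q0))%C in Hre by ring.
  set (lam := Re (om * om * (q0 * q0))%C / 2). assert (Hlam : 0 < lam) by (unfold lam; lra).
  (* the angle condition survives a small logarithmic perturbation of the coordinate *)
  assert (Hw : exists e2, 0 < e2 /\ forall w, Cmod w <= e2 -> lam <= Re (om * om * (q0 * q0) * Cexp (2 * w))%C).
  { destruct (hol_near0 (fun w => om * om * (q0 * q0) * Cexp (2 * w))%C lam) as (d & Hd & H); [|exact Hlam|].
    - apply hol_mult; [apply hol_const|]. apply (hol_comp (fun w => 2 * w)%C Cexp); [|apply hol_Cexp].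
      apply hol_mult; [apply hol_const|apply hol_id].
    - exists (d / 2). split; [lra|]. intros w Hw. specialize (H w ltac:(lra)). cbv beta in H.
      replace (2 * 0)%C with (RtoC 0) in H by ring. rewrite Cexp_0, Cmult_1_r in H.
      set (X := (om * om * (q0 * q0) * Cexp (2 * w))%C) in *. set (Y := (om * om * (q0 * q0))%C) in *.
      assert (H1 := Re_le_Cmod (X - Y)). replace (Re (X - Y)) with (Re X - Re Y) in H1 by (destruct X, Y; reflexivity).
      apply Rabs_le_between in H1. unfold lam in *. lra. }
  destruct Hw as (e2 & He2 & Hw).
  destruct (ccont_neq Q 0 0 (hol_cont _ _ (HQ 0%C H0R)) HQ0) as (d1 & Hd1 & HQn).
  set (R2 := Rmin d1 R1). assert (HR2 : 0 < R2) by (apply Rmin_glb_lt; lra).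
  assert (HR21 : R2 <= d1 /\ R2 <= R1) by (split; [apply Rmin_l|apply Rmin_r]).
  destruct (hol_log R2 Q HR2) as (L2 & HL2 & HL20 & HL2e & _).
  { apply (hol_on_sub R); [lra|exact HQ]. }
  { intros z Hz. apply HQn. replace (z - 0)%C with z by ring. lra. }
  (* the coordinate u = z q0 e^L with F = - u^2 *)
  set (L := fun z => (L2 z / 2)%C).
  assert (HL : hol_on R2 L) by (intros z Hz; apply hol_div; [now apply HL2|apply hol_const|apply RtoC_neq_0; lra]).
  assert (HL0 : L 0%C = 0%C) by (unfold L; rewrite HL20; field).
  assert (H0R2 : Cmod 0 < R2) by (rewrite Cmod_0; exact HR2).
  destruct (hol_near0 L e2 (HL 0%C H0R2) He2) as (d3 & Hd3 & HLe).
  destruct (ccont_neq (fun z => 1 + z * C_derive L z)%C 0 0) as (d4 & Hd4 & HL1).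
  { apply hol_cont, hol_plus; [apply hol_const|]. apply hol_mult; [apply hol_id|]. now apply (hol_deriv R2). }
  { rewrite Cmult_0_l, Cplus_0_r. apply C1_nz. }
  destruct (Re_derive_near R f c 1 HR Hf Hc Rlt_0_1) as (R5 & HR5 & Hdn).
  set (R4 := Rmin (Rmin d3 d4) (Rmin R2 R5)).
  assert (HR4 : 0 < R4 /\ R4 <= d3 /\ R4 <= d4 /\ R4 <= R2 /\ R4 <= R5).
  { unfold R4. generalize (Rmin_l (Rmin d3 d4) (Rmin R2 R5)) (Rmin_r (Rmin d3 d4) (Rmin R2 R5)) (Rmin_l d3 d4) (Rmin_r d3 d4) (Rmin_l R2 R5) (Rmin_r R2 R5).
    intros. split; [repeat apply Rmin_glb_lt; lra|lra]. }
  destruct HR4 as (HR4 & HR4a & HR4b & HR4c & HR4d).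
  assert (Hf4 : hol_on R4 f) by (apply (hol_on_sub R); [lra|exact Hf]).
  assert (Hh4 : hol_on R4 h) by (apply (hol_on_sub R); [lra|exact Hh]).
  assert (HL4 : hol_on R4 L) by (apply (hol_on_sub R2); [lra|exact HL]).
  assert (Hax4 : on_axis_neg R4 f) by (intros t Ht; apply Hax; lra).
  assert (Hdn4 : forall z, Cmod z < R4 -> Rabs (Re (C_derive f z) - c) <= 1) by (intros z Hz; apply Hdn; lra).
  assert (EF : forall z, Cmod z < R4 -> F z = (- ((z * (q0 * Cexp (L z))) * (z * (q0 * Cexp (L z)))))%C).
  { intros z Hz. rewrite EQ, HL2e by lra. replace (L2 z) with (L z + L z)%C by (unfold L; field).
    rewrite Cexp_plus, <- Eq0. ring. }
  assert (Hom : Cmod om <= 2).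
  { eapply Rle_trans; [apply Cmod_le_abs|]. unfold om, Re, Im; simpl. rewrite Rabs_R1. lra. }
  exists (R4 / 4). split; [lra|]. intros del Hdel.
  set (A := Rabs c + 1). assert (HA : 0 <= A) by (unfold A; generalize (Rabs_pos c); lra).
  destruct (corner_decay R4 f c 1 del A HR4 Hf4 Hax4 Hdn4 ltac:(lra) HA) as (mu & eta0 & Hmu & Heta0 & Hcor).
  exists eta0. split; [lra|]. intros eta Heta.
  destruct (pole_gauss_expansion R4 L h q0 om lam e2 del HR4 HL4 Hh4 Hq0 Hlam Hom Hw) as (beta & Hbeta); try lra.
  { intros z Hz. specialize (HLe z ltac:(lra)). rewrite HL0 in HLe. replace (L z - 0)%C with (L z) in HLe by ring. lra. }
  { intros z Hz. apply HL1. replace (z - 0)%C with z by ring. lra. }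
  exists (fun k => beta k / (RtoC (2 * PI) * Ci))%C. intros N.
  destruct (Hbeta N) as (M1 & HM1 & HN).
  destruct (hol_on_bounded R4 h (3 * R4 / 4) Hh4 ltac:(lra)) as (B & HB & Hb).
  destruct (exp_small mu N Hmu) as (M2 & HM2 & HE).
  assert (HBd : 0 < B / del) by (apply Rdiv_lt_0_compat; lra).
  set (T := B / del * (2 * (eta + del))). assert (HT : 0 <= T) by (unfold T; apply Rmult_le_pos; lra).
  exists (M1 + T * M2). split; [assert (0 <= T * M2) by (now apply Rmult_le_pos); lra|]. intros s Hs.
  destruct (HN s Hs) as (K & HK & HKb). clear HN. specialize (HE s Hs).
  assert (Hs0 := pos_INR s).
  set (r := c * INR s). set (m := (fun z => h z * Cexp (RtoC (INR s) * f z - RtoC r * z))%C).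
  assert (Hm : hol_on R4 m) by (now apply hol_expo).
  assert (Em : forall z, Cmod z < R4 -> m z = (h z * Cexp (- (RtoC (INR s) * ((z * (q0 * Cexp (L z))) * (z * (q0 * Cexp (L z)))))))%C).
  { intros z Hz. unfold m. do 2 f_equal. unfold r. rewrite RtoC_mult.
    replace (RtoC (INR s) * f z - RtoC c * RtoC (INR s) * z)%C with (RtoC (INR s) * F z)%C by (unfold F; ring).
    rewrite EF by exact Hz. ring. }
  assert (Hm0 : m 0%C = h 0%C).
  { unfold m. rewrite Hf0. replace (RtoC (INR s) * 0 - RtoC r * 0)%C with (RtoC 0) by ring. rewrite Cexp_0. ring. }
  assert (HK' : forall z, Cmod z < R4 -> z <> 0%C -> cderiv K z ((m z - m 0) / z)).
  { intros z Hz Hz0. rewrite Em, Hm0 by exact Hz. now apply HK. }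
  destruct (pole_primitives R4 m K Hm HK') as (GU & GD & GR & HU & HD & _ & Hint & _ & HGK).
  rewrite (pole_integral_eq h f eta del r (INR s) m eq_refl), (Hint eta del) by lra.
  set (b := (RtoC del * om)%C) in *.
  assert (Eb : b = (xi * del, del)%R) by (unfold b, om, RtoC, Cmult; simpl; f_equal; ring).
  assert (Enb : (- b)%C = (- (xi * del), - del)%R) by (rewrite Eb; unfold Copp; simpl; f_equal; ring).
  (* the edges from the segment to the ends b and -b of the tilted line *)
  set (X := ((GU (- eta, del)%R - GU (0, del)) + (GU (0, del) - GU b) - ((GD (- eta, - del)%R - GD (0, - del)%R) + (GD (0, - del)%R - GD (- b)%C)))%C).
  assert (Hne : (RtoC (2 * PI) * Ci <> 0)%C) by (apply Cmult_neq_0; [apply TwoPI_neq_0|apply Ci_nz]).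
  match goal with |- Cmod ?x <= _ => replace x with ((X / (RtoC (2 * PI) * Ci)) + (K b - K (- b) - Csum (fun k => beta k * RtoC (rsqrt s ^ S k)) N) / (RtoC (2 * PI) * Ci))%C end.
  2:{ replace (GU (- eta, del)%R - GD (- eta, - del)%R)%C with (X + (GU b - GD (- b)))%C by (unfold X; ring).
      rewrite HGK, Hm0.
      replace (Csum (fun k => beta k / (RtoC (2 * PI) * Ci) * RtoC (rsqrt s ^ S k)) N)%C
        with (Csum (fun k => beta k * RtoC (rsqrt s ^ S k)) N / (RtoC (2 * PI) * Ci))%C.
      2:{ unfold Cdiv at 1. rewrite Cmult_comm, <- Csum_scal. apply Csum_ext. intros k _. unfold Cdiv. ring. }
      rewrite RtoC_mult. field. split; [apply Ci_nz|]. apply RtoC_neq_0. generalize PI_RGT_0. lra. }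
  eapply Rle_trans; [apply Cmod_triangle|].
  assert (B2 := Cmod_div_2PI (K b - K (- b) - Csum (fun k => beta k * RtoC (rsqrt s ^ S k)) N)%C).
  assert (B1 := Cmod_div_2PI X).
  set (E := exp (- mu * INR s)) in *. assert (HEp : 0 < E) by apply exp_pos.
  assert (Hrabs : Rabs r <= A * INR s).
  { unfold r. rewrite Rabs_mult, (Rabs_pos_eq (INR s)) by exact Hs0. apply Rmult_le_compat_r; [exact Hs0|unfold A; lra]. }
  assert (Ad1 : Rabs del = del) by (apply Rabs_pos_eq; lra). assert (Ad2 : Rabs (- del) = del) by (now rewrite Rabs_Ropp).
  assert (Hpt : forall x y, Rabs x <= R4 / 2 -> Rabs y = del -> Cmod (x, y) <= 3 * R4 / 4).
  { intros x y Hx Hy. eapply Rle_trans; [apply (Cmod_pair_le _ _ (R4 / 2) del); lra|lra]. }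
  assert (BH : forall (G : C -> C) x1 y w, Rabs y = del ->
    (forall x, Rabs x <= R4 / 2 -> cderiv G (x, y) (m (x, y) / (x, y))) ->
    (forall t, 0 <= t <= 1 -> Rabs (t * x1) <= R4 / 2 /\ INR s * Re (f (t * x1, y)) - r * (t * x1) <= - mu * INR s) ->
    Rabs x1 <= w -> Cmod (G (x1, y) - G (0, y)) <= B / del * E * w).
  { intros G x1 y w Hy HG Hx Hw'.
    eapply Rle_trans; [apply (horizontal_edge G h f r (INR s) 0 x1 y B (- mu * INR s))|].
    - intros E0. rewrite E0, Rabs_R0 in Hy. lra.
    - intros t Ht. replace (0 + t * (x1 - 0)) with (t * x1) by ring. destruct (Hx t Ht) as [X1 X2].
      split; [now apply HG|]. split; [apply Hb, Hpt; assumption|exact X2].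
    - rewrite Hy, Rminus_0_r. apply Rmult_le_compat_l; [apply Rmult_le_pos; lra|exact Hw']. }
  assert (HU' : forall x, Rabs x <= R4 / 2 -> cderiv GU (x, del) (m (x, del) / (x, del))).
  { intros x Hx. apply HU; [|unfold Im; simpl; lra]. specialize (Hpt x del Hx Ad1). lra. }
  assert (HD' : forall x, Rabs x <= R4 / 2 -> cderiv GD (x, - del) (m (x, - del)%R / (x, - del)%R)).
  { intros x Hx. apply HD; [|unfold Im; simpl; lra]. specialize (Hpt x (- del) Hx Ad2). lra. }
  assert (Hxe : forall t, 0 <= t <= 1 -> Rabs (t * - eta) <= eta) by (intros; apply Rabs_le; nra).
  assert (Hae : Rabs (- eta) <= eta) by (rewrite Rabs_Ropp, Rabs_pos_eq; lra).
  assert (BU1 : Cmod (GU (- eta, del)%R - GU (0, del)) <= B / del * E * eta).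
  { apply BH; auto. intros t Ht. specialize (Hxe t Ht). split; [lra|]. apply Hcor; auto. lra. }
  assert (BD1 : Cmod (GD (- eta, - del)%R - GD (0, - del)%R) <= B / del * E * eta).
  { apply BH; auto. intros t Ht. specialize (Hxe t Ht). split; [lra|]. apply Hcor; auto. lra. }
  (* on the way to the tilted line Re F stays below its value on the axis *)
  assert (HFle : forall x y y0, Re (F (x, y)) <= Re (F (0, y0)) -> Re (f (0, y0)) <= - mu ->
     INR s * Re (f (x, y)) - r * Re (x, y) <= - mu * INR s).
  { intros x y y0 H1 H2. unfold F in H1. rewrite Re_minus_axis in H1.
    assert (E1 : Re (f (x, y) - RtoC c * (x, y))%C = Re (f (x, y)) - c * x).
    { destruct (f (x, y)). unfold Re, RtoC, Cminus, Copp, Cplus, Cmult; simpl. ring. }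
    rewrite E1 in H1. unfold r. unfold Re at 2; simpl.
    replace (INR s * Re (f (x, y)) - c * INR s * x) with (INR s * (Re (f (x, y)) - c * x)) by ring.
    rewrite (Rmult_comm (- mu)). apply Rmult_le_compat_l; lra. }
  assert (Hmu1 : Re (f (0, del)) <= - mu /\ Re (f (0, - del)) <= - mu).
  { assert (H := Hcor 0 0 1 ltac:(rewrite Rabs_R0; lra) ltac:(lra) ltac:(rewrite Rabs_R0; lra)). lra. }
  assert (Hxd : Rabs (xi * del) <= del / 2).
  { rewrite Rabs_mult, (Rabs_pos_eq del) by lra. nra. }
  assert (Hx2 : forall t, 0 <= t <= 1 -> Rabs (t * (xi * del)) <= R4 / 2).
  { intros t Ht. rewrite Rabs_mult, (Rabs_pos_eq t) by lra. assert (0 <= Rabs (xi * del)) by apply Rabs_pos. nra. }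
  assert (BU2 : Cmod (GU (0, del) - GU b) <= B / del * E * del).
  { rewrite Cmod_sub_sym, Eb. apply BH; auto; [|lra]. intros t Ht. split; [now apply Hx2|].
    apply (HFle _ _ del); [|apply Hmu1]. assert (H := Hdir 1 del t (or_introl eq_refl) ltac:(lra) Ht).
    rewrite !Rmult_1_l, Rmult_assoc in H. exact H. }
  assert (BD2 : Cmod (GD (0, - del)%R - GD (- b)%C) <= B / del * E * del).
  { rewrite Cmod_sub_sym, Enb. apply BH; auto; [|rewrite Rabs_Ropp; lra]. intros t Ht.
    replace (t * - (xi * del)) with (- (t * (xi * del))) by ring. split; [rewrite Rabs_Ropp; now apply Hx2|].
    apply (HFle _ _ (- del)); [|apply Hmu1]. assert (H := Hdir (-1) del t (or_intror eq_refl) ltac:(lra) Ht).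
    replace (-1 * (t * xi * del)) with (- (t * (xi * del))) in H by ring. replace (-1 * del) with (- del) in H by ring. exact H. }
  assert (HX : Cmod X <= T * E).
  { unfold X. eapply Rle_trans; [apply Cmod_minus_le|].
    eapply Rle_trans; [apply Rplus_le_compat; apply Cmod_triangle|]. unfold T. lra. }
  assert (T * E <= T * (M2 * rsqrt s ^ N)) by (apply Rmult_le_compat_l; assumption). lra.
Qed.

(** * Uniform holomorphy on slices of the bidisk *)

Definition slice_bounded (P : C -> C -> C) (x y : C) (B : R) : Prop := hol_at (P x) y /\ Cmod (P x y) <= B.

(** Local boundedness is included since Cauchy estimates for slices have to be uniform in the first
    variable. *)
Definition regular2 (f : C -> C -> C) (x0 y0 : C) : Prop :=
  exists d B, 0 < d /\ hol2_on f x0 y0 d /\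
    forall x y, Cmod (x - x0) < d -> Cmod (y - y0) < d -> Cmod (f x y) <= B.

Lemma slice_bounded_box P x0 y0 d B : 0 < d ->
  (forall x y, Cmod (x - x0) < d -> Cmod (y - y0) < d -> slice_bounded P x y B) ->
  exists e, 0 < e /\ forall x y, Cmod (x - x0) < e -> Cmod (y - y0) < e -> slice_bounded P x y (/ e).
Proof.
  intros Hd H. assert (HB := Rabs_pos B). set (e := Rmin d (/ (Rabs B + 1))).
  assert (He : 0 < e) by (apply Rmin_glb_lt; [exact Hd|apply Rinv_0_lt_compat; lra]).
  exists e. split; [exact He|]. intros x y Hx Hy.
  assert (He1 : e <= d) by apply Rmin_l. assert (He2 : e <= / (Rabs B + 1)) by apply Rmin_r.
  destruct (H x y) as [H1 H2]; try lra. split; [exact H1|].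
  eapply Rle_trans; [exact H2|]. apply Rle_trans with (Rabs B + 1); [generalize (Rle_abs B); lra|].
  rewrite <- (Rinv_inv (Rabs B + 1)). apply Rinv_le_contravar; assumption.
Qed.

(** The tube lemma: compactness of the closed unit disk in y gives one radius 1 + d and one bound
    that serve for all x near x0. The bound is written / d to have a single constant. *)
Lemma slice_bounded_tube P x0 :
  (forall y, Cmod y <= 1 -> exists e, 0 < e /\ forall x y', Cmod (x - x0) < e -> Cmod (y' - y) < e -> slice_bounded P x y' (/ e)) ->
  exists d, 0 < d /\ forall x y, Cmod (x - x0) < d -> Cmod y < 1 + d -> slice_bounded P x y (/ d).
Proof.
  intros H.
  destruct (disc_compact 1 (fun y d => forall x y', Cmod (x - x0) < 2 * d -> Cmod (y' - y) < 2 * d -> slice_bounded P x y' (/ d))) as (d & Hd & HC).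
  - intros y Hy. destruct (H y Hy) as (e & He & HP). exists (e / 2). split; [lra|]. intros x y' Hx Hy'.
    destruct (HP x y') as [H1 H2]; try lra. split; [exact H1|]. eapply Rle_trans; [exact H2|].
    apply Rinv_le_contravar; lra.
  - exists d. split; [exact Hd|]. intros x y Hx Hy.
    assert (Hy2 : exists y2, Cmod y2 <= 1 /\ Cmod (y - y2) <= d).
    { destruct (Rle_or_lt (Cmod y) 1) as [L|L].
      - exists y. split; [exact L|]. rewrite Cmod_diag. lra.
      - exists (RtoC (/ Cmod y) * y)%C. assert (Hi : 0 < / Cmod y) by (apply Rinv_0_lt_compat; lra).
        assert (Hiy : / Cmod y * Cmod y = 1) by (apply Rinv_l; lra).
        split.
        + rewrite Cmod_mult, Cmod_R, Rabs_pos_eq by lra. lra.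
        + replace (y - RtoC (/ Cmod y) * y)%C with (RtoC (1 - / Cmod y) * y)%C by (rewrite RtoC_minus; ring).
          assert (/ Cmod y <= 1) by (rewrite <- Rinv_1; apply Rinv_le_contravar; lra).
          rewrite Cmod_mult, Cmod_R, Rabs_pos_eq by lra. lra. }
    destruct Hy2 as (y2 & Hy2 & Hyy2). destruct (HC y2 Hy2) as (t & e & _ & HP & Hyt & Hde).
    destruct (HP x y) as [H1 H2]; [lra| |].
    + generalize (Cmod_sub_tri y y2 t). lra.
    + split; [exact H1|]. eapply Rle_trans; [exact H2|]. apply Rinv_le_contravar; lra.
Qed.

Lemma cir_lip a b : Cmod (cir 1 a - cir 1 b) <= Rabs (a - b).
Proof.
  assert (H : forall a b, a <= b -> Cmod (cir 1 b - cir 1 a) <= 1 * (b - a)).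
  { intros x y Hxy. apply (MVT_C (cir 1) (fun t => Ci * cir 1 t)%C x y 1 Hxy).
    - intros t _. apply cir_deriv.
    - intros t _. rewrite Cmod_mult, Cmod_Ci, Cmod_cir; lra. }
  destruct (Rle_or_lt a b) as [L|L].
  - rewrite Cmod_sub_sym. specialize (H a b L). rewrite Rabs_left1; lra.
  - specialize (H b a ltac:(lra)). rewrite Rabs_pos_eq; lra.
Qed.

(** Compactness of the interval of angles, given that the circle is parametrized by a Lipschitz map.
    *)
Lemma slice_bounded_arc (P : C -> C -> C) a b :
  (forall t, a <= t <= b -> exists d, 0 < d /\ forall x y, Cmod (x - cir 1 t) < d -> Cmod y < 1 + d -> slice_bounded P x y (/ d)) ->
  exists d, 0 < d /\ forall t x y, a <= t <= b -> Cmod (x - cir 1 t) < d -> Cmod y < 1 + d -> slice_bounded P x y (/ d).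
Proof.
  intros H.
  assert (HC : forall t, exists e : posreal, a <= t <= b ->
     forall x y, Cmod (x - cir 1 t) < 2 * e -> Cmod y < 1 + 2 * e -> slice_bounded P x y (/ e)).
  { intros t. destruct (classic (a <= t <= b)) as [Ht|Ht].
    - destruct (H t Ht) as (d & Hd & HP). assert (Hd2 : 0 < d / 2) by lra.
      exists (mkposreal _ Hd2). intros _ x y Hx Hy. simpl in Hx, Hy. destruct (HP x y) as [H1 H2]; try lra.
      split; [exact H1|]. eapply Rle_trans; [exact H2|]. simpl. apply Rinv_le_contravar; lra.
    - exists (mkposreal 1 Rlt_0_1). intros; contradiction. }
  destruct (choose_fun _ HC) as (delta & Hdelta).
  destruct (compactness_value_1d a b delta) as (d & Hd).
  exists d. split; [apply cond_pos|]. intros t x y Ht Hx Hy.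
  destruct (NNPP _ (Hd t Ht)) as (u & Hu & H1 & H2).
  destruct (Hdelta u Hu x y) as [G1 G2].
  - generalize (Cmod_sub_tri x (cir 1 t) (cir 1 u)) (cir_lip t u). lra.
  - generalize (cond_pos d). lra.
  - split; [exact G1|]. eapply Rle_trans; [exact G2|]. apply Rinv_le_contravar; [apply cond_pos|exact H2].
Qed.

(** * Coefficients of a function with one simple pole *)

Lemma cser_shift_mul c y G : cser (fun k => c k * y ^ k)%C G ->
  cser (fun k => match k with O => RtoC 0 | S k => c k end * y ^ k)%C (y * G)%C.
Proof.
  intros H. apply ctends_S. eapply ctends_ext; [|exact (ctends_scal y _ _ H)]. intros n. cbv beta.
  rewrite Csum_shift, <- Csum_scal. rewrite Cmult_0_l, Cplus_0_l. apply Csum_ext. intros k _. rewrite Cpow_S. ring.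
Qed.

Definition linear_factor_coef (v : C) (c : nat -> C) (k : nat) : C :=
  (c k - v * match k with O => RtoC 0 | S k => c k end)%C.

Lemma ps_linear_factor r v c g : ps r c g -> ps r (linear_factor_coef v c) (fun y => (1 - y * v) * g y)%C.
Proof.
  intros H y Hy. assert (H1 := H y Hy). assert (H2 := cser_scal (- v) _ _ (cser_shift_mul _ _ _ H1)).
  replace ((1 - y * v) * g y)%C with (g y + (- v) * (y * g y))%C by ring.
  eapply cser_ext; [|exact (cser_plus _ _ _ _ H1 H2)]. intros k. cbv beta. unfold linear_factor_coef. ring.
Qed.

(** If P(y) = (1 - y v) g(y) is holomorphic on a disk larger than |1/v|, the partial sums of P(1/v)
    telescope to c_s v^(-s): the tail of that convergent series is the error. *)
Lemma simple_pole_coefficients R P B (v : C) c g r rho s : 0 < r <= R -> hol_on R P -> (forall y, Cmod y < R -> Cmod (P y) <= B) ->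
  v <> 0%C -> 0 < rho < R -> Cmod (/ v) < rho -> ps r c g ->
  (forall y, Cmod y < r -> P y = ((1 - y * v) * g y)%C) ->
  Cmod (c s - v ^ s * P (/ v))%C <= B * / (1 - Cmod (/ v) / rho) * (/ rho) ^ s.
Proof.
  intros Hr HP HB Hv Hrho Hvr Hg HPg.
  assert (Hps : ps r (linear_factor_coef v c) P).
  { intros y Hy. rewrite HPg by exact Hy. exact (ps_linear_factor r v c g Hg y Hy). }
  assert (HpsR := hol_ps_extend R r _ _ Hr Hps HP).
  assert (Hb : forall k, Cmod (linear_factor_coef v c k) <= B * (/ rho) ^ k).
  { intros k. rewrite (ps_coef R R _ P rho k ltac:(lra) HpsR HP Hrho). apply (coef_bound R); auto.
    intros t. apply HB. rewrite Cmod_cir; lra. }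
  set (t := Cmod (/ v) / rho). assert (Ht : 0 <= t < 1) by (apply ratio_lt1; split; [apply Cmod_ge_0|exact Hvr]).
  assert (HB0 : 0 <= B).
  { specialize (Hb O). simpl in Hb. generalize (Cmod_ge_0 (linear_factor_coef v c 0)). lra. }
  assert (Hvm : 0 < Cmod v) by (apply Cmod_gt_0; exact Hv).
  assert (Hterm : forall k, Cmod (linear_factor_coef v c k * (/ v) ^ k)%C <= B * t ^ k).
  { intros k. rewrite Cmod_mult, Cmod_pow. unfold t, Rdiv. rewrite Rpow_mult_distr.
    specialize (Hb k). assert (0 <= Cmod (/ v) ^ k) by (apply pow_le, Cmod_ge_0).
    apply Rle_trans with (B * (/ rho) ^ k * Cmod (/ v) ^ k); [apply Rmult_le_compat_r; assumption|right; ring]. }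
  assert (HvR : Cmod (/ v) < R) by lra.
  assert (Htail := cser_tail _ _ B t (S s) HB0 Ht Hterm (HpsR (/ v)%C HvR)).
  assert (Hsum : forall n, Csum (fun k => linear_factor_coef v c k * (/ v) ^ k)%C (S n) = (c n * (/ v) ^ n)%C).
  { induction n as [|n IH].
    - simpl. unfold linear_factor_coef. ring.
    - change (Csum (fun k => linear_factor_coef v c k * (/ v) ^ k)%C (S (S n))) with (Csum (fun k => linear_factor_coef v c k * (/ v) ^ k)%C (S n) + linear_factor_coef v c (S n) * (/ v) ^ S n)%C.
      rewrite IH. unfold linear_factor_coef. rewrite Cpow_S. field. exact Hv. }
  rewrite Hsum in Htail.
  replace (c s - v ^ s * P (/ v))%C with (- (v ^ s * (P (/ v) - c s * (/ v) ^ s)))%C.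
  2:{ assert (E : (v ^ s * (/ v) ^ s = 1)%C) by (rewrite <- Cpow_mult_l, Cinv_r by exact Hv; apply Cpow_1_l).
      replace (c s) with (c s * (v ^ s * (/ v) ^ s))%C at 2 by (rewrite E; ring). ring. }
  rewrite Cmod_opp, Cmod_mult, Cmod_pow.
  apply Rle_trans with (Cmod v ^ s * (B * t ^ S s / (1 - t))).
  - apply Rmult_le_compat_l; [apply pow_le; lra|exact Htail].
  - assert (E : Cmod v ^ s * t ^ s = (/ rho) ^ s).
    { rewrite <- Rpow_mult_distr. f_equal. unfold t. rewrite Cmod_inv by exact Hv. field. lra. }
    simpl pow. replace (Cmod v ^ s * (B * (t * t ^ s) / (1 - t))) with (B * / (1 - t) * (Cmod v ^ s * t ^ s) * t) by (field; lra).
    rewrite E. assert (0 < / (1 - t)) by (apply Rinv_0_lt_compat; lra).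
    assert (0 <= B * / (1 - t) * (/ rho) ^ s).
    { apply Rmult_le_pos; [apply Rmult_le_pos; lra|]. apply pow_le. apply Rlt_le, Rinv_0_lt_compat; lra. }
    nra.
Qed.

(** * Coefficient functions of the double series *)

Definition slice (A : nat -> nat -> C) (s : nat) (x : C) : C := Clim (Csum (fun r => A r s * x ^ r)%C).

Definition summable_bidisk (A : nat -> nat -> C) : Prop :=
  forall rho, 0 < rho < 1 -> exists B, 0 <= B /\ forall i j, Cmod (A i j) * (rho ^ i * rho ^ j) <= B.

Lemma bidisk_row A x s : summable_bidisk A -> Cmod x < 1 -> exists l, cser (fun r => A r s * x ^ r)%C l.
Proof.
  intros HA Hx. assert (Hx0 := Cmod_ge_0 x). set (rho := (Cmod x + 1) / 2).
  destruct (HA rho) as (B & HB & Hb); [unfold rho; lra|].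
  assert (Hr : 0 < rho) by (unfold rho; lra).
  assert (Hrs : 0 < rho ^ s) by now apply pow_lt.
  destruct (cser_geom (fun r => A r s * x ^ r)%C (B / rho ^ s) (Cmod x / rho)) as (l & Hl & _).
  - apply Rmult_le_pos; [exact HB|apply Rlt_le, Rinv_0_lt_compat, Hrs].
  - apply ratio_lt1. unfold rho; lra.
  - intros r. rewrite Cmod_mult, Cmod_pow, (ratio_pow (Cmod x) rho r Hr).
    assert (H1 : Cmod (A r s) * rho ^ r <= B / rho ^ s).
    { apply (Rmult_le_reg_r (rho ^ s)); [exact Hrs|]. replace (B / rho ^ s * rho ^ s) with B by (field; lra). specialize (Hb r s). lra. }
    replace (Cmod (A r s) * ((Cmod x / rho) ^ r * rho ^ r)) with (Cmod (A r s) * rho ^ r * (Cmod x / rho) ^ r) by ring.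
    apply Rmult_le_compat_r; [|exact H1]. apply pow_le. apply Rmult_le_pos; [exact Hx0|apply Rlt_le, Rinv_0_lt_compat, Hr].
  - now exists l.
Qed.

Lemma slice_ps A s : summable_bidisk A -> ps 1 (fun r => A r s) (slice A s).
Proof. intros HA x Hx. unfold slice. apply Clim_correct. now apply bidisk_row. Qed.

Lemma summable_swap A : summable_bidisk A -> summable_bidisk (fun i j => A j i).
Proof.
  intros HA rho Hr. destruct (HA rho Hr) as (B & HB & Hb). exists B. split; [exact HB|].
  intros i j. rewrite (Rmult_comm (rho ^ i)). apply Hb.
Qed.

Lemma bidisk_dom A x y : summable_bidisk A -> Cmod x < 1 -> Cmod y < 1 -> exists B q, dom2 B q (monomials A x y).
Proof.
  intros HA Hx Hy. set (m := Rmax (Cmod x) (Cmod y)).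
  assert (Hm : 0 <= m < 1).
  { split; [eapply Rle_trans; [apply Cmod_ge_0|apply Rmax_l]|now apply Rmax_lub_lt]. }
  destruct (HA ((m + 1) / 2)) as (B & HB & Hb); [lra|].
  exists B, (m / ((m + 1) / 2)). apply mono_dom; auto; try lra; [apply Rmax_l|apply Rmax_r].
Qed.

(** For fixed small y the expansion of F(., y) in powers of x holds near 0 and hence, as F(., y) is
    holomorphic on the unit disk, for all |x| < 1. There the double series may be summed in the
    other order. *)
Lemma slice_expand A F r0 x : summable_bidisk A -> 0 < r0 <= 1 ->
  (forall x y, Cmod x < r0 -> Cmod y < r0 -> cser2 (monomials A x y) (F x y)) ->
  (forall y, Cmod y < r0 -> hol_on 1 (fun x => F x y)) -> Cmod x < 1 ->
  ps r0 (fun s => slice A s x) (F x).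
Proof.
  intros HA Hr0 HF Hh Hx y Hy.
  set (g := fun r => slice (fun i j => A j i) r y).
  assert (Hg : forall r, cser (fun s => A r s * y ^ s)%C (g r)).
  { intros r. apply (slice_ps (fun i j => A j i) r (summable_swap _ HA)). lra. }
  assert (Hps : ps r0 g (fun x => F x y)).
  { intros z Hz. destruct (bidisk_dom A z y HA) as (B & q & HD); try lra.
    apply (cser2_iter B q _ _ _ HD (HF z y Hz Hy)). intros r.
    rewrite (Cmult_comm (g r)). eapply cser_ext; [|exact (cser_scal (z ^ r) _ _ (Hg r))].
    intros s. cbv beta. unfold monomials. ring. }
  assert (Hx1 := hol_ps_extend 1 r0 g _ Hr0 Hps (Hh y Hy) x Hx). cbv beta in Hx1.
  destruct (bidisk_dom A x y HA) as (B & q & HD); try lra.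
  destruct (cser2_dom _ _ _ HD) as (l & Hl & _).
  assert (El : F x y = l).
  { apply (ctends_unique _ _ _ Hx1). apply (cser2_iter B q _ _ _ HD Hl). intros r.
    rewrite (Cmult_comm (g r)). eapply cser_ext; [|exact (cser_scal (x ^ r) _ _ (Hg r))].
    intros s. cbv beta. unfold monomials. ring. }
  rewrite El. apply (cser2_iter B q _ _ _ (dom2_swap _ _ _ HD) (cser2_swap _ _ Hl)). intros s.
  rewrite (Cmult_comm (slice A s x)). eapply cser_ext; [|exact (cser_scal (y ^ s) _ _ (slice_ps A s HA x Hx))].
  intros r. cbv beta. unfold monomials. ring.
Qed.

Lemma regular2_slices F x0 y0 : regular2 F x0 y0 ->
  exists e, 0 < e /\ forall x y, Cmod (x - x0) < e -> Cmod (y - y0) < e -> slice_bounded F x y (/ e).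
Proof.
  intros (d & B & Hd & Hh & HB). apply (slice_bounded_box F x0 y0 d B Hd). intros x y Hx Hy. split; [|now apply HB].
  apply (Hh (fun _ => x) (fun y => y) y); auto using hol_const, hol_id.
Qed.

Lemma regular2_hol_fst F x0 y0 : regular2 F x0 y0 -> hol_at (fun x => F x y0) x0.
Proof.
  intros (d & B & Hd & Hh & HB). apply (Hh (fun x => x) (fun _ => y0) x0); auto using hol_const, hol_id;
  now rewrite Cmod_diag.
Qed.

(** Through the power series: complex differentiability of the derivative is not part of [hol_at].
    *)
Lemma hol_at_deriv f z : hol_at f z -> hol_at (C_derive f) z.
Proof.
  intros Hf. destruct (hol_near f z Hf) as (d & Hd & H).
  assert (HS : hol_on d (fun w => f (z + w)%C)).
  { intros w Hw. apply (hol_comp (fun w => z + w)%C f).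
    - apply hol_plus; [apply hol_const|apply hol_id].
    - apply H. now replace (z + w - z)%C with w by ring. }
  assert (HD := hol_deriv d _ Hd HS).
  apply (hol_ext (fun y => C_derive (fun w => f (z + w)%C) (y - z)) _ z d Hd).
  - intros y Hy. symmetry. apply cderiv_C_derive.
    assert (E := hol_on_cderiv d _ (y - z)%C HS Hy).
    apply (cderiv_ext (fun y => (fun w => f (z + w)%C) (y - z)%C) _ _ _ 1 Rlt_0_1).
    + intros x _. cbv beta. f_equal. ring.
    + eapply cderiv_eq.
      * apply (cderiv_comp (fun y => y - z)%C (fun w => f (z + w)%C)); [|exact E].
        apply cderiv_plus; [apply cderiv_id|apply cderiv_const].
      * ring.
  - apply (hol_comp (fun y => y - z)%C (C_derive (fun w => f (z + w)%C))).
    + apply hol_minus; [apply hol_id|apply hol_const].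
    + apply HD. now rewrite Cmod_diag.
Qed.

(** Cauchy's estimate on a circle of radius larger than 1. *)
Lemma slice_decay A F r0 x d s : summable_bidisk A -> 0 < r0 <= 1 ->
  ps r0 (fun s => slice A s x) (F x) -> 0 < d ->
  (forall y, Cmod y < 1 + d -> slice_bounded F x y (/ d)) -> Cmod (slice A s x) <= / d * (/ (1 + d / 2)) ^ s.
Proof.
  intros HA Hr0 Hps Hd Hg.
  assert (HF : hol_on (1 + d) (F x)) by (intros y Hy; now apply Hg).
  rewrite (ps_coef (1 + d) r0 _ (F x) (1 + d / 2) s ltac:(lra) Hps HF ltac:(lra)).
  apply (coef_bound (1 + d)); [exact HF|lra|]. intros t. apply Hg. rewrite Cmod_cir; lra.
Qed.

Lemma cir_neq_1 t : 0 < Rabs t <= PI -> cir 1 t <> 1%C.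
Proof.
  intros Ht E. unfold cir, Cexp in E. rewrite Re_Ci_R, exp_0 in E.
  apply (f_equal fst) in E. simpl in E.
  assert (Hc : cos (Rabs t) = 1).
  { replace (cos (Rabs t)) with (cos t).
    - unfold Im, Ci, RtoC, Cmult in E; simpl in E. replace (0 * 0 + 1 * t) with t in E by ring. lra.
    - destruct (Rle_or_lt 0 t) as [L|L]; [now rewrite Rabs_pos_eq|]. rewrite Rabs_left by exact L. now rewrite cos_neg. }
  assert (cos (Rabs t) < cos 0) by (apply cos_decreasing_1; lra). rewrite cos_0 in H. lra.
Qed.

(** Compactness of the arc del <= |t| <= pi: there F is regular on the whole closed disk in y. *)
Lemma slice_bounded_far F del : (forall x y, Cmod x <= 1 -> Cmod y <= 1 -> ~ (x = 1%C /\ y = 1%C) -> regular2 F x y) -> 0 < del ->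
  exists d, 0 < d /\ forall t x y, del <= Rabs t <= PI -> Cmod (x - cir 1 t) < d -> Cmod y < 1 + d -> slice_bounded F x y (/ d).
Proof.
  intros HF Hdel.
  assert (HT : forall t, del <= Rabs t <= PI -> exists d, 0 < d /\ forall x y, Cmod (x - cir 1 t) < d -> Cmod y < 1 + d -> slice_bounded F x y (/ d)).
  { intros t Ht. apply slice_bounded_tube. intros y Hy. apply regular2_slices. apply HF; [rewrite Cmod_cir; lra|exact Hy|].
    intros [E _]. apply (cir_neq_1 t) in E; [exact E|lra]. }
  destruct (slice_bounded_arc F del PI) as (d1 & Hd1 & H1).
  { intros t Ht. apply HT. rewrite Rabs_pos_eq; lra. }
  destruct (slice_bounded_arc F (- PI) (- del)) as (d2 & Hd2 & H2).
  { intros t Ht. apply HT. rewrite Rabs_left; lra. }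
  exists (Rmin d1 d2). split; [now apply Rmin_glb_lt|]. intros t x y Ht Hx Hy.
  assert (Hm1 := Rmin_l d1 d2). assert (Hm2 := Rmin_r d1 d2). assert (Hm0 : 0 < Rmin d1 d2) by now apply Rmin_glb_lt.
  destruct (Rle_or_lt 0 t) as [L|L].
  - rewrite Rabs_pos_eq in Ht by exact L. destruct (H1 t x y) as [G1 G2]; try lra. split; [exact G1|].
    eapply Rle_trans; [exact G2|]. apply Rinv_le_contravar; lra.
  - rewrite Rabs_left in Ht by exact L. destruct (H2 t x y) as [G1 G2]; try lra. split; [exact G1|].
    eapply Rle_trans; [exact G2|]. apply Rinv_le_contravar; lra.
Qed.

(** * The two poles near the double point *)

(** Near (1, 1) the product is replaced by phi, so that it is defined on the poles as well. *)
Definition cleared (F phi : C -> C -> C) (v0 v1 : C -> C) (d0 : R) (x y : C) : C :=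
  if excluded_middle_informative (Cmod (x - 1) < d0 /\ Cmod (y - 1) < d0) then phi x y
  else (F x y * ((1 - y * v0 x) * (1 - y * v1 x)))%C.

(** At x = 1 the only zero of 1 - y v(x) is y = 1, and this persists nearby. *)
Lemma sheet_neq (v : C -> C) (y : C) : hol_at v 1 -> v 1%C = 1%C -> y <> 1%C ->
  exists e, 0 < e /\ forall x y', Cmod (x - 1) < e -> Cmod (y' - y) < e -> (1 - y' * v x <> 0)%C.
Proof.
  intros Hv H1 Hy. set (D := Cmod (1 - y)). assert (HD : 0 < D).
  { apply Cmod_gt_0. intros E. apply Hy. replace y with (1 - (1 - y))%C by ring. rewrite E. ring. }
  assert (Hy0 := Cmod_ge_0 y). set (T := D / (4 * (Cmod y + 1))).
  assert (HT : 0 < T) by (apply Rdiv_lt_0_compat; lra).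
  destruct (hol_cont v 1 Hv (Rmin T 1)) as (d & Hd & Hc); [apply Rmin_glb_lt; lra|].
  exists (Rmin d (D / 8)). split; [apply Rmin_glb_lt; lra|]. intros x y' Hx Hy' E.
  assert (Hx1 : Cmod (x - 1) < d) by (eapply Rlt_le_trans; [exact Hx|apply Rmin_l]).
  assert (Hy1 : Cmod (y' - y) < D / 8) by (eapply Rlt_le_trans; [exact Hy'|apply Rmin_r]).
  specialize (Hc x Hx1). rewrite H1 in Hc. assert (Hm1 := Rmin_l T 1). assert (Hm2 := Rmin_r T 1).
  assert (Hvx : Cmod (v x) <= 2).
  { replace (v x) with ((v x - 1) + 1)%C by ring. eapply Rle_trans; [apply Cmod_triangle|]. rewrite Cmod_1. lra. }
  assert (HH : Cmod (1 - y) <= Cmod ((y' - y) * v x + y * (v x - 1))%C).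
  { right. f_equal. replace (1 - y)%C with ((1 - y' * v x) + ((y' - y) * v x + y * (v x - 1)))%C by ring. rewrite E. ring. }
  fold D in HH.
  assert (HH2 : Cmod ((y' - y) * v x + y * (v x - 1))%C <= Cmod (y' - y) * Cmod (v x) + Cmod y * Cmod (v x - 1)).
  { rewrite <- !Cmod_mult. apply Cmod_triangle. }
  assert (A1 : Cmod (y' - y) * Cmod (v x) <= D / 8 * 2) by (apply Rmult_le_compat; try apply Cmod_ge_0; lra).
  assert (A2 : Cmod y * Cmod (v x - 1) <= (Cmod y + 1) * T) by (apply Rmult_le_compat; try apply Cmod_ge_0; lra).
  replace ((Cmod y + 1) * T) with (D / 4) in A2 by (unfold T; field; lra). lra.
Qed.

(** The two definitions of the product agree where they overlap and neither has a singularity, so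
    the tube lemma applies at x = 1. *)
Lemma cleared_bounded F phi v0 v1 d0 :
  (forall x y, Cmod x <= 1 -> Cmod y <= 1 -> ~ (x = 1%C /\ y = 1%C) -> regular2 F x y) ->
  regular2 phi 1 1 -> hol_at v0 1 -> hol_at v1 1 -> v0 1%C = 1%C -> v1 1%C = 1%C -> 0 < d0 ->
  (forall x y, Cmod (x - 1) < d0 -> Cmod (y - 1) < d0 -> (1 - y * v0 x <> 0)%C -> (1 - y * v1 x <> 0)%C ->
     (F x y * ((1 - y * v0 x) * (1 - y * v1 x)) = phi x y)%C) ->
  exists d, 0 < d /\ forall x y, Cmod (x - 1) < d -> Cmod y < 1 + d -> slice_bounded (cleared F phi v0 v1 d0) x y (/ d).
Proof.
  intros HF Hphi Hv0 Hv1 E0 E1 Hd0 Hid. apply slice_bounded_tube. intros y Hy.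
  destruct (Ceq_dec y 1) as [->|Hy1].
  - destruct (regular2_slices phi 1 1 Hphi) as (e & He & Hg).
    apply (slice_bounded_box _ _ _ (Rmin e d0) (/ e)); [now apply Rmin_glb_lt|]. intros x y' Hx Hy'.
    assert (X1 : Cmod (x - 1) < e) by (eapply Rlt_le_trans; [exact Hx|apply Rmin_l]).
    assert (X2 : Cmod (x - 1) < d0) by (eapply Rlt_le_trans; [exact Hx|apply Rmin_r]).
    assert (Y1 : Cmod (y' - 1) < e) by (eapply Rlt_le_trans; [exact Hy'|apply Rmin_l]).
    assert (Y2 : Cmod (y' - 1) < d0) by (eapply Rlt_le_trans; [exact Hy'|apply Rmin_r]).
    assert (HE : forall w, Cmod (w - y') < d0 - Cmod (y' - 1) -> phi x w = cleared F phi v0 v1 d0 x w).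
    { intros w Hw. unfold cleared. destruct (excluded_middle_informative _) as [_|N]; [reflexivity|].
      destruct N. split; [exact X2|]. generalize (Cmod_sub_tri w y' 1). lra. }
    destruct (Hg x y' X1 Y1) as [G1 G2]. split.
    + refine (hol_ext _ _ _ _ _ HE G1). lra.
    + rewrite <- HE; [exact G2|]. rewrite Cmod_diag. lra.
  - destruct (sheet_neq v0 y Hv0 E0 Hy1) as (e0 & He0 & Hn0). destruct (sheet_neq v1 y Hv1 E1 Hy1) as (e1 & He1 & Hn1).
    destruct (regular2_slices F 1 y) as (e & He & Hg).
    { apply HF; [rewrite Cmod_1; lra|exact Hy|]. intros [_ N]. contradiction. }
    assert (Hb : forall v, hol_at v 1 -> v 1%C = 1%C -> exists b, 0 < b /\ forall x, Cmod (x - 1) < b -> Cmod (v x) <= 2).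
    { intros v Hv Ev. destruct (hol_cont v 1 Hv 1 Rlt_0_1) as (b & Hb & Hc). exists b. split; [exact Hb|].
      intros x Hx. specialize (Hc x Hx). rewrite Ev in Hc. replace (v x) with ((v x - 1) + 1)%C by ring.
      eapply Rle_trans; [apply Cmod_triangle|]. rewrite Cmod_1. lra. }
    destruct (Hb v0 Hv0 E0) as (b0 & Hb0 & Hv0b). destruct (Hb v1 Hv1 E1) as (b1 & Hb1 & Hv1b).
    set (m := Rmin (Rmin (Rmin e0 e1) (Rmin b0 b1)) (Rmin e 1)).
    assert (Hm : 0 < m /\ m <= e0 /\ m <= e1 /\ m <= b0 /\ m <= b1 /\ m <= e /\ m <= 1).
    { unfold m. split; [repeat apply Rmin_glb_lt; lra|].
      generalize (Rmin_l (Rmin (Rmin e0 e1) (Rmin b0 b1)) (Rmin e 1)) (Rmin_r (Rmin (Rmin e0 e1) (Rmin b0 b1)) (Rmin e 1))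
        (Rmin_l (Rmin e0 e1) (Rmin b0 b1)) (Rmin_r (Rmin e0 e1) (Rmin b0 b1)) (Rmin_l e0 e1) (Rmin_r e0 e1) (Rmin_l b0 b1) (Rmin_r b0 b1) (Rmin_l e 1) (Rmin_r e 1). lra. }
    destruct Hm as (Hm & M0 & M1 & M2 & M3 & M4 & M5).
    apply (slice_bounded_box _ _ _ m (/ e * 49)); [exact Hm|]. intros x y' Hx Hy'.
    assert (HE : forall w, Cmod (w - y') < m - Cmod (y' - y) -> (F x w * ((1 - w * v0 x) * (1 - w * v1 x)))%C = cleared F phi v0 v1 d0 x w).
    { intros w Hw. assert (Hwy : Cmod (w - y) < m) by (generalize (Cmod_sub_tri w y' y); lra).
      unfold cleared. destruct (excluded_middle_informative _) as [[D1 D2]|_]; [|reflexivity].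
      apply Hid; auto; [apply Hn0|apply Hn1]; lra. }
    destruct (Hg x y') as [G1 G2]; try lra. split.
    + refine (hol_ext _ _ _ _ _ HE _); [lra|].
      assert (Hl : forall v : C -> C, hol_at (fun w => 1 - w * v x)%C y').
      { intros v. apply hol_minus; [apply hol_const|]. apply hol_mult; [apply hol_id|apply hol_const]. }
      apply hol_mult; [exact G1|]. apply hol_mult; apply Hl.
    + rewrite <- HE by (rewrite Cmod_diag; lra). rewrite !Cmod_mult.
      assert (Hy'b : Cmod y' <= 2).
      { replace y' with ((y' - y) + y)%C by ring. eapply Rle_trans; [apply Cmod_triangle|]. lra. }
      assert (Hl : forall v : C -> C, Cmod (v x) <= 2 -> Cmod (1 - y' * v x) <= 7).
      { intros v Hvx. eapply Rle_trans; [apply Cmod_minus_le|]. rewrite Cmod_1, Cmod_mult.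
        assert (Cmod y' * Cmod (v x) <= 2 * 2) by (apply Rmult_le_compat; try apply Cmod_ge_0; lra). lra. }
      assert (L0 := Hl v0 (Hv0b x ltac:(lra))). assert (L1 := Hl v1 (Hv1b x ltac:(lra))).
      assert (Cmod (1 - y' * v0 x) * Cmod (1 - y' * v1 x) <= 7 * 7) by (apply Rmult_le_compat; try apply Cmod_ge_0; lra).
      apply Rmult_le_compat; try apply Cmod_ge_0; [|exact G2|lra].
      apply Rmult_le_pos; apply Cmod_ge_0.
Qed.

(** Divide out one pole at a time: g = F (1 - y v1) has the single pole 1/v0, and likewise with the
    indices exchanged. By [simple_pole_coefficients] both sequences of coefficients are geometric up
    to a small error, and (v0 - v1) f_s is the difference of v0 g_s and v1 g'_s. *)
Lemma slice_two_poles F phi v0 v1 d0 A r0 d x s : summable_bidisk A -> 0 < r0 <= 1 -> 0 < d0 < 1 ->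
  ps r0 (fun s => slice A s x) (F x) -> 0 < d ->
  (forall y, Cmod y < 1 + d -> slice_bounded (cleared F phi v0 v1 d0) x y (/ d)) ->
  Cmod (x - 1) < d0 -> v0 x <> 0%C -> v1 x <> 0%C -> Cmod (v0 x) <= 1 -> Cmod (v1 x) <= 1 ->
  Cmod (/ v0 x - 1) < d0 -> Cmod (/ v1 x - 1) < d0 -> Cmod (/ v0 x) <= 1 + d / 4 -> Cmod (/ v1 x) <= 1 + d / 4 ->
  Cmod ((v0 x - v1 x) * slice A s x - (v0 x * phi x (/ v0 x)%C * v0 x ^ s - v1 x * phi x (/ v1 x)%C * v1 x ^ s))%C
    <= 2 * (/ d * / (1 - (1 + d / 4) / (1 + d / 2))) * (/ (1 + d / 2)) ^ s.
Proof.
  intros HA Hr0 Hd0 Hps Hd Hg Hx Hn0 Hn1 Hv0 Hv1 Hi0 Hi1 Hb0 Hb1.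
  set (P := cleared F phi v0 v1 d0 x).
  assert (HP : hol_on (1 + d) P) by (intros y Hy; now apply Hg).
  assert (HPb : forall y, Cmod y < 1 + d -> Cmod (P y) <= / d) by (intros y Hy; now apply Hg).
  set (r := Rmin r0 (1 - d0)).
  assert (Hr : 0 < r <= 1 + d /\ r <= r0 /\ r <= 1 - d0).
  { unfold r. generalize (Rmin_l r0 (1 - d0)) (Rmin_r r0 (1 - d0)). intros. split; [split; [apply Rmin_glb_lt; lra|lra]|lra]. }
  destruct Hr as (Hr & Hr1 & Hr2).
  assert (Hpsr : ps r (fun s => slice A s x) (F x)) by (apply (ps_sub r0); [exact Hr1|exact Hps]).
  assert (HPF : forall y, Cmod y < r -> P y = (F x y * ((1 - y * v0 x) * (1 - y * v1 x)))%C).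
  { intros y Hy. unfold P, cleared. destruct (excluded_middle_informative _) as [[_ N]|_]; [|reflexivity].
    exfalso. generalize (Cmod_ge_sub 1 y). rewrite Cmod_1, Cmod_sub_sym. lra. }
  assert (HPphi : forall y, Cmod (y - 1) < d0 -> P y = phi x y).
  { intros y Hy. unfold P, cleared. destruct (excluded_middle_informative _) as [_|N]; [reflexivity|]. destruct N. auto. }
  set (q := fun t => / d * / (1 - t / (1 + d / 2))).
  assert (Hq : forall t, t <= 1 + d / 4 -> q t <= q (1 + d / 4)).
  { intros t Ht. unfold q. apply Rmult_le_compat_l; [apply Rlt_le, Rinv_0_lt_compat, Hd|].
    assert (Hi : 0 < / (1 + d / 2)) by (apply Rinv_0_lt_compat; lra).
    assert (H1 : (1 + d / 2) * / (1 + d / 2) = 1) by (apply Rinv_r; lra).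
    apply Rinv_le_contravar; unfold Rdiv in *; nra. }
  assert (Hpow : 0 <= (/ (1 + d / 2)) ^ s) by (apply pow_le, Rlt_le, Rinv_0_lt_compat; lra).
  assert (O0 := simple_pole_coefficients (1 + d) P (/ d) (v0 x) (linear_factor_coef (v1 x) (fun s => slice A s x)) (fun y => (1 - y * v1 x) * F x y)%C r (1 + d / 2) s
    Hr HP HPb Hn0 ltac:(lra) ltac:(lra) (ps_linear_factor r (v1 x) _ _ Hpsr)).
  specialize (O0 ltac:(intros y Hy; rewrite HPF by exact Hy; ring)).
  assert (O1 := simple_pole_coefficients (1 + d) P (/ d) (v1 x) (linear_factor_coef (v0 x) (fun s => slice A s x)) (fun y => (1 - y * v0 x) * F x y)%C r (1 + d / 2) s
    Hr HP HPb Hn1 ltac:(lra) ltac:(lra) (ps_linear_factor r (v0 x) _ _ Hpsr)).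
  specialize (O1 ltac:(intros y Hy; rewrite HPF by exact Hy; ring)).
  rewrite HPphi in O0 by exact Hi0. rewrite HPphi in O1 by exact Hi1.
  fold (q (Cmod (/ v0 x))) in O0. fold (q (Cmod (/ v1 x))) in O1. fold (q (1 + d / 4)).
  set (G0 := linear_factor_coef (v1 x) (fun s => slice A s x) s) in *. set (G1 := linear_factor_coef (v0 x) (fun s => slice A s x) s) in *.
  assert (EG : ((v0 x - v1 x) * slice A s x = v0 x * G0 - v1 x * G1)%C).
  { unfold G0, G1, linear_factor_coef. destruct s; ring. }
  replace ((v0 x - v1 x) * slice A s x - (v0 x * phi x (/ v0 x)%C * v0 x ^ s - v1 x * phi x (/ v1 x)%C * v1 x ^ s))%C
    with (v0 x * (G0 - v0 x ^ s * phi x (/ v0 x)) - v1 x * (G1 - v1 x ^ s * phi x (/ v1 x)))%C by (rewrite EG; ring).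
  eapply Rle_trans; [apply Cmod_minus_le|]. rewrite !Cmod_mult.
  assert (B0 : Cmod (G0 - v0 x ^ s * phi x (/ v0 x))%C <= q (1 + d / 4) * (/ (1 + d / 2)) ^ s).
  { eapply Rle_trans; [exact O0|]. apply Rmult_le_compat_r; [exact Hpow|now apply Hq]. }
  assert (B1 : Cmod (G1 - v1 x ^ s * phi x (/ v1 x))%C <= q (1 + d / 4) * (/ (1 + d / 2)) ^ s).
  { eapply Rle_trans; [exact O1|]. apply Rmult_le_compat_r; [exact Hpow|now apply Hq]. }
  set (Y := q (1 + d / 4) * (/ (1 + d / 2)) ^ s) in *.
  assert (Cmod (v0 x) * Cmod (G0 - v0 x ^ s * phi x (/ v0 x))%C <= 1 * Y) by (apply Rmult_le_compat; try apply Cmod_ge_0; assumption).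
  assert (Cmod (v1 x) * Cmod (G1 - v1 x ^ s * phi x (/ v1 x))%C <= 1 * Y) by (apply Rmult_le_compat; try apply Cmod_ge_0; assumption).
  rewrite Rmult_assoc. fold Y. lra.
Qed.

Lemma coef_slice A rho r s : summable_bidisk A -> 0 < rho < 1 -> A r s = coef (slice A s) rho r.
Proof.
  intros HA Hr. assert (Hps := slice_ps A s HA).
  apply (ps_coef 1 1 (fun r => A r s)); [lra|exact Hps|exact (ps_hol_on _ _ _ Hps)|exact Hr].
Qed.

(** * The coefficients as two integrals *)

Lemma Cint_minus_on f g a b : a <= b -> (forall t, a <= t <= b -> rcont f t) -> (forall t, a <= t <= b -> rcont g t) ->
  Cint (fun t => f t - g t)%C a b = (Cint f a b - Cint g a b)%C.
Proof.
  intros Hab Hf Hg. unfold Cint.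
  apply (RInt_minus (V := C_R_CompleteNormedModule)); now apply Cint_ex.
Qed.

Lemma cir_Cexp eta t : cir (exp (- eta)) t = Cexp (- eta, t)%R.
Proof. rewrite pair_C, Cexp_plus, Cexp_R. reflexivity. Qed.

Lemma Cinv_Cexp z : (/ Cexp z = Cexp (- z))%C.
Proof.
  assert (E := Cexp_opp z). assert (H := Cexp_neq_0 z).
  replace (Cexp (- z)) with (/ Cexp z * (Cexp z * Cexp (- z)))%C by (field; exact H). rewrite E. ring.
Qed.

Lemma inv_pow_exp a k s : 0 < a -> k <= ln a -> (/ a) ^ s <= exp (- k * INR s).
Proof.
  intros Ha Hk. rewrite exp_INR. apply pow_incr. split; [now apply Rlt_le, Rinv_0_lt_compat|].
  rewrite <- (exp_ln a Ha) at 1. rewrite <- exp_Ropp. apply exp_le. lra.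
Qed.

Lemma sheet_log v R0 : 0 < R0 -> (forall z, Cmod z < R0 -> hol_at v (Cexp z)) -> v 1%C = 1%C ->
  (forall z, Cmod z < R0 -> v (Cexp z) <> 0%C) ->
  exists f, hol_on R0 f /\ f 0%C = 0%C /\ (forall z, Cmod z < R0 -> v (Cexp z) = Cexp (f z)) /\
    forall z, Cmod z < R0 -> C_derive f z = (Cexp z * C_derive v (Cexp z) / v (Cexp z))%C.
Proof.
  intros HR0 Hv Ev Hn.
  assert (HV : hol_on R0 (fun z => v (Cexp z))).
  { intros z Hz. apply (hol_comp Cexp v); [apply hol_Cexp|now apply Hv]. }
  destruct (hol_log R0 _ HR0 HV Hn) as (f & Hf & Hf0 & Hfe & Hfd).
  exists f. split; [exact Hf|]. split; [exact Hf0|]. split.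
  - intros z Hz. rewrite (Hfe z Hz), Cexp_0, Ev. ring.
  - intros z Hz. rewrite (Hfd z Hz). f_equal.
    rewrite (cderiv_C_derive _ _ _ (cderiv_comp Cexp v z _ _ (cderiv_Cexp z) (hol_cderiv _ _ (Hv z Hz)))). ring.
Qed.

(** This is the quantity that [phase_nondegenerate] requires to be nonzero, up to normalization. *)
Lemma log_deriv2 v f R0 : 0 < R0 -> hol_at v 1 -> v 1%C = 1%C -> hol_on R0 f ->
  (forall z, Cmod z < R0 -> C_derive f z = (Cexp z * C_derive v (Cexp z) / v (Cexp z))%C) ->
  C_derive (C_derive f) 0 = C_derive (fun x => x * C_derive v x / v x)%C 1.
Proof.
  intros HR0 Hv Ev Hf Hfd. apply cderiv_C_derive.
  assert (Hl : hol_at (fun x => x * C_derive v x / v x)%C 1).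
  { apply hol_div; [apply hol_mult; [apply hol_id|now apply hol_at_deriv]|exact Hv|rewrite Ev; apply C1_nz]. }
  apply (cderiv_ext (fun z => (fun x => x * C_derive v x / v x)%C (Cexp z)) _ _ _ R0 HR0).
  - intros y Hy. rewrite Hfd; [reflexivity|]. now replace (y - 0)%C with y in Hy by ring.
  - eapply cderiv_eq.
    + apply (cderiv_comp Cexp (fun x => x * C_derive v x / v x)%C); [apply cderiv_Cexp|]. rewrite Cexp_0. now apply hol_cderiv.
    + rewrite Cexp_0. ring.
Qed.

(** The order of the quantifiers matters: the rate ka depends only on the angle del that separates
    the far arc, and eta, the distance of the contour from the unit circle, is chosen small
    afterwards so that the factor x^(-r) does not spoil the rate for r <= C0 s. *)
Definition pole_integral_approximation (A : nat -> nat -> C) (h0 f0 h1 f1 : C -> C) : Prop :=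
  exists del0, 0 < del0 /\ forall del, 0 < del < del0 -> exists ka, 0 < ka /\ forall C0, exists eta0, 0 < eta0 /\
    forall eta, 0 < eta < eta0 -> exists M, forall r s : nat, INR r <= C0 * INR s ->
      Cmod (A r s - (pole_integral h0 f0 eta del (INR r) (INR s) + pole_integral h1 f1 eta del (INR r) (INR s)))%C <= M * exp (- ka * INR s).

(** Cauchy's integral for the coefficient of x^r in f_s, on the circle of radius e^(-eta). The far
    arc is controlled by [slice_decay]; near x = 1 the function f_s is replaced by the two powers of
    [slice_two_poles], divided by u_0 - u_1, which is z times a nonvanishing function of z = log x.
    *)
Lemma coefficients_as_pole_integrals A (F phi : C -> C -> C) (v0 v1 : C -> C) d0 : summable_bidisk A ->
  (exists r0, 0 < r0 <= 1 /\ forall x y, Cmod x < r0 -> Cmod y < r0 -> cser2 (monomials A x y) (F x y)) ->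
  (forall x y, Cmod x <= 1 -> Cmod y <= 1 -> ~ (x = 1%C /\ y = 1%C) -> regular2 F x y) ->
  regular2 phi 1 1 -> hol_at v0 1 -> hol_at v1 1 -> v0 1%C = 1%C -> v1 1%C = 1%C ->
  C_derive v0 1 <> C_derive v1 1 -> 0 < d0 < 1 ->
  (forall x y, Cmod (x - 1) < d0 -> Cmod (y - 1) < d0 -> (1 - y * v0 x <> 0)%C -> (1 - y * v1 x <> 0)%C ->
     (F x y * ((1 - y * v0 x) * (1 - y * v1 x)) = phi x y)%C) ->
  (forall x, Cmod x <= 1 -> x <> 1%C -> Cmod (x - 1) < d0 -> Cmod (v0 x) < 1 /\ Cmod (v1 x) < 1) ->
  exists R0 (f0 f1 h0 h1 : C -> C), 0 < R0 /\ hol_on R0 f0 /\ hol_on R0 f1 /\ hol_on R0 h0 /\ hol_on R0 h1 /\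
    f0 0%C = 0%C /\ f1 0%C = 0%C /\
    C_derive f0 0 = C_derive v0 1 /\ C_derive f1 0 = C_derive v1 1 /\
    C_derive (C_derive f0) 0 = C_derive (fun x => x * C_derive v0 x / v0 x)%C 1 /\
    C_derive (C_derive f1) 0 = C_derive (fun x => x * C_derive v1 x / v1 x)%C 1 /\
    on_axis_neg R0 f0 /\ on_axis_neg R0 f1 /\
    h0 0%C = (phi 1 1 / (C_derive v0 1 - C_derive v1 1))%C /\ h1 0%C = (phi 1 1 / (C_derive v1 1 - C_derive v0 1))%C /\
    pole_integral_approximation A h0 f0 h1 f1.
Proof.
  intros HA (r0 & Hr0 & Hser) HF Hphi Hv0 Hv1 Ev0 Ev1 Hne Hd0 Hid Hlt.
  assert (Hslice : forall x, Cmod x < 1 -> ps r0 (fun s => slice A s x) (F x)).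
  { intros x Hx. apply (slice_expand A F r0 x HA Hr0 Hser); [|exact Hx].
    intros y Hy x' Hx'. apply regular2_hol_fst, HF; try lra. intros [E _]. rewrite E, Cmod_1 in Hx'. lra. }
  destruct (cleared_bounded F phi v0 v1 d0 HF Hphi Hv0 Hv1 Ev0 Ev1 (proj1 Hd0) Hid) as (d & Hd & Hcl).
  destruct Hphi as (dp & Bp & Hdp & Hph & _).
  destruct (hol_near v0 1 Hv0) as (b0 & Hb0 & Hv0n). destruct (hol_near v1 1 Hv1) as (b1 & Hb1 & Hv1n).
  set (lim := Rmin (Rmin d0 (d / 4)) dp).
  assert (Hlim : 0 < lim /\ lim <= d0 /\ lim <= d / 4 /\ lim <= dp).
  { unfold lim. generalize (Rmin_l (Rmin d0 (d / 4)) dp) (Rmin_r (Rmin d0 (d / 4)) dp) (Rmin_l d0 (d / 4)) (Rmin_r d0 (d / 4)).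
    intros. split; [repeat apply Rmin_glb_lt; lra|lra]. }
  destruct Hlim as (Hlim & Hlim1 & Hlim2 & Hlim3).
  assert (HVh : forall v, hol_at v 1 -> hol_at (fun z => v (Cexp z)) 0).
  { intros v Hv. apply (hol_comp Cexp v); [apply hol_Cexp|now rewrite Cexp_0]. }
  destruct (hol_near0 Cexp (Rmin lim (Rmin b0 b1)) (hol_Cexp 0)) as (e1 & He1 & HE1); [repeat apply Rmin_glb_lt; lra|].
  assert (Hinv : forall v, hol_at v 1 -> v 1%C = 1%C -> exists e, 0 < e /\ forall z, Cmod z < e -> v (Cexp z) <> 0%C /\ Cmod (/ v (Cexp z) - 1) < lim).
  { intros v Hv Ev. assert (HV := HVh v Hv).
    assert (Hn : v (Cexp 0) <> 0%C) by (rewrite Cexp_0, Ev; apply C1_nz).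
    destruct (ccont_neq _ 0 0 (hol_cont _ _ HV) Hn) as (e & He & Hne').
    destruct (hol_near0 (fun z => / v (Cexp z))%C lim (hol_inv _ _ HV Hn) Hlim) as (e' & He' & Hi).
    exists (Rmin e e'). split; [now apply Rmin_glb_lt|]. intros z Hz.
    assert (Z1 : Cmod z < e) by (eapply Rlt_le_trans; [exact Hz|apply Rmin_l]).
    assert (Z2 : Cmod z < e') by (eapply Rlt_le_trans; [exact Hz|apply Rmin_r]).
    split; [apply Hne'; now replace (z - 0)%C with z by ring|].
    specialize (Hi z Z2). cbv beta in Hi. rewrite Cexp_0, Ev in Hi. now replace (/ 1)%C with (RtoC 1) in Hi by field. }
  destruct (Hinv v0 Hv0 Ev0) as (e2 & He2 & HE2). destruct (Hinv v1 Hv1 Ev1) as (e3 & He3 & HE3).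
  set (W := fun z => (v0 (Cexp z) - v1 (Cexp z))%C).
  set (Ra := Rmin (Rmin e1 (Rmin e2 e3)) 1).
  assert (HRa : 0 < Ra /\ Ra <= e1 /\ Ra <= e2 /\ Ra <= e3 /\ Ra <= 1).
  { unfold Ra. generalize (Rmin_l (Rmin e1 (Rmin e2 e3)) 1) (Rmin_r (Rmin e1 (Rmin e2 e3)) 1) (Rmin_l e1 (Rmin e2 e3)) (Rmin_r e1 (Rmin e2 e3)) (Rmin_l e2 e3) (Rmin_r e2 e3).
    intros. split; [repeat apply Rmin_glb_lt; lra|lra]. }
  destruct HRa as (HRa & Ha1 & Ha2 & Ha3 & Ha4).
  assert (HX : forall z, Cmod z < Ra -> Cmod (Cexp z - 1) < lim /\ Cmod (Cexp z - 1) < b0 /\ Cmod (Cexp z - 1) < b1).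
  { intros z Hz. specialize (HE1 z ltac:(lra)). rewrite Cexp_0 in HE1.
    generalize (Rmin_l lim (Rmin b0 b1)) (Rmin_r lim (Rmin b0 b1)) (Rmin_l b0 b1) (Rmin_r b0 b1). lra. }
  assert (Hhv0 : forall z, Cmod z < Ra -> hol_at v0 (Cexp z)) by (intros z Hz; apply Hv0n; now apply HX).
  assert (Hhv1 : forall z, Cmod z < Ra -> hol_at v1 (Cexp z)) by (intros z Hz; apply Hv1n; now apply HX).
  assert (HWh : hol_on Ra W).
  { intros z Hz. apply hol_minus; [apply (hol_comp Cexp v0)|apply (hol_comp Cexp v1)]; auto using hol_Cexp. }
  assert (HW0 : W 0%C = 0%C) by (unfold W; rewrite Cexp_0, Ev0, Ev1; ring).
  assert (H0Ra : Cmod 0 < Ra) by (rewrite Cmod_0; exact HRa).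
  set (m := divz W). assert (Hm : hol_on Ra m) by now apply hol_divz.
  assert (Em : forall z, W z = (z * m z)%C) by (intros z; rewrite (divz_eq W z), HW0; unfold m; ring).
  assert (Em0 : m 0%C = (C_derive v0 1 - C_derive v1 1)%C).
  { unfold m. rewrite divz_0. apply cderiv_C_derive. unfold W. eapply cderiv_eq.
    - apply cderiv_plus.
      + apply (cderiv_comp Cexp v0); [apply cderiv_Cexp|rewrite Cexp_0; now apply hol_cderiv].
      + apply (cderiv_ext (fun z => (-1) * v1 (Cexp z))%C _ _ _ 1 Rlt_0_1); [intros; ring|].
        apply cderiv_mult; [apply cderiv_const|].
        apply (cderiv_comp Cexp v1); [apply cderiv_Cexp|rewrite Cexp_0; now apply hol_cderiv].
    - cbv beta. rewrite Cexp_0. ring. }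
  assert (Hm0 : m 0%C <> 0%C) by (rewrite Em0; now apply Cminus_eq_contra).
  set (mu := Cmod (m 0%C) / 2). assert (Hmu : 0 < mu) by (unfold mu; assert (0 < Cmod (m 0%C)) by (now apply Cmod_gt_0); lra).
  destruct (hol_near0 m mu (Hm 0%C H0Ra) Hmu) as (e4 & He4 & HE4).
  set (R0 := Rmin Ra e4). assert (HR0 : 0 < R0) by now apply Rmin_glb_lt.
  assert (HR0a : R0 <= Ra) by apply Rmin_l. assert (HR0e : R0 <= e4) by apply Rmin_r.
  assert (Hmb : forall z, Cmod z < R0 -> mu <= Cmod (m z)).
  { intros z Hz. specialize (HE4 z ltac:(lra)). rewrite Cmod_sub_sym in HE4. generalize (Cmod_ge_sub (m 0%C) (m z)). unfold mu in *. lra. }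
  assert (Hmn : forall z, Cmod z < R0 -> m z <> 0%C) by (intros z Hz; apply Cmod_gt_0; specialize (Hmb z Hz); lra).
  destruct (sheet_log v0 R0 HR0) as (f0 & Hf0 & Hf00 & Hf0e & Hf0d); auto.
  { intros z Hz. apply Hhv0. lra. } { intros z Hz. apply HE2. lra. }
  destruct (sheet_log v1 R0 HR0) as (f1 & Hf1 & Hf10 & Hf1e & Hf1d); auto.
  { intros z Hz. apply Hhv1. lra. } { intros z Hz. apply HE3. lra. }
  set (h0 := fun z => (v0 (Cexp z) * phi (Cexp z) (/ v0 (Cexp z))%C / m z)%C).
  set (h1 := fun z => (- (v1 (Cexp z) * phi (Cexp z) (/ v1 (Cexp z))%C / m z))%C).
  assert (Hhh : forall v, (forall z, Cmod z < R0 -> hol_at v (Cexp z) /\ v (Cexp z) <> 0%C /\ Cmod (/ v (Cexp z) - 1) < lim) ->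
     hol_on R0 (fun z => (v (Cexp z) * phi (Cexp z) (/ v (Cexp z))%C / m z)%C)).
  { intros v Hv z Hz. destruct (Hv z Hz) as (H1 & H2 & H3).
    assert (HV : hol_at (fun z => v (Cexp z)) z) by (apply (hol_comp Cexp v); [apply hol_Cexp|exact H1]).
    apply hol_div; [|apply Hm; lra|now apply Hmn]. apply hol_mult; [exact HV|].
    apply (Hph Cexp (fun z => / v (Cexp z))%C z); [|lra|apply hol_Cexp|now apply hol_inv].
    assert (Cmod (Cexp z - 1) < lim) by (apply HX; lra). lra. }
  assert (Hh0 : hol_on R0 h0).
  { apply Hhh. intros z Hz. split; [apply Hhv0; lra|]. apply HE2. lra. }
  assert (Hh1 : hol_on R0 h1).
  { intros z Hz. unfold h1. apply hol_opp. apply (Hhh v1); [|exact Hz]. intros w Hw'. split; [apply Hhv1; lra|]. apply HE3. lra. }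
  assert (Hdiff : (C_derive v0 1 - C_derive v1 1 <> 0)%C) by (rewrite <- Em0; exact Hm0).
  assert (Hdiff' : (C_derive v1 1 - C_derive v0 1 <> 0)%C) by (now apply Cminus_eq_contra, not_eq_sym).
  assert (H0R0 : Cmod 0 < R0) by (rewrite Cmod_0; exact HR0).
  assert (Hax : forall v f, (forall x, Cmod x <= 1 -> x <> 1%C -> Cmod (x - 1) < d0 -> Cmod (v x) < 1) ->
     (forall z, Cmod z < R0 -> v (Cexp z) = Cexp (f z)) -> on_axis_neg R0 f).
  { intros v f Hv Hf t Ht.
    assert (Ez : ((0, t)%R : C) = (Ci * RtoC t)%C) by (rewrite pair_C; ring).
    assert (Hz : Cmod (0, t)%R < R0) by (rewrite Ez, Cmod_mult, Cmod_Ci, Cmod_R; lra).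
    assert (Ec : Cexp (0, t)%R = cir 1 t) by (rewrite Ez; unfold cir; ring).
    assert (Hvx : Cmod (v (Cexp (0, t)%R)) < 1).
    { apply Hv.
      - rewrite Ec, Cmod_cir; lra.
      - rewrite Ec. apply cir_neq_1. generalize PI2_1. lra.
      - assert (Cmod (Cexp (0, t)%R - 1) < lim) by (apply HX; lra). lra. }
    rewrite (Hf _ Hz), Cmod_Cexp, <- exp_0 in Hvx. now apply exp_lt_inv. }
  exists R0, f0, f1, h0, h1. do 7 (split; [assumption|]).
  split; [rewrite (Hf0d 0%C H0R0), Cexp_0, Ev0; field|].
  split; [rewrite (Hf1d 0%C H0R0), Cexp_0, Ev1; field|].
  split; [now apply (log_deriv2 v0 f0 R0)|]. split; [now apply (log_deriv2 v1 f1 R0)|].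
  split; [apply (Hax v0); [intros; now apply Hlt|exact Hf0e]|]. split; [apply (Hax v1); [intros; now apply Hlt|exact Hf1e]|].
  split; [unfold h0; rewrite Em0, Cexp_0, Ev0; replace (/ 1)%C with (RtoC 1) by field; field; exact Hdiff|].
  split; [unfold h1; rewrite Em0, Cexp_0, Ev1; replace (/ 1)%C with (RtoC 1) by field; field; split; assumption|].
  exists (R0 / 4). split; [lra|]. intros del Hdel.
  destruct (slice_bounded_far F del HF (proj1 Hdel)) as (dF & HdF & Hfar).
  (* the rate on the circles of radius 1 + d/2 near x = 1 and 1 + dF/2 on the far arc *)
  set (k1 := Rmin (ln (1 + d / 2)) (ln (1 + dF / 2))).
  assert (Hk1 : 0 < k1) by (apply Rmin_glb_lt; rewrite <- ln_1; apply ln_increasing; lra).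
  assert (Hk1a : k1 <= ln (1 + d / 2)) by apply Rmin_l. assert (Hk1b : k1 <= ln (1 + dF / 2)) by apply Rmin_r.
  exists (k1 / 2). split; [lra|]. intros C0.
  (* half of the rate is spent on the factor e^(r eta) *)
  assert (HC0 := Rabs_pos C0). set (et := k1 / (2 * (Rabs C0 + 1))). assert (Het : 0 < et) by (apply Rdiv_lt_0_compat; lra).
  exists (Rmin (R0 / 4) (Rmin dF et)). split; [repeat apply Rmin_glb_lt; lra|]. intros eta Heta.
  assert (Heta' : 0 < eta /\ eta < R0 / 4 /\ eta < dF /\ eta < et).
  { generalize (Rmin_l (R0 / 4) (Rmin dF et)) (Rmin_r (R0 / 4) (Rmin dF et)) (Rmin_l dF et) (Rmin_r dF et). lra. }
  destruct Heta' as (Heta0 & Heta1 & Heta2 & Heta3).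
  set (Cn := 2 * (/ d * / (1 - (1 + d / 4) / (1 + d / 2)))).
  assert (HCn : 0 <= Cn).
  { unfold Cn. assert (Hi : 0 < / (1 + d / 2)) by (apply Rinv_0_lt_compat; lra).
    assert (Hi1 : (1 + d / 2) * / (1 + d / 2) = 1) by (apply Rinv_r; lra).
    assert (0 < 1 - (1 + d / 4) / (1 + d / 2)) by (unfold Rdiv in *; nra).
    apply Rmult_le_pos; [lra|]. apply Rmult_le_pos; apply Rlt_le, Rinv_0_lt_compat; assumption. }
  set (Mn := Cn / (eta * mu)). assert (Hemu : 0 < eta * mu) by (now apply Rmult_lt_0_compat).
  assert (HMn : 0 <= Mn) by (apply Rmult_le_pos; [exact HCn|now apply Rlt_le, Rinv_0_lt_compat]).
  assert (HPI := PI2_1). assert (HidF : 0 < / dF) by now apply Rinv_0_lt_compat.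
  exists (PI * / dF + PI * / dF + 2 * del * Mn). intros r s Hrs.
  assert (Hs := pos_INR s). assert (Hr := pos_INR r).
  set (rho := exp (- eta)). assert (Hrho : 0 < rho < 1).
  { split; [apply exp_pos|]. rewrite <- exp_0. apply exp_increasing. lra. }
  set (E := exp (- (k1 / 2) * INR s)). assert (HEp : 0 < E) by apply exp_pos.
  assert (Hexp : exp (INR r * eta) * exp (- k1 * INR s) <= E).
  { rewrite <- exp_plus. apply exp_le.
    assert (H1 : INR r * eta <= (Rabs C0 * INR s) * et).
    { apply Rmult_le_compat; try lra. eapply Rle_trans; [exact Hrs|]. apply Rmult_le_compat_r; [exact Hs|apply Rle_abs]. }
    assert (H2 : Rabs C0 * INR s * et <= k1 / 2 * INR s).
    { replace (k1 / 2 * INR s) with ((Rabs C0 + 1) * INR s * et) by (unfold et; field; lra).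
      apply Rmult_le_compat_r; [lra|]. apply Rmult_le_compat_r; lra. }
    lra. }
  set (I := fun t => (slice A s (cir rho t) * (/ cir rho t) ^ r)%C).
  assert (HIc : forall t, rcont I t).
  { intros t. apply (hol_cir_cont 1); [|exact Hrho]. exact (ps_hol_on _ _ _ (slice_ps A s HA)). }
  assert (HImod : forall t, Cmod (I t) = Cmod (slice A s (cir rho t)) * exp (INR r * eta)).
  { intros t. unfold I. rewrite Cmod_mult, Cmod_pow, Cmod_inv by (apply cir_neq_0; lra). rewrite Cmod_cir by lra. f_equal.
    unfold rho. rewrite <- exp_Ropp, Ropp_involutive.
    replace (INR r * eta) with (- - eta * INR r) by ring. rewrite exp_INR. f_equal. f_equal. ring. }
  assert (Hxlt : forall t, Cmod (cir rho t) < 1) by (intros t; rewrite Cmod_cir; lra).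
  assert (Hfarb : forall t, del <= Rabs t <= PI -> Cmod (I t) <= / dF * E).
  { intros t Ht. rewrite HImod.
    assert (H1 : Cmod (slice A s (cir rho t)) <= / dF * (/ (1 + dF / 2)) ^ s).
    { apply (slice_decay A F r0); auto. intros y Hy. apply (Hfar t); auto.
      replace (cir rho t - cir 1 t)%C with (RtoC (rho - 1) * Cexp (Ci * RtoC t))%C by (unfold cir; rewrite RtoC_minus; ring).
      rewrite Cmod_mult, Cmod_Cexp_i, Cmod_R, Rabs_left by lra.
      assert (1 - eta <= rho); [|lra]. unfold rho. destruct (Req_dec (- eta) 0) as [E0|E0]; [lra|]. generalize (exp_ineq1 _ E0). lra. }
    assert (H2 := inv_pow_exp (1 + dF / 2) k1 s ltac:(lra) Hk1b).
    apply Rle_trans with (/ dF * exp (- k1 * INR s) * exp (INR r * eta)).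
    - apply Rmult_le_compat_r; [apply Rlt_le, exp_pos|]. eapply Rle_trans; [exact H1|]. apply Rmult_le_compat_l; lra.
    - rewrite Rmult_assoc. apply Rmult_le_compat_l; lra. }
  set (J0 := fun t => (h0 (- eta, t)%R * Cexp (RtoC (INR s) * f0 (- eta, t)%R - RtoC (INR r) * (- eta, t)%R) / (- eta, t)%R)%C).
  set (J1 := fun t => (h1 (- eta, t)%R * Cexp (RtoC (INR s) * f1 (- eta, t)%R - RtoC (INR r) * (- eta, t)%R) / (- eta, t)%R)%C).
  assert (HJ0 : forall t, - del <= t <= del -> rcont J0 t).
  { intros t Ht. assert (Rabs t <= del) by (apply Rabs_le; lra). apply (pole_integrand_cont R0); auto. lra. }
  assert (HJ1 : forall t, - del <= t <= del -> rcont J1 t).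
  { intros t Ht. assert (Rabs t <= del) by (apply Rabs_le; lra). apply (pole_integrand_cont R0); auto. lra. }
  assert (HIJ : forall t, - del <= t <= del -> rcont (fun t => I t - J0 t)%C t).
  { intros t Ht. apply (rcont_ext (fun t => I t + (-1) * J0 t)%C); [intros; ring|].
    apply rcont_plus; [apply HIc|apply rcont_mult; [apply rcont_const|now apply HJ0]]. }
  assert (Hnear : forall t, - del <= t <= del -> Cmod (I t - J0 t - J1 t) <= Mn * E).
  { intros t Ht. assert (Habs : Rabs t <= del) by (apply Rabs_le; lra).
    set (z := ((- eta, t)%R : C)).
    assert (Hz : Cmod z < R0).
    { eapply Rle_lt_trans; [apply (Cmod_pair_le _ _ eta del); [rewrite Rabs_Ropp, Rabs_pos_eq; lra|exact Habs]|lra]. }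
    assert (Hzeta : eta <= Cmod z).
    { eapply Rle_trans; [|apply re_le_Cmod_pair]. rewrite Rabs_Ropp, Rabs_pos_eq; lra. }
    assert (Hz0 : z <> 0%C) by (apply Cmod_gt_0; lra).
    assert (Ex : cir rho t = Cexp z) by apply cir_Cexp.
    set (x := Cexp z) in *.
    assert (Hx1 : Cmod x < 1) by (rewrite <- Ex; apply Hxlt).
    assert (Hxl : Cmod (x - 1) < lim) by (apply HX; lra).
    assert (Hxn : x <> 1%C) by (intros E0; rewrite E0, Cmod_1 in Hx1; lra).
    destruct (Hlt x ltac:(lra) Hxn ltac:(lra)) as [Hl0 Hl1].
    destruct (HE2 z ltac:(lra)) as [Hn0 Hi0]. destruct (HE3 z ltac:(lra)) as [Hn1 Hi1]. fold x in Hn0, Hi0, Hn1, Hi1.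
    assert (Hle : forall w : C, Cmod (w - 1) < lim -> Cmod w <= 1 + d / 4).
    { intros w Hw'. replace w with ((w - 1) + 1)%C by ring. eapply Rle_trans; [apply Cmod_triangle|]. rewrite Cmod_1. lra. }
    assert (HS := slice_two_poles F phi v0 v1 d0 A r0 d x s HA Hr0 Hd0 (Hslice x Hx1) Hd
      (fun y Hy => Hcl x y ltac:(lra) Hy) ltac:(lra) Hn0 Hn1 ltac:(lra) ltac:(lra) ltac:(lra) ltac:(lra) (Hle _ Hi0) (Hle _ Hi1)).
    fold Cn in HS.
    assert (EW : (v0 x - v1 x = z * m z)%C) by (rewrite <- Em; reflexivity).
    set (D := ((v0 x - v1 x) * slice A s x - (v0 x * phi x (/ v0 x)%C * v0 x ^ s - v1 x * phi x (/ v1 x)%C * v1 x ^ s))%C) in *.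
    assert (EJ : (I t - J0 t - J1 t = Cexp (- (RtoC (INR r) * z)) * (D / (z * m z)))%C).
    { unfold I, J0, J1. rewrite Ex. unfold x at 2. rewrite Cinv_Cexp, Cexp_pow. fold z.
      replace (RtoC (INR r) * - z)%C with (- (RtoC (INR r) * z))%C by ring.
      replace (RtoC (INR s) * f0 z - RtoC (INR r) * z)%C with (RtoC (INR s) * f0 z + - (RtoC (INR r) * z))%C by ring.
      replace (RtoC (INR s) * f1 z - RtoC (INR r) * z)%C with (RtoC (INR s) * f1 z + - (RtoC (INR r) * z))%C by ring.
      rewrite !Cexp_plus, <- !Cexp_pow, <- Hf0e, <- Hf1e by exact Hz. fold x.
      unfold D. rewrite EW. unfold h0, h1. fold x. field. split; [now apply Hmn|exact Hz0]. }
    rewrite EJ, Cmod_mult, Cmod_Cexp.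
    assert (Ere : Re (- (RtoC (INR r) * z))%C = INR r * eta) by (unfold z, Re, RtoC, Cmult, Copp; simpl; ring).
    rewrite Ere. rewrite Cmod_div by (apply Cmult_neq_0; [exact Hz0|now apply Hmn]). rewrite Cmod_mult.
    assert (H2 := inv_pow_exp (1 + d / 2) k1 s ltac:(lra) Hk1a).
    assert (Hden : eta * mu <= Cmod z * Cmod (m z)) by (apply Rmult_le_compat; try lra; now apply Hmb).
    assert (HD : Cmod D / (Cmod z * Cmod (m z)) <= Mn * exp (- k1 * INR s)).
    { replace (Mn * exp (- k1 * INR s)) with (Cn * exp (- k1 * INR s) * / (eta * mu)) by (unfold Mn; field; lra).
      apply Rmult_le_compat; [apply Cmod_ge_0|apply Rlt_le, Rinv_0_lt_compat; lra| |apply Rinv_le_contravar; assumption].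
      eapply Rle_trans; [exact HS|]. apply Rmult_le_compat_l; assumption. }
    apply Rle_trans with (exp (INR r * eta) * (Mn * exp (- k1 * INR s))).
    - apply Rmult_le_compat_l; [apply Rlt_le, exp_pos|exact HD].
    - replace (exp (INR r * eta) * (Mn * exp (- k1 * INR s))) with (Mn * (exp (INR r * eta) * exp (- k1 * INR s))) by ring.
      apply Rmult_le_compat_l; assumption. }
  rewrite (coef_slice A rho r s HA Hrho). unfold coef, pole_integral. fold I. fold J0. fold J1.
  assert (Hdel_PI : del < PI) by lra.
  rewrite (Cint_Chasles I (- PI) (- del) PI) by (auto; lra). rewrite (Cint_Chasles I (- del) del PI) by (auto; lra).
  set (X := (Cint I (- PI) (- del) + Cint I del PI + (Cint I (- del) del - Cint J0 (- del) del - Cint J1 (- del) del))%C).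
  match goal with |- Cmod ?y <= _ => replace y with (X / RtoC (2 * PI))%C by (unfold X; field; apply TwoPI_neq_0) end.
  rewrite Cmod_div by apply TwoPI_neq_0. rewrite Cmod_R, (Rabs_pos_eq (2 * PI)) by lra.
  assert (HXb : Cmod X <= (PI * / dF + PI * / dF + 2 * del * Mn) * E).
  { unfold X. eapply Rle_trans; [apply Cmod_triangle|].
    assert (X1 : Cmod (Cint I (- PI) (- del)) <= PI * (/ dF * E)).
    { eapply Rle_trans; [apply (Cint_bound I (- PI) (- del) (/ dF * E)); auto; [lra|]|].
      - intros t Ht. apply Hfarb. rewrite Rabs_left; lra.
      - apply Rmult_le_compat_r; [apply Rmult_le_pos; lra|lra]. }
    assert (X2 : Cmod (Cint I del PI) <= PI * (/ dF * E)).
    { eapply Rle_trans; [apply (Cint_bound I del PI (/ dF * E)); auto; [lra|]|].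
      - intros t Ht. apply Hfarb. rewrite Rabs_pos_eq; lra.
      - apply Rmult_le_compat_r; [apply Rmult_le_pos; lra|lra]. }
    assert (X3 : Cmod (Cint I (- del) del - Cint J0 (- del) del - Cint J1 (- del) del) <= 2 * del * (Mn * E)).
    { rewrite <- Cint_minus_on by (auto; lra). rewrite <- Cint_minus_on by (auto; lra).
      eapply Rle_trans; [apply (Cint_bound _ (- del) del (Mn * E)); auto; [lra|]|].
      - intros t Ht. apply (rcont_ext (fun t => (I t - J0 t) + (-1) * J1 t)%C); [intros; ring|].
        apply rcont_plus; [now apply HIJ|apply rcont_mult; [apply rcont_const|now apply HJ1]].
      - right. ring. }
    assert (X4 := Cmod_triangle (Cint I (- PI) (- del)) (Cint I del PI)). lra. }
  apply Rle_trans with (Cmod X * 1).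
  - apply Rmult_le_compat_l; [apply Cmod_ge_0|]. rewrite <- Rinv_1. apply Rinv_le_contravar; lra.
  - rewrite Rmult_1_r. exact HXb.
Qed.

(** * The Hessian at a crossing of two sheets *)

(** The chain rule along curves, with p and q in the role of the partial derivatives. *)
Definition chain2 (rho : R) (f p q : C -> C -> C) : Prop :=
  forall (X Y : C -> C) (t X' Y' : C), Cmod (X t) < rho -> Cmod (Y t) < rho -> cderiv X t X' -> cderiv Y t Y' ->
    cderiv (fun s => f (X s) (Y s)) t (p (X t) (Y t) * X' + q (X t) (Y t) * Y').

Lemma ps2_0 R a f : ps2 R a f -> f 0%C 0%C = a O O.
Proof.
  intros (HR & _ & H). apply (ctends_unique (Csum2 (monomials a 0 0))).
  - apply H; now rewrite Cmod_0.
  - apply ctends_S. eapply ctends_ext; [|apply (ctends_const (a O O))]. intros n.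
    unfold Csum2. rewrite Csum_shift.
    rewrite (Csum_ext (fun k => Csum (monomials a 0 0 (S k)) (S n)) (fun _ => RtoC 0)).
    + rewrite Csum_0, Csum_shift, (Csum_ext _ (fun _ => RtoC 0)), Csum_0; [unfold monomials; simpl; ring|].
      intros k _. unfold monomials. rewrite Cpow_S. ring.
    + intros k _. rewrite (Csum_ext _ (fun _ => RtoC 0)), Csum_0; [reflexivity|].
      intros j _. unfold monomials. rewrite Cpow_S. ring.
Qed.

Lemma chain2_weaken rho rho' f p q : rho <= rho' -> chain2 rho' f p q -> chain2 rho f p q.
Proof. intros H Hc X Y t X' Y' HX HY. apply Hc; lra. Qed.

(** The derivatives of order at most two, with equality of the mixed ones read off from the
    coefficients and a uniform second-order remainder. *)
Lemma analytic2_jet H z0 w0 : analytic2_at H z0 w0 -> exists rho p q pp pq qp qq M, 0 < rho /\ 0 <= M /\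
  chain2 rho (fun h k => H (z0 + h)%C (w0 + k)%C) p q /\ chain2 rho p pp pq /\ chain2 rho q qp qq /\ pq 0%C 0%C = qp 0%C 0%C /\
  forall x y x' y', Cmod x < rho -> Cmod y < rho -> Cmod x' < rho -> Cmod y' < rho ->
    Cmod (H (z0 + x')%C (w0 + y')%C - H (z0 + x)%C (w0 + y)%C - p x y * (x' - x) - q x y * (y' - y))%C
      <= M * (Cmod (x' - x) + Cmod (y' - y)) ^ 2.
Proof.
  intros HH. destruct (analytic2_ps2 _ _ _ HH) as (R & a & Hps). assert (HR : 0 < R) by apply Hps.
  assert (H1 : 0 < R / 2 < R) by lra. assert (H2 : 0 < R / 4 < R / 2) by lra. assert (H3 : 0 < R / 8 < R / 4) by lra.
  destruct (ps2_pder1 R (R / 2) a _ H1 Hps) as (p & Hp). destruct (ps2_pder2 R (R / 2) a _ H1 Hps) as (q & Hq).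
  destruct (ps2_pder1 _ (R / 4) _ _ H2 Hp) as (pp & Hpp). destruct (ps2_pder2 _ (R / 4) _ _ H2 Hp) as (pq & Hpq).
  destruct (ps2_pder1 _ (R / 4) _ _ H2 Hq) as (qp & Hqp). destruct (ps2_pder2 _ (R / 4) _ _ H2 Hq) as (qq & Hqq).
  destruct (ps2_quad R (R / 2) a _ p q H1 Hps Hp Hq) as (M & HM & Hquad).
  exists (R / 4), p, q, pp, pq, qp, qq, M. split; [lra|]. split; [exact HM|].
  split; [apply (chain2_weaken _ (R / 2)); [lra|]; intros X Y t X' Y'; now apply (ps2_curve_cderiv R (R / 2) a (fun h k => H (z0 + h)%C (w0 + k)%C) p q X Y)|].
  split; [intros X Y t X' Y'; now apply (ps2_curve_cderiv (R / 2) (R / 4) (pder1 a))|].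
  split; [intros X Y t X' Y'; now apply (ps2_curve_cderiv (R / 2) (R / 4) (pder2 a))|].
  split; [rewrite (ps2_0 _ _ _ Hpq), (ps2_0 _ _ _ Hqp); unfold pder1, pder2; simpl; ring|].
  intros x y x' y' Hx Hy Hx' Hy'. apply Hquad; lra.
Qed.

Lemma cderiv_zero_near (f : C -> C) (z l : C) (d : R) : 0 < d -> (forall t, Cmod (t - z) < d -> f t = 0%C) -> cderiv f z l -> l = 0%C.
Proof.
  intros Hd H Hf. apply (cderiv_unique f z); [exact Hf|].
  apply (cderiv_ext (fun _ => 0%C) f z _ d Hd); [|apply cderiv_const]. intros y Hy. now rewrite H.
Qed.

(** The first and second derivatives of the identity h(t, Y(t)) = 0. *)
Lemma sheet_relations rho h p q pp pq qp qq (Y : C -> C) : 0 < rho ->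
  chain2 rho h p q -> chain2 rho p pp pq -> chain2 rho q qp qq -> hol_at Y 0 -> Y 0%C = 0%C ->
  (exists d, 0 < d /\ forall t, Cmod t < d -> h t (Y t) = 0%C) ->
  let y := C_derive Y 0 in
  (p 0 0 + q 0 0 * y = 0)%C /\
  (q 0%C 0%C = 0%C -> pp 0 0 + pq 0 0 * y + (qp 0 0 + qq 0 0 * y) * y = 0)%C.
Proof.
  intros Hrho Hh Hp Hq HY HY0 (d & Hd & HV) y.
  destruct (hol_near _ _ HY) as (d1 & Hd1 & HYn).
  destruct (hol_cont _ _ HY rho Hrho) as (d2 & Hd2 & HYr).
  set (e := Rmin (Rmin d d1) (Rmin d2 rho)).
  assert (He : 0 < e /\ e <= d /\ e <= d1 /\ e <= d2 /\ e <= rho).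
  { unfold e. generalize (Rmin_l (Rmin d d1) (Rmin d2 rho)) (Rmin_r (Rmin d d1) (Rmin d2 rho)) (Rmin_l d d1) (Rmin_r d d1) (Rmin_l d2 rho) (Rmin_r d2 rho).
    intros. split; [repeat apply Rmin_glb_lt; lra|lra]. }
  assert (Hrel : forall t, Cmod t < e -> (p t (Y t) + q t (Y t) * C_derive Y t = 0)%C).
  { intros t Ht. apply (cderiv_zero_near (fun s => h s (Y s)) t _ (e - Cmod t)); [lra| |].
    - intros s Hs. apply HV. generalize (Cmod_ge_sub s t). lra.
    - eapply cderiv_eq; [apply (Hh (fun s => s) Y t 1%C (C_derive Y t))|ring].
      + lra.
      + specialize (HYr t). rewrite HY0 in HYr. replace (Y t - 0)%C with (Y t) in HYr by ring. apply HYr. replace (t - 0)%C with t by ring. lra.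
      + apply cderiv_id.
      + apply hol_cderiv, HYn. replace (t - 0)%C with t by ring. lra. }
  split; [generalize (Hrel 0%C); rewrite HY0, Cmod_0; intros E; apply E; lra|].
  intros Hq0. apply (cderiv_zero_near (fun s => p s (Y s) + q s (Y s) * C_derive Y s)%C 0 _ e); [lra| |].
  - intros t Ht. apply Hrel. now replace (t - 0)%C with t in Ht by ring.
  - assert (HdY := hol_cderiv _ _ HY). assert (HddY := hol_cderiv _ _ (hol_at_deriv _ _ HY)).
    assert (H0 : Cmod 0 < rho) by (rewrite Cmod_0; exact Hrho).
    assert (HY0' : Cmod (Y 0%C) < rho) by (rewrite HY0; exact H0).
    eapply cderiv_eq.
    + apply cderiv_plus; [apply (Hp (fun s => s) Y 0%C 1%C y)|apply cderiv_mult; [apply (Hq (fun s => s) Y 0%C 1%C y)|exact HddY]];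
      auto using cderiv_id.
    + cbv beta. rewrite !HY0, Hq0. unfold y. ring.
Qed.

Lemma Cmult_0_reg (x y : C) : (y <> 0 -> x * y = 0 -> x = 0)%C.
Proof. intros Hy E. replace x with (x * y / y)%C by (field; exact Hy). rewrite E. field. exact Hy. Qed.

(** If u is dominated by a function that vanishes to second order, even only along some points
    tending to 0, then u vanishes to second order too. *)
Lemma frequent_small (u g : C -> C) l M : 0 <= M -> cderiv u 0 l -> cderiv g 0 0 -> g 0%C = 0%C ->
  (forall e, 0 < e -> exists t, 0 < Cmod t < e /\ Cmod (u t) <= M * Cmod (g t)) -> u 0%C = 0%C /\ l = 0%C.
Proof.
  intros HM Hu Hg Hg0 Hf.
  assert (Hgs : forall e, 0 < e -> exists d, 0 < d /\ forall t, Cmod t < d -> M * Cmod (g t) <= e * Cmod t).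
  { intros e He. destruct (Hg (e / (M + 1))) as (d & Hd & H); [apply Rdiv_lt_0_compat; lra|].
    exists d. split; [exact Hd|]. intros t Ht. specialize (H t). rewrite Hg0 in H.
    replace (t - 0)%C with t in H by ring. replace (g t - 0 - 0 * t)%C with (g t) in H by ring. specialize (H Ht).
    apply Rle_trans with (M * (e / (M + 1) * Cmod t)); [apply Rmult_le_compat_l; assumption|].
    rewrite <- Rmult_assoc. apply Rmult_le_compat_r; [apply Cmod_ge_0|].
    assert (E : e = (M + 1) * (e / (M + 1))) by (field; lra).
    assert (0 < e / (M + 1)) by (apply Rdiv_lt_0_compat; lra). lra. }
  assert (Hu0 : u 0%C = 0%C).
  { apply Cmod_le_eq0. intros e He. destruct (Hgs 1 Rlt_0_1) as (d & Hd & H1).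
    destruct (cderiv_cont _ _ _ Hu (e / 2)) as (d' & Hd' & H2); [lra|].
    destruct (Hf (Rmin (Rmin d d') (e / 2))) as (t & [_ Ht] & Hut); [repeat apply Rmin_glb_lt; lra|].
    generalize (Rmin_l (Rmin d d') (e / 2)) (Rmin_r (Rmin d d') (e / 2)) (Rmin_l d d') (Rmin_r d d'). intros.
    specialize (H1 t ltac:(lra)). specialize (H2 t). replace (t - 0)%C with t in H2 by ring. specialize (H2 ltac:(lra)).
    rewrite Cmod_sub_sym in H2. generalize (Cmod_ge_sub (u 0%C) (u t)). lra. }
  split; [exact Hu0|]. apply Cmod_le_eq0. intros e He.
  destruct (Hgs (e / 2) ltac:(lra)) as (d & Hd & H1). destruct (Hu (e / 2) ltac:(lra)) as (d' & Hd' & H2).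
  destruct (Hf (Rmin d d')) as (t & [Ht0 Ht] & Hut); [repeat apply Rmin_glb_lt; lra|].
  generalize (Rmin_l d d') (Rmin_r d d'). intros.
  specialize (H1 t ltac:(lra)). specialize (H2 t). rewrite Hu0 in H2.
  replace (t - 0)%C with t in H2 by ring. specialize (H2 ltac:(lra)). rewrite Cmod_sub_sym in H2.
  replace (l * t - (u t - 0))%C with (l * t - u t)%C in H2 by ring.
  assert (H3 := Cmod_ge_sub (l * t) (u t)). rewrite Cmod_mult in H3.
  apply Rmult_le_reg_r with (Cmod t); [exact Ht0|]. lra.
Qed.

(** If the sheets have different slopes, two first-order relations force the gradient to vanish, and
    two second-order relations make their slopes the roots of the quadratic form of second
    derivatives, whose discriminant is therefore - 4 det. If the slopes are equal, then at points
    where the sheets differ the mean value theorem between them makes h_y of the order of their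
    distance, which is o(t); so h_y and its derivative along the sheet vanish at 0, and with the
    second-order relation the determinant is zero. *)
Lemma two_sheets rho h p q pp pq qp qq M (Y0 Y1 : C -> C) : 0 < rho -> 0 <= M ->
  chain2 rho h p q -> chain2 rho p pp pq -> chain2 rho q qp qq -> pq 0%C 0%C = qp 0%C 0%C ->
  (forall x y x' y', Cmod x < rho -> Cmod y < rho -> Cmod x' < rho -> Cmod y' < rho ->
    Cmod (h x' y' - h x y - p x y * (x' - x) - q x y * (y' - y))%C <= M * (Cmod (x' - x) + Cmod (y' - y)) ^ 2) ->
  hol_at Y0 0 -> hol_at Y1 0 -> Y0 0%C = 0%C -> Y1 0%C = 0%C ->
  (exists d, 0 < d /\ forall t, Cmod t < d -> h t (Y0 t) = 0%C /\ h t (Y1 t) = 0%C) ->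
  (forall e, 0 < e -> exists t, Cmod t < e /\ Y0 t <> Y1 t) ->
  (pp 0 0 * qq 0 0 - pq 0 0 * qp 0 0 <> 0)%C ->
  C_derive Y0 0 <> C_derive Y1 0 /\ q 0%C 0%C = 0%C /\
  (pp 0 0 * qq 0 0 - pq 0 0 * qp 0 0 = - (qq 0 0 * qq 0 0 * (C_derive Y0 0 - C_derive Y1 0) * (C_derive Y0 0 - C_derive Y1 0) / 4))%C.
Proof.
  intros Hrho HM Hh Hp Hq Hsym Hquad HY0 HY1 E0 E1 (d & Hd & HV) Hfr Hdet.
  destruct (sheet_relations rho h p q pp pq qp qq Y0) as [R0 S0]; auto.
  { exists d. split; [exact Hd|]. intros t Ht. now apply HV. }
  destruct (sheet_relations rho h p q pp pq qp qq Y1) as [R1 S1]; auto.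
  { exists d. split; [exact Hd|]. intros t Ht. now apply HV. }
  set (y0 := C_derive Y0 0) in *. set (y1 := C_derive Y1 0) in *.
  assert (H0 : Cmod 0 < rho) by (rewrite Cmod_0; exact Hrho).
  assert (Hne : y0 <> y1).
  { intros Ey. apply Hdet.
    destruct (hol_cont _ _ HY0 rho Hrho) as (d2 & Hd2 & HYr). destruct (hol_cont _ _ HY1 rho Hrho) as (d3 & Hd3 & HYr').
    rewrite E0 in HYr. rewrite E1 in HYr'.
    (* equal slopes: compare h_y on the first sheet with the distance of the sheets *)
    destruct (frequent_small (fun s => q s (Y0 s)) (fun s => Y1 s + (-1) * Y0 s)%C (qp 0 0 + qq 0 0 * y0)%C M HM) as [Hq0 Hl].
    - eapply cderiv_eq; [apply (Hq (fun s => s) Y0 0%C 1%C y0)|]; auto using cderiv_id.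
      + now rewrite E0.
      + now apply hol_cderiv.
      + rewrite E0. ring.
    - eapply cderiv_eq; [apply cderiv_plus; [now apply hol_cderiv|apply cderiv_mult; [apply cderiv_const|now apply hol_cderiv]]|].
      fold y1 y0. rewrite Ey. ring.
    - rewrite E0, E1. ring.
    - intros e He. set (e' := Rmin (Rmin d e) (Rmin (Rmin d2 d3) rho)).
      assert (He' : 0 < e' /\ e' <= d /\ e' <= e /\ e' <= d2 /\ e' <= d3 /\ e' <= rho).
      { unfold e'. generalize (Rmin_l (Rmin d e) (Rmin (Rmin d2 d3) rho)) (Rmin_r (Rmin d e) (Rmin (Rmin d2 d3) rho)) (Rmin_l d e) (Rmin_r d e) (Rmin_l (Rmin d2 d3) rho) (Rmin_r (Rmin d2 d3) rho) (Rmin_l d2 d3) (Rmin_r d2 d3).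
        intros. split; [repeat apply Rmin_glb_lt; lra|lra]. }
      destruct (Hfr e' ltac:(lra)) as (t & Ht & Hyt). exists t.
      assert (Ht0 : t <> 0%C) by (intros ->; apply Hyt; now rewrite E0, E1).
      split; [split; [now apply Cmod_gt_0|lra]|].
      destruct (HV t ltac:(lra)) as [V0 V1].
      assert (B0 : Cmod (Y0 t) < rho).
      { specialize (HYr t). replace (Y0 t - 0)%C with (Y0 t) in HYr by ring. apply HYr. replace (t - 0)%C with t by ring. lra. }
      assert (B1 : Cmod (Y1 t) < rho).
      { specialize (HYr' t). replace (Y1 t - 0)%C with (Y1 t) in HYr' by ring. apply HYr'. replace (t - 0)%C with t by ring. lra. }
      assert (HQ := Hquad t (Y0 t) t (Y1 t) ltac:(lra) B0 ltac:(lra) B1).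
      rewrite V0, V1 in HQ. replace (t - t)%C with (RtoC 0) in HQ by ring. rewrite Cmod_0, Rplus_0_l in HQ.
      replace (0 - 0 - p t (Y0 t) * 0 - q t (Y0 t) * (Y1 t - Y0 t))%C with (- (q t (Y0 t) * (Y1 t - Y0 t)))%C in HQ by ring.
      rewrite Cmod_opp, Cmod_mult in HQ. replace (Y1 t + (-1) * Y0 t)%C with (Y1 t - Y0 t)%C by ring.
      assert (HP : 0 < Cmod (Y1 t - Y0 t)) by (apply Cmod_gt_0, Cminus_eq_contra; congruence).
      apply Rmult_le_reg_r with (Cmod (Y1 t - Y0 t)); [exact HP|]. simpl in HQ. lra.
    - cbv beta in Hq0. rewrite E0 in Hq0. specialize (S0 Hq0).
      replace (pp 0 0)%C with ((pp 0 0 + pq 0 0 * y0 + (qp 0 0 + qq 0 0 * y0) * y0) - pq 0 0 * y0 - (qp 0 0 + qq 0 0 * y0) * y0)%C by ring.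
      rewrite S0, Hl. rewrite Hsym. replace (qp 0 0)%C with ((qp 0 0 + qq 0 0 * y0) - qq 0 0 * y0)%C by ring. rewrite Hl. ring. }
  assert (Hne' : (y0 - y1 <> 0)%C) by now apply Cminus_eq_contra.
  assert (Hq0 : q 0%C 0%C = 0%C).
  { assert (E : (q 0 0 * (y0 - y1) = 0)%C).
    { replace (q 0 0 * (y0 - y1))%C with ((p 0 0 + q 0 0 * y0) - (p 0 0 + q 0 0 * y1))%C by ring. rewrite R0, R1. ring. }
    exact (Cmult_0_reg _ _ Hne' E). }
  split; [exact Hne|]. split; [exact Hq0|].
  specialize (S0 Hq0). specialize (S1 Hq0). rewrite Hsym in *.
  set (b := qp 0%C 0%C) in *. set (c := qq 0%C 0%C) in *. set (a := pp 0%C 0%C) in *.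
  assert (E : (2 * b + c * (y0 + y1) = 0)%C).
  { assert (E : ((2 * b + c * (y0 + y1)) * (y0 - y1) = 0)%C).
    { replace ((2 * b + c * (y0 + y1)) * (y0 - y1))%C with ((a + b * y0 + (b + c * y0) * y0) - (a + b * y1 + (b + c * y1) * y1))%C by ring.
      rewrite S0, S1. ring. }
    exact (Cmult_0_reg _ _ Hne' E). }
  assert (Eb : b = (- (c * (y0 + y1) / 2))%C).
  { replace b with (((2 * b + c * (y0 + y1)) - c * (y0 + y1)) / 2)%C by field. rewrite E. field. }
  assert (Ea : a = (c * y0 * y1)%C).
  { replace a with ((a + b * y0 + (b + c * y0) * y0) - 2 * b * y0 - c * y0 * y0)%C by ring. rewrite S0, Eb. field. }
  rewrite Ea, Eb. field.
Qed.

Lemma chain2_partials rho f p q (g : C -> C -> C) (zs ws : C) : chain2 rho f p q ->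
  (forall z w : C, Cmod (z - zs) < rho -> Cmod (w - ws) < rho -> g z w = f (z - zs)%C (w - ws)%C) ->
  forall z w : C, Cmod (z - zs) < rho -> Cmod (w - ws) < rho ->
    dz g z w = p (z - zs)%C (w - ws)%C /\ dw g z w = q (z - zs)%C (w - ws)%C.
Proof.
  intros Hc Hg z w Hz Hw.
  assert (Hs : forall x y : C, cderiv (fun s => s - y)%C x 1).
  { intros x y. eapply cderiv_eq; [apply cderiv_plus; [apply cderiv_id|apply cderiv_const]|ring]. }
  split; apply cderiv_C_derive.
  - apply (cderiv_ext (fun s => f (s - zs)%C (w - ws)%C) _ z _ (rho - Cmod (z - zs))); [lra| |].
    + intros y Hy. symmetry. apply Hg; [|exact Hw]. generalize (Cmod_sub_tri y z zs). lra.
    + eapply cderiv_eq; [apply (Hc (fun s => s - zs)%C (fun _ => w - ws)%C z 1%C 0%C); auto using cderiv_const|ring].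
  - apply (cderiv_ext (fun s => f (z - zs)%C (s - ws)%C) _ w _ (rho - Cmod (w - ws))); [lra| |].
    + intros y Hy. symmetry. apply Hg; [exact Hz|]. generalize (Cmod_sub_tri y w ws). lra.
    + eapply cderiv_eq; [apply (Hc (fun _ => z - zs)%C (fun s => s - ws)%C w 0%C 1%C); auto using cderiv_const|ring].
Qed.

Lemma sheet_curve (v : C -> C) (zs ws : C) : hol_at v zs -> (ws * v zs = 1)%C ->
  let Y := fun t => (/ v (zs + t) - ws)%C in
  hol_at Y 0 /\ Y 0%C = 0%C /\ C_derive Y 0 = (- (ws * ws * C_derive v zs))%C /\
  exists d, 0 < d /\ forall t, Cmod t < d -> v (zs + t)%C <> 0%C.
Proof.
  intros Hv Ev Y. assert (E0 : (zs + 0)%C = zs) by ring.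
  assert (Hn : v zs <> 0%C) by (intros E; rewrite E in Ev; apply C1_nz; rewrite <- Ev; ring).
  assert (Hws : ws = (/ v zs)%C) by (replace (/ v zs)%C with (1 / v zs)%C by (unfold Cdiv; ring); rewrite <- Ev; field; exact Hn).
  assert (Hc : cderiv (fun t => zs + t)%C 0 1).
  { eapply cderiv_eq; [apply cderiv_plus; [apply cderiv_const|apply cderiv_id]|ring]. }
  assert (Hvt : hol_at (fun t => v (zs + t)%C) 0).
  { apply (hol_comp (fun t => zs + t)%C v); [apply hol_plus; [apply hol_const|apply hol_id]|now rewrite E0]. }
  assert (Hn0 : v (zs + 0)%C <> 0%C) by (now rewrite E0).
  split; [apply hol_minus; [now apply hol_inv|apply hol_const]|].
  split; [unfold Y; rewrite E0, Hws; ring|]. split.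
  - apply cderiv_C_derive. unfold Y. eapply cderiv_eq.
    + apply cderiv_plus; [|apply cderiv_const].
      apply (cderiv_comp (fun t => v (zs + t)%C) Cinv); [|now apply cderiv_inv].
      apply (cderiv_comp (fun t => zs + t)%C v); [exact Hc|]. rewrite E0. now apply hol_cderiv.
    + cbv beta. rewrite E0, Hws. field. exact Hn.
  - destruct (ccont_neq _ 0 0 (hol_cont _ _ Hvt) Hn0) as (d & Hd & H). exists d. split; [exact Hd|].
    intros t Ht. apply H. now replace (t - 0)%C with t by ring.
Qed.

Lemma ccont_eq_punctured (f g : C -> C) z d : ccont f z -> ccont g z -> 0 < d ->
  (forall y, 0 < Cmod (y - z) < d -> f y = g y) -> f z = g z.
Proof.
  intros Hf Hg Hd H. apply NNPP. intros Hne.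
  assert (Hc : ccont (fun y => f y + (-1) * g y)%C z) by (apply ccont_plus; [exact Hf|apply ccont_mult; [apply ccont_const|exact Hg]]).
  assert (Hn : (f z + (-1) * g z)%C <> 0%C).
  { replace (f z + (-1) * g z)%C with (f z - g z)%C by ring. now apply Cminus_eq_contra. }
  destruct (ccont_neq _ z 0 Hc Hn) as (e & He & H').
  set (k := Rmin d e / 2). assert (Hk : 0 < k /\ k < d /\ k < e).
  { unfold k. assert (0 < Rmin d e) by (now apply Rmin_glb_lt). generalize (Rmin_l d e) (Rmin_r d e). lra. }
  assert (Ek : Cmod (z + RtoC k - z) = k).
  { replace (z + RtoC k - z)%C with (RtoC k) by ring. rewrite Cmod_R, Rabs_pos_eq; lra. }
  apply (H' (z + RtoC k)%C); [rewrite Ek; lra|]. rewrite (H (z + RtoC k)%C) by (rewrite Ek; lra). ring.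
Qed.

(** The sheets are Y_j(t) = 1/v_j(zs + t) - ws, and [two_sheets] applies. The value of phi follows
    on the line z = zs, where H is k^2 (H_ww/2 + o(1)) at w = ws + k and each factor 1 - w v_j is -
    k/ws. *)
Lemma hessian_double (G H : C -> C -> C) (zs ws : C) (v0 v1 : C -> C) (phi : C -> C -> C) d :
  analytic2_at G zs ws -> analytic2_at H zs ws -> analytic2_at phi zs ws -> hol_at v0 zs -> hol_at v1 zs ->
  (ws * v0 zs = 1)%C -> (ws * v1 zs = 1)%C -> (forall e, 0 < e -> exists z, Cmod (z - zs) < e /\ v0 z <> v1 z) ->
  0 < d -> (forall z w, Cmod (z - zs) < d -> Cmod (w - ws) < d ->
    (H z w <> 0%C -> (G z w / H z w = phi z w / ((1 - w * v0 z) * (1 - w * v1 z)))%C) /\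
    ((w * v0 z = 1)%C \/ (w * v1 z = 1)%C <-> H z w = 0%C)) ->
  hessian_det H zs ws <> 0%C ->
  let s2 := (Cpow ws 2 * dw (dw H) zs ws)%C in
  s2 <> 0%C /\ C_derive v0 zs <> C_derive v1 zs /\ (2 * G zs ws = phi zs ws * s2)%C /\
  (- (Cpow zs 2 * Cpow ws 2 * hessian_det H zs ws) =
    (s2 * (zs * ws * C_derive v0 zs - zs * ws * C_derive v1 zs) / 2) * (s2 * (zs * ws * C_derive v0 zs - zs * ws * C_derive v1 zs) / 2))%C.
Proof.
  intros HG HH Hphi Hv0 Hv1 Ev0 Ev1 Hne Hd HD Hdet s2.
  assert (Hws : ws <> 0%C) by (intros E; rewrite E in Ev0; apply C1_nz; rewrite <- Ev0; ring).
  destruct (analytic2_jet H zs ws HH) as (rho & p & q & pp & pq & qp & qq & M & Hrho & HM & Hh & Hp & Hq & Hsym & Hquad).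
  assert (H0rho : Cmod (zs - zs) < rho /\ Cmod (ws - ws) < rho) by (rewrite !Cmod_diag; lra). destruct H0rho as [Hz0 Hw0].
  assert (HP1 := chain2_partials rho _ p q H zs ws Hh).
  assert (HP : forall z w : C, Cmod (z - zs) < rho -> Cmod (w - ws) < rho -> dz H z w = p (z - zs)%C (w - ws)%C /\ dw H z w = q (z - zs)%C (w - ws)%C).
  { apply HP1. intros z w _ _. f_equal; ring. }
  destruct (chain2_partials rho p pp pq (dz H) zs ws Hp (fun z w A B => proj1 (HP z w A B)) zs ws Hz0 Hw0) as [Ezz Ewz].
  destruct (chain2_partials rho q qp qq (dw H) zs ws Hq (fun z w A B => proj2 (HP z w A B)) zs ws Hz0 Hw0) as [Ezw Eww].
  replace (zs - zs)%C with (RtoC 0) in * by ring. replace (ws - ws)%C with (RtoC 0) in * by ring.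
  assert (Edet : hessian_det H zs ws = (pp 0 0 * qq 0 0 - pq 0 0 * qp 0 0)%C).
  { unfold hessian_det. rewrite Ezz, Eww, Ezw, Ewz. ring. }
  rewrite Edet in *.
  destruct (sheet_curve v0 zs ws Hv0 Ev0) as (HY0 & HY00 & EY0 & n0 & Hn0 & Hn0'). set (Y0 := fun t => (/ v0 (zs + t) - ws)%C) in *.
  destruct (sheet_curve v1 zs ws Hv1 Ev1) as (HY1 & HY10 & EY1 & n1 & Hn1 & Hn1'). set (Y1 := fun t => (/ v1 (zs + t) - ws)%C) in *.
  change (Y0 0%C = 0%C) in HY00. change (Y1 0%C = 0%C) in HY10.
  destruct (hol_cont _ _ HY0 d Hd) as (m0 & Hm0 & Hm0'). destruct (hol_cont _ _ HY1 d Hd) as (m1 & Hm1 & Hm1').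
  rewrite HY00 in Hm0'. rewrite HY10 in Hm1'.
  destruct (two_sheets rho (fun h k => H (zs + h)%C (ws + k)%C) p q pp pq qp qq M Y0 Y1) as (Hyne & Hq0 & Edet2); auto.
  { set (e := Rmin (Rmin d (Rmin n0 n1)) (Rmin m0 m1)).
    assert (He : 0 < e /\ e <= d /\ e <= n0 /\ e <= n1 /\ e <= m0 /\ e <= m1).
    { unfold e. generalize (Rmin_l (Rmin d (Rmin n0 n1)) (Rmin m0 m1)) (Rmin_r (Rmin d (Rmin n0 n1)) (Rmin m0 m1)) (Rmin_l d (Rmin n0 n1)) (Rmin_r d (Rmin n0 n1)) (Rmin_l n0 n1) (Rmin_r n0 n1) (Rmin_l m0 m1) (Rmin_r m0 m1).
      intros. split; [repeat apply Rmin_glb_lt; lra|lra]. }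
    exists e. split; [lra|]. intros t Ht.
    assert (Et : (t - 0)%C = t) by ring.
    assert (Ez : (zs + t - zs)%C = t) by ring.
    split.
    - apply (proj2 (HD (zs + t)%C (ws + Y0 t)%C ltac:(rewrite Ez; lra) ltac:(replace (ws + Y0 t - ws)%C with (Y0 t - 0)%C by ring; apply Hm0'; rewrite Et; lra))).
      left. unfold Y0. field. apply Hn0'. lra.
    - apply (proj2 (HD (zs + t)%C (ws + Y1 t)%C ltac:(rewrite Ez; lra) ltac:(replace (ws + Y1 t - ws)%C with (Y1 t - 0)%C by ring; apply Hm1'; rewrite Et; lra))).
      right. unfold Y1. field. apply Hn1'. lra. }
  { intros e He. destruct (Hne (Rmin e (Rmin n0 n1))) as (z & Hz & Hvz); [repeat apply Rmin_glb_lt; lra|].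
    generalize (Rmin_l e (Rmin n0 n1)) (Rmin_r e (Rmin n0 n1)) (Rmin_l n0 n1) (Rmin_r n0 n1). intros.
    exists (z - zs)%C. split; [lra|]. intros E. apply Hvz.
    specialize (Hn0' (z - zs)%C ltac:(lra)). specialize (Hn1' (z - zs)%C ltac:(lra)).
    unfold Y0, Y1 in E. replace (zs + (z - zs))%C with z in * by ring.
    assert (E' : (/ v0 z = / v1 z)%C).
    { replace (/ v0 z)%C with ((/ v0 z - ws) + ws)%C by ring. rewrite E. ring. }
    replace (v0 z) with (v0 z * v1 z * / v1 z)%C by (field; exact Hn1'). rewrite <- E'. field. exact Hn0'. }
  assert (Hqq : qq 0%C 0%C <> 0%C) by (intros E; apply Hdet; rewrite Edet2, E; field).
  assert (Hs2 : s2 <> 0%C) by (unfold s2; rewrite Eww; apply Cmult_neq_0; [|exact Hqq]; simpl; repeat apply Cmult_neq_0; try exact Hws; apply C1_nz).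
  split; [exact Hs2|]. split; [intros E; apply Hyne; rewrite EY0, EY1, E; reflexivity|]. split.
  2:{ rewrite Edet2, EY0, EY1. unfold s2. rewrite Eww. simpl. field. }
  destruct (analytic2_hol2 _ _ _ HH) as [(dH & HdH & HhH) _]. destruct (analytic2_hol2 _ _ _ HG) as [(dG & HdG & HhG) _].
  destruct (analytic2_hol2 _ _ _ Hphi) as [(dP & HdP & HhP) _].
  assert (Hcur : forall f e, hol2_on f zs ws e -> hol_on e (fun k => f zs (ws + k)%C)).
  { intros f e Hf k Hk. apply (Hf (fun _ => zs) (fun k => ws + k)%C k).
    - rewrite Cmod_diag. eapply Rle_lt_trans; [apply Cmod_ge_0|exact Hk].
    - now replace (ws + k - ws)%C with k by ring.
    - apply hol_const.
    - apply hol_plus; [apply hol_const|apply hol_id]. }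
  (* on the line z = zs: H = k^2 m(k) with m(0) = H_ww / 2 *)
  set (hk := fun k => H zs (ws + k)%C). assert (Hhk := Hcur H dH HhH : hol_on dH hk).
  assert (Cz : Cmod 0 < rho) by (rewrite Cmod_0; exact Hrho).
  assert (Ek : forall k, Cmod k < rho -> C_derive hk k = q 0%C k).
  { intros k Hk. apply cderiv_C_derive. unfold hk.
    apply (cderiv_ext (fun k => (fun h k => H (zs + h)%C (ws + k)%C) 0%C k) _ k _ 1 Rlt_0_1); [intros; f_equal; ring|].
    eapply cderiv_eq; [apply (Hh (fun _ => 0%C) (fun k => k) k 0%C 1%C); auto using cderiv_const, cderiv_id|ring]. }
  assert (Ekk : C_derive (C_derive hk) 0 = qq 0%C 0%C).
  { apply cderiv_C_derive. apply (cderiv_ext (fun k => q 0%C k) _ 0 _ rho Hrho).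
    - intros y Hy. symmetry. apply Ek. now replace (y - 0)%C with y in Hy by ring.
    - eapply cderiv_eq; [apply (Hq (fun _ => 0%C) (fun k => k) 0%C 0%C 1%C); auto using cderiv_const, cderiv_id|ring]. }
  assert (Hk0 : hk 0%C = 0%C).
  { unfold hk. replace (ws + 0)%C with ws by ring.
    apply (proj2 (HD zs ws ltac:(rewrite Cmod_diag; exact Hd) ltac:(rewrite Cmod_diag; exact Hd))). now left. }
  set (m1' := divz hk). set (m := divz m1').
  assert (Hhm1 : hol_on dH m1') by now apply hol_divz. assert (Hhm : hol_on dH m) by now apply hol_divz.
  assert (Em1 : m1' 0%C = 0%C) by (unfold m1'; rewrite divz_0, (Ek 0%C Cz); exact Hq0).
  assert (Em0 : (2 * m 0 = qq 0 0)%C) by (unfold m; rewrite divz_0; unfold m1'; rewrite (divz_derive dH); auto).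
  assert (Emk : forall k, hk k = (k * k * m k)%C).
  { intros k. rewrite (divz_eq hk k), Hk0. fold m1'. rewrite (divz_eq m1' k), Em1. fold m. ring. }
  set (GG := fun k => G zs (ws + k)%C). set (PP := fun k => (phi zs (ws + k) * (ws * ws) * m k)%C).
  assert (EG : GG 0%C = PP 0%C).
  { apply (ccont_eq_punctured GG PP 0 d); [| |exact Hd|].
    - apply hol_cont, (Hcur G dG HhG). now rewrite Cmod_0.
    - apply ccont_mult; [apply ccont_mult; [|apply ccont_const]|].
      + apply hol_cont, (Hcur phi dP HhP). now rewrite Cmod_0.
      + apply hol_cont, Hhm. now rewrite Cmod_0.
    - intros k Hk. replace (k - 0)%C with k in Hk by ring.
      assert (Hkn : k <> 0%C) by (apply Cmod_gt_0; lra).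
      destruct (HD zs (ws + k)%C ltac:(rewrite Cmod_diag; exact Hd) ltac:(replace (ws + k - ws)%C with k by ring; lra)) as [D1 D2].
      assert (Hv : forall v : C, (ws * v = 1)%C -> ((ws + k) * v <> 1)%C).
      { intros v Ev E. assert (Ekv : (k * v = 0)%C) by (replace (k * v)%C with ((ws + k) * v - ws * v)%C by ring; rewrite E, Ev; ring).
        assert (v = 0)%C; [|subst v; apply C1_nz; rewrite <- Ev; ring].
        apply (Cmult_0_reg v k Hkn). rewrite <- Ekv. ring. }
      assert (HHn : H zs (ws + k)%C <> 0%C) by (intros E; apply D2 in E; destruct E as [E|E]; revert E; now apply Hv).
      specialize (D1 HHn). fold (hk k) in D1, HHn. rewrite Emk in D1, HHn. fold (GG k) in D1. unfold PP.
      assert (Hmn : m k <> 0%C) by (intros E; apply HHn; rewrite E; ring).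
      assert (Ev : forall v : C, (ws * v = 1)%C -> (1 - (ws + k) * v = - k / ws)%C).
      { intros v Ev. replace v with ((ws * v) / ws)%C by (field; exact Hws). rewrite Ev. field. exact Hws. }
      rewrite (Ev _ Ev0), (Ev _ Ev1) in D1.
      replace (GG k) with (GG k / (k * k * m k) * (k * k * m k))%C by (field; split; assumption). rewrite D1. field. split; assumption. }
  unfold GG, PP in EG. replace (ws + 0)%C with ws in EG by ring. rewrite EG. unfold s2. rewrite Eww, <- Em0. simpl. ring.
Qed.

(** * Asymptotics inside the cone and on its walls *)

(** Re f is negative on both sides of 0 on the imaginary axis, so its derivative there, - Im f'(0),
    is zero. *)
Lemma axis_real R f : 0 < R -> hol_on R f -> f 0%C = 0%C -> on_axis_neg R f -> C_derive f 0 = RtoC (Re (C_derive f 0)).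
Proof.
  intros HR Hf H0 Hax. set (d := C_derive f 0).
  assert (Hd : cderiv f 0 d) by (apply hol_cderiv, Hf; now rewrite Cmod_0).
  assert (Him : Im d = 0).
  { apply NNPP. intros Hne. set (m := Rabs (Im d)). assert (Hm : 0 < m) by now apply Rabs_pos_lt.
    destruct (Hd (m / 2) ltac:(lra)) as (e & He & H). rewrite H0 in H.
    set (k := Rmin e R / 2). assert (Hk : 0 < k /\ k < e /\ k < R).
    { unfold k. assert (0 < Rmin e R) by (now apply Rmin_glb_lt). generalize (Rmin_l e R) (Rmin_r e R). lra. }
    assert (Hs : forall t, Rabs t = k -> - (Im d * t) <= m / 2 * k).
    { intros t Ht. assert (Hneg := Hax t ltac:(lra)). specialize (H (0, t)).
      assert (E0 : forall z : C, (z - 0)%C = z) by (intros; ring). rewrite !E0 in H.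
      assert (Ez : Cmod (0, t) = k) by (rewrite pair_C; replace (0 + Ci * t)%C with (Ci * t)%C by ring; rewrite Cmod_mult, Cmod_Ci, Cmod_R; lra).
      rewrite Ez in H. specialize (H ltac:(lra)).
      assert (H1 := Rle_trans _ _ _ (Re_le_Cmod _) H). apply Rabs_le_between in H1.
      assert (Er : Re (f (0, t) - d * (0, t))%C = Re (f (0, t)) + Im d * t) by (unfold Re, Im, RtoC, Cminus, Cplus, Copp, Cmult; simpl; ring).
      rewrite Er in H1. lra. }
    assert (H1 := Hs k ltac:(apply Rabs_pos_eq; lra)). assert (H2 := Hs (- k) ltac:(rewrite Rabs_Ropp; apply Rabs_pos_eq; lra)).
    assert (H3 : m * k <= m / 2 * k).
    { unfold m in *. destruct (Rle_dec 0 (Im d)); [rewrite Rabs_pos_eq in * by lra|rewrite Rabs_left in * by lra]; lra. }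
    assert (0 < m * k) by (apply Rmult_lt_0_compat; lra). lra. }
  unfold RtoC. rewrite <- Him. destruct d; reflexivity.
Qed.

Lemma pole_integral_approximation_sym A h0 f0 h1 f1 : pole_integral_approximation A h0 f0 h1 f1 -> pole_integral_approximation A h1 f1 h0 f0.
Proof.
  intros (del0 & Hdel0 & H). exists del0. split; [exact Hdel0|]. intros del Hdel.
  destruct (H del Hdel) as (ka & Hka & H1). exists ka. split; [exact Hka|]. intros C0.
  destruct (H1 C0) as (eta0 & Heta0 & H2). exists eta0. split; [exact Heta0|]. intros eta Heta.
  destruct (H2 eta Heta) as (M & HM). exists M. intros r s Hr. rewrite Cplus_comm. now apply HM.
Qed.

Lemma exp_weaken M k k' s : 0 <= s -> k' <= k -> M * exp (- k * s) <= Rabs M * exp (- k' * s).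
Proof.
  intros Hs Hk. apply Rle_trans with (Rabs M * exp (- k * s)).
  - apply Rmult_le_compat_r; [apply Rlt_le, exp_pos|apply Rle_abs].
  - apply Rmult_le_compat_l; [apply Rabs_pos|]. apply exp_le. assert (k' * s <= k * s) by (now apply Rmult_le_compat_r). lra.
Qed.

Lemma exists_below3 (a b c : R) : 0 < a -> 0 < b -> 0 < c -> exists d, 0 < d /\ d < a /\ d < b /\ d < c.
Proof.
  intros Ha Hb Hc. exists (Rmin a (Rmin b c) / 2).
  assert (0 < Rmin a (Rmin b c)) by (repeat apply Rmin_glb_lt; assumption).
  generalize (Rmin_l a (Rmin b c)) (Rmin_r a (Rmin b c)) (Rmin_l b c) (Rmin_r b c). lra.
Qed.

(** The first sheet, with the smaller slope, contributes its residue; the second one is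
    exponentially small. *)
Lemma inside_cone A R f0 f1 h0 h1 c0 c1 P eps : 0 < R -> hol_on R f0 -> hol_on R f1 -> hol_on R h0 -> hol_on R h1 ->
  f0 0%C = 0%C -> f1 0%C = 0%C -> C_derive f0 0 = RtoC c0 -> C_derive f1 0 = RtoC c1 -> on_axis_neg R f0 -> on_axis_neg R f1 ->
  h0 0%C = (- P)%C -> pole_integral_approximation A h0 f0 h1 f1 -> 0 < eps ->
  exists ka M, 0 < ka /\ forall r s : nat, (c0 + eps) * INR s <= INR r <= (c1 - eps) * INR s ->
    Cmod (A r s - P)%C <= M * exp (- ka * INR s).
Proof.
  intros HR Hf0 Hf1 Hh0 Hh1 E0 E1 D0 D1 X0 X1 EP (del0 & Hdel0 & HA) Heps.
  destruct (pole_integral_above_slope R f0 h0 c0 (eps / 2) HR Hf0 Hh0 E0 D0 X0 ltac:(lra)) as (d1 & Hd1 & HB).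
  destruct (pole_integral_below_slope R f1 h1 c1 (eps / 2) HR Hf1 Hh1 E1 D1 X1 ltac:(lra)) as (d2 & Hd2 & HAl).
  destruct (exists_below3 del0 d1 d2 Hdel0 Hd1 Hd2) as (del & Hdel & L1 & L2 & L3).
  destruct (HA del ltac:(lra)) as (ka & Hka & HA'). destruct (HA' c1) as (eta1 & Heta1 & HA2).
  destruct (HB del c1 ltac:(lra)) as (eta2 & Heta2 & HB2).
  destruct (exists_below3 eta1 eta2 d2 Heta1 Heta2 Hd2) as (eta & Heta & L4 & L5 & L6).
  destruct (HA2 eta ltac:(lra)) as (M1 & HM1). destruct (HB2 eta ltac:(lra)) as (M2 & k2 & Hk2 & HM2).
  destruct (HAl del eta ltac:(lra) ltac:(lra)) as (M3 & HM3).
  set (k3 := eps / 2 * eta) in *. assert (Hk3 : 0 < k3) by (unfold k3; apply Rmult_lt_0_compat; lra).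
  destruct (exists_below3 ka k2 k3 Hka Hk2 Hk3) as (k & Hk & L7 & L8 & L9).
  exists k, (Rabs M1 + Rabs M2 + Rabs M3). split; [exact Hk|]. intros r s Hrs. assert (Hs := pos_INR s).
  assert (Hes : 0 <= eps * INR s) by (apply Rmult_le_pos; lra).
  specialize (HM1 r s ltac:(lra)). specialize (HM2 (INR r) (INR s) Hs ltac:(lra)). specialize (HM3 (INR r) (INR s) Hs ltac:(lra)).
  assert (W1 := exp_weaken M1 ka k _ Hs ltac:(lra)). assert (W2 := exp_weaken M2 k2 k _ Hs ltac:(lra)). assert (W3 := exp_weaken M3 k3 k _ Hs ltac:(lra)).
  set (l0 := pole_integral h0 f0 eta del (INR r) (INR s)) in *. set (l1 := pole_integral h1 f1 eta del (INR r) (INR s)) in *.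
  rewrite EP in HM2.
  replace (A r s - P)%C with ((A r s - (l0 + l1)) + (l0 + - P) + l1)%C by ring.
  eapply Rle_trans; [apply Cmod_triangle|]. generalize (Cmod_triangle (A r s - (l0 + l1)) (l0 + - P)). lra.
Qed.

Lemma exp_small_abs M k N : 0 < k -> exists M', 0 <= M' /\ forall s, (1 <= s)%nat -> M * exp (- k * INR s) <= M' * rsqrt s ^ N.
Proof.
  intros Hk. destruct (exp_small k N Hk) as (M' & HM' & H). exists (Rabs M * M').
  split; [apply Rmult_le_pos; [apply Rabs_pos|exact HM']|]. intros s Hs.
  apply Rle_trans with (Rabs M * exp (- k * INR s)).
  - apply Rmult_le_compat_r; [apply Rlt_le, exp_pos|apply Rle_abs].
  - rewrite Rmult_assoc. apply Rmult_le_compat_l; [apply Rabs_pos|now apply H].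
Qed.

(** Powers start with s^(-1/2) since the constant B is stated apart. *)
Definition ray_expansion (A : nat -> nat -> C) (c : R) (B : C) : Prop :=
  exists beta : nat -> C, forall N, exists M, 0 <= M /\ forall r s, (1 <= s)%nat -> INR r = c * INR s ->
    Cmod (A r s - B - Csum (fun k => beta k * RtoC (rsqrt s ^ S k))%C N)%C <= M * rsqrt s ^ N.

(** On the wall of the smaller slope its own sheet contributes half of the residue and the
    expansion; the other one is exponentially small. *)
Lemma lower_ray A R f0 f1 h0 h1 c0 c1 P : 0 < R -> hol_on R f0 -> hol_on R f1 -> hol_on R h0 -> hol_on R h1 ->
  f0 0%C = 0%C -> f1 0%C = 0%C -> C_derive f0 0 = RtoC c0 -> C_derive f1 0 = RtoC c1 -> on_axis_neg R f0 -> on_axis_neg R f1 ->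
  h0 0%C = (- P)%C -> pole_integral_approximation A h0 f0 h1 f1 -> c0 < c1 -> C_derive (C_derive f0) 0 <> 0%C -> ray_expansion A c0 (P / 2)%C.
Proof.
  intros HR Hf0 Hf1 Hh0 Hh1 E0 E1 D0 D1 X0 X1 EP (del0 & Hdel0 & HA) Hc Hnd.
  destruct (pole_integral_at_slope R f0 h0 c0 HR Hf0 Hh0 E0 D0 Hnd X0) as (d1 & Hd1 & HG).
  set (e := (c1 - c0) / 2). assert (He : 0 < e) by (unfold e; lra).
  destruct (pole_integral_below_slope R f1 h1 c1 e HR Hf1 Hh1 E1 D1 X1 He) as (d2 & Hd2 & HAl).
  destruct (exists_below3 del0 d1 d2 Hdel0 Hd1 Hd2) as (del & Hdel & L1 & L2 & L3).
  destruct (HA del ltac:(lra)) as (ka & Hka & HA'). destruct (HA' c0) as (eta1 & Heta1 & HA2).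
  destruct (HG del ltac:(lra)) as (eta2 & Heta2 & HG2).
  destruct (exists_below3 eta1 eta2 d2 Heta1 Heta2 Hd2) as (eta & Heta & L4 & L5 & L6).
  destruct (HA2 eta ltac:(lra)) as (M1 & HM1). destruct (HG2 eta ltac:(lra)) as (beta & HM2).
  destruct (HAl del eta ltac:(lra) ltac:(lra)) as (M3 & HM3).
  exists beta. intros N.
  destruct (HM2 N) as (M2 & HM2' & HM2N).
  destruct (exp_small_abs M1 ka N Hka) as (M1' & HM1' & W1).
  destruct (exp_small_abs M3 (e * eta) N ltac:(apply Rmult_lt_0_compat; lra)) as (M3' & HM3' & W3).
  exists (M1' + M2 + M3'). split; [lra|]. intros r s Hs1 Hrs. assert (Hs := pos_INR s).
  specialize (HM1 r s ltac:(lra)). specialize (HM2N s Hs1). specialize (W1 s Hs1). specialize (W3 s Hs1).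
  specialize (HM3 (INR r) (INR s) Hs ltac:(rewrite Hrs; unfold e; lra)).
  rewrite <- Hrs, EP in HM2N.
  set (l0 := pole_integral h0 f0 eta del (INR r) (INR s)) in *. set (l1 := pole_integral h1 f1 eta del (INR r) (INR s)) in *.
  set (S := Csum _ N) in *.
  replace (A r s - P / 2 - S)%C with ((A r s - (l0 + l1)) + (l0 + - P / 2 - S) + l1)%C by (field).
  eapply Rle_trans; [apply Cmod_triangle|]. generalize (Cmod_triangle (A r s - (l0 + l1)) (l0 + - P / 2 - S)). lra.
Qed.

(** Here the sheet of smaller slope contributes its full residue P, and the other one - P/2 and the
    expansion. *)
Lemma upper_ray A R f0 f1 h0 h1 c0 c1 P : 0 < R -> hol_on R f0 -> hol_on R f1 -> hol_on R h0 -> hol_on R h1 ->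
  f0 0%C = 0%C -> f1 0%C = 0%C -> C_derive f0 0 = RtoC c0 -> C_derive f1 0 = RtoC c1 -> on_axis_neg R f0 -> on_axis_neg R f1 ->
  h0 0%C = (- P)%C -> h1 0%C = P -> pole_integral_approximation A h0 f0 h1 f1 -> c0 < c1 -> C_derive (C_derive f1) 0 <> 0%C -> ray_expansion A c1 (P / 2)%C.
Proof.
  intros HR Hf0 Hf1 Hh0 Hh1 E0 E1 D0 D1 X0 X1 EP0 EP1 (del0 & Hdel0 & HA) Hc Hnd.
  destruct (pole_integral_at_slope R f1 h1 c1 HR Hf1 Hh1 E1 D1 Hnd X1) as (d1 & Hd1 & HG).
  set (e := (c1 - c0) / 2). assert (He : 0 < e) by (unfold e; lra).
  destruct (pole_integral_above_slope R f0 h0 c0 e HR Hf0 Hh0 E0 D0 X0 He) as (d2 & Hd2 & HB).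
  destruct (exists_below3 del0 d1 d2 Hdel0 Hd1 Hd2) as (del & Hdel & L1 & L2 & L3).
  destruct (HA del ltac:(lra)) as (ka & Hka & HA'). destruct (HA' c1) as (eta1 & Heta1 & HA2).
  destruct (HG del ltac:(lra)) as (eta2 & Heta2 & HG2). destruct (HB del c1 ltac:(lra)) as (eta3 & Heta3 & HB2).
  destruct (exists_below3 eta1 eta2 eta3 Heta1 Heta2 Heta3) as (eta & Heta & L4 & L5 & L6).
  destruct (HA2 eta ltac:(lra)) as (M1 & HM1). destruct (HG2 eta ltac:(lra)) as (beta & HM2).
  destruct (HB2 eta ltac:(lra)) as (M3 & k3 & Hk3 & HM3).
  exists beta. intros N.
  destruct (HM2 N) as (M2 & HM2' & HM2N).
  destruct (exp_small_abs M1 ka N Hka) as (M1' & HM1' & W1).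
  destruct (exp_small_abs M3 k3 N Hk3) as (M3' & HM3' & W3).
  exists (M1' + M2 + M3'). split; [lra|]. intros r s Hs1 Hrs. assert (Hs := pos_INR s).
  specialize (HM1 r s ltac:(lra)). specialize (HM2N s Hs1). specialize (W1 s Hs1). specialize (W3 s Hs1).
  specialize (HM3 (INR r) (INR s) Hs ltac:(rewrite Hrs; unfold e; lra)).
  rewrite <- Hrs, EP1 in HM2N. rewrite EP0 in HM3.
  set (l0 := pole_integral h0 f0 eta del (INR r) (INR s)) in *. set (l1 := pole_integral h1 f1 eta del (INR r) (INR s)) in *.
  set (S := Csum _ N) in *.
  replace (A r s - P / 2 - S)%C with ((A r s - (l0 + l1)) + (l1 + P / 2 - S) + (l0 + - P))%C by (field).
  eapply Rle_trans; [apply Cmod_triangle|]. generalize (Cmod_triangle (A r s - (l0 + l1)) (l1 + P / 2 - S)). lra.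
Qed.

Lemma rsqrt_Rpower s k : (1 <= s)%nat -> Rpower (INR s) (- INR k / 2) = rsqrt s ^ k.
Proof.
  intros Hs. assert (Hp : 0 < INR s) by (apply lt_0_INR; lia).
  unfold rsqrt. rewrite <- Rpower_sqrt by exact Hp. rewrite <- Rpower_Ropp, <- Rpower_pow by apply exp_pos.
  rewrite Rpower_mult. f_equal. field.
Qed.

(** One more term of the expansion, moved into the remainder, turns an error of order s^(-N/2) after
    N terms into the required one. *)
Lemma ray_half_power a zs ws c B : ray_expansion (fun r s => a r s * Cpow zs r * Cpow ws s)%C c B ->
  exists b : nat -> C, b O = B /\ half_power_expansion a zs ws c b.
Proof.
  intros (beta & H). exists (fun k => match k with O => B | S k => beta k end). split; [reflexivity|].
  intros N. destruct (H (S N)) as (M & HM & HN). exists (M + Cmod (beta N)), 1%nat. intros r s Hs _ Hrs.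
  specialize (HN r s Hs Hrs). cbv beta in HN. replace (N + 1)%nat with (S N) by lia. rewrite (rsqrt_Rpower s (S N) Hs).
  assert (ES : sum_n (fun k => match k with O => B | S k => beta k end * RtoC (Rpower (INR s) (- INR k / 2)))%C N
     = (B + Csum (fun k => beta k * RtoC (rsqrt s ^ S k))%C N)%C).
  { rewrite (sum_n_Csum _ N), Csum_shift. f_equal.
    - rewrite rsqrt_Rpower by exact Hs. simpl. ring.
    - apply Csum_ext. intros k _. now rewrite rsqrt_Rpower. }
  rewrite ES. cbn [Csum] in HN.
  set (T := Csum _ N) in *. set (W := (a r s * Cpow zs r * Cpow ws s)%C) in *.
  replace (W - (B + T))%C with ((W - B - (T + beta N * RtoC (rsqrt s ^ S N))) + beta N * RtoC (rsqrt s ^ S N))%C by ring.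
  eapply Rle_trans; [apply Cmod_triangle|]. rewrite Cmod_mult, Cmod_R, (Rabs_pos_eq (rsqrt s ^ S N)).
  - lra.
  - apply pow_le. unfold rsqrt. apply Rlt_le, Rinv_0_lt_compat, sqrt_lt_R0, lt_0_INR. lia.
Qed.

(** * The cone *)

Lemma hull_sym c0 c1 x : positive_hull (c0, 1) (c1, 1) x <-> positive_hull (c1, 1) (c0, 1) x.
Proof. split; intros (a & b & Ha & Hb & E); exists b, a; (split; [exact Hb|split; [exact Ha|]]); rewrite E; simpl; f_equal; ring. Qed.

Lemma hull_iff c0 c1 x y : c0 < c1 -> positive_hull (c0, 1) (c1, 1) (x, y) <-> c0 * y <= x <= c1 * y.
Proof.
  intros Hc. split.
  - intros (a & b & Ha & Hb & E). injection E as -> ->. simpl.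
    assert (0 <= a * (c1 - c0)) by (apply Rmult_le_pos; lra). assert (0 <= b * (c1 - c0)) by (apply Rmult_le_pos; lra). lra.
  - intros H. exists ((c1 * y - x) / (c1 - c0)), ((x - c0 * y) / (c1 - c0)).
    assert (0 < / (c1 - c0)) by (apply Rinv_0_lt_compat; lra).
    split; [apply Rmult_le_pos; lra|]. split; [apply Rmult_le_pos; lra|]. simpl. f_equal; field; lra.
Qed.

(** Written with products of the coordinates, so that the set is stable under all nonzero scalings.
    *)
Definition sector (c0 c1 eps : R) (p : R * R) : Prop :=
  snd p <> 0 /\ (c0 + eps) * (snd p * snd p) < fst p * snd p < (c1 - eps) * (snd p * snd p).

Lemma open_and3 {T : UniformSpace} (A B D : T -> Prop) : open A -> open B -> open D -> open (fun p => A p /\ B p /\ D p).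
Proof. intros HA HB HD. apply open_and; [exact HA|now apply open_and]. Qed.

Lemma continuous_fst' (p : R * R) : continuous (fun q : R * R => fst q) p.
Proof. intros P (e & H). exists e. intros q Hq. apply H, Hq. Qed.

Lemma continuous_snd' (p : R * R) : continuous (fun q : R * R => snd q) p.
Proof. intros P (e & H). exists e. intros q Hq. apply H, Hq. Qed.

Lemma open_pos (g : R * R -> R) : (forall p, continuous g p) -> open (fun p => 0 < g p).
Proof. intros Hg. apply (open_comp g (fun t => 0 < t)); [intros x _; apply Hg|apply open_gt]. Qed.

Lemma cont_quad k l (p : R * R) : continuous (fun q : R * R => k * (fst q * snd q) + l * (snd q * snd q)) p.
Proof.
  assert (H1 := continuous_fst' p). assert (H2 := continuous_snd' p).
  apply (continuous_plus (V := R_NormedModule)); (apply (continuous_scal_r k (V := R_NormedModule)) || apply (continuous_scal_r l (V := R_NormedModule)));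
  apply (continuous_mult (K := R_AbsRing)); assumption.
Qed.

Lemma sector_open c0 c1 eps : rp1_open (sector c0 c1 eps).
Proof.
  split.
  - intros (x, y) (H1 & H2 & H3). simpl in *. split; [intros E; injection E as -> ->; now apply H1|].
    intros t Ht. assert (Htt : 0 < t * t) by (destruct (Rlt_dec 0 t); [now apply Rmult_lt_0_compat|replace (t * t) with ((- t) * (- t)) by ring; apply Rmult_lt_0_compat; lra]).
    split; simpl; [now apply Rmult_integral_contrapositive_currified|].
    replace (t * x * (t * y)) with (t * t * (x * y)) by ring. replace (t * y * (t * y)) with (t * t * (y * y)) by ring.
    split; [apply (Rmult_lt_compat_l (t * t)) in H2; [lra|exact Htt]|apply (Rmult_lt_compat_l (t * t)) in H3; [lra|exact Htt]].
  - apply (open_ext (fun p : R * R => 0 < 0 * (fst p * snd p) + 1 * (snd p * snd p) /\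
      0 < 1 * (fst p * snd p) + - (c0 + eps) * (snd p * snd p) /\ 0 < - 1 * (fst p * snd p) + (c1 - eps) * (snd p * snd p))).
    + intros (x, y). unfold sector. simpl. split.
      * intros (H1 & H2 & H3). split; [intros ->; lra|lra].
      * intros (H1 & H2 & H3). split; [|lra].
        destruct (Rlt_dec 0 y) as [H|H]; [assert (0 < y * y) by (now apply Rmult_lt_0_compat)|assert (0 < (- y) * (- y)) by (apply Rmult_lt_0_compat; lra)]; lra.
    + apply open_and3; apply open_pos; intros p; apply cont_quad.
Qed.

(** A whole neighborhood of an interior direction lies in the cone: moving the first coordinate both
    ways stays in the cone, which keeps the direction off the walls. *)
Lemma interior_strict c0 c1 p : c0 < c1 -> rp1_interior (rp1_image (positive_hull (c0, 1) (c1, 1))) p ->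
  exists n : nat, sector c0 c1 (/ (INR n + 1)) p.
Proof.
  intros Hc (U & [HU HUo] & HUA & Hp). destruct p as [x y].
  destruct (HUo _ Hp) as (e & He).
  assert (Hpt : forall d, Rabs d < e -> (x + d, y) <> (0, 0) /\ exists t, t <> 0 /\ c0 * (t * y) <= t * (x + d) <= c1 * (t * y)).
  { intros d Hd. destruct (HUA (x + d, y)) as [Hn (t & Ht & Hh)].
    - apply He. split; [|apply ball_center]. change (Rabs ((x + d) - x) < e). now replace (x + d - x) with d by ring.
    - split; [exact Hn|]. exists t. split; [exact Ht|]. now apply (hull_iff c0 c1 (t * (x + d)) (t * y) Hc). }
  set (d := e / 2). assert (Hd : 0 < d < e) by (unfold d; generalize (cond_pos e); lra).
  assert (Hy : y <> 0).
  { intros ->. destruct (Hpt 0) as [Hn (t & Ht & Hh)]; [rewrite Rabs_R0; apply cond_pos|].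
    apply Hn. f_equal. rewrite !Rmult_0_r in Hh. assert (E : t * (x + 0) = 0) by lra. destruct (Rmult_integral _ _ E); [contradiction|assumption]. }
  assert (Hyy : 0 < y * y) by (destruct (Rlt_dec 0 y); [now apply Rmult_lt_0_compat|replace (y * y) with ((- y) * (- y)) by ring; apply Rmult_lt_0_compat; lra]).
  assert (Hq : forall d, Rabs d < e -> c0 <= (x + d) / y <= c1).
  { intros d' Hd'. destruct (Hpt d' Hd') as [_ (t & Ht & Hh)].
    set (u := t * y). assert (Hu : u <> 0) by (now apply Rmult_integral_contrapositive_currified).
    set (v := (x + d') / y). assert (Ev : t * (x + d') = u * v) by (unfold u, v; field; exact Hy).
    rewrite Ev in Hh. fold u in Hh. destruct (Rlt_dec 0 u) as [H|H].
    - split; apply Rmult_le_reg_l with u; lra.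
    - assert (0 <= (c1 - c0) * u) by lra. assert ((c1 - c0) * (- u) > 0) by (apply Rmult_lt_0_compat; lra). lra. }
  assert (Hq1 := Hq d ltac:(rewrite Rabs_pos_eq; lra)). assert (Hq2 := Hq (- d) ltac:(rewrite Rabs_Ropp, Rabs_pos_eq; lra)).
  set (m := d / Rabs y). assert (Hay : 0 < Rabs y) by now apply Rabs_pos_lt.
  assert (Hm : 0 < m) by (apply Rdiv_lt_0_compat; lra).
  assert (Hs : c0 + m <= x / y <= c1 - m).
  { unfold m. replace ((x + d) / y) with (x / y + d / y) in Hq1 by (field; exact Hy). replace ((x + - d) / y) with (x / y - d / y) in Hq2 by (field; exact Hy).
    destruct (Rlt_dec 0 y); [rewrite Rabs_pos_eq by lra; lra|]. rewrite Rabs_left by lra.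
    replace (d / - y) with (- (d / y)) by (field; exact Hy). lra. }
  destruct (nfloor_ex (/ m)) as (n & Hn); [now apply Rlt_le, Rinv_0_lt_compat|].
  exists n. split; [exact Hy|]. simpl. destruct Hn as [_ Hn].
  assert (Hi : / (INR n + 1) < m).
  { rewrite <- (Rinv_inv m). apply Rinv_lt_contravar; [|exact Hn]. apply Rmult_lt_0_compat; [now apply Rinv_0_lt_compat|]. generalize (pos_INR n). lra. }
  replace (x * y) with (x / y * (y * y)) by (field; exact Hy). split; apply Rmult_lt_compat_r; lra.
Qed.

(** The sectors are open and exhaust the interior of the cone, and compactness selects one of them.
    *)
Lemma boundedly_interior_sector c0 c1 K : c0 < c1 -> boundedly_interior (positive_hull (c0, 1) (c1, 1)) K ->
  exists eps, 0 < eps /\ forall x y, K (x, y) -> 0 <= y -> (x, y) <> (0, 0) -> (c0 + eps) * y <= x <= (c1 - eps) * y.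
Proof.
  intros Hc (HK & T & [HT1 HT] & Hint & Him).
  destruct (HT nat (fun n => sector c0 c1 (/ (INR n + 1)))) as (l & Hl).
  - intros n. apply sector_open.
  - intros p Hp. now apply interior_strict, Hint.
  - exists (/ (INR (list_max l) + 1)). assert (Hm := pos_INR (list_max l)). split; [apply Rinv_0_lt_compat; lra|].
    intros x y HKp Hy Hn. assert (Hh := proj1 (hull_iff c0 c1 x y Hc) (HK _ HKp)).
    assert (Hy' : y <> 0) by (intros ->; apply Hn; f_equal; lra). assert (Hy0 : 0 < y) by lra.
    destruct (Hl (x, y)) as (n & Hin & Hs1 & Hs2 & Hs3).
    { apply Him. split; [exact Hn|]. exists 1. split; [lra|]. simpl. now rewrite !Rmult_1_l. }
    simpl in *. assert (Hle : (n <= list_max l)%nat).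
    { assert (HF := proj1 (list_max_le l (list_max l)) (le_n _)). rewrite Forall_forall in HF. now apply HF. }
    apply le_INR in Hle. assert (Hnn := pos_INR n).
    assert (Hi : / (INR (list_max l) + 1) <= / (INR n + 1)) by (apply Rinv_le_contravar; lra).
    assert (Hs4 : (c0 + / (INR n + 1)) * y < x) by (apply Rmult_lt_reg_r with y; lra).
    assert (Hs5 : x < (c1 - / (INR n + 1)) * y) by (apply Rmult_lt_reg_r with y; lra).
    apply (Rmult_le_compat_r y) in Hi; lra.
Qed.

Lemma boundary_slope c0 c1 delta : c0 < c1 -> boundary (positive_hull (c0, 1) (c1, 1)) (delta, 1) -> delta = c0 \/ delta = c1.
Proof.
  intros Hc [H1 H2].
  assert (Hcont : forall k l p, continuous (fun q : R * R => k * fst q + l * snd q) p).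
  { intros k l p. apply (continuous_plus (V := R_NormedModule)); [apply (continuous_scal_r k (V := R_NormedModule)), continuous_fst'|apply (continuous_scal_r l (V := R_NormedModule)), continuous_snd']. }
  destruct (Req_dec delta c0) as [E|E0]; [now left|]. destruct (Req_dec delta c1) as [E|E1]; [now right|]. exfalso.
  assert (Hop : forall k l, open (fun p : R * R => 0 < k * fst p + l * snd p)) by (intros k l; now apply open_pos).
  destruct (Rlt_dec delta c0) as [Hlt|Hlt]; [|destruct (Rlt_dec c1 delta) as [Hgt|Hgt]].
  - apply H2. apply (locally_open (fun p : R * R => 0 < - 1 * fst p + c0 * snd p)); [apply Hop| |simpl; lra].
    intros (x, y) Hp Hh. apply hull_iff in Hh; [|exact Hc]. simpl in Hp. lra.
  - apply H2. apply (locally_open (fun p : R * R => 0 < 1 * fst p + - c1 * snd p)); [apply Hop| |simpl; lra].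
    intros (x, y) Hp Hh. apply hull_iff in Hh; [|exact Hc]. simpl in Hp. lra.
  - apply H1. apply (locally_open (fun p : R * R => 0 < 1 * fst p + - c0 * snd p /\ 0 < - 1 * fst p + c1 * snd p)).
    + apply open_and; apply Hop.
    + intros (x, y) Hp. apply hull_iff; [exact Hc|]. simpl in Hp. lra.
    + simpl. lra.
Qed.

(** * Normalization of the double point *)

Lemma analytic2_regular2 f z0 w0 : analytic2_at f z0 w0 -> regular2 f z0 w0.
Proof.
  intros H. destruct (analytic2_hol2 _ _ _ H) as [(d & Hd & Hh) Hc]. destruct (Hc 1 Rlt_0_1) as (e & He & Hb).
  exists (Rmin d e), (Cmod (f z0 w0) + 1). split; [now apply Rmin_glb_lt|]. split.
  - intros X Y t HX HY. apply Hh; (eapply Rlt_le_trans; [eassumption|apply Rmin_l]).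
  - intros x y Hx Hy. assert (H1 := Hb x y ltac:(eapply Rlt_le_trans; [exact Hx|apply Rmin_r]) ltac:(eapply Rlt_le_trans; [exact Hy|apply Rmin_r])).
    generalize (Cmod_ge_sub (f x y) (f z0 w0)). lra.
Qed.

Lemma regular2_div G H z0 w0 : analytic2_at G z0 w0 -> analytic2_at H z0 w0 -> H z0 w0 <> 0%C -> regular2 (fun z w => G z w / H z w)%C z0 w0.
Proof.
  intros HG HH Hn. destruct (analytic2_regular2 _ _ _ HG) as (d1 & B & Hd1 & Hh1 & HB).
  destruct (analytic2_hol2 _ _ _ HH) as [(d2 & Hd2 & Hh2) Hc].
  set (m := Cmod (H z0 w0) / 2). assert (Hm : 0 < m) by (assert (0 < Cmod (H z0 w0)) by (now apply Cmod_gt_0); unfold m; lra).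
  destruct (Hc m Hm) as (d3 & Hd3 & Hb). destruct (exists_below3 d1 d2 d3 Hd1 Hd2 Hd3) as (d & Hd & L1 & L2 & L3).
  assert (HHm : forall x y, Cmod (x - z0) < d -> Cmod (y - w0) < d -> m <= Cmod (H x y)).
  { intros x y Hx Hy. specialize (Hb x y ltac:(lra) ltac:(lra)). rewrite Cmod_sub_sym in Hb.
    generalize (Cmod_ge_sub (H z0 w0) (H x y)). unfold m in *. lra. }
  assert (HHn : forall x y, Cmod (x - z0) < d -> Cmod (y - w0) < d -> H x y <> 0%C).
  { intros x y Hx Hy. apply Cmod_gt_0. specialize (HHm x y Hx Hy). lra. }
  exists d, (B * / m). split; [exact Hd|]. split.
  - intros X Y t HX HY HhX HhY. apply hol_div; [apply Hh1; auto; lra|apply Hh2; auto; lra|now apply HHn].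
  - intros x y Hx Hy. unfold Cdiv. rewrite Cmod_mult, Cmod_inv by (now apply HHn).
    apply Rmult_le_compat; [apply Cmod_ge_0|apply Rlt_le, Rinv_0_lt_compat, Cmod_gt_0; now apply HHn|apply HB; lra|].
    apply Rinv_le_contravar; auto.
Qed.

Lemma Cmod_scale_sub (c x y : C) : Cmod (c * x - c * y) = Cmod c * Cmod (x - y).
Proof. rewrite <- Cmod_mult. f_equal. ring. Qed.

Lemma scale_radius (zs ws : C) d : 0 < d -> exists e, 0 < e /\ forall x0 x : C, Cmod (x - x0) < e ->
  Cmod (zs * x - zs * x0) < d /\ Cmod (ws * x - ws * x0) < d.
Proof.
  intros Hd. set (K := Cmod zs + Cmod ws + 1). assert (H1 := Cmod_ge_0 zs). assert (H2 := Cmod_ge_0 ws).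
  assert (HK : 0 < K) by (unfold K; lra). exists (d / K). split; [now apply Rdiv_lt_0_compat|]. intros x0 x Hx.
  assert (E : K * (d / K) = d) by (field; lra). assert (H0 := Cmod_ge_0 (x - x0)).
  assert (H3 : K * Cmod (x - x0) < d) by (rewrite <- E; now apply Rmult_lt_compat_l).
  rewrite !Cmod_scale_sub. unfold K in H3.
  assert (0 <= Cmod zs * Cmod (x - x0)) by (now apply Rmult_le_pos). assert (0 <= Cmod ws * Cmod (x - x0)) by (now apply Rmult_le_pos). lra.
Qed.

Lemma regular2_scale f (zs ws x0 y0 : C) : regular2 f (zs * x0) (ws * y0) -> regular2 (fun x y => f (zs * x) (ws * y))%C x0 y0.
Proof.
  intros (d & B & Hd & Hh & HB). destruct (scale_radius zs ws d Hd) as (e & He & HE).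
  exists e, B. split; [exact He|]. split.
  - intros X Y t HX HY HhX HhY. apply (Hh (fun s => zs * X s)%C (fun s => ws * Y s)%C t); [now apply HE|now apply HE| |];
    apply hol_mult; auto using hol_const.
  - intros x y Hx Hy. apply HB; now apply HE.
Qed.

(** There are points of convergence arbitrarily close to (zs, ws), and at such points the terms are
    bounded. *)
Lemma boundary_bidisk a (zs ws : C) : zs <> 0%C -> ws <> 0%C -> boundary (convergence_domain a) (zs, ws) ->
  summable_bidisk (fun r s => a r s * Cpow zs r * Cpow ws s)%C.
Proof.
  intros Hzs Hws [_ Hb] rho Hrho.
  assert (Hz := proj1 (Cmod_gt_0 zs) Hzs). assert (Hw := proj1 (Cmod_gt_0 ws) Hws).
  assert (Hd1 : 0 < (1 - rho) * Cmod zs) by (apply Rmult_lt_0_compat; lra). assert (Hd2 : 0 < (1 - rho) * Cmod ws) by (apply Rmult_lt_0_compat; lra).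
  set (d := Rmin ((1 - rho) * Cmod zs) ((1 - rho) * Cmod ws)).
  assert (Hd : 0 < d) by now apply Rmin_glb_lt.
  assert (Hex : exists z w, Cmod (z - zs) < d /\ Cmod (w - ws) < d /\ convergence_domain a (z, w)).
  { apply NNPP. intros Hno. apply Hb. apply locally_C2_iff. exists d. split; [exact Hd|].
    intros x y Hx Hy HD. apply Hno. now exists x, y. }
  destruct Hex as (z & w & Hzd & Hwd & HD). apply locally_singleton in HD. simpl in HD.
  destruct (abs_summable_terms _ HD) as (B & HB & HBt). exists B. split; [exact HB|]. intros i j.
  assert (Gz : rho * Cmod zs <= Cmod z).
  { rewrite Cmod_sub_sym in Hzd. generalize (Cmod_ge_sub zs z) (Rmin_l ((1 - rho) * Cmod zs) ((1 - rho) * Cmod ws)). fold d. lra. }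
  assert (Gw : rho * Cmod ws <= Cmod w).
  { rewrite Cmod_sub_sym in Hwd. generalize (Cmod_ge_sub ws w) (Rmin_r ((1 - rho) * Cmod zs) ((1 - rho) * Cmod ws)). fold d. lra. }
  eapply Rle_trans; [|apply (HBt i j)]. unfold monomials. rewrite !Cmod_mult, !Cmod_pow.
  replace (Cmod (a i j) * Cmod zs ^ i * Cmod ws ^ j * (rho ^ i * rho ^ j)) with (Cmod (a i j) * (rho * Cmod zs) ^ i * (rho * Cmod ws) ^ j)
    by (rewrite !Rpow_mult_distr; ring).
  assert (P1 : 0 <= rho * Cmod zs) by (apply Rmult_le_pos; lra). assert (P2 : 0 <= rho * Cmod ws) by (apply Rmult_le_pos; lra).
  apply Rmult_le_compat.
  - apply Rmult_le_pos; [apply Cmod_ge_0|now apply pow_le].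
  - now apply pow_le.
  - apply Rmult_le_compat_l; [apply Cmod_ge_0|]. apply pow_incr. now split.
  - apply pow_incr. now split.
Qed.

Lemma scaled_series a F (zs ws : C) :
  locally ((RtoC 0, RtoC 0) : C * C) (fun p => is_pseries2 a (fst p) (snd p) (F (fst p) (snd p))) ->
  exists r0, 0 < r0 <= 1 /\ forall x y, Cmod x < r0 -> Cmod y < r0 ->
    cser2 (monomials (fun r s => a r s * Cpow zs r * Cpow ws s)%C x y) (F (zs * x) (ws * y))%C.
Proof.
  intros H. apply locally_C2_iff in H. destruct H as (d & Hd & H). simpl in H.
  destruct (scale_radius zs ws d Hd) as (e & He & HE). exists (Rmin e 1). split.
  { split; [apply Rmin_glb_lt; lra|apply Rmin_r]. }
  assert (E : forall c x : C, (c * x - 0 = c * x - c * 0)%C) by (intros; ring).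
  intros x y Hx Hy. assert (Hs := sum2_cser2 _ _ (H (zs * x)%C (ws * y)%C
    ltac:(rewrite E; apply HE; replace (x - 0)%C with x by ring; eapply Rlt_le_trans; [exact Hx|apply Rmin_l])
    ltac:(rewrite E; apply HE; replace (y - 0)%C with y by ring; eapply Rlt_le_trans; [exact Hy|apply Rmin_l]))).
  eapply ctends_ext; [|exact Hs]. intros n. unfold Csum2. apply Csum_ext. intros i _. apply Csum_ext. intros j _.
  unfold monomials. rewrite !Cpow_mult_l. ring.
Qed.

(** The substitution x = z/zs multiplies derivatives at the base point by zs, and leaves z
    v'(z)/v(z) unchanged as a function. *)
Lemma scaled_sheet (v : C -> C) (zs ws : C) : hol_at v zs -> (ws * v zs = 1)%C ->
  let u := fun x => (ws * v (zs * x))%C in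
  hol_at u 1 /\ u 1%C = 1%C /\ C_derive u 1 = (zs * ws * C_derive v zs)%C /\
  C_derive (fun x => x * C_derive u x / u x)%C 1 = (zs * C_derive (fun z => z * C_derive v z / v z)%C zs)%C.
Proof.
  intros Hv Ev u. assert (E1 : (zs * 1)%C = zs) by ring.
  assert (Hws : ws <> 0%C) by (intros E; rewrite E in Ev; apply C1_nz; rewrite <- Ev; ring).
  assert (Hn : v zs <> 0%C) by (intros E; rewrite E in Ev; apply C1_nz; rewrite <- Ev; ring).
  assert (Hsc : forall x, cderiv (fun x => zs * x)%C x zs).
  { intros x. eapply cderiv_eq; [apply cderiv_mult; [apply cderiv_const|apply cderiv_id]|cbv beta; ring]. }
  assert (Hsh : forall x, hol_at (fun x => zs * x)%C x) by (intros x; apply hol_mult; [apply hol_const|apply hol_id]).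
  assert (Hu : hol_at u 1).
  { apply hol_mult; [apply hol_const|]. apply (hol_comp (fun x => zs * x)%C v); [apply Hsh|now rewrite E1]. }
  assert (Hud : forall x, hol_at v (zs * x)%C -> C_derive u x = (zs * ws * C_derive v (zs * x))%C).
  { intros x Hx. apply cderiv_C_derive. unfold u. eapply cderiv_eq.
    - apply cderiv_mult; [apply cderiv_const|]. apply (cderiv_comp (fun x => zs * x)%C v); [apply Hsc|now apply hol_cderiv].
    - cbv beta. ring. }
  split; [exact Hu|]. split; [unfold u; rewrite E1; exact Ev|]. split; [rewrite Hud by (now rewrite E1); now rewrite E1|].
  set (L := fun z => (z * C_derive v z / v z)%C).
  assert (HL : hol_at L zs) by (apply hol_div; [apply hol_mult; [apply hol_id|now apply hol_at_deriv]|exact Hv|exact Hn]).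
  destruct (hol_near _ _ Hv) as (d1 & Hd1 & Hvn). destruct (ccont_neq _ _ _ (hol_cont _ _ Hv) Hn) as (d2 & Hd2 & Hvz).
  destruct (scale_radius zs ws (Rmin d1 d2)) as (e & He & HE); [now apply Rmin_glb_lt|].
  apply cderiv_C_derive. apply (cderiv_ext (fun x => L (zs * x)%C) _ 1 _ e He).
  - intros x Hx. destruct (HE 1%C x Hx) as [H1 _]. rewrite E1 in H1.
    assert (G1 : hol_at v (zs * x)%C) by (apply Hvn; eapply Rlt_le_trans; [exact H1|apply Rmin_l]).
    assert (G2 : v (zs * x)%C <> 0%C) by (apply Hvz; eapply Rlt_le_trans; [exact H1|apply Rmin_r]).
    rewrite (Hud x G1). unfold L, u. field. split; assumption.
  - eapply cderiv_eq; [apply (cderiv_comp (fun x => zs * x)%C L); [apply Hsc|rewrite E1; now apply hol_cderiv]|ring].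
Qed.

Lemma polydisk_open R1 R2 (z w : C) : polydisk R1 R2 z w -> exists d, 0 < d /\
  forall z' w' : C, Cmod (z' - z) < d -> Cmod (w' - w) < d -> polydisk R1 R2 z' w'.
Proof.
  assert (Hone : forall (Rb : Rbar) (z : C), Rbar_lt (Cmod z) Rb -> exists d, 0 < d /\ forall z', Cmod (z' - z) < d -> Rbar_lt (Cmod z') Rb).
  { intros [r| |] x Hx; simpl in Hx; [|exists 1; split; [lra|intros; exact I]|destruct Hx].
    exists (r - Cmod x). split; [lra|]. intros x' Hx'. simpl. generalize (Cmod_ge_sub x' x). lra. }
  intros [H1 H2]. destruct (Hone R1 z H1) as (d1 & Hd1 & A1). destruct (Hone R2 w H2) as (d2 & Hd2 & A2).
  exists (Rmin d1 d2). split; [now apply Rmin_glb_lt|]. intros z' w' Hz Hw. split; [apply A1|apply A2]; eapply Rlt_le_trans; try eassumption; [apply Rmin_l|apply Rmin_r].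
Qed.

Lemma polydisk_le R1 R2 (z w z' w' : C) : polydisk R1 R2 z w -> Cmod z' <= Cmod z -> Cmod w' <= Cmod w -> polydisk R1 R2 z' w'.
Proof.
  intros [H1 H2] Hz Hw. split; [apply (Rbar_le_lt_trans _ (Cmod z))|apply (Rbar_le_lt_trans _ (Cmod w))]; assumption.
Qed.

(** * The theorem *)

Lemma norm_le_sum x y : 0 <= x -> 0 <= y -> sqrt (x ^ 2 + y ^ 2) <= x + y.
Proof.
  intros Hx Hy. rewrite <- (sqrt_pow2 (x + y)) by lra. apply sqrt_le_1_alt.
  assert (0 <= x * y) by (now apply Rmult_le_pos). simpl. lra.
Qed.

Lemma cone_asymptotics A R f0 f1 h0 h1 c0 c1 P : 0 < R -> hol_on R f0 -> hol_on R f1 -> hol_on R h0 -> hol_on R h1 ->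
  f0 0%C = 0%C -> f1 0%C = 0%C -> C_derive f0 0 = RtoC c0 -> C_derive f1 0 = RtoC c1 -> on_axis_neg R f0 -> on_axis_neg R f1 ->
  h0 0%C = (- P)%C -> h1 0%C = P -> pole_integral_approximation A h0 f0 h1 f1 -> c0 < c1 ->
  (forall K, boundedly_interior (positive_hull (c0, 1) (c1, 1)) K -> exists c M, 0 < c /\
     forall r s : nat, K (INR r, INR s) -> Cmod (A r s - P)%C <= M * exp (- c * sqrt (INR r ^ 2 + INR s ^ 2))) /\
  (forall delta, boundary (positive_hull (c0, 1) (c1, 1)) (delta, 1) ->
     (delta = c0 -> C_derive (C_derive f0) 0 <> 0%C) -> (delta = c1 -> C_derive (C_derive f1) 0 <> 0%C) -> ray_expansion A delta (P / 2)%C).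
Proof.
  intros HR Hf0 Hf1 Hh0 Hh1 E0 E1 D0 D1 X0 X1 EP0 EP1 HA Hc. split.
  - intros K HK. destruct (boundedly_interior_sector c0 c1 K Hc HK) as (eps & Heps & HKs).
    destruct (inside_cone A R f0 f1 h0 h1 c0 c1 P eps) as (ka & M & Hka & HM); auto.
    assert (H1 := Rabs_pos c1). set (c := ka / (1 + Rabs c1)).
    assert (Hcp : 0 < c) by (apply Rdiv_lt_0_compat; lra).
    exists c, (Rabs M + Cmod (A O O - P)%C). split; [exact Hcp|]. intros r s Hrs.
    assert (Hr := pos_INR r). assert (Hs := pos_INR s). assert (HC := Cmod_ge_0 (A O O - P)%C). assert (HMp := Rabs_pos M).
    destruct (excluded_middle_informative ((INR r, INR s) = (0, 0))) as [E|Hn].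
    + injection E as Er Es. apply (INR_eq r 0) in Er. apply (INR_eq s 0) in Es. subst r s. simpl.
      replace (0 * (0 * 1) + 0 * (0 * 1)) with 0 by ring. rewrite sqrt_0, Rmult_0_r, exp_0. lra.
    + specialize (HKs _ _ Hrs Hs Hn). specialize (HM r s HKs).
      assert (Hle : c * sqrt (INR r ^ 2 + INR s ^ 2) <= ka * INR s).
      { replace (ka * INR s) with (c * ((1 + Rabs c1) * INR s)) by (unfold c; field; lra).
        apply Rmult_le_compat_l; [lra|]. eapply Rle_trans; [now apply norm_le_sum|].
        assert (c1 * INR s <= Rabs c1 * INR s) by (apply Rmult_le_compat_r; [exact Hs|apply Rle_abs]).
        assert (0 <= eps * INR s) by (apply Rmult_le_pos; lra). lra. }
      apply Rle_trans with (Rabs M * exp (- ka * INR s)).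
      * eapply Rle_trans; [exact HM|]. apply Rmult_le_compat_r; [apply Rlt_le, exp_pos|apply Rle_abs].
      * apply Rle_trans with (Rabs M * exp (- c * sqrt (INR r ^ 2 + INR s ^ 2))).
        -- apply Rmult_le_compat_l; [exact HMp|]. apply exp_le. lra.
        -- apply Rmult_le_compat_r; [apply Rlt_le, exp_pos|lra].
  - intros delta Hb N0 N1. destruct (boundary_slope c0 c1 delta Hc Hb) as [-> | ->].
    + apply (lower_ray A R f0 f1 h0 h1 c0 c1 P); auto.
    + apply (upper_ray A R f0 f1 h0 h1 c0 c1 P); auto.
Qed.

Lemma cone_sym c0 c1 : positive_hull (c0, 1) (c1, 1) = positive_hull (c1, 1) (c0, 1).
Proof. apply functional_extensionality. intros x. apply propositional_extensionality, hull_sym. Qed.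

(** Near the double point the zero set is all of H = 0, since the polydisk is open. *)
Lemma double_point_local R1 R2 G H (zs ws : C) v0 v1 phi : zero_set R1 R2 H zs ws -> double_point (zero_set R1 R2 H) G H zs ws v0 v1 phi ->
  exists d, 0 < d /\ (forall z w, Cmod (z - zs) < d -> Cmod (w - ws) < d ->
    (H z w <> 0%C -> (G z w / H z w = phi z w / ((1 - w * v0 z) * (1 - w * v1 z)))%C) /\
    ((w * v0 z = 1)%C \/ (w * v1 z = 1)%C <-> H z w = 0%C) /\ polydisk R1 R2 z w).
Proof.
  intros [HP _] (_ & _ & _ & _ & _ & _ & _ & _ & HL). apply locally_C2_iff in HL. destruct HL as (d & Hd & HL). simpl in HL.
  destruct (polydisk_open _ _ _ _ HP) as (e & He & Hp). exists (Rmin d e). split; [now apply Rmin_glb_lt|].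
  intros z w Hz Hw. generalize (Rmin_l d e) (Rmin_r d e). intros L1 L2.
  destruct (HL z w ltac:(lra) ltac:(lra)) as [A1 A2]. assert (A3 := Hp z w ltac:(lra) ltac:(lra)).
  split; [exact A1|]. split; [|exact A3]. rewrite A2. split; [intros [_ E]; exact E|intros E; now split].
Qed.

(** Strict minimality is used twice: F is regular on the closed bidisk away from (1, 1), and a value
    |u_j(x)| >= 1 with |x| <= 1, x <> 1 would give the point (zs x, ws/u_j(x)) of the zero set in
    the closed polydisk. *)
Lemma normal_form (R1 R2 : Rbar) (G H : C -> C -> C) (a : nat -> nat -> C) (zs ws : C) (v0 v1 : C -> C) (phi : C -> C -> C) :
  analytic_on_polydisk R1 R2 G -> analytic_on_polydisk R1 R2 H ->
  locally (RtoC 0, RtoC 0) (fun p => is_pseries2 a (fst p) (snd p) (G (fst p) (snd p) / H (fst p) (snd p))%C) ->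
  strictly_minimal (zero_set R1 R2 H) a zs ws -> double_point (zero_set R1 R2 H) G H zs ws v0 v1 phi ->
  C_derive v0 zs <> C_derive v1 zs ->
  exists R0 f0 f1 h0 h1, 0 < R0 /\ hol_on R0 f0 /\ hol_on R0 f1 /\ hol_on R0 h0 /\ hol_on R0 h1 /\
    f0 0%C = 0%C /\ f1 0%C = 0%C /\ C_derive f0 0 = (zs * ws * C_derive v0 zs)%C /\ C_derive f1 0 = (zs * ws * C_derive v1 zs)%C /\
    (phase_nondegenerate v0 zs -> C_derive (C_derive f0) 0 <> 0%C) /\ (phase_nondegenerate v1 zs -> C_derive (C_derive f1) 0 <> 0%C) /\
    on_axis_neg R0 f0 /\ on_axis_neg R0 f1 /\
    h0 0%C = (phi zs ws / (zs * ws * C_derive v0 zs - zs * ws * C_derive v1 zs))%C /\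
    h1 0%C = (phi zs ws / (zs * ws * C_derive v1 zs - zs * ws * C_derive v0 zs))%C /\
    pole_integral_approximation (fun r s => a r s * Cpow zs r * Cpow ws s)%C h0 f0 h1 f1.
Proof.
  intros HG HH Hser [(HV & Hbd & Hzs & Hws) Hmin] Hdp Hne.
  destruct (double_point_local _ _ _ _ _ _ _ _ _ HV Hdp) as (d & Hd & HD).
  destruct Hdp as (Hv0 & Hv1 & Hphi & Ev0 & Ev1 & _ & _ & _ & _).
  apply analytic_hol in Hv0. apply analytic_hol in Hv1.
  destruct (scaled_sheet v0 zs ws Hv0 Ev0) as (Hu0 & Eu0 & Du0 & Pu0). set (u0 := fun x => (ws * v0 (zs * x))%C) in *.
  destruct (scaled_sheet v1 zs ws Hv1 Ev1) as (Hu1 & Eu1 & Du1 & Pu1). set (u1 := fun x => (ws * v1 (zs * x))%C) in *.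
  change (u0 1%C = 1%C) in Eu0. change (u1 1%C = 1%C) in Eu1.
  change (C_derive (fun x => x * C_derive u0 x / u0 x)%C 1 = (zs * C_derive (fun z => z * C_derive v0 z / v0 z)%C zs)%C) in Pu0.
  change (C_derive (fun x => x * C_derive u1 x / u1 x)%C 1 = (zs * C_derive (fun z => z * C_derive v1 z / v1 z)%C zs)%C) in Pu1.
  assert (Ez1 : (zs * 1)%C = zs) by ring. assert (Ew1 : (ws * 1)%C = ws) by ring.
  assert (Hinj : forall c x : C, c <> 0%C -> (c * x)%C = c -> x = 1%C).
  { intros c x Hc E. replace x with ((c * x) / c)%C by (field; exact Hc). rewrite E. field. exact Hc. }
  assert (Hone : forall c x : C, Cmod x <= 1 -> Cmod (c * x) <= Cmod c).
  { intros c x Hx. rewrite Cmod_mult. rewrite <- (Rmult_1_r (Cmod c)) at 2. apply Rmult_le_compat_l; [apply Cmod_ge_0|exact Hx]. }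
  destruct (scale_radius zs ws d Hd) as (e & He & HE).
  assert (Hinvr : forall u, hol_at u 1 -> u 1%C = 1%C -> exists e', 0 < e' /\ forall x : C, Cmod (x - 1) < e' -> u x <> 0%C /\ Cmod (/ u x - 1) < e).
  { intros u Hu Eu. assert (Hn : u 1%C <> 0%C) by (rewrite Eu; apply C1_nz).
    destruct (ccont_neq _ _ _ (hol_cont _ _ Hu) Hn) as (a1 & Ha1 & A1).
    destruct (hol_cont _ _ (hol_inv _ _ Hu Hn) e He) as (a2 & Ha2 & A2). rewrite Eu in A2.
    exists (Rmin a1 a2). split; [now apply Rmin_glb_lt|]. intros x Hx. split.
    - apply A1. eapply Rlt_le_trans; [exact Hx|apply Rmin_l].
    - replace (RtoC 1) with (/ 1)%C by field. apply A2. eapply Rlt_le_trans; [exact Hx|apply Rmin_r]. }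
  destruct (Hinvr u0 Hu0 Eu0) as (e0 & He0 & HI0). destruct (Hinvr u1 Hu1 Eu1) as (e1 & He1 & HI1).
  destruct (exists_below3 1 e (Rmin e0 e1) Rlt_0_1 He) as (d0 & Hd0 & L1 & L2 & L3); [now apply Rmin_glb_lt|].
  assert (L4 : d0 < e0) by (eapply Rlt_le_trans; [exact L3|apply Rmin_l]). assert (L5 : d0 < e1) by (eapply Rlt_le_trans; [exact L3|apply Rmin_r]).
  set (F := fun x y => (G (zs * x) (ws * y) / H (zs * x) (ws * y))%C).
  set (ph := fun x y => phi (zs * x)%C (ws * y)%C).
  assert (Hnear : forall x : C, Cmod (x - 1) < e -> Cmod (zs * x - zs) < d /\ Cmod (ws * x - ws) < d).
  { intros x Hx. destruct (HE 1%C x Hx) as [A1 A2]. now rewrite Ez1 in A1; rewrite Ew1 in A2. }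
  (* a sheet point of the closed bidisk other than (1, 1) contradicts strict minimality *)
  assert (Hlt : forall v : C -> C, (forall z w : C, Cmod (z - zs) < d -> Cmod (w - ws) < d -> (w * v z = 1)%C -> H z w = 0%C) ->
    (forall x : C, Cmod (x - 1) < d0 -> (ws * v (zs * x))%C <> 0%C /\ Cmod (/ (ws * v (zs * x)) - 1)%C < e) ->
    forall x : C, Cmod x <= 1 -> x <> 1%C -> Cmod (x - 1) < d0 -> Cmod (ws * v (zs * x))%C < 1).
  { intros v Hv Hi x Hx Hx1 Hxd. destruct (Hi x Hxd) as [Hn Hi']. apply Rnot_le_lt. intros Hge. apply Hx1.
    set (u := (ws * v (zs * x))%C) in *.
    assert (Hy : Cmod (/ u) <= 1) by (rewrite Cmod_inv by exact Hn; rewrite <- Rinv_1; apply Rinv_le_contravar; lra).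
    destruct (Hnear x ltac:(lra)) as [N1 _]. destruct (Hnear (/ u)%C Hi') as [_ N2].
    assert (HVx : H (zs * x)%C (ws * / u)%C = 0%C).
    { apply Hv; auto. unfold u. field. split; [|exact Hws]. intros E. apply Hn. unfold u. rewrite E. ring. }
    apply (Hinj zs x Hzs). apply (Hmin (zs * x)%C (ws * / u)%C); auto.
    split; [|exact HVx]. now apply (HD (zs * x)%C (ws * / u)%C). }
  destruct (coefficients_as_pole_integrals (fun r s => a r s * Cpow zs r * Cpow ws s)%C F ph u0 u1 d0) as
    (R0 & f0 & f1 & h0 & h1 & K1 & K2 & K3 & K4 & K5 & K6 & K7 & K8 & K9 & K10 & K11 & K12 & K13 & K14 & K15 & K16).
  - now apply boundary_bidisk.
  - exact (scaled_series a (fun z w => G z w / H z w)%C zs ws Hser).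
  - intros x y Hx Hy Hxy. apply (regular2_scale (fun z w => G z w / H z w)%C).
    assert (HPd : polydisk R1 R2 (zs * x)%C (ws * y)%C) by (apply (polydisk_le _ _ zs ws); auto; apply HV).
    apply regular2_div; [now apply HG|now apply HH|]. intros E. apply Hxy.
    destruct (Hmin (zs * x)%C (ws * y)%C) as [M1 M2]; auto; [now split|]. split; [exact (Hinj zs x Hzs M1)|exact (Hinj ws y Hws M2)].
  - apply regular2_scale. rewrite Ez1, Ew1. now apply analytic2_regular2.
  - exact Hu0.
  - exact Hu1.
  - exact Eu0.
  - exact Eu1.
  - rewrite Du0, Du1. intros E. apply Hne.
    replace (C_derive v0 zs) with ((zs * ws * C_derive v0 zs) / (zs * ws))%C by (field; split; assumption). rewrite E. field. split; assumption.
  - lra.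
  - intros x y Hx Hy N0 N1. destruct (Hnear x ltac:(lra)) as [A1 _]. destruct (Hnear y ltac:(lra)) as [_ A2].
    destruct (HD _ _ A1 A2) as (B1 & B2 & _).
    assert (Q : forall v, (ws * y * v (zs * x) = y * (ws * v (zs * x)))%C) by (intros; ring).
    assert (HHn : H (zs * x)%C (ws * y)%C <> 0%C).
    { intros E. apply B2 in E. rewrite !Q in E. destruct E as [E|E]; [apply N0|apply N1]; unfold u0, u1; rewrite E; ring. }
    specialize (B1 HHn). rewrite !Q in B1. unfold F. rewrite B1. unfold ph, u0, u1 in *. field. split; assumption.
  - intros x Hx Hx1 Hxd. split.
    + apply (Hlt v0); auto.
      * intros z w Hz Hw E. apply (HD z w Hz Hw). now left.
      * intros x' Hx'. apply HI0. lra.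
    + apply (Hlt v1); auto.
      * intros z w Hz Hw E. apply (HD z w Hz Hw). now right.
      * intros x' Hx'. apply HI1. lra.
  - exists R0, f0, f1, h0, h1. unfold ph in K14, K15. rewrite Ez1, Ew1 in K14, K15. rewrite Du0, Du1 in K14, K15. rewrite Du0 in K8. rewrite Du1 in K9.
    rewrite Pu0 in K10. rewrite Pu1 in K11.
    repeat (split; [assumption|]).
    split; [intros N; rewrite K10; apply Cmult_neq_0; [exact Hzs|exact N]|].
    split; [intros N; rewrite K11; apply Cmult_neq_0; [exact Hzs|exact N]|].
    repeat (split; [assumption|]). exact K16.
Qed.

Theorem theorem3p1 :
  forall (R1 R2 : Rbar) (G H : C -> C -> C) (a : nat -> nat -> C) (zs ws : C)
    (v0 v1 : C -> C) (phi : C -> C -> C),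
  Rbar_lt 0 R1 -> Rbar_lt 0 R2 ->
  analytic_on_polydisk R1 R2 G ->
  analytic_on_polydisk R1 R2 H ->
  H (RtoC 0) (RtoC 0) <> RtoC 0 ->
  locally (RtoC 0, RtoC 0) (fun p =>
    is_pseries2 a (fst p) (snd p)
      (G (fst p) (snd p) / H (fst p) (snd p))%C) ->
  strictly_minimal (zero_set R1 R2 H) a zs ws ->
  double_point (zero_set R1 R2 H) G H zs ws v0 v1 phi ->
  hessian_det H zs ws <> RtoC 0 ->
  exists S : C, is_branch_sqrt H zs ws S /\
  (forall K : R * R -> Prop,
     boundedly_interior (cone zs ws v0 v1) K ->
     exists (c M : R), 0 < c /\
       forall r s : nat, K (INR r, INR s) ->
         Cmod (a r s * Cpow zs r * Cpow ws s - G zs ws / S)%C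
           <= M * exp (- c * sqrt (INR r ^ 2 + INR s ^ 2))) /\
  (forall delta : R,
     boundary (cone zs ws v0 v1) (delta, 1) ->
     (delta = slope zs ws v0 -> phase_nondegenerate v0 zs) ->
     (delta = slope zs ws v1 -> phase_nondegenerate v1 zs) ->
     exists b : nat -> C,
       b 0%nat = (G zs ws / (2 * S))%C /\
       half_power_expansion a zs ws delta b).
Proof.
  intros R1 R2 G H a zs ws v0 v1 phi _ _ HG HH _ Hser Hmin Hdp Hdet.
  destruct (Hmin) as [(HV & _ & Hzs & Hws) _].
  destruct (double_point_local _ _ _ _ _ _ _ _ _ HV Hdp) as (d & Hd & HD).
  destruct (Hdp) as (Hv0 & Hv1 & Hphi & Ev0 & Ev1 & _ & _ & Hgerm & _).
  apply analytic_hol in Hv0. apply analytic_hol in Hv1.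
  destruct (hessian_double G H zs ws v0 v1 phi d) as (Hs2 & Hne & EG & Esq); auto.
  { apply HG, HV. } { apply HH, HV. }
  { intros e He. apply NNPP. intros Hno. apply Hgerm. apply locally_C_iff. exists e. split; [exact He|].
    intros z Hz. apply NNPP. intros Hvz. apply Hno. now exists z. }
  { intros z w Hz Hw. destruct (HD z w Hz Hw) as (A1 & A2 & _). now split. }
  destruct (normal_form R1 R2 G H a zs ws v0 v1 phi) as
    (R0 & f0 & f1 & h0 & h1 & HR & Hf0 & Hf1 & Hh0 & Hh1 & E0 & E1 & D0 & D1 & N0 & N1 & X0 & X1 & EP0 & EP1 & HA); auto.
  assert (S0 : (zs * ws * C_derive v0 zs)%C = RtoC (slope zs ws v0)).
  { unfold slope. rewrite <- D0. now apply (axis_real R0). }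
  assert (S1 : (zs * ws * C_derive v1 zs)%C = RtoC (slope zs ws v1)).
  { unfold slope. rewrite <- D1. now apply (axis_real R0). }
  unfold cone. set (c0 := slope zs ws v0) in *. set (c1 := slope zs ws v1) in *.
  set (s2 := (Cpow ws 2 * dw (dw H) zs ws)%C) in *.
  rewrite S0 in *. rewrite S1 in *.
  assert (Hc : c0 <> c1).
  { intros E. apply Hne. replace (C_derive v0 zs) with ((zs * ws * C_derive v0 zs) / (zs * ws))%C by (field; split; assumption).
    rewrite S0, E, <- S1. field. split; assumption. }
  set (t := Rabs (c0 - c1) / 2). assert (Hat : 0 < Rabs (c0 - c1)) by (apply Rabs_pos_lt; lra).
  assert (Ht : 0 < t) by (unfold t; lra).
  assert (Ht0 : RtoC t <> 0%C) by (intros E; apply RtoC_inj in E; lra).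
  set (S := (RtoC t * s2)%C).
  assert (HP : (G zs ws / S = phi zs ws / (2 * RtoC t))%C).
  { replace (G zs ws) with (2 * G zs ws / 2)%C by field. rewrite EG. unfold S. field. split; assumption. }
  exists S. split.
  { split; [|now exists t]. rewrite Esq. unfold S, t.
    assert (Habs : (RtoC (Rabs (c0 - c1)) * RtoC (Rabs (c0 - c1)) = (RtoC c0 - RtoC c1) * (RtoC c0 - RtoC c1))%C).
    { rewrite <- RtoC_minus, <- !RtoC_mult. f_equal. symmetry. apply (Rsqr_abs (c0 - c1)). }
    rewrite RtoC_div by lra. replace (RtoC (Rabs (c0 - c1)) / RtoC 2 * s2 * (RtoC (Rabs (c0 - c1)) / RtoC 2 * s2))%C
      with (RtoC (Rabs (c0 - c1)) * RtoC (Rabs (c0 - c1)) * (s2 * s2 / 4))%C by field.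
    rewrite Habs. field. }
  assert (H2S : (G zs ws / (2 * S) = G zs ws / S / 2)%C) by (unfold S; field; split; assumption).
  rewrite H2S, HP. clear HP H2S.
  set (P := (phi zs ws / (2 * RtoC t))%C) in *.
  (* the sheets are interchangeable, up to the sign of the residues *)
  destruct (Rlt_dec c0 c1) as [Hlt|Hlt].
  - assert (E2t : (2 * RtoC t = RtoC c1 - RtoC c0)%C).
    { rewrite <- RtoC_minus, <- RtoC_mult. f_equal. unfold t. rewrite Rabs_left by lra. lra. }
    assert (Hdn : (RtoC c1 - RtoC c0)%C <> 0%C) by (rewrite <- RtoC_minus; intros E; apply RtoC_inj in E; lra).
    destruct (cone_asymptotics (fun r s => a r s * Cpow zs r * Cpow ws s)%C R0 f0 f1 h0 h1 c0 c1 P) as [I J]; auto.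
    { rewrite EP0. unfold P. rewrite E2t. field. split; [exact Hdn|]. apply Cminus_eq_contra; intros E; apply RtoC_inj in E; lra. }
    { rewrite EP1. unfold P. now rewrite E2t. }
    split; [exact I|]. intros delta Hb P0 P1. apply ray_half_power. apply J; auto.
  - assert (E2t : (2 * RtoC t = RtoC c0 - RtoC c1)%C).
    { rewrite <- RtoC_minus, <- RtoC_mult. f_equal. unfold t. rewrite Rabs_pos_eq by lra. lra. }
    assert (Hdn : (RtoC c0 - RtoC c1)%C <> 0%C) by (rewrite <- RtoC_minus; intros E; apply RtoC_inj in E; lra).
    rewrite cone_sym.
    destruct (cone_asymptotics (fun r s => a r s * Cpow zs r * Cpow ws s)%C R0 f1 f0 h1 h0 c1 c0 P) as [I J]; auto.
    { rewrite EP1. unfold P. rewrite E2t. field. split; [exact Hdn|]. apply Cminus_eq_contra; intros E; apply RtoC_inj in E; lra. }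
    { rewrite EP0. unfold P. now rewrite E2t. }
    { now apply pole_integral_approximation_sym. } { lra. }
    split; [exact I|]. intros delta Hb P0 P1. apply ray_half_power. apply J; auto.
Qed.
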